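(* Consider the linear final value problem $${}^cD_t^\alpha u(t,x)=-\mathcal L^\beta u(t,x)+F(t,x)\ \text{ in } J\times D,\qquad \mathcal Hu=0\ \text{ on } J\times\partial D,\qquad u(T,x)=\varphi(x)\ \text{ in } D. \quad (\ast)$$ Let $0<p,q<1$ with $p+q=1$; $0<s<\min(\alpha q,1-\alpha q)$; $0<p'\le p-\frac s\alpha$, $q'=1-p'$, $0<r\le\frac{1-\alpha q'}{\alpha q'}$; $0\le\widehat q\le\min(p,q,\frac s\alpha)$, $\widehat p=1-\widehat q$, $0<\widehat r\le\frac{1-\alpha}{\alpha}$. (a) If $\varphi\in\mathbf V_{\beta(p+\widehat q)}$ and $F\in L^{\frac1{\alpha q-s}+\widehat r}(0,T;L^2(D))$, then $(\ast)$ has a unique mild solution $u$ such that $$u\in L^{\frac1{\alpha q'}-r}(0,T;\mathbf V_{\beta(p-p')})\cap C^{\alpha q}((0,T];L^2(D))\cap C^s([0,T];\mathbf V_{-\beta q'}),$$ $${}^cD_t^\alpha u\in L^{\frac1\alpha-\widehat r}(0,T;\mathbf V_{-\beta(q-\widehat q)}).$$ Moreover, there exists a positive constant $C_3$ (independent of $\varphi,F$) such that $$\|{}^cD_t^\alpha u\|_{L^{\frac1\alpha-\widehat r}(0,T;\mathbf V_{-\beta(q-\widehat q)})}\le C_3\|F\|_{L^{\frac1{\alpha q-s}+\widehat r}(0,T;L^2(D))}+C_3\|\varphi\|_{\mathbf V_{\beta(p+\widehat q)}}.$$ (b) If $\varphi\in\mathbf V_{\beta(p+\widehat q)}$ and $F\in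 L^{\frac1{\alpha q-s}+\widehat r}(0,T;L^2(D))\cap C^\alpha((0,T];\mathbf V_{-\beta q})$, then $(\ast)$ has a unique mild solution $u$ such that $$u\in L^{\frac1{\alpha q'}-r}(0,T;\mathbf V_{\beta(p-p')})\cap C^{\alpha q}((0,T];L^2(D))\cap C^s([0,T];\mathbf V_{-\beta q'}),$$ $${}^cD_t^\alpha u\in L^{\frac1\alpha-\widehat r}(0,T;\mathbf V_{-\beta(q-\widehat q)})\cap C^\alpha((0,T];\mathbf V_{-\beta q}).$$ Moreover, there exists a positive constant $C_4$ (independent of $\varphi,F$) such that $$\|{}^cD_t^\alpha u\|_{L^{\frac1\alpha-\widehat r}(0,T;\mathbf V_{-\beta(q-\widehat q)})}+\|{}^cD_t^\alpha u\|_{C^\alpha((0,T];\mathbf V_{-\beta q})}\le C_4\|\varphi\|_{\mathbf V_{\beta(p+\widehat q)}}+C_4\|F\|_{L^{\frac1{\alpha q-s}+\widehat r}(0,T;L^2(D))}+C_4\|F\|_{C^\alpha((0,T];\mathbf V_{-\beta q})}.$$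
   Context: Standing setting: $0<\alpha<1$, $0<\beta\le 1$, $T>0$, $J=(0,T)$, $D\subset\mathbb R^k$ ($k\ge1$) is a bounded open domain with boundary $\partial D$. $\mathcal L u=-\sum_{i}\partial_{x_i}\big(\sum_j \mathcal L_{ij}(x)\partial_{x_j}u\big)+b(x)u$ is a symmetric uniformly elliptic operator on $L^2(D)$ ($\mathcal L_{ij}=\mathcal L_{ji}\in C^1(\overline D)$, $b\in C(\overline D)$, $b\ge0$, $\xi^T[\mathcal L_{ij}(x)]\xi\ge L_0|\xi|^2$ for some $L_0>0$) with boundary condition $\mathcal Hv=0$ on $\partial D$, where $\mathcal Hv=v$ or $\mathcal Hv=\partial v/\partial n+\kappa v$, $\kappa>0$. Its eigenvalues are $0<m_1\le m_2\le\dots$, $m_j\to\infty$, with eigenfunctions $e_j\in\{v\in H^2(D):\mathcal Hv=0\}$, $\mathcal Le_j=m_je_j$, forming an orthonormal basis of $L^2(D)$. $(\cdot,\cdot)$ and $\|\cdot\|$ are the inner product and norm of $L^2(D)$. ${}^cD_t^\alpha$ is the left Caputo derivative, ${}^cD_t^\alpha v=I_t^{1-\alpha}D_tv$ with $I_t^{\alpha}v(t)=\frac1{\Gamma(\alpha)}\int_0^t(t-\tau)^{\alpha-1}v(\tau)d\tau$. For $u(t,\cdot)=\sum_ju_j(t)e_j$ it is taken termwise: ${}^cD_t^\alpha u(t,\cdot)=\sum_j{}^cD_t^\alpha u_j(t)\,e_j$, with convergence in the relevant space. For $\gamma\ge0$, $\mathcal L^\gamma v=\sum_j m_j^\gamma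 (v,e_j)e_j$ and $\mathbf V_\gamma=\{v\in L^2(D):\|\mathcal L^\gamma v\|<\infty\}$ with norm $\|v\|_{\mathbf V_\gamma}=\|\mathcal L^\gamma v\|$. For $\gamma>0$, $\mathbf V_{-\gamma}$ is the dual of $\mathbf V_\gamma$ (identifying $L^2(D)$ with its dual), with norm $\|v\|_{\mathbf V_{-\gamma}}=\{\sum_j (v,e_j)_{-\gamma,\gamma}^2m_j^{-2\gamma}\}^{1/2}$, where $(\cdot,\cdot)_{-\gamma,\gamma}$ is the duality pairing. For a Banach space $B$: $C^\theta([0,T];B)$ is the space of Hölder continuous functions of exponent $\theta$ on $[0,T]$. In contrast, $C^\rho((0,T];B)$ (half-open interval) is the space of continuous functions $v:(0,T]\to B$ with $\|v\|_{C^\rho((0,T];B)}:=\sup_{0<t\le T}t^\rho\|v(t)\|_B<\infty$. $E_{a,b}(z)=\sum_{k=0}^\infty z^k/\Gamma(ak+b)$ is the Mittag-Leffler function, $\widetilde E_{\alpha,\alpha}(-mt^\alpha):=t^{\alpha-1}E_{\alpha,\alpha}(-mt^\alpha)$. Writing $g_j(t)=(g(t),e_j)$, $v_j=(v,e_j)$: $$\mathcal O_1(t,\cdot)g=\sum_{j\ge1}\Big(\int_0^t g_j(\tau)\widetilde E_{\alpha,\alpha}(-m_j^\beta(t-\tau)^\alpha)d\tau\Big)e_j,\quad \mathcal O_2(t,\cdot)v=\sum_{j\ge1}v_j\frac{E_{\alpha,1}(-m_j^\beta t^\alpha)}{E_{\alpha,1}(-m_j^\beta T^\alpha)}e_j,$$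 $$\mathcal O_3(t,\cdot)g=-\mathcal O_2(t,\cdot)\,\mathcal O_1(T,\cdot)g.$$ A mild solution of the linear problem is a function $u\in L^a(0,T;L^b(D))$, for some $a,b\ge1$, satisfying $u(t,\cdot)=\mathcal O_1(t,\cdot)F+\mathcal O_2(t,\cdot)\varphi+\mathcal O_3(t,\cdot)F$.
   Formalization: The Caputo derivative I_t^{1-α}D_t is taken as its closure from C[0,T] to L^1(0,T) (i.e. v-v(0)=I_t^α w), since the coefficients u_j need not be differentiable in t for such F; it agrees with the literal formula for absolutely continuous u_j. *)

(* Defs.v *)
From HB Require Import structures.
From mathcomp Require Import all_boot all_order all_algebra.
From mathcomp Require Import all_classical all_reals all_analysis.

Set Implicit Arguments.
Unset Strict Implicit.
Unset Printing Implicit Defensive.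
Import Order.TTheory GRing.Theory Num.Theory.
Import numFieldNormedType.Exports.

Local Open Scope classical_set_scope.
Local Open Scope ring_scope.

Section Euclid.
Context {R : realType} {k : nat}.
Implicit Types x y : 'rV[R]_k.

Definition dotp x y : R := \sum_(i < k) x 0 i * y 0 i.

(* The library norm on row vectors is the sup norm. *)
Definition enorm x : R := Num.sqrt (dotp x x).

Definition half_open_box x y : set 'rV[R]_k :=
  [set z | forall i, x 0 i <= z 0 i < y 0 i].

Definition diam (A : set 'rV[R]_k) : \bar R :=
  ereal_sup [set (enorm (z.1 - z.2))%:E | z in A `*` A].

End Euclid.

Section CoverOuterMeasure.
Context {R : realType} {T : pointedType}.
Implicit Type w : set T -> \bar R.

Definition cover_outer w (A : set T) : \bar R :=
  ereal_inf [set (\sum_(n <oo) w (F n))%E |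
             F in [set F : (set T)^nat | A `<=` \bigcup_n F n]].

Lemma cover_outerE w :
  cover_outer w = @mu_ext _ (g_sigma_algebraType [set: set T]) R w.
Proof.
apply/funext => A; rewrite /cover_outer /mu_ext; congr (ereal_inf (_ @` _)).
apply/seteqP; split => F /=; last by case.
by move=> AF; split => // n; exact: sub_sigma_algebra.
Qed.

Section props.
Variable w : set T -> \bar R.
Hypothesis w0 : w set0 = 0%E.
Hypothesis w_ge0 : forall A, (0 <= w A)%E.

Lemma cover_outer0 : cover_outer w set0 = 0%E.
Proof.
by rewrite cover_outerE (@mu_ext0 _ (g_sigma_algebraType [set: set T])).
Qed.

Lemma cover_outer_ge0 A : (0 <= cover_outer w A)%E.
Proof.
by rewrite cover_outerE (@mu_ext_ge0 _ (g_sigma_algebraType [set: set T])).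
Qed.

Lemma le_cover_outer : {homo cover_outer w : A B / A `<=` B >-> (A <= B)%E}.
Proof.
rewrite cover_outerE.
exact: (@le_mu_ext _ (g_sigma_algebraType [set: set T])).
Qed.

Lemma cover_outer_sigma_subadditive : sigma_subadditive (cover_outer w).
Proof.
rewrite cover_outerE.
exact: (@mu_ext_sigma_subadditive _ (g_sigma_algebraType [set: set T])).
Qed.

End props.
End CoverOuterMeasure.

Section LebesgueMeasure.
Context {R : realType} (k : nat).
Local Notation V := 'rV[R]_k.+1.

(* The volume of a box, and +oo (infimum of the empty set) on other sets. *)
Definition box_volume (A : set V) : \bar R :=
  ereal_inf [set (\prod_(i < k.+1) (z.2 0 i - z.1 0 i))%:E |
     z in [set z : V * V | (forall i, z.1 0 i <= z.2 0 i) /\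
                           A = half_open_box z.1 z.2]].

Lemma box_volume_ge0 A : (0 <= box_volume A)%E.
Proof.
apply: le_ereal_inf_tmp => _ [z [zle _] <-]; rewrite lee_fin.
by apply: prodr_ge0 => i _; rewrite subr_ge0.
Qed.

Lemma box_volume0 : box_volume set0 = 0%E.
Proof.
apply/eqP; rewrite eq_le box_volume_ge0 andbT.
apply: ereal_inf_lbound; exists (0, 0) => /=.
  split=> [i //|]; apply/esym/seteqP; split => // z /(_ ord0) /=.
  by rewrite mxE => /andP[/le_lt_trans h /h]; rewrite ltxx.
by rewrite big_ord_recl mxE subrr mul0r.
Qed.

Definition box_outer : set V -> \bar R := cover_outer box_volume.

HB.instance Definition _ := isOuterMeasure.Build R V box_outer
  (cover_outer0 box_volume0 box_volume_ge0) (cover_outer_ge0 box_volume_ge0)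
  (le_cover_outer box_volume)
  (cover_outer_sigma_subadditive box_volume_ge0).

Definition lebesgue_outer : {outer_measure set V -> \bar R} := box_outer.

(* Lebesgue measure on R^(k+1), on the sigma-algebra of Lebesgue measurable
   sets *)
Definition lebesgue_rV :
    {measure set (caratheodory_type lebesgue_outer) -> \bar R} :=
  (lebesgue_outer : set (caratheodory_type lebesgue_outer) -> \bar R).

End LebesgueMeasure.

Section HausdorffMeasure.
Context {R : realType} (k : nat).
Local Notation V := 'rV[R]_k.+1.

(* Only sets of diameter at most delta may be used in a cover. *)
Definition diam_weight (delta : R) (A : set V) : \bar R :=
  if `[< A = set0 >] then 0%E
  else if (diam A <= delta%:E)%E then (diam A ^+ k)%E else +oo%E.

Lemma diam_weight0 delta : diam_weight delta set0 = 0%E.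
Proof. by rewrite /diam_weight; case: asboolP. Qed.

Lemma diam_weight_ge0 delta A : (0 <= diam_weight delta A)%E.
Proof.
rewrite /diam_weight; case: asboolP => // /eqP/set0P[x Ax].
case: ifP => // _; apply: expe_ge0; apply: ereal_sup_ubound.
exists (x, x) => //=; rewrite subrr /enorm /dotp.
by rewrite big1 ?sqrtr0// => i _; rewrite mxE mul0r.
Qed.

(* Up to a normalizing constant, the k-dimensional Hausdorff measure on R^(k+1),
   i.e. the surface measure on hypersurfaces. *)
Definition diam_outer (A : set V) : \bar R :=
  ereal_sup [set cover_outer (diam_weight delta) A |
             delta in `]0, +oo[%classic].

Lemma diam_outer_ge0 A : (0 <= diam_outer A)%E.
Proof.
apply: (@le_trans _ _ (cover_outer (diam_weight 1) A)).
  exact/cover_outer_ge0/diam_weight_ge0.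
by apply: ereal_sup_ubound; exists 1 => //=; rewrite in_itv/= ltr01.
Qed.

Lemma diam_outer0 : diam_outer set0 = 0%E.
Proof.
apply/eqP; rewrite eq_le diam_outer_ge0 andbT.
apply: ge_ereal_sup => _ [delta _ <-].
by rewrite cover_outer0//; [exact: diam_weight0|exact: diam_weight_ge0].
Qed.

Lemma le_diam_outer :
  {homo diam_outer : A B / A `<=` B >-> (A <= B)%E}.
Proof.
move=> A B AB; apply: ge_ereal_sup => _ [delta d0 <-].
apply: (le_trans (le_cover_outer _ AB)).
by apply: ereal_sup_ubound; exists delta.
Qed.

Lemma diam_outer_sigma_subadditive : sigma_subadditive diam_outer.
Proof.
move=> F; apply: ge_ereal_sup => _ [delta d0 <-].
apply: (le_trans (cover_outer_sigma_subadditive (diam_weight_ge0 delta) F)).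
apply: lee_nneseries => [n _ _|n _].
  exact/cover_outer_ge0/diam_weight_ge0.
by apply: ereal_sup_ubound; exists delta.
Qed.

HB.instance Definition _ := isOuterMeasure.Build R V diam_outer
  diam_outer0 diam_outer_ge0 le_diam_outer
  diam_outer_sigma_subadditive.

Definition hausdorff_outer : {outer_measure set V -> \bar R} := diam_outer.

Definition surface_measure :
    {measure set (caratheodory_type hausdorff_outer) -> \bar R} :=
  (hausdorff_outer : set (caratheodory_type hausdorff_outer) -> \bar R).

End HausdorffMeasure.

(* A seminormed space carried by part of an ambient group; elements at distance
   0 (e.g. functions equal almost everywhere) are not identified. *)
Record nspace (R : realType) (X : zmodType) := NSpace {
  ns_mem : set X;
  ns_norm : X -> R }.

Section Bochner.
Context {R : realType} {X : zmodType}.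
Variables (T : R) (B : nspace R X).
Local Notation mu := (@lebesgue_measure R).
Implicit Types (f s : R -> X).

Definition simple_fun s := [/\ finite_set (range s),
  forall x, measurable (s @^-1` [set x]) & forall t, ns_mem B (s t)].

Definition strongly_measurable f :=
  exists2 s : nat -> R -> X, (forall n, simple_fun (s n)) &
    {ae mu, forall t : R, t \in `]0, T[ ->
      ns_mem B (f t) /\ ns_norm B (s n t - f t) @[n --> \oo] --> 0}.

Definition Bochner_norm (p : R) f : \bar R :=
  let g : R -> R := (fun t : R => ns_norm B (f t)) \_ (`]0, T[%classic) in
  Lnorm mu p%:E (EFin \o g).

(* L^p(0,T;B) *)
Definition BochnerL (p : R) : nspace R (R -> X) := NSpace
  [set f | strongly_measurable f /\ (Bochner_norm p f < +oo)%E]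
  (fun f => fine (Bochner_norm p f)).

(* C^theta([0,T];B) *)
Definition Hoelder (theta : R) : set (R -> X) :=
  [set f | (forall t : R, t \in `[0, T] -> ns_mem B (f t)) /\
    exists K, forall t1 t2 : R, t1 \in `[0, T] -> t2 \in `[0, T] ->
      ns_norm B (f t1 - f t2) <= K * `|t1 - t2| `^ theta].

(* C^rho((0,T];B) *)
Definition weightedC (rho : R) : nspace R (R -> X) := NSpace
  [set f | [/\ forall t : R, t \in `]0, T] -> ns_mem B (f t),
    forall t : R, t \in `]0, T] ->
      ns_norm B (f t' - f t) @[t' --> within `]0, T] (nbhs t)] --> 0 &
    has_ubound [set t `^ rho * ns_norm B (f t) | t in `]0, T]%classic]]]
  (fun f => sup [set t `^ rho * ns_norm B (f t) | t in `]0, T]%classic]).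

End Bochner.

Section FractionalCalculus.
Context {R : realType}.
Local Notation mu := (@lebesgue_measure R).

Definition Gamma (x : R) : R :=
  \int[mu]_(t in `]0, +oo[) (t `^ (x - 1) * expR (- t)).

Definition mittag_leffler (a b z : R) : R :=
  limn (series (fun i => z ^+ i / Gamma (a * i%:R + b))).

(* \widetilde E_{alpha,alpha}(- lam * t ^ alpha) *)
Definition ml_kernel (alpha lam t : R) : R :=
  t `^ (alpha - 1) * mittag_leffler alpha alpha (- (lam * t `^ alpha)).

(* I_t^a *)
Definition frac_int (a : R) (f : R -> R) (t : R) : R :=
  (Gamma a)^-1 * \int[mu]_(tau in `[0, t]) ((t - tau) `^ (a - 1) * f tau).

(* [v] is absolutely continuous on [0,T] with D_t v = [dv]. *)
Definition AC_deriv (T : R) (v dv : R -> R) :=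
  mu.-integrable `]0, T[ (EFin \o dv) /\
  forall t : R, t \in `[0, T] -> v t = v 0 + \int[mu]_(tau in `[0, t]) dv tau.

(* [w] is the Caputo derivative I_t^(1-alpha) D_t v. Mild solutions need not be
   absolutely continuous in time (F is only integrable in time), so
   I_t^(1-alpha) D_t, defined on absolutely continuous functions, is extended to
   its closure from C[0,T] to L^1(0,T). *)
Definition caputo (T alpha : R) (v w : R -> R) :=
  mu.-integrable `]0, T[ (EFin \o w) /\
  exists vn dvn : nat -> R -> R, [/\
    forall n, AC_deriv T (vn n) (dvn n),
    forall eps, 0 < eps -> \forall n \near \oo, forall t : R, t \in `[0, T] ->
      `|vn n t - v t| < eps &
    (\int[mu]_(t in `]0%R, T[)
       `|frac_int (1 - alpha) (dvn n) t - w t|%:E)%E @[n --> \oo] --> 0%E].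

End FractionalCalculus.

Section SpaceDomain.
Context {R : realType} {k : nat}.
Local Notation V := 'rV[R]_k.+1.
Local Notation lambda := (@lebesgue_rV R k).
Local Notation sigma := (@surface_measure R k).
Variable D : set V.
Implicit Types (f g v w phi psi : V -> R).

(* L^b(D); values outside of D are irrelevant. *)
Definition Lb (b : R) : nspace R (V -> R) := NSpace
  [set f | (f \_ D : caratheodory_type (@lebesgue_outer R k) -> R) \in
           Lfun lambda b%:E]
  (fun f => fine (Lnorm lambda b%:E (EFin \o (f \_ D)))).

Local Notation L2 := (Lb 2).

Definition inner f g : R := \int[lambda]_(x in D) (f x * g x).

Definition ae_in_D (P : V -> Prop) := {ae lambda, forall x, D x -> P x}.

Definition ei (i : 'I_k.+1) : V := delta_mx 0 i.

Definition partial (i : 'I_k.+1) f : V -> R := 'D_(ei i) f.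

Fixpoint Cn (n : nat) f : Prop :=
  match n with
  | 0 => continuous f
  | n'.+1 => [/\ continuous f, forall i x, derivable f x (ei i) &
                 forall i, Cn n' (partial i f)]
  end.

Definition smooth f := forall n, Cn n f.

Definition test_function psi := smooth psi /\
  exists K : set V, [/\ compact K, K `<=` D & forall x, ~ K x -> psi x = 0].

Definition weak_partial (i : 'I_k.+1) f g :=
  [/\ ns_mem L2 f, ns_mem L2 g & forall psi, test_function psi ->
    inner f (partial i psi) = - inner g psi].

(* [v] is in H^2(D), with gradient [dv] and Hessian [ddv]. *)
Definition H2_with v (dv : 'I_k.+1 -> V -> R)
    (ddv : 'I_k.+1 -> 'I_k.+1 -> V -> R) :=
  (forall i, weak_partial i v (dv i)) /\
  (forall i j, weak_partial j (dv i) (ddv i j)).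

Definition H2 v := exists dv ddv, H2_with v dv ddv.

Definition continuous_bar f := {within closure D, continuous f}.

(* C^1(\overline D) *)
Definition C1_bar f := continuous_bar f /\
  forall i, (forall x, D x -> derivable f x (ei i)) /\
    exists2 g, continuous_bar g & forall x, D x -> partial i f x = g x.

Definition boundary : set V := closure D `\` D.

Inductive boundary_condition :=
  | Dirichlet
  | Robin (kappa : R) of 0 < kappa.

(* [nu] is the outward unit normal at the boundary point [x]: the blow-up of D
   at [x] is the half space of directions making an obtuse angle with [nu]. *)
Definition outward_normal (x nu : V) := enorm nu = 1 /\
  forall eps, 0 < eps -> \forall y \near x,
    (dotp (y - x) nu < - eps * enorm (y - x) -> D y) /\
    (dotp (y - x) nu > eps * enorm (y - x) -> ~ D y).

Definition boundary_op (bc : boundary_condition) (nu : V -> V) phi x : R :=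
  match bc with
  | Dirichlet => phi x
  | Robin kappa _ => (\sum_i nu x 0 i * partial i phi x) + kappa * phi x
  end.

Definition normal_field (bc : boundary_condition) (nu : V -> V) :=
  match bc with
  | Dirichlet => True
  | Robin _ _ => {ae sigma, forall x, boundary x -> outward_normal x (nu x)}
  end.

(* H v = 0 on the boundary for [v] in H^2(D), in the sense of traces: v is the
   H^2-limit of smooth functions phi_n with H phi_n -> 0 in L^2(boundary). *)
Definition boundary_zero (bc : boundary_condition) v :=
  exists dv ddv nu (phi : nat -> V -> R),
  [/\ H2_with v dv ddv, normal_field bc nu, forall n, smooth (phi n),
   [/\ ns_norm L2 (phi n - v) @[n --> \oo] --> 0,
       forall i, ns_norm L2 (partial i (phi n) - dv i) @[n --> \oo] --> 0 &
       forall i j, ns_norm L2 (partial j (partial i (phi n)) - ddv i j)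
         @[n --> \oo] --> 0] &
   (\int[sigma]_(x in boundary) ((boundary_op bc nu (phi n) x) ^+ 2)%:E)%E
     @[n --> \oo] --> 0%E].

Variables (A : 'I_k.+1 -> 'I_k.+1 -> V -> R) (b : V -> R).

Definition elliptic :=
  [/\ forall i j, C1_bar (A i j),
      forall i j x, closure D x -> A i j x = A j i x,
      continuous_bar b /\ (forall x, closure D x -> 0 <= b x) &
      exists2 L0 : R, 0 < L0 & forall x (xi : V), closure D x ->
        L0 * dotp xi xi <= \sum_i \sum_j xi 0 i * A i j x * xi 0 j].

(* L v = f for [v] in H^2(D) *)
Definition elliptic_op v f := exists dv ddv (h : 'I_k.+1 -> V -> R),
  [/\ H2_with v dv ddv,
      forall i, weak_partial i (fun x => \sum_j A i j x * dv j x) (h i) &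
      ae_in_D (fun x => f x = - (\sum_i h i x) + b x * v x)].

(* sum_j c_j e_j = w in L^2(D) *)
Definition L2_series (e : nat -> V -> R) (c : nat -> R) w :=
  ns_mem L2 w /\
  ns_norm L2 ((fun x => \sum_(j < n) c j * e j x) - w) @[n --> \oo] --> 0.

(* The indices of eigenvalues start at 0. *)
Definition eigensystem (bc : boundary_condition) (m : nat -> R)
    (e : nat -> V -> R) :=
  [/\ [/\ 0 < m 0%N, nondecreasing_seq m & m n @[n --> \oo] --> +oo],
      forall j, [/\ H2 (e j), boundary_zero bc (e j) &
                    elliptic_op (e j) (fun x => m j * e j x)],
      forall i j, inner (e i) (e j) = (i == j)%:R &
      forall v, ns_mem L2 v -> L2_series e (fun j => inner v (e j)) v].

End SpaceDomain.

Section SpectralSpaces.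
Context {R : realType} {k : nat}.
Local Notation V := 'rV[R]_k.+1.
Variables (D : set V) (m : nat -> R) (e : nat -> V -> R).
Local Notation L2 := (Lb D 2).

(* L^gamma v = w *)
Definition pow_op_rel (gamma : R) (v w : V -> R) :=
  L2_series D e (fun j => m j `^ gamma * inner D v (e j)) w.

Definition pow_op (gamma : R) (v : V -> R) : V -> R :=
  xget 0 [set w | pow_op_rel gamma v w].

(* V_gamma, for gamma >= 0 *)
Definition Vpos (gamma : R) : nspace R (V -> R) := NSpace
  [set v | ns_mem L2 v /\ exists w, pow_op_rel gamma v w]
  (fun v => ns_norm L2 (pow_op gamma v)).

(* V_{-gamma}, for gamma > 0: bounded linear functionals on V_gamma. Values
   outside of V_gamma are irrelevant, so that V_{-gamma1} is included in
   V_{-gamma2} for gamma1 <= gamma2. *)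
Definition Vneg (gamma : R) : nspace R ((V -> R) -> R) := NSpace
  [set l | (forall a v w, ns_mem (Vpos gamma) v -> ns_mem (Vpos gamma) w ->
              l (fun x => a * v x + w x) = a * l v + l w) /\
           exists C, forall v, ns_mem (Vpos gamma) v ->
             `|l v| <= C * ns_norm (Vpos gamma) v]
  (fun l => Num.sqrt
     (limn (series (fun j => (l (e j)) ^+ 2 * m j `^ (- 2 * gamma))))).

(* The inclusion of L^2(D) in V_{-gamma}. *)
Definition embed (v : V -> R) : (V -> R) -> R := fun w => inner D v w.

(* Equality in V_{-gamma}. *)
Definition Vneg_eq (gamma : R) (l1 l2 : (V -> R) -> R) :=
  forall v, ns_mem (Vpos gamma) v -> l1 v = l2 v.

Variables (T alpha beta : R).
Local Notation mu := (@lebesgue_measure R).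

(* O_1(t,.) g = w *)
Definition O1 (t : R) (g : R -> V -> R) (w : V -> R) :=
  L2_series D e (fun j => \int[mu]_(tau in `[0, t])
    (inner D (g tau) (e j) * ml_kernel alpha (m j `^ beta) (t - tau))) w.

(* O_2(t,.) v = w *)
Definition O2 (t : R) (v w : V -> R) :=
  L2_series D e (fun j => inner D v (e j) *
    (mittag_leffler alpha 1 (- (m j `^ beta * t `^ alpha)) /
     mittag_leffler alpha 1 (- (m j `^ beta * T `^ alpha)))) w.

(* O_3(t,.) g = w *)
Definition O3 (t : R) (g : R -> V -> R) (w : V -> R) :=
  exists w1 w2, [/\ O1 T g w1, O2 t w1 w2 & w = - w2].

Definition mild_solution (F : R -> V -> R) (phi : V -> R) (u : R -> V -> R) :=
  (exists a b, [/\ 1 <= a, 1 <= b & ns_mem (BochnerL T (Lb D b) a) u]) /\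
  {ae mu, forall t : R, t \in `]0, T[ -> exists w1 w2 w3,
    [/\ O1 t F w1, O2 t phi w2, O3 t F w3 &
        ae_in_D D (fun x => u t x = w1 x + w2 x + w3 x)]}.

(* [u] is the only mild solution, up to null sets. *)
Definition unique_mild_solution (F : R -> V -> R) (phi : V -> R)
    (u : R -> V -> R) :=
  mild_solution F phi u /\
  forall u', mild_solution F phi u' -> {ae mu, forall t : R, t \in `]0, T[ ->
    ae_in_D D (fun x => u' t x = u t x)}.

(* [W] is the termwise Caputo derivative of the curve [U] (in a space of
   functionals), the series converging in V_{-gamma}. *)
Definition caputo_curve (gamma : R) (U W : R -> (V -> R) -> R) :=
  exists w : nat -> R -> R,
    (forall j, caputo T alpha (fun t => U t (e j)) (w j)) /\
    {ae mu, forall t : R, t \in `]0, T[ -> ns_mem (Vneg gamma) (W t) /\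
      ns_norm (Vneg gamma) (embed (fun x => \sum_(j < n) w j t * e j x) - W t)
        @[n --> \oo] --> 0}.

End SpectralSpaces.

(* Main.v *)
(* Taking coefficients in the basis (e_j), with lam_j = m_j^beta, turns the problem
   into scalar equations.  All kernels are built from k_a(t) = t^(a-1)/Gamma(a),
   extended by 0 to t <= 0, with k_a * k_b = k_(a+b); the function
   t^(nu-1) E_(alpha,nu)(- lam t^alpha) is sum_i (- lam)^i k_(alpha i + nu).
   Convolution identities between these kernels give, for e = ml_kernel and
   E = E_(alpha,1), the relations E = k_(1-alpha) * e and t e = alpha (E * e).  Since
   they express e at a point through its earlier values, e > 0 follows, and then
   0 < E <= 1, the upper and lower bounds of order 1/(1 + lam t^alpha) for E, and
   interpolated bounds on lam^theta e.
   The bounds are applied to a sequence of coefficients at once, through Minkowski's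
   and Hoelder's inequalities, f(t) being bounded in l2 by a function of L^P.
   The Duhamel term v satisfies v = k_alpha * (f - lam v), which yields both
   its Hoelder continuity and, by approximating v with Steklov averages of
   f - lam v, its Caputo derivative.  Membership and norms in V_gamma and V_(-gamma)
   are weighted l2 conditions on coefficients by Parseval and Riesz-Fischer. *)
Require Import Defs.
From mathcomp Require Import all_boot all_order all_algebra.
From mathcomp Require Import all_classical all_reals all_analysis.
From mathcomp Require Import measurable_realfun.
From mathcomp Require Import ring lra.
Import Order.TTheory GRing.Theory Num.Theory.
Import numFieldNormedType.Exports.
Local Open Scope classical_set_scope.
Local Open Scope ring_scope.

(** * Power and Gamma integrals *)

(** The surplus [rh > 0] in the integrability of [F] makes P^-1 < alpha q - s strict, and most
    restrictions on the parameters enter through it: by Hoelder, t^(a-1) can be convolved with an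
    L^P function once P^-1 < a. As lam^th e is at most C t^(alpha (1 - th) - 1), the Duhamel term
    carries the weight lam^th for every th <= p + s/alpha, and the defect phi - v(T) keeps the
    weight p + qh of phi. Division by E(T) costs one power of lam, and the bound E(t)/E(T) <= C
    lam^th t^(- alpha (1 - th)) trades weight against the singularity at 0: each space of the
    statement is one choice of th. Two obstacles shape the formulation. The source has no pointwise
    bound in time, so the derivative is bounded by c g(t) + M t^(- alpha), whose two terms are
    integrated differently. Part (b) controls the derivative at every time of ]0, T], whereas F is
    determined only almost everywhere; there the derivative is built from the coefficients of [G]
    and compared with the one built from [F] off a null set. *)

Section affine_change_of_variables.
Context {R : realType}.
Local Notation mu := (@lebesgue_measure R).
Local Open Scope ereal_scope.

(** Both measures give []x, y]] its length, and Lebesgue measure is determined by these values; the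
    dilation below is treated in the same way. *)
Lemma lebesgue_measure_shift (a : R) (A : set R) : measurable A ->
  pushforward mu ((fun x => x + a)%R : _ -> measurableTypeR R) A = mu A.
Proof.
move=> mA; have ms : measurable_fun setT ((fun x => x + a)%R : R -> measurableTypeR R).
  exact: measurable_funD.
apply/esym/lebesgue_measure_unique => //= _ [[x y]] _ <-.
rewrite /pushforward/=.
rewrite (_ : _ @^-1` _ = `](x - a)%R, (y - a)%R]%classic); last first.
  by apply/seteqP; split => z /=; rewrite !in_itv/= ltrBlDr lerBrDr.
rewrite !lebesgue_measure_itv/= !lte_fin ltrD2r.
by case: ifP => // _; rewrite -!EFinB; congr (_%:E); ring.
Qed.

Lemma ge0_integral_shift (a : R) (f : R -> \bar R) :
  measurable_fun setT f -> (forall x, 0 <= f x) ->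
  \int[mu]_x f (x + a)%R = \int[mu]_x f x.
Proof.
move=> mf f0; rewrite [in RHS](_ : setT = setT :> set R)//.
transitivity (\int[pushforward mu
    ((fun x => x + a)%R : _ -> measurableTypeR R)]_x f x).
  by rewrite ge0_integral_pushforward//=; exact: measurable_funD.
have ms : measurable_fun setT ((fun x => x + a)%R : R -> measurableTypeR R).
  exact: measurable_funD.
pose nu := measure_function_pushforward__canonical__measure_function_Measure mu ms.
by apply: (@eq_measure_integral _ _ _ _ mu nu) => //= A mA _; exact: lebesgue_measure_shift.
Qed.

Lemma ge0_integral_opp (f : R -> \bar R) :
  measurable_fun setT f -> (forall x, 0 <= f x) ->
  \int[mu]_x f (- x)%R = \int[mu]_x f x.
Proof.
move=> mf f0.
transitivity (\int[pushforward mu (-%R : _ -> measurableTypeR R)]_x f x).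
  by rewrite ge0_integral_pushforward//= => ? ?; exact: f0.
by apply: eq_measure_integral => //= A mA _; exact: lebesgue_measureN.
Qed.

Lemma ge0_integral_reflect (a : R) (f : R -> \bar R) :
  measurable_fun setT f -> (forall x, 0 <= f x) ->
  \int[mu]_x f (a - x)%R = \int[mu]_x f x.
Proof.
move=> mf f0; rewrite -[in RHS](@ge0_integral_opp f)//.
rewrite -[in RHS](@ge0_integral_shift (- a)%R (fun x => f (- x)%R)).
- by apply: eq_integral => x _; rewrite opprB.
- exact: measurableT_comp.
- by move=> x; exact: f0.
Qed.

Lemma ge0_integral_dilate (c : R) (f : R -> \bar R) : (0 < c)%R ->
  measurable_fun setT f -> (forall x, 0 <= f x) ->
  c%:E * \int[mu]_x f (c * x)%R = \int[mu]_x f x.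
Proof.
move=> c0 mf f0; pose phi : R -> measurableTypeR R := fun x => (c * x)%R.
have mphi : measurable_fun setT phi by exact: measurable_funM.
pose cn : {nonneg R} := NngNum (ltW c0).
pose nu := mscale cn
  (measure_function_pushforward__canonical__measure_function_Measure mu mphi).
transitivity (\int[nu]_x f x).
  by rewrite ge0_integral_mscale//= ge0_integral_pushforward.
apply: eq_measure_integral => //= A mA _; apply/esym/lebesgue_measure_unique => //= _ [[x y]] _ <-.
transitivity (c%:E * mu (phi @^-1` `]x, y]%classic)); last by [].
rewrite /= (_ : _ @^-1` _ = `](x / c)%R, (y / c)%R]%classic)//; last first.
  apply/seteqP; split => z /=; rewrite !in_itv/= /phi;
  by rewrite ltr_pdivrMr// ler_pdivlMr// ![(c * _)%R]mulrC.
rewrite !lebesgue_measure_itv/= !lte_fin ltr_pM2r ?invr_gt0//.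
case: ifP => // _; last by rewrite mule0.
by rewrite -!EFinB -EFinM; congr (_%:E); field; rewrite gt_eqF.
Qed.

End affine_change_of_variables.

Section power_integral.
Context {R : realType}.
Local Notation mu := (@lebesgue_measure R).

Lemma continuous_powR (a x : R) : 0 < x -> {for x, continuous (@powR R ^~ a)}.
Proof.
move=> x0; apply: differentiable_continuous; apply/derivable1_diffP.
by apply: derivable_powR; rewrite in_itv/= x0.
Qed.

Lemma integral_powR_cc (a x t : R) : 0 < a -> 0 < x -> x < t ->
  (\int[mu]_(y in `[x, t]) (y `^ (a - 1))%:E = ((t `^ a - x `^ a) / a)%:E)%E.
Proof.
move=> a0 x0 xt.
have pos y : y \in `[x, t] -> 0 < y by rewrite in_itv/= => /andP[+ _]; exact: lt_le_trans.
rewrite (@continuous_FTC2 _ _ (fun y => a^-1 * y `^ a))//.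
- by rewrite -EFinB; congr (_%:E); field; rewrite gt_eqF.
- apply: derivable_within_continuous => y /pos y0.
  by apply: derivable_powR; rewrite in_itv/= y0.
- have dd y : 0 < y -> derivable (fun y => a^-1 * y `^ a) y 1.
    move=> y0; apply: derivableM; first exact: derivable_cst.
    by apply: derivable_powR; rewrite in_itv/= y0.
  have cc y : 0 < y -> {for y, continuous (fun y => a^-1 * y `^ a)}.
    by move=> y0; apply: differentiable_continuous; apply/derivable1_diffP/dd.
  split.
  + by move=> y yxt; apply/dd/pos; exact: subset_itv_oo_cc.
  + by apply: cvg_at_right_filter; exact: cc.
  + by apply: cvg_at_left_filter; apply: cc; exact: lt_trans xt.
- move=> y yxt; have y0 : 0 < y by apply: pos; exact: subset_itv_oo_cc.
  have dp : derivable (@powR R ^~ a) y 1 by apply: derivable_powR; rewrite in_itv/= y0.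
  rewrite derive1E deriveM//= derive_cst scaler0 addr0.
  rewrite -derive1E powR_derive1 ?in_itv/= ?y0//.
  by rewrite /GRing.scale/= mulrA mulVf ?mul1r// gt_eqF.
Qed.

Lemma powR_cvg0r (a : R) : 0 < a -> (n.+1%:R^-1 : R) `^ a @[n --> \oo] --> (0 : R).
Proof.
move=> a0; have /cvg_at_rightP := @powR_cvg0 R a a0; apply; split.
  by move=> n; rewrite invr_gt0.
exact: cvg_harmonic.
Qed.

Lemma integral_powR (a t : R) : 0 < a -> 0 < t ->
  (\int[mu]_(y in `]0%R, t]) (y `^ (a - 1))%:E = (t `^ a / a)%:E)%E.
Proof.
(* For a < 1 the integrand is singular at 0, so the fundamental theorem of calculus is applied on
   [1/(n+1), t] and the interval is exhausted by monotone convergence. *)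
move=> a0 t0; pose F (n : nat) : set R := `[n.+1%:R^-1, t]%classic.
have FE : `]0, t]%classic = \bigcup_n F n.
  apply/seteqP; split => [y /=|y [n _]]; rewrite ?/F/= !in_itv/=.
    move=> /andP[y0 yt]; exists (Num.truncn y^-1) => //.
    rewrite /F/= in_itv/= yt andbT invf_ple ?posrE//.
    by rewrite ltW// truncnS_gt.
  by move=> /andP[ny ->]; rewrite andbT (lt_le_trans _ ny).
rewrite FE.
have ndF : nondecreasing_seq F.
  move=> i n lin; apply/subsetPset => y; rewrite /F/= !in_itv/= => /andP[ny ->].
  by rewrite andbT (le_trans _ ny)// lef_pV2 ?posrE// ler_nat.
have h := @ge0_nondecreasing_set_cvg_integral _ (measurableTypeR R) R F
    (fun y : R => (y `^ (a - 1))%:E) mu ndF.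
have {h}/cvg_lim <- // : (\int[mu]_(y in F n) (y `^ (a - 1))%:E)%E @[n --> \oo] -->
    (\int[mu]_(y in \bigcup_n F n) (y `^ (a - 1))%:E)%E.
  apply: h.
  - by move=> i; exact: measurable_itv.
  - by move=> i; apply/measurable_EFinP/measurable_funTS; exact: measurable_powR.
  - by move=> i x _; rewrite lee_fin powR_ge0.
apply/cvg_lim => //.
apply: (@cvg_trans _ ((((t `^ a - (n.+1%:R^-1) `^ a) / a)%:E) @[n --> \oo])).
  apply: near_eq_cvg; have [N _ HN] : \forall n \near \oo, n.+1%:R^-1 < t.
    by have /cvgr_lt /(_ t t0) := @cvg_harmonic R.
  exists N => // n /= Nn; rewrite integral_powR_cc//; exact: HN.
apply: cvg_EFin; first by near=> n.
apply: cvgMl; rewrite -[X in _ --> X]subr0; apply: cvgB; first exact: cvg_cst.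
exact: powR_cvg0r.
Unshelve. all: end_near. Qed.

End power_integral.

Section gamma.
Context {R : realType}.
Local Notation mu := (@lebesgue_measure R).
Implicit Types a b t : R.

(** One term of the exponential series at x / 2 already dominates the power; the other half of the
    exponent is kept for integrability. *)
Lemma powR_le_expR a : exists C : R, forall x, 1 <= x -> x `^ (a - 1) <= C * expR (x / 2).
Proof.
pose n := Num.truncn (`|a|); have an : a - 1 <= n.+1%:R.
  by rewrite lerBlDr (le_trans (ler_norm _))// ltW// (lt_le_trans (truncnS_gt _))// lerDl.
exists (2 ^+ n.+1 * n.+1`!%:R) => x x1; have x0 : 0 <= x by rewrite (le_trans _ x1).
rewrite (le_trans (ler_powR x1 an))// powR_mulrn//.
have := @expR_ge1Dxn R (x / 2) n; rewrite divr_ge0// => /(_ isT) h.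
have {h} : (x / 2) ^+ n.+1 / n.+1`!%:R <= expR (x / 2) by rewrite (le_trans _ h)// lerDr.
by rewrite ler_pdivrMr ?ltr0n ?fact_gt0// expr_div_n ler_pdivrMr ?exprn_gt0// => /le_trans; apply;
  rewrite le_eqVlt; apply/orP; left; apply/eqP; ring.
Qed.

Definition gamma_pdf a t : R := if 0 < t then t `^ (a - 1) * expR (- t) else 0.

Lemma gamma_pdf_ge0 a t : 0 <= gamma_pdf a t.
Proof. by rewrite /gamma_pdf; case: ifP => // _; rewrite mulr_ge0 ?powR_ge0 ?expR_ge0. Qed.

Lemma measurable_causal (f : R -> R) : measurable_fun setT f ->
  measurable_fun setT (fun t => if 0 < t then f t else 0).
Proof.
move=> mf; apply: measurable_fun_if => //.
- exact: measurable_fun_ltr.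
- exact: measurable_funTS.
Qed.

Lemma measurable_gamma_pdf a : measurable_fun setT (gamma_pdf a).
Proof.
apply: measurable_causal; apply: measurable_funM; first exact: measurable_powR.
by apply: measurableT_comp => //; exact: measurable_expR.
Qed.

Lemma integral_expRN : (\int[mu]_(x in `[0%R, +oo[) (expR (- x))%:E = 1)%E.
Proof.
have := @integral_exponential_pdf R 1 ltr01.
rewrite /exponential_pdf => <-; rewrite integral_mkcond; apply: eq_integral => x _.
by rewrite !patchE; case: ifP => //= _; rewrite mul1r mulNr mul1r.
Qed.

Lemma gamma_integral_lty a : 0 < a -> (\int[mu]_x (gamma_pdf a x)%:E < +oo)%E.
Proof.
move=> a0; have [C HC] := powR_le_expR a.
pose C' := Num.max C 0.
have C'0 : 0 <= C' by rewrite /C' le_max lexx orbT.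
have HC' x : 1 <= x -> x `^ (a - 1) <= C' * expR (x / 2).
  by move=> /HC/le_trans; apply; rewrite ler_wpM2r ?expR_ge0// /C' le_max lexx.
pose g1 x : \bar R := ((fun x => (x `^ (a - 1))%:E) \_ `]0%R, 1%R]) x.
pose g2 x : \bar R := (C'%:E * 2%:E * ((EFin \o exponential_pdf 2^-1) x))%E.
apply: (@le_lt_trans _ _ (\int[mu]_x (g1 x + g2 x))%E).
  apply: ge0_le_integral => //.
  - by move=> x _; rewrite lee_fin gamma_pdf_ge0.
  - by apply/measurable_EFinP; exact: measurable_gamma_pdf.
  - apply: emeasurable_funD.
      apply/(measurable_restrictT (fun x => (x `^ (a - 1))%:E)) => //.
      by apply/measurable_EFinP/measurable_funTS; exact: measurable_powR.
    apply: emeasurable_funM => //.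
    by apply/measurable_EFinP; exact: measurable_exponential_pdf.
  move=> x _; rewrite /gamma_pdf; have [x0|x0] := ltP 0 x; last first.
    rewrite adde_ge0// ?/g1 ?/g2; first by rewrite erestrict_ge0// => y _; rewrite lee_fin powR_ge0.
    by rewrite ?mule_ge0// lee_fin ?exponential_pdf_ge0.
  have h2 : (0 <= g2 x)%E by rewrite ?mule_ge0// lee_fin ?exponential_pdf_ge0.
  have [x1|x1] := leP x 1.
    rewrite (@le_trans _ _ (g1 x))// ?leeDl// /g1 patchE mem_set/=; last first.
      by rewrite in_itv/= x0.
    by rewrite lee_fin ler_piMr ?powR_ge0// -expR0 ler_expR oppr_le0 ltW.
  rewrite (@le_trans _ _ (g2 x))// ?leeDr//; last first.
    by rewrite /g1 erestrict_ge0// => y _; rewrite lee_fin powR_ge0.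
  rewrite /g2/= /exponential_pdf patchE mem_set/=; last first.
    by rewrite in_itv/= andbT ltW.
  rewrite -!EFinM lee_fin (_ : C' * 2 * _ = C' * expR (x / 2) * expR (- x)).
    by rewrite ler_wpM2r ?expR_ge0// HC'// ltW.
  rewrite -[RHS]mulrA -expRD -!mulrA; congr (_ * _).
  by rewrite mulrA mulfV// mul1r; congr expR; lra.
have g1E : (\int[mu]_x g1 x = (a^-1)%:E)%E.
  by rewrite /g1 -integral_mkcond integral_powR// powR1 div1r.
rewrite ge0_integralD//; last 4 first.
- by move=> x _; rewrite /g1 erestrict_ge0// => y _; rewrite lee_fin powR_ge0.
- apply/(measurable_restrictT (fun x => (x `^ (a - 1))%:E)) => //.
  by apply/measurable_EFinP/measurable_funTS; exact: measurable_powR.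
- by move=> x _; rewrite ?mule_ge0// lee_fin ?exponential_pdf_ge0.
- apply: emeasurable_funM => //.
  by apply/measurable_EFinP; exact: measurable_exponential_pdf.
rewrite g1E /g2 ge0_integralZl//; last 3 first.
- by apply/measurable_EFinP; exact: measurable_exponential_pdf.
- by move=> x _; rewrite lee_fin exponential_pdf_ge0.
- by rewrite lee_fin mulr_ge0.
by rewrite (@integral_exponential_pdf R 2^-1)// mule1 -EFinM -EFinD ltry.
Qed.

Lemma Gamma_causal a : Gamma a = \int[mu]_x gamma_pdf a x.
Proof.
rewrite /Gamma Rintegral_mkcond; apply: eq_Rintegral => x _.
by rewrite patchE /gamma_pdf mem_setE in_itv/= andbT.
Qed.

Lemma GammaE a : 0 < a -> (\int[mu]_x (gamma_pdf a x)%:E = (Gamma a)%:E)%E.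
Proof.
move=> a0; rewrite Gamma_causal /Rintegral fineK// ge0_fin_numE; first exact: gamma_integral_lty.
by apply: integral_ge0 => x _; rewrite lee_fin gamma_pdf_ge0.
Qed.

Lemma Gamma1 : Gamma (1 : R) = 1.
Proof.
rewrite /Gamma; under eq_Rintegral do rewrite subrr powRr0 mul1r.
rewrite /Rintegral integral_itv_obnd_cbnd ?integral_expRN//.
by apply/measurable_EFinP/measurable_funTS/measurableT_comp.
Qed.

(** Only the mass of [M, M + 1] is counted. With M free, this gives 1/Gamma(al i + nu) <= C M^(- al
    i), which replaces Stirling's formula in the convergence of Mittag-Leffler series. *)
Lemma Gamma_lb a (M : R) : 0 < a -> 1 <= M ->
  M `^ (a - 1) / 2 * expR (- (M + 1)) <= Gamma a.
Proof.
move=> a0 M1; have M0 : 0 < M by rewrite (lt_le_trans _ M1).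
rewrite -lee_fin -GammaE//.
pose c := M `^ (a - 1) / 2 * expR (- (M + 1)).
have c0 : 0 <= c by rewrite mulr_ge0 ?expR_ge0// divr_ge0// powR_ge0.
apply: (@le_trans _ _ (\int[mu]_(x in `[M, (M + 1)%R]) (cst c%:E x))%E).
  rewrite integral_cst//= lebesgue_measure_itv/= lte_fin ltrDl ltr01.
  by rewrite -EFinB addrAC subrr add0r mule1.
rewrite integral_mkcond; apply: ge0_le_integral => //.
- by move=> x _; rewrite erestrict_ge0.
- by apply/(measurable_restrictT (cst c%:E)).
- by apply/measurable_EFinP; exact: measurable_gamma_pdf.
move=> x _; rewrite patchE; case: ifPn; last by rewrite lee_fin gamma_pdf_ge0.
rewrite inE/= in_itv/= => /andP[Mx xM]; rewrite /cst lee_fin /gamma_pdf.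
have x0 : 0 < x by exact: lt_le_trans Mx.
rewrite x0; apply: ler_pM; rewrite ?expR_ge0 ?ler_expR ?lerN2//.
  by rewrite divr_ge0// powR_ge0.
have [a1|a1] := leP 1 a.
  apply: (@le_trans _ _ (M `^ (a - 1))).
    by rewrite ler_pdivrMr// ler_peMr ?powR_ge0// ler1n.
  by rewrite ge0_ler_powR ?nnegrE ?subr_ge0// ltW.
(* For a < 1 the power decreases, but x / M lies in [1, 2], so the loss is at most 2^(a-1) >=
   1/2. *)
have -> : x `^ (a - 1) = M `^ (a - 1) * (x / M) `^ (a - 1).
  by rewrite -powRM ?divr_ge0 ?(ltW x0) ?(ltW M0)// mulrCA mulfV ?mulr1// gt_eqF.
rewrite ler_wpM2l ?powR_ge0//.
have xM2 : x / M <= 2 by rewrite ler_pdivrMr//; lra.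
have xM1 : 1 <= x / M by rewrite ler_pdivlMr// mul1r.
rewrite -[a - 1]opprB powRN lef_pV2 ?posrE ?powR_gt0 ?divr_gt0//.
by rewrite (le_trans _ xM2)// ler1_powR// gerBl ltW.
Qed.

Lemma Gamma_gt0 a : 0 < a -> 0 < Gamma a.
Proof.
move=> a0; apply: (lt_le_trans _ (@Gamma_lb a 1 a0 (lexx 1))).
by rewrite mulr_gt0 ?expR_gt0// divr_gt0// powR_gt0.
Qed.

End gamma.

Set Implicit Arguments.
Unset Strict Implicit.
Unset Printing Implicit Defensive.

Opaque Gamma.

(** * Convolutions and fractional integration kernels *)

Section convolution.
Context {R : realType}.
Local Notation mu := (@lebesgue_measure R).
Local Open Scope ereal_scope.
Implicit Types f g h : R -> \bar R.

(** Convolution over the whole line with extended values: for nonnegative functions, commutativity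
    and associativity then need no integrability. Convolutions over [0, t] are recovered from
    factors that vanish at nonpositive times. *)
Definition econv f g (t : R) : \bar R := \int[mu]_x (f (t - x)%R * g x).

Lemma econv_ge0 f g t : (forall x, 0 <= f x) -> (forall x, 0 <= g x) ->
  0 <= econv f g t.
Proof. by move=> f0 g0; apply: integral_ge0 => x _; rewrite mule_ge0. Qed.

Lemma measurable_reflect f (t : R) : measurable_fun setT f ->
  measurable_fun setT (fun x : R => f (t - x)%R).
Proof. by move=> mf; apply: measurableT_comp => //; exact: measurable_funB. Qed.

Lemma econvC f g t : measurable_fun setT f -> measurable_fun setT g ->
  (forall x, 0 <= f x) -> (forall x, 0 <= g x) -> econv f g t = econv g f t.
Proof.
move=> mf mg f0 g0.
rewrite /econv -(@ge0_integral_reflect _ t (fun x => g (t - x)%R * f x)); last 2 first.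
- by apply: emeasurable_funM => //; exact: measurable_reflect.
- by move=> x; rewrite mule_ge0.
by apply: eq_integral => x _; rewrite subKr muleC.
Qed.

Lemma measurable_econv_ker f g : measurable_fun setT f -> measurable_fun setT g ->
  measurable_fun setT (fun z : R * R => f (z.1 - z.2)%R * g z.2).
Proof.
move=> mf mg; apply: emeasurable_funM.
  by apply: measurableT_comp => //; exact: measurable_funB.
exact: measurableT_comp.
Qed.

Lemma measurable_econv f g : measurable_fun setT f -> measurable_fun setT g ->
  (forall x, 0 <= f x) -> (forall x, 0 <= g x) -> measurable_fun setT (econv f g).
Proof.
move=> mf mg f0 g0.
apply: (@measurable_fun_fubini_tonelli_F _ _ (measurableTypeR R) (measurableTypeR R) R
  mu (fun z => f (z.1 - z.2)%R * g z.2)); first exact: measurable_econv_ker.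
by move=> z; rewrite mule_ge0.
Qed.

Lemma econvA f g h t : measurable_fun setT f -> measurable_fun setT g ->
  measurable_fun setT h -> (forall x, 0 <= f x) -> (forall x, 0 <= g x) ->
  (forall x, 0 <= h x) -> econv f (econv g h) t = econv (econv f g) h t.
Proof.
move=> mf mg mh f0 g0 h0.
pose K (z : R * R) := f (t - z.1)%R * (g (z.1 - z.2)%R * h z.2).
transitivity (\int[mu]_x \int[mu]_y K (x, y)).
  apply: eq_integral => x _; rewrite /K/= ge0_integralZl//.
  - apply: emeasurable_funM => //; exact: measurable_reflect.
  - by move=> y _; rewrite mule_ge0.
rewrite (@fubini_tonelli _ _ (measurableTypeR R) (measurableTypeR R) R mu mu K).
- apply: eq_integral => y _; rewrite /K/=.
  under eq_integral do rewrite muleA.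
  rewrite ge0_integralZr//; last 2 first.
  + apply: emeasurable_funM; first exact: measurable_reflect.
    by apply: measurableT_comp => //; exact: measurable_funB.
  + by move=> x _; rewrite mule_ge0.
  congr (_ * _).
  rewrite /econv -(@ge0_integral_shift _ y (fun x => f (t - x)%R * g (x - y)%R)).
  + by apply: eq_integral => x _; rewrite addrK opprD addrA addrAC.
  + apply: emeasurable_funM; first exact: measurable_reflect.
    by apply: measurableT_comp => //; exact: measurable_funB.
  + by move=> x; rewrite mule_ge0.
- apply: emeasurable_funM; last exact: measurable_econv_ker.
  by apply: measurableT_comp => //; exact: measurable_funB.
- by move=> z; rewrite !mule_ge0.
Qed.

Lemma integral_econv f g : measurable_fun setT f -> measurable_fun setT g ->
  (forall x, 0 <= f x) -> (forall x, 0 <= g x) ->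
  \int[mu]_t econv f g t = (\int[mu]_x f x) * (\int[mu]_x g x).
Proof.
move=> mf mg f0 g0.
rewrite /econv (@fubini_tonelli _ _ (measurableTypeR R) (measurableTypeR R) R mu mu
  (fun z => f (z.1 - z.2)%R * g z.2)).
- rewrite -ge0_integralZl//; last exact: integral_ge0.
  apply: eq_integral => y _ /=; rewrite ge0_integralZr//.
  + congr (_ * _); rewrite -(@ge0_integral_shift _ (- y)%R f)//.
  + by apply: measurableT_comp => //; exact: measurable_funB.
- exact: measurable_econv_ker.
- by move=> z; rewrite mule_ge0.
Qed.

End convolution.

Section riemann_liouville_kernel.
Context {R : realType}.
Local Notation mu := (@lebesgue_measure R).
Implicit Types a b t : R.

Definition cpow a t : R := if 0 < t then t `^ (a - 1) else 0.

Lemma cpow_ge0 a t : 0 <= cpow a t.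
Proof. by rewrite /cpow; case: ifP => // _; exact: powR_ge0. Qed.

Lemma measurable_cpow a : measurable_fun setT (cpow a).
Proof. by apply: measurable_causal; exact: measurable_powR. Qed.

Lemma cpowM a c t : 0 < c -> cpow a (c * t) = c `^ (a - 1) * cpow a t.
Proof.
move=> c0; rewrite /cpow pmulr_rgt0//; case: ifP => [t0|]; last by rewrite mulr0.
by rewrite powRM// ltW.
Qed.

Lemma econv_causal0 (f g : R -> R) t : t <= 0 ->
  (forall x, x <= 0 -> f x = 0) -> (forall x, x <= 0 -> g x = 0) ->
  econv (EFin \o f) (EFin \o g) t = 0%E.
Proof.
move=> t0 f0 g0; apply: integral0_eq => x _ /=.
have [x0|x0] := leP x 0; first by rewrite g0// mule0.
by rewrite f0 ?mul0e// subr_le0 (le_trans t0)// ltW.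
Qed.

(** The Beta function B(a, b), as a convolution at time 1. *)
Definition betaB a b := econv (EFin \o cpow a) (EFin \o cpow b) 1.

Let mcpow a : measurable_fun setT (EFin \o cpow a).
Proof. by apply/measurable_EFinP; exact: measurable_cpow. Qed.

Let cpow0 a x : (0 <= (EFin \o cpow a) x)%E.
Proof. by rewrite lee_fin cpow_ge0. Qed.

(** Substituting t x for x pulls the powers of t out of the integral. *)
Lemma econv_cpow a b t : 0 < t ->
  econv (EFin \o cpow a) (EFin \o cpow b) t = ((t `^ (a + b - 1))%:E * betaB a b)%E.
Proof.
move=> t0; pose h (x : R) := ((EFin \o cpow a) (t - x)%R * (EFin \o cpow b) x)%E.
have mh : measurable_fun setT h.
  by apply: emeasurable_funM; [apply: measurable_reflect; exact: mcpow|exact: mcpow].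
have h0 x : (0 <= h x)%E by rewrite mule_ge0// cpow0.
rewrite -[LHS]/(\int[mu]_x h x)%E -(ge0_integral_dilate t h t0 mh h0).
transitivity (t%:E * ((t `^ (a - 1) * t `^ (b - 1))%:E * betaB a b))%E.
  congr (_ * _)%E; rewrite /betaB /econv -ge0_integralZl//; last 3 first.
  - by apply: emeasurable_funM; [exact: (measurable_reflect 1 (mcpow a))|exact: mcpow].
  - by move=> x _; rewrite mule_ge0// cpow0.
  - by rewrite lee_fin mulr_ge0 ?powR_ge0.
  apply: eq_integral => x _; rewrite /h/= -{1}[t]mulr1 -mulrBr !cpowM// -!EFinM.
  by congr (_%:E); ring.
rewrite muleA -EFinM; congr (_%:E * _)%E.
rewrite -{1}[t]powRr1 ?ltW// -!powRD; last 2 first.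
- by apply/implyP => _; rewrite gt_eqF.
- by apply/implyP => _; rewrite gt_eqF.
by congr (_ `^ _); ring.
Qed.

(** The convolution of two Gamma densities is integrated in two ways: as a product of integrals, and
    as B(a, b) times another Gamma integral, since the factor exp(- (t - x)) exp(- x) = exp(- t)
    leaves the inner integral. *)
Lemma betaBE a b : 0 < a -> 0 < b ->
  betaB a b = (Gamma a * Gamma b / Gamma (a + b))%:E.
Proof.
move=> a0 b0; have ab0 : 0 < a + b by exact: addr_gt0.
have mG c : measurable_fun setT (EFin \o @gamma_pdf R c).
  by apply/measurable_EFinP; exact: measurable_gamma_pdf.
have G0 c x : (0 <= (EFin \o @gamma_pdf R c) x)%E by rewrite lee_fin gamma_pdf_ge0.
have gE c x : gamma_pdf c x = expR (- x) * cpow c x :> R.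
  by rewrite /gamma_pdf /cpow; case: ifP => _; rewrite ?mulr0// mulrC.
have B0 : (0 <= betaB a b)%E by apply: econv_ge0.
have := integral_econv (mG a) (mG b) (G0 a) (G0 b).
rewrite !GammaE// -EFinM.
have -> : (\int[mu]_t econv (EFin \o gamma_pdf a) (EFin \o gamma_pdf b) t =
    \int[mu]_t (betaB a b * (EFin \o gamma_pdf (a + b)) t))%E.
  apply: eq_integral => t _; have [t0|t0] := ltP 0 t; last first.
    rewrite econv_causal0//; first by rewrite /= /gamma_pdf ltNge t0 mule0.
      by move=> x x0; rewrite /gamma_pdf ltNge x0.
    by move=> x x0; rewrite /gamma_pdf ltNge x0.
  rewrite /= gE /cpow t0 mulrC EFinM muleA [(betaB a b * _)%E]muleC -econv_cpow// muleC.
  have mh : measurable_fun setT (fun x : R => (EFin \o cpow a) (t - x)%R * (EFin \o cpow b) x)%E.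
    by apply: emeasurable_funM; [exact: (measurable_reflect t (mcpow a))|exact: mcpow].
  have h0 (x : R) : setT x -> (0 <= (EFin \o cpow a) (t - x)%R * (EFin \o cpow b) x)%E.
    by move=> _; rewrite mule_ge0// cpow0.
  rewrite /econv -(ge0_integralZl mu measurableT mh h0) ?lee_fin ?expR_ge0//.
  apply: eq_integral => x _ /=; rewrite !gE -!EFinM; congr (_%:E).
  by rewrite mulrACA -expRD; congr (expR _ * _); ring.
rewrite (ge0_integralZl mu measurableT (mG (a + b)) (fun x _ => G0 (a + b) x) B0).
rewrite [X in (_ * X)%E](GammaE (a + b))//.
(* So far B(a, b) is only an extended number; an infinite value is excluded by the finite product on
   the other side. *)
case: (betaB a b) B0 => [r|//|//] _; last by rewrite gt0_mulye// lte_fin Gamma_gt0.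
by rewrite -EFinM => -[<-]; rewrite mulfK// gt_eqF// Gamma_gt0.
Qed.

(* The kernel [t^(a-1) / Gamma a] of [I_t^a], extended by 0 to nonpositive times. *)
Definition kk a t : R := cpow a t / Gamma a.

Lemma kkE a t : 0 < t -> kk a t = t `^ (a - 1) / Gamma a.
Proof. by rewrite /kk /cpow => ->. Qed.

Lemma kk_le0 a t : t <= 0 -> kk a t = 0.
Proof. by rewrite /kk /cpow leNgt => /negbTE->; rewrite mul0r. Qed.

Lemma kk_ge0 a t : 0 < a -> 0 <= kk a t.
Proof. by move=> a0; rewrite /kk divr_ge0 ?cpow_ge0// ltW// Gamma_gt0. Qed.

Lemma kk_gt0 a t : 0 < a -> 0 < t -> 0 < kk a t.
Proof. by move=> a0 t0; rewrite kkE// divr_gt0 ?powR_gt0// Gamma_gt0. Qed.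

Lemma measurable_kk a : measurable_fun setT (kk a).
Proof. by apply: measurable_funM => //; exact: measurable_cpow. Qed.

Lemma econv_kk a b t : 0 < a -> 0 < b ->
  econv (EFin \o kk a) (EFin \o kk b) t = (kk (a + b) t)%:E.
Proof.
move=> a0 b0; have [t0|t0] := ltP 0 t; last first.
  by rewrite econv_causal0//; [rewrite kk_le0|exact: kk_le0|exact: kk_le0].
have c0 : 0 <= (Gamma a * Gamma b)^-1 by rewrite invr_ge0 mulr_ge0// ltW// Gamma_gt0.
transitivity (((Gamma a * Gamma b)^-1)%:E *
    econv (EFin \o cpow a) (EFin \o cpow b) t)%E.
  rewrite /econv -ge0_integralZl//; last 2 first.
  - by apply: emeasurable_funM; [exact: (measurable_reflect t (mcpow a))|exact: mcpow].
  - by move=> x _; rewrite mule_ge0// cpow0.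
  apply: eq_integral => x _ /=; rewrite -!EFinM /kk invfM; congr (_%:E).
  by move: (Gamma a)^-1 (Gamma b)^-1 => ? ?; ring.
rewrite econv_cpow// betaBE// -!EFinM kkE//; congr (_%:E).
have := (Gamma_gt0 _ a0, Gamma_gt0 _ b0, Gamma_gt0 _ (addr_gt0 a0 b0)) => -[[]].
move: (Gamma a) (Gamma b) (Gamma (a + b)) => x y z x0 y0 z0.
by field; rewrite !gt_eqF.
Qed.

Lemma kk1 t : 0 < t -> kk 1 t = 1.
Proof. by move=> t0; rewrite kkE// subrr powRr0 Gamma1 divr1. Qed.

Lemma integral_cpow a t : 0 < a -> 0 < t ->
  (\int[mu]_x (kk 1 (t - x) * cpow a x)%:E = (t `^ a / a)%:E)%E.
Proof.
move=> a0 t0; rewrite -integral_powR// -integral_itv_bndo_bndc; last first.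
  by apply/measurable_EFinP/measurable_funTS; exact: measurable_powR.
rewrite [RHS]integral_mkcond; apply: eq_integral => x _.
rewrite patchE mem_setE in_itv/= /cpow.
have [x0|x0] := ltP 0 x; last by rewrite mulr0.
have [xt|xt] := ltP x t => /=; first by rewrite kk1 ?mul1r// subr_gt0.
by rewrite kk_le0 ?mul0r// subr_le0.
Qed.

(** Read off from k_1 * k_a = k_(a+1) at time 1, whose left side is the integral of t^(a-1) over ]0,
    1[; no integration by parts is needed. *)
Lemma GammaS a : 0 < a -> Gamma (a + 1) = a * Gamma a.
Proof.
move=> a0; have := @econv_kk 1 a 1 ltr01 a0.
rewrite /econv; under eq_integral do rewrite /= {2}/kk -EFinM mulrA EFinM.
rewrite ge0_integralZr//; last 3 first.
- apply/measurable_EFinP; apply: measurable_funM; last exact: measurable_cpow.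
  by apply: measurableT_comp; [exact: measurable_kk|exact: measurable_funB].
- by move=> x _; rewrite lee_fin mulr_ge0 ?kk_ge0 ?cpow_ge0.
- by rewrite lee_fin invr_ge0 ltW// Gamma_gt0.
have G1 : Gamma (a + 1) != 0 by rewrite gt_eqF// Gamma_gt0// addr_gt0.
have G0 : Gamma a != 0 by rewrite gt_eqF// Gamma_gt0.
rewrite integral_cpow// kkE// !powR1 addrC !div1r -EFinM -invfM.
by move=> [/invr_inj].
Qed.

End riemann_liouville_kernel.

Section real_convolution.
Context {R : realType}.
Local Notation mu := (@lebesgue_measure R).
Implicit Types f g : R -> R.

Definition cvl f g (t : R) : R := \int[mu]_x (f (t - x) * g x).

Lemma cvlE f g t : cvl f g t = \int[mu]_x (f (t - x) * g x).
Proof. by []. Qed.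

(** The real integral is the finite part of an extended one and sends an infinite value to 0, so
    identities for [cvl] are accompanied by this integrability. *)
Definition cint f g (t : R) : Prop :=
  mu.-integrable setT (EFin \o (fun x : R => f (t - x) * g x)).

Lemma measurable_conv_ker f g t : measurable_fun setT f -> measurable_fun setT g ->
  measurable_fun setT (fun x : R => f (t - x) * g x).
Proof.
move=> mf mg; apply: measurable_funM => //.
by apply: measurableT_comp => //; exact: measurable_funB.
Qed.

Lemma econv_cvl f g t r : measurable_fun setT f -> measurable_fun setT g ->
  (forall x, 0 <= f x) -> (forall x, 0 <= g x) ->
  econv (EFin \o f) (EFin \o g) t = r%:E -> cint f g t /\ cvl f g t = r.
Proof.
move=> mf mg f0 g0 h; split.
  apply/integrableP; split; first by apply/measurable_EFinP; exact: measurable_conv_ker.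
  rewrite (_ : integral _ _ _ = r%:E) ?ltry// -h; apply: eq_integral => x _ /=.
  by rewrite ger0_norm// mulr_ge0.
by rewrite /cvl /Rintegral -[r]/(fine r%:E) -h.
Qed.

Lemma econv_cint f g t : (forall x, 0 <= f x) -> (forall x, 0 <= g x) -> cint f g t ->
  econv (EFin \o f) (EFin \o g) t = (cvl f g t)%:E.
Proof.
move=> f0 g0 h; rewrite /cvl /Rintegral fineK//; last exact: (integrable_fin_num _ h).
Qed.

Lemma cint_le f g f' g' t c : measurable_fun setT f' -> measurable_fun setT g' ->
  (forall x, `|f' (t - x) * g' x| <= c * (f (t - x) * g x)) ->
  cint f g t -> cint f' g' t.
Proof.
move=> mf' mg' h i.
apply: le_integrable (integrableZl measurableT c i) => //.
- by apply/measurable_EFinP; exact: measurable_conv_ker.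
- by move=> x _ /=; rewrite lee_fin (le_trans (h x))// ler_norm.
Qed.

Lemma cvl_abs_le f g f' g' t c : measurable_fun setT f' -> measurable_fun setT g' ->
  (forall x, `|f' (t - x) * g' x| <= c * (f (t - x) * g x)) ->
  cint f g t -> `|cvl f' g' t| <= c * cvl f g t.
Proof.
move=> mf' mg' h i; have i' := cint_le mf' mg' h i.
rewrite /cvl (le_trans (le_normr_Rintegral measurableT i'))// -RintegralZl//.
apply: le_Rintegral => //; first exact: (integrable_norm i').
exact: (integrableZl measurableT c i).
Qed.

Lemma cvl_le f g f' g' s t : cint f g s -> cint f' g' t ->
  (forall x, f (s - x) * g x <= f' (t - x) * g' x) -> cvl f g s <= cvl f' g' t.
Proof. by move=> i i' h; apply: le_Rintegral. Qed.

Lemma cvl_eq0 f g t : (forall x, f (t - x) * g x = 0) -> cvl f g t = 0.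
Proof. by move=> h; rewrite /cvl /Rintegral integral0_eq// => x _; rewrite h. Qed.

Lemma cvl_ge0 f g t : (forall x, 0 <= f x) -> (forall x, 0 <= g x) -> 0 <= cvl f g t.
Proof. by move=> f0 g0; apply: Rintegral_ge0 => x _; rewrite mulr_ge0. Qed.

Lemma cintZr f g t c : cint f g t -> cint f (fun x => c * g x) t.
Proof.
move=> i; apply: eq_integrable (integrableZl measurableT c i) => // x _ /=.
by rewrite -EFinM mulrCA.
Qed.

Lemma cvlZr f g t c : cint f g t -> cvl f (fun x => c * g x) t = c * cvl f g t.
Proof.
move=> i; rewrite /cvl -RintegralZl//; apply: eq_Rintegral => x _.
by rewrite mulrCA.
Qed.

Lemma cintDr f g1 g2 t : cint f g1 t -> cint f g2 t -> cint f (fun x => g1 x + g2 x) t.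
Proof.
move=> i1 i2; apply: eq_integrable (integrableD measurableT i1 i2) => // x _ /=.
by rewrite -EFinD mulrDr.
Qed.

Lemma cvlDr f g1 g2 t : cint f g1 t -> cint f g2 t ->
  cvl f (fun x => g1 x + g2 x) t = cvl f g1 t + cvl f g2 t.
Proof.
move=> i1 i2; rewrite /cvl -RintegralD//; apply: eq_Rintegral => x _.
by rewrite mulrDr.
Qed.

Lemma cintBr f g1 g2 t : cint f g1 t -> cint f g2 t -> cint f (fun x => g1 x - g2 x) t.
Proof.
move=> i1 i2; have := cintDr i1 (cintZr (-1) i2).
by apply: eq_integrable => // x _; rewrite /= mulN1r.
Qed.

Lemma cvlBr f g1 g2 t : cint f g1 t -> cint f g2 t ->
  cvl f (fun x => g1 x - g2 x) t = cvl f g1 t - cvl f g2 t.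
Proof.
move=> i1 i2; rewrite /cvl -RintegralB//; apply: eq_Rintegral => x _.
by rewrite mulrBr.
Qed.

Lemma cintZl f g t c : cint f g t -> cint (fun x => c * f x) g t.
Proof.
move=> i; apply: eq_integrable (integrableZl measurableT c i) => // x _ /=.
by rewrite -EFinM mulrA.
Qed.

Lemma cvlZl f g t c : cint f g t -> cvl (fun x => c * f x) g t = c * cvl f g t.
Proof.
move=> i; rewrite /cvl -RintegralZl//; apply: eq_Rintegral => x _.
by rewrite mulrA.
Qed.

Lemma cvlBl f1 f2 g t : cint f1 g t -> cint f2 g t ->
  cvl (fun x => f1 x - f2 x) g t = cvl f1 g t - cvl f2 g t.
Proof.
move=> i1 i2; rewrite /cvl -RintegralB//; apply: eq_Rintegral => x _.
by rewrite mulrBl.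
Qed.

Lemma eq_cvl f g f' g' t : (forall x, f (t - x) * g x = f' (t - x) * g' x) ->
  cvl f g t = cvl f' g' t.
Proof. by move=> h; apply: eq_Rintegral => x _. Qed.

Lemma eq_cint f g f' g' t : (forall x, f (t - x) * g x = f' (t - x) * g' x) ->
  cint f g t -> cint f' g' t.
Proof. by move=> h; apply: eq_integrable => // x _ /=; rewrite h. Qed.

Lemma cvl_kk a b t : 0 < a -> 0 < b -> cint (kk a) (kk b) t /\ cvl (kk a) (kk b) t = kk (a + b) t.
Proof.
move=> a0 b0; apply: econv_cvl; rewrite ?econv_kk//; try exact: measurable_kk.
  by move=> x; exact: kk_ge0.
by move=> x; exact: kk_ge0.
Qed.

End real_convolution.

(** Applied to the difference of the two sides of an identity between Mittag-Leffler kernels: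
    iterating the recursion expresses d_0 through d_N, and the geometric bound lets N go to
    infinity. Series and integrals are never interchanged. *)
Lemma geometric_remainder (R : realType) (d : nat -> R) (lam C : R) :
  (forall N, d N = - lam * d N.+1) ->
  (forall N, `|lam ^+ N * d N| <= C * 2^-1 ^+ N) -> d 0%N = 0.
Proof.
move=> dS dC; have d0N N : d 0%N = (- lam) ^+ N * d N.
  by elim: N => [|N ->]; [rewrite mul1r|rewrite exprSr -mulrA -dS].
apply/eqP; rewrite -normr_le0.
have : (geometric C 2^-1 : R^nat) @ \oo --> (0 : R).
  by apply: cvg_geometric; rewrite ger0_norm// invf_lt1// ltr1n.
move/cvg_lim => <- //; apply: limr_ge.
  by apply/cvg_ex; exists 0; apply: cvg_geometric; rewrite ger0_norm// invf_lt1// ltr1n.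
apply: nearW => N /=; rewrite (le_trans _ (dC N))// (d0N N) !normrM.
by rewrite normrX normrN -normrX.
Qed.

(** * Mittag-Leffler kernels *)

Section mittag_leffler_kernels.
Context {R : realType}.
Local Notation mu := (@lebesgue_measure R).
Variables (al lam : R).
Hypotheses (al0 : 0 < al) (lam0 : 0 < lam).

Definition mlt nu t (i : nat) : R := (- lam) ^+ i * kk (al * i%:R + nu) t.

(* [ML nu t = t^(nu-1) E_{al,nu}(- lam t^al)], extended by 0 to nonpositive times. *)
Definition ML nu t : R := limn (series (mlt nu t)).

Lemma al_nu_gt0 nu i : 0 < nu -> 0 < al * i%:R + nu.
Proof. by move=> nu0; rewrite ltr_wpDl// mulr_ge0// ltW. Qed.

(** Domination by a geometric series that keeps the factor t^(nu-1): the bound stays integrable at 0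
    and can be convolved. *)
Lemma kk_series_bound nu T : 0 < nu -> 0 < T -> exists2 C, 0 <= C &
  forall i t, t <= T -> lam ^+ i * kk (al * i%:R + nu) t <= C * 4^-1 ^+ i * cpow nu t.
Proof.
(* This M gives lam (t / M)^al <= 1/4 for 0 < t <= T, and [Gamma_lb] at M turns the i-th term into
   the i-th power of this quantity. *)
move=> nu0 T0; pose M := Num.max 1 ((4 * lam) `^ (al^-1) * T).
have M1 : 1 <= M by rewrite /M le_max lexx.
have M0 : 0 < M by rewrite (lt_le_trans _ M1).
have Mal t : 0 < t -> t <= T -> lam * (t / M) `^ al <= 4^-1.
  move=> t0 tT; rewrite -[4^-1]div1r ler_pdivlMr// mulrAC.
  have -> : lam * 4 = ((4 * lam) `^ (al^-1)) `^ al.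
    by rewrite -powRrM mulVf ?gt_eqF// powRr1 1?mulrC// mulr_ge0// ltW.
  rewrite -powRM ?powR_ge0 ?divr_ge0 ?(ltW t0) ?(ltW M0)//.
  have h1 : (1 : R) `^ al = 1 by rewrite powR1.
  rewrite -[leRHS]h1 ge0_ler_powR ?nnegrE ?(ltW al0)//.
    by rewrite mulr_ge0 ?powR_ge0// divr_ge0// ltW.
  rewrite mulrA ler_pdivrMr// mul1r (@le_trans _ _ ((4 * lam) `^ al^-1 * T))//.
    by rewrite ler_wpM2l// powR_ge0.
  by rewrite /M le_max lexx orbT.
exists (2 * expR (M + 1) * M `^ (1 - nu)).
  by rewrite mulr_ge0 ?powR_ge0// mulr_ge0// expR_ge0.
move=> i t tT; have [t0|t0] := ltP 0 t; last first.
  by rewrite kk_le0// /cpow ltNge t0 !mulr0.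
have a0 := al_nu_gt0 i nu0.
set a := al * i%:R + nu in a0 *.
rewrite kkE// /cpow t0.
have -> : t `^ (a - 1) = (t `^ al) ^+ i * t `^ (nu - 1).
  rewrite -powR_mulrn ?powR_ge0// -powRrM -powRD; first by congr powR; rewrite /a addrA.
  by apply/implyP => _; rewrite gt_eqF.
have GV : (Gamma a)^-1 <= 2 * expR (M + 1) * (M `^ (1 - nu) * ((M `^ al) ^+ i)^-1).
  rewrite invf_ple ?posrE ?Gamma_gt0//; last first.
    by rewrite !mulr_gt0 ?expR_gt0 ?invr_gt0 ?exprn_gt0 ?powR_gt0.
  apply: le_trans (Gamma_lb a M a0 M1).
  rewrite expRN invfM invfM le_eqVlt; apply/orP; left; apply/eqP.
  have -> : M `^ (a - 1) = (M `^ (1 - nu))^-1 * (M `^ al) ^+ i.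
    rewrite -powR_mulrn ?powR_ge0// -powRrM -powRN -powRD.
      by congr powR; rewrite /a; ring.
    by apply/implyP => _; rewrite gt_eqF.
  by rewrite invf_div; ring.
apply: (@le_trans _ _ (lam ^+ i * ((t `^ al) ^+ i * t `^ (nu - 1) *
   (2 * expR (M + 1) * (M `^ (1 - nu) * ((M `^ al) ^+ i)^-1))))).
  rewrite ler_wpM2l ?exprn_ge0 ?(ltW lam0)// ler_wpM2l//.
  by rewrite mulr_ge0 ?exprn_ge0 ?powR_ge0.
have -> : lam ^+ i * ((t `^ al) ^+ i * t `^ (nu - 1) *
   (2 * expR (M + 1) * (M `^ (1 - nu) * ((M `^ al) ^+ i)^-1))) =
   2 * expR (M + 1) * M `^ (1 - nu) * (lam * (t / M) `^ al) ^+ i * t `^ (nu - 1).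
  rewrite powRM ?invr_ge0 ?(ltW t0) ?(ltW M0)//.
  have -> : M^-1 `^ al = (M `^ al)^-1.
    by rewrite -(powR_inv1 (ltW M0)) -powRrM mulN1r powRN.
  by rewrite !exprMn exprVn; ring.
rewrite ler_wpM2r ?powR_ge0// ler_wpM2l//.
  by rewrite mulr_ge0 ?powR_ge0// mulr_ge0// expR_ge0.
rewrite lerXn2r ?nnegrE ?Mal// ?invr_ge0//.
by rewrite mulr_ge0 ?powR_ge0// ltW.
Qed.

Lemma normr_mlt nu t i : 0 < nu -> `|mlt nu t i| = lam ^+ i * kk (al * i%:R + nu) t.
Proof.
move=> nu0; rewrite normrM normrX normrN (ger0_norm (ltW lam0)) ger0_norm//.
exact/kk_ge0/al_nu_gt0.
Qed.

Lemma is_cvg_ML_norm nu t : 0 < nu -> cvgn [normed series (mlt nu t)].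
Proof.
move=> nu0.
have T0 : 0 < Num.max 1 t by rewrite lt_max ltr01.
have [C C0 HC] := kk_series_bound nu0 T0.
apply: (@series_le_cvg _ _ (geometric (C * cpow nu t) 4^-1)).
- by move=> i; exact: normr_ge0.
- by move=> i; rewrite /= mulr_ge0 ?mulr_ge0 ?cpow_ge0 ?exprn_ge0 ?invr_ge0.
- move=> i /=; rewrite normr_mlt// (le_trans (HC _ _ _))//; first by rewrite le_max lexx orbT.
  by rewrite mulrAC.
- by apply: is_cvg_geometric_series; rewrite ger0_norm ?invr_ge0// invf_lt1// ltr1n.
Qed.

Lemma ML_cvg nu t : 0 < nu -> series (mlt nu t) @ \oo --> ML nu t.
Proof. by move=> nu0; have := normed_cvg (@is_cvg_ML_norm nu t nu0). Qed.

(** Peels off the first term of the series. Later identities iterate this recursion instead of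
    manipulating the series. *)
Lemma ML_recr nu t : 0 < nu -> ML nu t = kk nu t - lam * ML (nu + al) t.
Proof.
move=> nu0; have nual0 : 0 < nu + al by exact: addr_gt0.
have h1 := @ML_cvg nu t nu0; rewrite -cvg_shiftS /= in h1.
suff h2 : series (mlt nu t) n.+1 @[n --> \oo] --> kk nu t - lam * ML (nu + al) t.
  exact: (cvg_unique _ h1 h2).
have -> : (fun n => series (mlt nu t) n.+1) =
    (fun n => kk nu t - lam * series (mlt (nu + al) t) n).
  apply/funext => n; rewrite /series/= big_nat_recl//= {1}/mlt expr0 mul1r mulr0 add0r.
  congr (_ + _); rewrite -mulNr big_distrr/=; apply: eq_bigr => i _.
  rewrite /mlt exprS -mulrA; congr (_ * (_ * kk _ _)).
  by rewrite -natr1; ring.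
apply: cvgB; first exact: cvg_cst.
by apply: cvgMr; exact: ML_cvg.
Qed.

Lemma ML_le0 nu t : t <= 0 -> ML nu t = 0.
Proof.
move=> t0; rewrite /ML (_ : series _ = cst 0); first exact: lim_cst.
apply/funext => n; rewrite /series/= big1// => i _.
by rewrite /mlt kk_le0 ?mulr0.
Qed.

(** Up to sign, lam^N ML (al N + nu) is the remainder of [ML nu] after N terms; the same domination
    applies to it after a shift of the index. *)
Lemma ML_tail_bound nu T : 0 < nu -> 0 < T -> exists2 C, 0 <= C &
  forall N t, t <= T -> `|lam ^+ N * ML (al * N%:R + nu) t| <= C * 4^-1 ^+ N * cpow nu t.
Proof.
move=> nu0 T0; have [C C0 HC] := kk_series_bound nu0 T0.
exists (C * (1 - 4^-1)^-1) => [|N t tT]; first by rewrite mulr_ge0// invr_ge0; lra.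
have aN0 := al_nu_gt0 N nu0.
have h : (fun n => lam ^+ N * series (mlt (al * N%:R + nu) t) n) @ \oo -->
    lam ^+ N * ML (al * N%:R + nu) t by apply: cvgMr; exact: ML_cvg.
rewrite -(cvg_lim _ h)//.
have gc : cvgn (series (geometric (C * 4^-1 ^+ N * cpow nu t) 4^-1 : R^nat)).
  by apply: is_cvg_geometric_series; rewrite ger0_norm ?invr_ge0// invf_lt1// ltr1n.
have /cvg_norm hn := h.
rewrite -lim_norm//; last by apply/cvg_ex; eexists; exact: h.
apply: (@le_trans _ _ (limn (series (geometric (C * 4^-1 ^+ N * cpow nu t) 4^-1 : R^nat)))).
  apply: ler_lim => //; first by apply/cvg_ex; eexists; exact: hn.
  apply: nearW => n; rewrite /series/= big_distrr/= (le_trans (ler_norm_sum _ _ _))//.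
  apply: ler_sum => i _; rewrite normrM normr_mlt// normrX (ger0_norm (ltW lam0)).
  rewrite mulrA -exprD addrA -mulrDr -natrD addnC.
  rewrite (le_trans (HC _ _ tT))// exprD; lra.
rewrite (cvg_lim _ (cvg_geometric_series _)) ?ger0_norm ?invr_ge0// ?invf_lt1 ?ltr1n//; lra.
Qed.

Lemma measurable_ML nu : 0 < nu -> measurable_fun setT (ML nu).
Proof.
move=> nu0; apply: (@measurable_fun_cvg _ _ _ _ (fun n t => series (mlt nu t) n)).
  move=> n; apply: measurable_sum => i; apply: measurable_funM => //.
  exact: measurable_kk.
by move=> t _; exact: ML_cvg.
Qed.

End mittag_leffler_kernels.

Section continuity_of_power_kernels.
Context {R : realType}.

Lemma cpow_continuous (a t0 : R) : 0 < t0 -> {for t0, continuous (cpow a)}.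
Proof.
move=> t00; have := continuous_powR (a - 1) t0 t00.
rewrite /prop_for /continuous_at (_ : cpow a t0 = t0 `^ (a - 1)); last by rewrite /cpow t00.
apply: cvg_trans; apply: near_eq_cvg.
by near=> t; rewrite /cpow ifT//; near: t; exact: lt_nbhsr.
Unshelve. all: end_near. Qed.

Lemma kk_continuous (a t0 : R) : 0 < t0 -> {for t0, continuous (kk a)}.
Proof. by move=> t00; apply: cvgMl; exact: cpow_continuous. Qed.

End continuity_of_power_kernels.

Section power_domination.
Context {R : realType}.
Implicit Types (f g : R -> R) (a b c d t T : R).

(** As [cpow a] vanishes at nonpositive times, the bound includes causality. A convolution of causal
    functions at t <= T reads them up to T only, so a bound on ]-oo, T] suffices. *)
Definition domk T f c a := [/\ measurable_fun setT f, 0 <= c &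
  forall x, x <= T -> `|f x| <= c * cpow a x].

Lemma domk_ker T t f g a b c d : 0 <= T -> t <= T -> domk T f c a -> domk T g d b ->
  forall x, `|f (t - x) * g x| <= c * d * (cpow a (t - x) * cpow b x).
Proof.
move=> T0 tT [mf c0 hf] [mg d0 hg] x.
have R0 : 0 <= c * d * (cpow a (t - x) * cpow b x) by rewrite !mulr_ge0 ?cpow_ge0.
have [xT|xT] := leP x T; last first.
  have tx0 : t - x <= 0 by rewrite subr_le0 (le_trans tT (ltW xT)).
  have := hf (t - x) (le_trans tx0 T0); rewrite (_ : cpow a (t - x) = 0) ?mulr0; last first.
    by rewrite /cpow ltNge tx0.
  by rewrite normr_le0 => /eqP ->; rewrite mul0r normr0 mul0r mulr0.
have [txT|txT] := leP (t - x) T; last first.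
  have x0 : x <= 0 by lra.
  have := hg x xT; rewrite (_ : cpow b x = 0) ?mulr0; last by rewrite /cpow ltNge x0.
  by rewrite normr_le0 => /eqP ->; rewrite mulr0 normr0.
rewrite normrM (le_trans (ler_pM _ _ (hf _ txT) (hg _ xT)))//.
by rewrite le_eqVlt; apply/orP; left; apply/eqP; ring.
Qed.

Lemma cpow_kk a t : 0 < a -> cpow a t = Gamma a * kk a t.
Proof. by move=> a0; rewrite /kk mulrCA mulfV ?mulr1// gt_eqF// Gamma_gt0. Qed.

Lemma cint_cpow a b t : 0 < a -> 0 < b -> cint (cpow a) (cpow b) t.
Proof.
move=> a0 b0; have [h _] := cvl_kk t a0 b0.
have := cintZl (Gamma a) (cintZr (Gamma b) h); apply: eq_cint => x.
by rewrite !cpow_kk.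
Qed.

Lemma domk_cint T t f g a b c d : 0 < a -> 0 < b -> 0 <= T -> t <= T ->
  domk T f c a -> domk T g d b -> cint f g t.
Proof.
move=> a0 b0 T0 tT hf hg; have [mf _ _] := hf; have [mg _ _] := hg.
apply: (cint_le mf mg (domk_ker T0 tT hf hg)); exact: cint_cpow.
Qed.

Lemma domk_cvl T t f g a b c d : 0 < a -> 0 < b -> 0 <= T -> t <= T ->
  domk T f c a -> domk T g d b -> `|cvl f g t| <= c * d * cvl (cpow a) (cpow b) t.
Proof.
move=> a0 b0 T0 tT hf hg; have [mf _ _] := hf; have [mg _ _] := hg.
apply: (cvl_abs_le mf mg (domk_ker T0 tT hf hg)); exact: cint_cpow.
Qed.

Lemma domk_kk T a : 0 < a -> domk T (kk a) (Gamma a)^-1 a.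
Proof.
move=> a0; split; first exact: measurable_kk.
  by rewrite invr_ge0 ltW// Gamma_gt0.
by move=> x _; rewrite ger0_norm ?kk_ge0// /kk mulrC.
Qed.

Lemma cvl_cpow_ge0 a b t : 0 <= cvl (cpow a) (cpow b) t.
Proof. by apply: Rintegral_ge0 => x _; rewrite mulr_ge0 ?cpow_ge0. Qed.

End power_domination.

Section mittag_leffler_convolutions.
Context {R : realType}.
Variables (al lam : R).
Hypotheses (al0 : 0 < al) (lam0 : 0 < lam).
Local Notation ML := (ML al lam).

Lemma domk_ML_tail nu T : 0 < nu -> 0 < T -> exists2 C, 0 <= C &
  forall N, domk T (fun t => lam ^+ N * ML (al * N%:R + nu) t) (C * 4^-1 ^+ N) nu.
Proof.
move=> nu0 T0; have [C C0 HC] := ML_tail_bound al0 lam0 nu0 T0.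
exists C => // N; split; last exact: HC.
- by apply: measurable_funM => //; apply: measurable_ML => //; exact: al_nu_gt0.
- by rewrite mulr_ge0// exprn_ge0// invr_ge0.
Qed.

Lemma domk_ML nu T : 0 < nu -> 0 < T -> exists C, domk T (ML nu) C nu.
Proof.
move=> nu0 T0; have [C _ /(_ 0%N)] := domk_ML_tail nu0 T0.
rewrite mulr0 add0r !expr0 mulr1 => h; exists C.
by move: h; rewrite (_ : (fun t => 1 * ML nu t) = ML nu)//; apply/funext => t; rewrite mul1r.
Qed.

Lemma cint_kk_ML a nu t : 0 < a -> 0 < nu -> cint (kk a) (ML nu) t.
Proof.
move=> a0 nu0; have T0 : 0 < Num.max 1 t by rewrite lt_max ltr01.
have [C h] := domk_ML nu0 T0.
apply: (domk_cint a0 nu0 (ltW T0) _ (domk_kk _ a0) h).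
by rewrite le_max lexx orbT.
Qed.

Lemma cint_ML_ML a nu t : 0 < a -> 0 < nu -> cint (ML a) (ML nu) t.
Proof.
move=> a0 nu0; have T0 : 0 < Num.max 1 t by rewrite lt_max ltr01.
have [C h] := domk_ML nu0 T0; have [C' h'] := domk_ML a0 T0.
apply: (domk_cint a0 nu0 (ltW T0) _ h' h).
by rewrite le_max lexx orbT.
Qed.

Lemma quarter_half N : (4^-1 : R) ^+ N <= 2^-1 ^+ N.
Proof. by rewrite lerXn2r ?nnegrE//; lra. Qed.

(** The ratio 1/4 in the tail bounds leaves room for the factor N that appears in [cvl_ML_ML]. *)
Lemma half_quarter N : N%:R * (4^-1 : R) ^+ N <= 2^-1 ^+ N.
Proof.
have -> : (4^-1 : R) = 2^-1 * 2^-1 by rewrite -invfM; congr (_^-1); ring.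
rewrite exprMn mulrA ler_piMl ?exprn_ge0//.
rewrite exprVn ler_pdivrMr ?exprn_gt0// mul1r -natrX ler_nat.
exact/ltnW/ltn_expl.
Qed.

(** Let d_N be the difference of the two sides with nu replaced by al N + nu. The identity is exact
    for the term peeled off by [ML_recr], whence d_N = - lam d_(N+1). *)
Lemma cvl_kk_ML a nu t : 0 < a -> 0 < nu -> cvl (kk a) (ML nu) t = ML (nu + a) t.
Proof.
move=> a0 nu0; have T0 : 0 < Num.max 1 t by rewrite lt_max ltr01.
set T := Num.max 1 t in T0; have tT : t <= T by rewrite le_max lexx orbT.
have [C C0 HC] := domk_ML_tail nu0 T0.
have [C' C'0 HC'] := domk_ML_tail (addr_gt0 nu0 a0) T0.
pose d N := cvl (kk a) (ML (al * N%:R + nu)) t - ML (al * N%:R + nu + a) t.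
suff : d 0%N = 0 by rewrite /d mulr0 add0r => /eqP; rewrite subr_eq0 => /eqP.
apply: (@geometric_remainder _ d lam
   ((Gamma a)^-1 * C * cvl (cpow a) (cpow nu) t + C' * cpow (nu + a) t)).
  move=> N; rewrite /d; have n0 := al_nu_gt0 al0 N nu0.
  have nE : al * N.+1%:R + nu = al * N%:R + nu + al by rewrite -natr1; ring.
  rewrite nE; set n := al * N%:R + nu in n0 *.
  have -> : ML n = (fun x => kk n x - lam * ML (n + al) x) by apply/funext => x; exact: ML_recr.
  have i1 := cint_kk_ML t a0 (addr_gt0 n0 al0).
  have [i2 E2] := cvl_kk t a0 n0.
  rewrite cvlBr//; last exact: cintZr.
  rewrite cvlZr// E2 (ML_recr al0 lam0 t (addr_gt0 n0 a0)) [a + n]addrC.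
  by rewrite (addrAC n al a); ring.
move=> N; have n0 := al_nu_gt0 al0 N nu0; rewrite /d mulrBr.
rewrite -cvlZr; last exact: cint_kk_ML.
apply: (le_trans (ler_normB _ _)); rewrite [leRHS]mulrDl; apply: lerD.
  apply: (le_trans (domk_cvl a0 nu0 (ltW T0) tT (domk_kk T a0) (HC N))).
  rewrite -!mulrA ler_wpM2l ?invr_ge0 ?(ltW (Gamma_gt0 a a0))//.
  by rewrite ler_wpM2l// mulrC ler_wpM2l ?cvl_cpow_ge0// quarter_half.
have [_ _ /(_ t tT)] := HC' N; rewrite -[al * N%:R + nu + a]addrA => /le_trans; apply.
by rewrite -!mulrA ler_wpM2l// mulrC ler_wpM2l ?cpow_ge0// quarter_half.
Qed.

Lemma ML_kk1 t : cvl (kk 1) (ML al) t = (kk 1 t - ML 1 t) / lam.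
Proof.
rewrite cvl_kk_ML// [al + 1]addrC.
have -> : kk 1 t - ML 1 t = ML (1 + al) t * lam by rewrite (ML_recr al0 lam0 t ltr01); ring.
by rewrite mulfK// lt0r_neq0.
Qed.

Lemma time_kk (a t : R) : 0 < a -> t * kk a t = a * kk (a + 1) t.
Proof.
move=> a0; have [t0|t0] := ltP 0 t; last by rewrite !kk_le0// !mulr0.
rewrite (kkE a t0) (kkE (a + 1) t0) (GammaS a0) addrK.
rewrite mulrA (mulr_powRB1 (ltW t0) a0).
have := lt0r_neq0 (Gamma_gt0 a a0); move: (Gamma a) (t `^ a) (lt0r_neq0 a0) => g h a1 g0.
by field; rewrite a1 g0.
Qed.

(** Formally E * e is the sum of (i + 1) (- lam)^i k_(al i + al + 1), while t k_a = a k_(a+1)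
    multiplies the i-th term of e by al (i + 1); hence t e = al (E * e). *)
Lemma cvl_ML_ML t : cvl (ML 1) (ML al) t = t / al * ML al t.
Proof.
have T0 : 0 < Num.max 1 t by rewrite lt_max ltr01.
set T := Num.max 1 t in T0; have tT : t <= T by rewrite le_max lexx orbT.
have al10 : 0 < 1 + al by exact: addr_gt0.
have [C1 C10 HC1] := domk_ML_tail ltr01 T0.
have [Ca Ca0 HCa] := domk_ML_tail al0 T0.
have [Cs Cs0 HCs] := domk_ML_tail al10 T0.
have [Ce HCe] := domk_ML al0 T0.
have [_ Ce0 _] := HCe.
(* With E replaced by its remainder after N terms, the formal coefficients are i + 1 on the left but
   N + i + 1 in t / al times the remainder of e. The last term corrects this by N. *)
pose d N := cvl (ML (al * N%:R + 1)) (ML al) t -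
  (t / al * ML (al * N%:R + al) t - N%:R * ML (al * N%:R + (1 + al)) t).
suff : d 0%N = 0.
  by rewrite /d mulr0 !add0r mul0r subr0 => /eqP; rewrite subr_eq0 => /eqP.
apply: (@geometric_remainder _ d lam (C1 * Ce * cvl (cpow 1) (cpow al) t +
    `|t / al| * (Ca * cpow al t) + Cs * cpow (1 + al) t)).
  move=> N; rewrite /d.
  have n0 := al_nu_gt0 al0 N ltr01; have na0 := al_nu_gt0 al0 N al0.
  have nE x : al * N.+1%:R + x = al * N%:R + x + al by rewrite -natr1; ring.
  rewrite !nE.
  have -> : ML (al * N%:R + 1) = (fun x => kk (al * N%:R + 1) x - lam * ML (al * N%:R + 1 + al) x).
    by apply/funext => x; exact: ML_recr.
  have i1 := cint_kk_ML t n0 al0.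
  have i2 := cint_ML_ML t (addr_gt0 n0 al0) al0.
  rewrite cvlBl//; last exact: cintZl.
  rewrite cvlZl// cvl_kk_ML// (ML_recr al0 lam0 t na0).
  rewrite -natr1; have -> : al * N%:R + (1 + al) = al + (al * N%:R + 1) by ring.
  rewrite (ML_recr al0 lam0 t (addr_gt0 al0 n0)).
  have := time_kk t na0.
  have -> : al * N%:R + al + 1 = al + (al * N%:R + 1) by ring.
  move: (kk (al * N%:R + al) t) (kk (al + (al * N%:R + 1)) t) => K' K.
  move: (ML (al * N%:R + al + al) t) (ML (al + (al * N%:R + 1) + al) t) => c1 c2.
  move: (cvl _ (ML al) t) (lt0r_neq0 al0) => c3 aln0 tK.
  have -> : t / al * (K' - lam * c1) = (t * K') / al - lam * (t / al) * c1.
    by field; rewrite aln0.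
  by rewrite tK; field; rewrite aln0.
move=> N; have n0 := al_nu_gt0 al0 N ltr01.
rewrite /d mulrBr -cvlZl; last exact: cint_ML_ML.
rewrite mulrBr opprB addrA addrAC.
have b1 := domk_cvl ltr01 al0 (ltW T0) tT (HC1 N) HCe.
have [_ _ /(_ t tT) ba] := HCa N.
have [_ _ /(_ t tT) bs] := HCs N.
have cv0 := @cvl_cpow_ge0 R 1 al t.
apply: (le_trans (ler_normD _ _)); rewrite [leRHS]mulrDl; apply: lerD; last first.
  rewrite mulrCA normrM ger0_norm// (le_trans (ler_wpM2l _ bs))//.
  have -> : N%:R * (Cs * 4^-1 ^+ N * cpow (1 + al) t) =
    Cs * cpow (1 + al) t * (N%:R * 4^-1 ^+ N) by ring.
  by rewrite ler_wpM2l ?mulr_ge0 ?cpow_ge0 ?half_quarter.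
apply: (le_trans (ler_normB _ _)); rewrite [leRHS]mulrDl; apply: lerD.
  rewrite (le_trans b1)// -!mulrA ler_wpM2l// mulrCA ler_wpM2l// mulrC.
  by rewrite ler_wpM2l// quarter_half.
rewrite mulrCA normrM -mulrA ler_wpM2l// (le_trans ba)// -mulrA -mulrA ler_wpM2l//.
by rewrite mulrC ler_wpM2l ?cpow_ge0// quarter_half.
Qed.

End mittag_leffler_convolutions.

Opaque ML cvl kk.

(** * Positivity and bounds of Mittag-Leffler kernels *)

Section mittag_leffler_positivity.
Context {R : realType}.
Local Notation mu := (@lebesgue_measure R).
Variables (al lam : R).
Hypotheses (al0 : 0 < al) (al1 : al < 1) (lam0 : 0 < lam).
Local Notation ML := (ML al lam).
Local Notation mlt := (mlt al lam).

Lemma ML_expand nu N t : 0 < nu ->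
  ML nu t = \sum_(i < N) mlt nu t i + (- lam) ^+ N * ML (al * N%:R + nu) t.
Proof.
move=> nu0; elim: N => [|N IH]; first by rewrite big_ord0 mulr0 !add0r mul1r.
rewrite IH big_ord_recr/= -addrA; congr (_ + _).
rewrite (ML_recr al0 lam0 t (al_nu_gt0 al0 N nu0)) /(mlt nu t N) exprSr.
have -> : al * N.+1%:R + nu = al * N%:R + nu + al by rewrite -natr1; ring.
by move: (ML _ t) (kk _ t) => ? ?; ring.
Qed.

(** Away from 0 the partial sums are continuous, and [ML_tail_bound] makes their convergence uniform
    near [t0]. *)
Lemma ML_continuous nu (t0 : R) : 0 < nu -> 0 < t0 -> {for t0, continuous (ML nu)}.
Proof.
move=> nu0 t00; apply/cvgrPdist_le => /= eps eps0.
have [C C0 HC] := ML_tail_bound al0 lam0 nu0 (addr_gt0 t00 t00).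
pose K := cpow nu t0 + 1.
have K0 : 0 <= K by rewrite addr_ge0 ?cpow_ge0.
have [N HN] : exists N, C * 4^-1 ^+ N * K <= eps / 3.
  have : (geometric (C * K) 4^-1 : R^nat) @ \oo --> (0 : R).
    by apply: cvg_geometric; rewrite ger0_norm ?invr_ge0// invf_lt1// ltr1n.
  move/cvgr_le => /(_ (eps / 3)); rewrite divr_gt0// => /(_ isT)[N _ HN].
  by exists N; rewrite mulrAC; exact: (HN N (leqnn N)).
have tail t : t <= t0 + t0 -> cpow nu t <= K ->
    `|ML nu t - \sum_(i < N) mlt nu t i| <= eps / 3.
  move=> tt tK; rewrite (ML_expand N t nu0) addrAC subrr add0r.
  rewrite normrM normrX normrN -normrX -normrM (le_trans (HC N t tt))//.
  by rewrite (le_trans _ HN)// ler_wpM2l// mulr_ge0// exprn_ge0// invr_ge0.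
have cs : (fun t => \sum_(i < N) mlt nu t i) @ t0 --> \sum_(i < N) mlt nu t0 i.
  by apply: cvg_big => [|i _]; [exact: add_continuous|apply: cvgMr; exact: kk_continuous].
near=> t.
have ht0 := tail t0; have ht := tail t.
have -> : ML nu t0 - ML nu t = (ML nu t0 - \sum_(i < N) mlt nu t0 i) +
  (\sum_(i < N) mlt nu t0 i - \sum_(i < N) mlt nu t i) -
  (ML nu t - \sum_(i < N) mlt nu t i) by ring.
have -> : eps = eps / 3 + eps / 3 + eps / 3 by field.
apply: (le_trans (ler_normB _ _)); apply: lerD; last first.
  apply: ht; first by apply: ltW; near: t; apply: lt_nbhsl; rewrite ltrDl.
  near: t; have /cvgrPdist_le /(_ 1 ltr01) := @cpow_continuous R nu t0 t00.
  apply: filterS => t; rewrite distrC => /(le_trans (ler_norm _)).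
  by rewrite lerBlDl.
apply: (le_trans (ler_normD _ _)); apply: lerD.
  by apply: ht0; rewrite ?lerDl ?(ltW t00)// /K lerDl.
near: t; move/cvgrPdist_le: cs; apply; exact: divr_gt0.
Unshelve. all: end_near. Qed.

Local Notation E := (ML 1).
Local Notation e := (ML al).
Local Notation l := (kk (1 - al)).

Let al1' : 0 < 1 - al. Proof. by rewrite subr_gt0. Qed.

Lemma cvl_l_e t : cvl l e t = E t.
Proof.
have a1 : al + (1 - al) = 1 :> R by ring.
by have := cvl_kk_ML al0 lam0 t al1' al0; rewrite a1.
Qed.

Lemma kk1_subE t : kk 1 t - E t = lam * cvl (kk 1) e t.
Proof. by rewrite ML_kk1// mulrCA mulfV ?mulr1// lt0r_neq0. Qed.

Lemma kk1_subE' t : kk 1 t - E t = lam * cvl (kk al) E t.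
Proof. by rewrite cvl_kk_ML// (ML_recr al0 lam0 t ltr01) subKr. Qed.

Lemma l_nonincr x y : 0 < x -> x <= y -> l y <= l x.
Proof.
move=> x0 xy; have y0 := lt_le_trans x0 xy.
rewrite !kkE// ler_pM2r ?invr_gt0 ?Gamma_gt0//.
rewrite addrAC subrr add0r !powRN lef_pV2 ?posrE ?powR_gt0//.
by rewrite ge0_ler_powR ?nnegrE// ltW.
Qed.

Lemma kk1E (x : R) : kk 1 x = if 0 < x then 1 else 0.
Proof. by case: ltP => x0; [rewrite kk1|rewrite kk_le0]. Qed.

(* Both [E = l * e] and [t e = al (E * e)] express a value at [t0] through
   values of [e] on ]0, t0[, so that [e] cannot change sign. *)
Section step.
Variable t0 : R.
Hypotheses (t00 : 0 < t0) (e_ge0 : forall x, 0 < x -> x < t0 -> 0 <= e x).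

(** As l is nonincreasing, E(t) = (l * e)(t) >= l(t) (1 * e)(t) = l(t) (1 - E(t)) / lam. *)
Lemma ML1_lower_step t : 0 < t -> t <= t0 -> l t <= (lam + l t) * E t.
Proof.
move=> t_gt0 tt0; have i1 := cint_kk_ML al0 lam0 t ltr01 al0.
have : cvl (fun y => l t * kk 1 y) e t <= cvl l e t.
  apply: cvl_le; [exact: cintZl|exact: cint_kk_ML|move=> x].
  have [x0|x0] := leP x 0; first by rewrite !(ML_le0 _ _ _ x0) !mulr0.
  have [tx|tx] := leP (t - x) 0; first by rewrite !(kk_le0 _ tx) mulr0 !mul0r.
  rewrite kk1// mulr1 ler_wpM2r// ?e_ge0//; last by apply: l_nonincr => //; lra.
  by rewrite (lt_le_trans _ tt0)//; lra.
rewrite cvl_l_e cvlZl// ML_kk1// kk1// => h.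
have := ler_wpM2l (ltW lam0) h.
rewrite mulrCA [lam * (_ / lam)]mulrCA mulfV ?lt0r_neq0// mulr1.
by rewrite mulrBr mulr1 mulrDl lerBlDr.
Qed.

(** The bound l / (lam + l) for E increases with l and l decreases in time, so the value at [t0]
    serves on all of ]0, t0]. *)
Let c := l t0 / (lam + l t0).

Let c_gt0 : 0 < c.
Proof. by rewrite divr_gt0 ?addr_gt0 ?kk_gt0. Qed.

Let cE x : 0 < x -> x <= t0 -> c <= E x.
Proof.
move=> x0 xt0; have lx := kk_gt0 al1' x0; have lt0 := kk_gt0 al1' t00.
apply: (@le_trans _ _ (l x / (lam + l x))).
  rewrite /c ler_pdivrMr ?addr_gt0// mulrAC ler_pdivlMr ?addr_gt0//.
  by rewrite !mulrDr [l x * l t0]mulrC lerD2r ler_pM2r// l_nonincr.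
by rewrite ler_pdivrMr ?addr_gt0// mulrC ML1_lower_step.
Qed.

(** Here 1 - E = lam (k_al * E), and E is at least [c] on ]0, t0]. *)
Lemma ML1_lt1_step : 0 < kk 1 t0 - E t0.
Proof.
rewrite kk1_subE' mulr_gt0//.
have [i1 E1] := cvl_kk t0 al0 (@ltr01 R).
apply: (@lt_le_trans _ _ (c * kk (al + 1) t0)); first by rewrite mulr_gt0 ?kk_gt0 ?addr_gt0.
rewrite -E1 -cvlZr//; apply: cvl_le; [exact: cintZr|exact: cint_kk_ML|move=> x].
have [x0|x0] := leP x 0; first by rewrite !(ML_le0 _ _ _ x0) (kk_le0 _ x0) !mulr0.
have [tx|tx] := leP (t0 - x) 0; first by rewrite !(kk_le0 _ tx) !mul0r.
by rewrite kk1// mulr1 ler_wpM2l ?kk_ge0// cE//; lra.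
Qed.

(** The value t0 e(t0) / al equals (E * e)(t0), which is at least c (1 * e)(t0) = c (1 - E(t0)) /
    lam > 0. *)
Lemma ML_al_gt0_step : 0 < e t0.
Proof.
have : 0 < t0 / al * e t0.
  rewrite -cvl_ML_ML//; have i1 := cint_kk_ML al0 lam0 t0 ltr01 al0.
  apply: (@lt_le_trans _ _ (c * cvl (kk 1) e t0)).
    by rewrite mulr_gt0// -(pmulr_rgt0 _ lam0) -kk1_subE ML1_lt1_step.
  rewrite -cvlZl//; apply: cvl_le; [exact: cintZl|exact: cint_ML_ML|move=> x].
  have [x0|x0] := leP x 0; first by rewrite !(ML_le0 _ _ _ x0) !mulr0.
  have [tx|tx] := leP (t0 - x) 0.
    by rewrite !(kk_le0 _ tx) (ML_le0 _ _ _ tx) mulr0 !mul0r.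
  by rewrite kk1// mulr1 ler_wpM2r ?e_ge0 ?cE//; lra.
by rewrite pmulr_rgt0// divr_gt0.
Qed.

End step.

(** Near 0 the first term k_al dominates the rest, which is of order t^(2 al - 1). *)
Lemma ML_al_gt0_near0 : exists2 d, 0 < d & forall x, 0 < x -> x < d -> 0 < e x.
Proof.
have [C [_ C0 HC]] := domk_ML al0 lam0 (addr_gt0 al0 al0) (@ltr01 R).
have G0 := Gamma_gt0 al al0.
(* Threshold for x^al below which lam C x^(2 al - 1) < x^(al-1) / Gamma(al); the added 1 covers C =
   0. *)
pose w := (Gamma al * (lam * C + 1))^-1.
have lC0 : 0 < lam * C + 1 by rewrite ltr_wpDl// mulr_ge0// ltW.
have w0 : 0 < w by rewrite invr_gt0 mulr_gt0.
exists (Num.min 1 (w `^ al^-1)); first by rewrite lt_min ltr01 powR_gt0.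
move=> x x0; rewrite lt_min => /andP[x1 xw].
rewrite (ML_recr al0 lam0 x al0) subr_gt0.
have xal : x `^ al < w.
  have -> : w = (w `^ al^-1) `^ al by rewrite -powRrM mulVf ?lt0r_neq0// powRr1// ltW.
  by rewrite gt0_ltr_powR ?nnegrE ?powR_ge0// ltW.
apply: (@le_lt_trans _ _ (lam * (C * cpow (al + al) x))).
  by rewrite ler_pM2l// (le_trans (ler_norm _))// HC// ltW.
rewrite kkE// /cpow x0.
have -> : x `^ (al + al - 1) = x `^ al * x `^ (al - 1).
  rewrite -powRD; first by congr powR; ring.
  by apply/implyP => _; rewrite lt0r_neq0.
have xp : 0 < x `^ (al - 1) by exact: powR_gt0.
rewrite mulrA mulrA mulrC ltr_pM2l//.
apply: (@le_lt_trans _ _ ((lam * C) * w)); first by rewrite ler_wpM2l ?mulr_ge0// ltW.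
rewrite /w invfM mulrCA gtr_pMr ?invr_gt0//.
by rewrite ltr_pdivrMr// mul1r ltrDl.
Qed.

(** At the infimum of the times where e <= 0, which is positive by the behaviour near 0, the step
    above gives e > 0; by continuity e stays positive a little longer, a contradiction. Complete
    monotonicity is not invoked. *)
Theorem ML_al_gt0 t : 0 < t -> 0 < e t.
Proof.
move=> t_gt0; rewrite ltNge; apply/negP => et0.
pose B := [set x : R | 0 < x /\ e x <= 0].
have B0 : B !=set0 by exists t.
have Blb : has_lbound B by exists 0 => x [/ltW].
have [d d0 Hd] := ML_al_gt0_near0.
have dlb : lbound B d.
  by move=> x [x0 ex]; rewrite leNgt; apply/negP => /(Hd _ x0); rewrite ltNge ex.
have t00 : 0 < inf B by rewrite (lt_le_trans d0)//; exact: lb_le_inf.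
have epos x : 0 < x -> x < inf B -> 0 <= e x.
  move=> x0 xB; rewrite leNgt; apply/negP => ex.
  have : inf B <= x by apply: ge_inf => //; split => //; exact: ltW.
  by rewrite leNgt xB.
have := ML_al_gt0_step t00 epos.
have ce := ML_continuous al0 t00.
move=> /(cvgr_gt _ ce)/nbhs_ballP[r /= r0 Hr].
have [x [x0 ex] xr] := inf_adherent r0 (conj B0 Blb).
have : inf B <= x by apply: ge_inf.
move=> Bx; have := Hr x.
rewrite /ball/= ltr_distlC; rewrite (lt_le_trans _ Bx) ?xr; last by lra.
by move=> /(_ isT); rewrite ltNge ex.
Qed.

Lemma ML_al_ge0 t : 0 <= e t.
Proof.
have [t0|t0] := ltP 0 t; first exact/ltW/ML_al_gt0.
by rewrite (ML_le0 _ _ _ t0).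
Qed.

Let nonneg t0 : forall x, 0 < x -> x < t0 -> 0 <= e x.
Proof. by move=> x _ _; exact: ML_al_ge0. Qed.

Lemma ML1_lower t : 0 < t -> l t <= (lam + l t) * E t.
Proof. by move=> t0; apply: (@ML1_lower_step t) => //; exact: nonneg. Qed.

Lemma ML1_gt0 t : 0 < t -> 0 < E t.
Proof.
move=> t0; rewrite -(pmulr_rgt0 _ (addr_gt0 lam0 (kk_gt0 al1' t0))).
exact: lt_le_trans (kk_gt0 al1' t0) (ML1_lower t0).
Qed.

Lemma ML1_ge0 t : 0 <= E t.
Proof.
have [t0|t0] := ltP 0 t; first exact/ltW/ML1_gt0.
by rewrite (ML_le0 _ _ _ t0).
Qed.

Lemma ML1_lower_bound t : 0 < t -> (E t)^-1 <= 1 + Gamma (1 - al) * lam * t `^ al.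
Proof.
move=> t0; have l0 := kk_gt0 al1' t0; have E0 := ML1_gt0 t0.
have := ML1_lower t0; rewrite -(@ler_pM2r _ (E t)^-1) ?invr_gt0// => h.
have {h} : l t * (E t)^-1 <= lam + l t by rewrite (le_trans h)// mulfK ?lt0r_neq0.
rewrite mulrC -ler_pdivlMr// mulrDl mulfV ?lt0r_neq0// addrC.
suff -> : lam / l t = Gamma (1 - al) * lam * t `^ al by [].
rewrite kkE// addrAC subrr add0r powRN invf_div invrK.
by ring.
Qed.

Lemma ML1_le_kk1 t : E t <= kk 1 t.
Proof.
rewrite -subr_ge0 kk1_subE mulr_ge0 ?(ltW lam0)//; apply: cvl_ge0 => x;
  by rewrite ?kk_ge0 ?ML_al_ge0.
Qed.

Lemma ML1_le1 t : E t <= 1.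
Proof. by rewrite (le_trans (ML1_le_kk1 t))// kk1E; case: ifP. Qed.

Lemma cvl_kk1_homo s t : s <= t -> cvl (kk 1) e s <= cvl (kk 1) e t.
Proof.
move=> st; apply: cvl_le; try exact: cint_kk_ML.
move=> x; rewrite ler_wpM2r ?ML_al_ge0// !kk1E.
case: ifPn => [sx|_]; last by case: ifP.
by rewrite ifT//; lra.
Qed.

Lemma ML1_nonincr s t : 0 < s -> s <= t -> E t <= E s.
Proof.
move=> s0 st; have t0 := lt_le_trans s0 st.
have := kk1_subE s; have := kk1_subE t; rewrite !kk1//.
have := ler_wpM2l (ltW lam0) (cvl_kk1_homo st).
move: (E s) (E t) (cvl _ _ s) (cvl _ _ t) => a b c d; lra.
Qed.

(** By monotonicity of E, 1 >= 1 - E(t) = lam (k_al * E)(t) >= lam E(t) k_(al+1)(t). *)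
Lemma ML1_upper t : 0 < t -> E t <= Gamma (al + 1) / (lam * t `^ al).
Proof.
move=> t0; have [i1 E1] := cvl_kk t al0 (@ltr01 R).
have : cvl (kk al) (fun x => E t * kk 1 x) t <= cvl (kk al) E t.
  apply: cvl_le; [exact: cintZr|exact: cint_kk_ML|move=> x].
  have [x0|x0] := leP x 0; first by rewrite !(ML_le0 _ _ _ x0) (kk_le0 _ x0) !mulr0.
  have [tx|tx] := leP (t - x) 0; first by rewrite !(kk_le0 _ tx) !mul0r.
  by rewrite kk1// mulr1 ler_wpM2l ?kk_ge0// ML1_nonincr//; lra.
rewrite cvlZr// E1 => /(ler_wpM2l (ltW lam0)); rewrite -kk1_subE' kk1// => h.
have {h} : lam * (E t * kk (al + 1) t) <= 1.
  by rewrite (le_trans h)// gerBl ML1_ge0.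
have G0 := Gamma_gt0 (al + 1) (addr_gt0 al0 ltr01).
rewrite kkE// addrK ler_pdivlMr ?mulr_gt0 ?powR_gt0// => h.
have := ler_wpM2r (ltW G0) h; rewrite mul1r; apply: le_trans.
rewrite le_eqVlt; apply/orP; left; apply/eqP.
by move: (Gamma (al + 1)) G0 (E t) (t `^ al) => g g0 u v; field; rewrite lt0r_neq0.
Qed.

Lemma ML_al_le_kk t : e t <= kk al t.
Proof.
rewrite (ML_recr al0 lam0 t al0) gerBl mulr_ge0 ?(ltW lam0)//.
rewrite -cvl_kk_ML//; apply: cvl_ge0 => x;
  by rewrite ?kk_ge0 ?ML_al_ge0.
Qed.

(** From E <= 1: lam t e(t) / al = lam (E * e)(t) <= lam (1 * e)(t) = 1 - E(t) <= 1. *)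
Lemma ML_al_upper t : 0 < t -> e t <= al / (lam * t).
Proof.
move=> t0; have h : cvl E e t <= cvl (kk 1) e t.
  apply: cvl_le; [exact: cint_ML_ML|exact: cint_kk_ML|move=> x].
  by rewrite ler_wpM2r ?ML_al_ge0 ?ML1_le_kk1.
have := ler_wpM2l (ltW lam0) h; rewrite -kk1_subE cvl_ML_ML// kk1// => {}h.
have {h} : lam * (t / al * e t) <= 1 by rewrite (le_trans h)// gerBl ML1_ge0.
move=> h; rewrite ler_pdivlMr ?mulr_gt0//.
have := ler_wpM2r (ltW al0) h; rewrite mul1r; apply: le_trans.
by rewrite le_eqVlt; apply/orP; left; apply/eqP; move: (e t) => u; field; rewrite lt0r_neq0.
Qed.

End mittag_leffler_positivity.

Section real_powers.
Context {R : realType}.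
Implicit Types x y A B th s : R.

Lemma powRV x r : 0 <= x -> (x^-1) `^ r = x `^ (- r).
Proof. by move=> x0; rewrite -(powR_inv1 x0) -powRrM mulN1r. Qed.

Lemma powRDp x r r' : 0 < x -> x `^ (r + r') = x `^ r * x `^ r'.
Proof. by move=> x0; apply: powRD; apply/implyP => _; rewrite lt0r_neq0. Qed.

Lemma geo_interp x A B th : 0 <= x -> x <= A -> x <= B -> 0 <= th -> th <= 1 ->
  x <= A `^ (1 - th) * B `^ th.
Proof.
move=> x0 xA xB th0 th1; have [->|xn0] := eqVneq x 0.
  by rewrite mulr_ge0 ?powR_ge0.
have xp : 0 < x by rewrite lt0r xn0.
have {1}-> : x = x `^ (1 - th) * x `^ th.
  by rewrite -powRDp// subrK powRr1.
apply: ler_pM; rewrite ?powR_ge0// ge0_ler_powR ?nnegrE ?subr_ge0//.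
  exact: le_trans xA.
exact: le_trans xB.
Qed.

(** The fractions of x and y in x + y add up to 1, and each is at most its s-th power since s <=
    1. *)
Lemma powR_subadd x y s : 0 <= x -> 0 <= y -> 0 < s -> s <= 1 ->
  (x + y) `^ s <= x `^ s + y `^ s.
Proof.
move=> x0 y0 s0 s1; have [xy0|xyn0] := eqVneq (x + y) 0.
  by rewrite xy0 powR0 ?lt0r_neq0// addr_ge0 ?powR_ge0.
have xy : 0 < x + y by rewrite lt0r xyn0 addr_ge0.
have h z : 0 <= z -> z <= x + y -> z / (x + y) * (x + y) `^ s <= z `^ s.
  move=> z0 zxy; have [->|zn0] := eqVneq z 0; first by rewrite !mul0r powR_ge0.
  have zp : 0 < z by rewrite lt0r zn0.
  have -> : z `^ s = (z / (x + y)) `^ s * (x + y) `^ s.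
    by rewrite -powRM ?divr_ge0 ?(ltW xy)// divfK// lt0r_neq0.
  rewrite ler_wpM2r ?powR_ge0// ger1_powR// divr_gt0//=.
  by rewrite ler_pdivrMr// mul1r.
have := lerD (h x x0 _) (h y y0 _); rewrite lerDl y0 lerDr x0 => /(_ isT isT).
by rewrite -mulrDl -mulrDl mulfV// mul1r.
Qed.

End real_powers.

(** * Interpolated kernel bounds, uniform in lam *)

Section interpolated_bounds.
Context {R : realType}.
Variables (al : R).
Hypotheses (al0 : 0 < al) (al1 : al < 1).
Implicit Types (lam t th s T : R).

(** Geometric mean of e <= k_al, which ignores lam, and e <= al / (lam t), which gains a full power
    of lam at the price of integrability at 0. *)
Lemma ML_al_interp th : 0 <= th -> th <= 1 -> exists2 C : R, 0 <= C &
  forall lam t, 0 < lam -> ML al lam al t <= C * lam `^ (- th) * cpow (al * (1 - th)) t.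
Proof.
move=> th0 th1; have G0 := Gamma_gt0 al al0.
exists ((Gamma al)^-1 `^ (1 - th) * al `^ th); first by rewrite mulr_ge0 ?powR_ge0.
move=> lam t lam0; have [t0|t0] := leP t 0.
  by rewrite ML_le0// mulr_ge0 ?cpow_ge0// mulr_ge0 ?powR_ge0// mulr_ge0 ?powR_ge0.
have h := geo_interp (ML_al_ge0 al0 al1 lam0 t) (ML_al_le_kk al0 al1 lam0 t)
  (ML_al_upper al0 al1 lam0 t0) th0 th1.
apply: (le_trans h); rewrite kkE// /cpow t0.
rewrite powRM ?powR_ge0 ?invr_ge0 ?(ltW G0)//.
rewrite [(al / _) `^ _]powRM ?(ltW al0) ?invr_ge0 ?(ltW (mulr_gt0 lam0 t0))//.
rewrite (powRV _ (ltW (mulr_gt0 lam0 t0))) powRM ?(ltW lam0) ?(ltW t0)//.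
rewrite -powRrM.
have -> : t `^ (al * (1 - th) - 1) = t `^ ((al - 1) * (1 - th)) * t `^ (- th).
  by rewrite -powRDp//; congr powR; ring.
by rewrite le_eqVlt; apply/orP; left; apply/eqP; ring.
Qed.

(** The denominator costs one power of lam, since 1 / E(T) <= 1 + C lam and the 1 is absorbed by lam
    >= lam1. The numerator returns lam^(- (1 - th)), by interpolation between 1 and C / (lam
    t^al). *)
Lemma ML1_ratio th T lam1 : 0 <= th -> th <= 1 -> 0 < T -> 0 < lam1 ->
  exists2 C : R, 0 <= C & forall lam t, lam1 <= lam -> 0 < t ->
  ML al lam 1 t / ML al lam 1 T <= C * lam `^ th * t `^ (- (al * (1 - th))).
Proof.
move=> th0 th1 T0 lam10.
have G0 := Gamma_gt0 (al + 1) (addr_gt0 al0 ltr01).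
have G1 := Gamma_gt0 (1 - al) ltac:(by rewrite subr_gt0).
pose C2 := lam1^-1 + Gamma (1 - al) * T `^ al.
have C20 : 0 <= C2 by rewrite addr_ge0 ?invr_ge0 ?(ltW lam10)// mulr_ge0 ?powR_ge0// ltW.
exists (Gamma (al + 1) `^ (1 - th) * C2); first by rewrite mulr_ge0 ?powR_ge0.
move=> lam t llam t0; have lam0 := lt_le_trans lam10 llam.
have th1' : 0 <= 1 - th by rewrite subr_ge0.
have h := geo_interp (ML1_ge0 al0 al1 lam0 t) (ML1_le1 al0 al1 lam0 t)
  (ML1_upper al0 al1 lam0 t0) th1' ltac:(by rewrite gerBl).
have hT : (ML al lam 1 T)^-1 <= C2 * lam.
  apply: (le_trans (ML1_lower_bound al0 al1 lam0 T0)).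
  rewrite mulrDl mulrAC lerD2r -ler_pdivrMl ?invr_gt0// invrK mulr1//.
have hTi : 0 <= (ML al lam 1 T)^-1 by rewrite invr_ge0 ML1_ge0.
apply: (le_trans (ler_pM (ML1_ge0 al0 al1 lam0 t) hTi h hT)).
rewrite powR1 mul1r.
rewrite powRM ?(ltW G0) ?invr_ge0 ?mulr_ge0 ?powR_ge0 ?(ltW lam0)//.
rewrite powRV ?mulr_ge0 ?powR_ge0 ?(ltW lam0)// powRM ?powR_ge0 ?(ltW lam0)//.
rewrite -powRrM.
have -> : lam `^ th = lam `^ (- (1 - th)) * lam.
  by rewrite -[X in _ * X](powRr1 (ltW lam0)) -powRDp//; congr powR; ring.
have -> : - (al * (1 - th)) = al * - (1 - th) by ring.
by rewrite le_eqVlt; apply/orP; left; apply/eqP; ring.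
Qed.

Lemma kk1_cpow s t : 0 < s -> 0 <= t -> cvl (kk 1) (cpow s) t = t `^ s / s.
Proof.
move=> s0 t0; have [i1 E1] := cvl_kk t (@ltr01 R) s0.
have -> : cvl (kk 1) (cpow s) t = Gamma s * cvl (kk 1) (kk s) t.
  by rewrite -cvlZr//; apply: eq_cvl => x; rewrite cpow_kk.
rewrite E1; move: t0; rewrite le_eqVlt => /predU1P[<-|t0].
  by rewrite kk_le0// mulr0 powR0 ?mul0r// lt0r_neq0.
rewrite kkE// addrAC subrr add0r addrC GammaS//.
have := Gamma_gt0 s s0; move: (Gamma s) (t `^ s) => g h g0; field.
by rewrite !lt0r_neq0.
Qed.

Lemma cint_kk1_cpow s t : 0 < s -> cint (kk 1) (cpow s) t.
Proof.
move=> s0; have [i1 _] := cvl_kk t (@ltr01 R) s0.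
by have := cintZr (Gamma s) i1; apply: eq_cint => x; rewrite cpow_kk.
Qed.

Lemma kk1_nondecreasing (x y : R) : x <= y -> kk 1 x <= kk 1 y.
Proof. by move=> xy; rewrite !kk1E; case: ltP => x0; case: ltP => // y0; lra. Qed.

(* Bounds the increments of [1 - E_al(- lam t^al)] by interpolation. *)
Lemma ML1_hoelder s : 0 < s -> s <= al -> exists2 C : R, 0 <= C &
  forall lam t1 t2, 0 < lam -> 0 <= t1 -> t1 <= t2 ->
  `|lam * (cvl (kk 1) (ML al lam al) t2 - cvl (kk 1) (ML al lam al) t1)|
    <= C * lam `^ (s / al) * (t2 - t1) `^ s.
Proof.
(* Chosen so that al (1 - th) = s: the interpolated bound of e is a multiple of t^(s-1), whose
   primitive is Hoelder continuous of exponent s. *)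
move=> s0 sal; pose th := 1 - s / al.
have th0 : 0 <= th by rewrite subr_ge0 ler_pdivrMr// mul1r.
have th1 : th <= 1 by rewrite gerBl divr_ge0// ltW.
have [C C0 HC] := ML_al_interp th0 th1.
exists (C / s) => [|lam t1 t2 lam0 t10 t12]; first by rewrite divr_ge0// ltW.
have cE : al * (1 - th) = s by rewrite /th subKr mulrCA mulfV ?mulr1// lt0r_neq0.
pose c := C * lam `^ (- th).
have ge x : 0 <= c * cpow s x - ML al lam al x.
  by rewrite subr_ge0; have := HC lam x lam0; rewrite cE.
have i t := cint_kk_ML al0 lam0 t (@ltr01 R) al0.
have j t := cintZr c (cint_kk1_cpow t s0).
have D t := cvlBr (j t) (i t).
(* The difference c t^(s-1) - e is nonnegative, so its primitive is nondecreasing: increments of the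
   primitive of e are at most those of c t^s / s. *)
have : cvl (kk 1) (fun x => c * cpow s x - ML al lam al x) t1 <=
       cvl (kk 1) (fun x => c * cpow s x - ML al lam al x) t2.
  apply: cvl_le; [exact: cintBr|exact: cintBr|move=> x].
  by rewrite ler_wpM2r// kk1_nondecreasing// lerB.
rewrite !D !cvlZr; try exact: cint_kk1_cpow.
have t20 := le_trans t10 t12.
rewrite !kk1_cpow// => h.
have mono := cvl_kk1_homo al0 al1 lam0 t12.
rewrite ger0_norm ?mulr_ge0 ?(ltW lam0) ?subr_ge0//.
have sub : t2 `^ s - t1 `^ s <= (t2 - t1) `^ s.
  have := @powR_subadd _ t1 (t2 - t1) s t10; rewrite subr_ge0 => /(_ t12 s0).
  by rewrite addrCA subrr addr0 lerBlDl; apply; rewrite (le_trans sal)// ltW.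
apply: (@le_trans _ _ (lam * (c * ((t2 - t1) `^ s / s)))).
  rewrite ler_wpM2l ?(ltW lam0)//.
  apply: (@le_trans _ _ (c * ((t2 `^ s - t1 `^ s) / s))).
    have -> : c * ((t2 `^ s - t1 `^ s) / s) = c * (t2 `^ s / s) - c * (t1 `^ s / s) by ring.
    move: h; move: (cvl _ _ t1) (cvl _ _ t2) (c * _) (c * _) => a b x y; lra.
  by rewrite ler_wpM2l ?mulr_ge0 ?powR_ge0// ler_wpM2r ?invr_ge0 ?(ltW s0).
rewrite le_eqVlt; apply/orP; left; apply/eqP.
have -> : lam `^ (s / al) = lam * lam `^ (- th).
  rewrite (_ : lam * lam `^ (- th) = lam `^ (1 + - th)); last first.
    by rewrite powRDp// powRr1// ltW.
  by congr powR; rewrite /th; ring.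
by rewrite /c; ring.
Qed.

End interpolated_bounds.

Section statement_kernels.
Context {R : realType}.
Variables (al lam : R).
Hypotheses (al0 : 0 < al) (al1 : al < 1) (lam0 : 0 < lam).

Lemma mittag_leffler_ML nu t : 0 < nu -> 0 < t ->
  t `^ (nu - 1) * mittag_leffler al nu (- (lam * t `^ al)) = ML al lam nu t.
Proof.
move=> nu0 t0; rewrite /mittag_leffler.
have tp : t `^ (nu - 1) != 0 by rewrite lt0r_neq0// powR_gt0.
set u := fun i => _ / Gamma _.
have uE i : u i = (t `^ (nu - 1))^-1 * mlt al lam nu t i.
  rewrite /u /mlt kkE//.
  have -> : t `^ (al * i%:R + nu - 1) = (t `^ al) ^+ i * t `^ (nu - 1).
    by rewrite -powR_mulrn ?powR_ge0// -powRrM -powRDp// addrA.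
  rewrite -[- (lam * _)]mulNr exprMn.
  move: (Gamma _)^-1 (t `^ (nu - 1)) tp => g h h0.
  by field.
have : (fun n => (t `^ (nu - 1))^-1 * series (mlt al lam nu t) n) @ \oo -->
  (t `^ (nu - 1))^-1 * ML al lam nu t by apply: cvgMr; exact: ML_cvg.
have -> : (fun n => (t `^ (nu - 1))^-1 * series (mlt al lam nu t) n) = series u.
  by apply/funext => n; rewrite /series/= big_distrr/=; apply: eq_bigr => i _; rewrite uE.
by move=> /cvg_lim ->//; rewrite mulrA mulfV ?mul1r.
Qed.

Lemma mittag_leffler1E t : 0 < t ->
  mittag_leffler al 1 (- (lam * t `^ al)) = ML al lam 1 t.
Proof. by move=> t0; rewrite -mittag_leffler_ML// subrr powRr0 mul1r. Qed.

Lemma ml_kernelE t : 0 <= t -> ml_kernel al lam t = ML al lam al t.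
Proof.
rewrite le_eqVlt => /predU1P[<-|t0]; last exact: mittag_leffler_ML.
(* At t = 0 the power of 0 with exponent al - 1 != 0 is 0 by convention, in agreement with the
   extension of [ML] by 0. *)
rewrite /ml_kernel powR0 ?mul0r ?ML_le0//.
by rewrite subr_eq0 lt_eqF.
Qed.

End statement_kernels.

(** * Fractional integrals of square-summable sequences *)

Section signed_associativity.
Context {R : realType}.
Implicit Types f g h : R -> R.

Definition posp (h : R -> R) : R -> R := fun x => Num.max (h x) 0.

Lemma posp_ge0 h x : 0 <= posp h x.
Proof. by rewrite /posp le_max lexx orbT. Qed.

Lemma posp_le h x : posp h x <= `|h x|.
Proof. by rewrite /posp ge_max ler_norm normr_ge0. Qed.

Lemma pospN_le h x : posp (fun y => - h y) x <= `|h x|.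
Proof. by rewrite /posp ge_max -normrN ler_norm normr_ge0. Qed.

Lemma posp_sub h x : h x = posp h x - posp (fun y => - h y) x.
Proof.
by rewrite /posp; case: leP => hx; case: leP => hy; lra.
Qed.

Lemma measurable_posp h : measurable_fun setT h -> measurable_fun setT (posp h).
Proof. by move=> mh; apply: measurable_maxr. Qed.

Let measEFin h : measurable_fun setT h -> measurable_fun setT (EFin \o h).
Proof. by move=> mh; apply/measurable_EFinP. Qed.

Lemma measurable_cvl_ge0 f g : measurable_fun setT f -> measurable_fun setT g ->
  (forall x, 0 <= f x) -> (forall x, 0 <= g x) -> (forall x, cint f g x) ->
  measurable_fun setT (cvl f g).
Proof.
move=> mf mg f0 g0 i; apply/measurable_EFinP.
rewrite (_ : EFin \o cvl f g = econv (EFin \o f) (EFin \o g)); last first.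
  by apply/funext => x /=; rewrite econv_cint.
by apply: measurable_econv => //; try exact: measEFin; move=> x; rewrite lee_fin.
Qed.

Lemma cint_dom f g g' t : measurable_fun setT f -> measurable_fun setT g' ->
  (forall x, 0 <= f x) -> (forall x, `|g' x| <= g x) -> cint f g t -> cint f g' t.
Proof.
move=> mf mg' f0 gg' i; apply: (cint_le (c := 1) mf mg' _ i) => x.
by rewrite mul1r normrM ger0_norm// ler_wpM2l.
Qed.

(** [K] is a closed form of f * g, so that identities such as k_a * k_b = k_(a+b) can be supplied
    directly. The statement is Tonelli's theorem. *)
Lemma cvlA_ge0 f g h K t : measurable_fun setT f -> measurable_fun setT g ->
  measurable_fun setT h -> (forall x, 0 <= f x) -> (forall x, 0 <= g x) ->
  (forall x, 0 <= h x) -> (forall x, cint f g x /\ cvl f g x = K x) ->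
  (forall x, cint g h x) -> cint f (cvl g h) t ->
  cint K h t /\ cvl K h t = cvl f (cvl g h) t.
Proof.
move=> mf mg mh f0 g0 h0 fgK igh ifgh.
have KE : K = cvl f g by apply/funext => x; have [_ ->] := fgK x.
have K0 x : 0 <= K x by rewrite KE; apply: cvl_ge0.
have mK : measurable_fun setT K.
  by rewrite KE; apply: measurable_cvl_ge0 => // x; have [] := fgK x.
have E1 : EFin \o cvl g h = econv (EFin \o g) (EFin \o h).
  by apply/funext => x /=; rewrite econv_cint.
have E2 : EFin \o K = econv (EFin \o f) (EFin \o g).
  by apply/funext => x /=; rewrite KE econv_cint//; have [] := fgK x.
apply: econv_cvl => //.
rewrite E2 -econvA//; try exact: measEFin; try by move=> x; rewrite lee_fin.
by rewrite -E1 econv_cint// => x; exact: cvl_ge0.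
Qed.

Lemma cvl_posp f h x : cint f (posp h) x -> cint f (posp (fun y => - h y)) x ->
  cvl f h x = cvl f (posp h) x - cvl f (posp (fun y => - h y)) x.
Proof.
move=> i1 i2; rewrite -cvlBr//; apply: eq_cvl => y; by rewrite -posp_sub.
Qed.

Lemma measurable_cvl f h : measurable_fun setT f -> measurable_fun setT h ->
  (forall x, 0 <= f x) -> (forall x, cint f (fun y => `|h y|) x) ->
  measurable_fun setT (cvl f h).
Proof.
move=> mf mh f0 ih.
have mp := measurable_posp mh.
have mn : measurable_fun setT (posp (fun y => - h y)).
  by apply: measurable_posp; exact: measurableT_comp.
have pl x : `|posp h x| <= `|h x| by rewrite ger0_norm ?posp_ge0// posp_le.
have nl x : `|posp (fun y => - h y) x| <= `|h x| by rewrite ger0_norm ?posp_ge0// pospN_le.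
have ip x := cint_dom mf mp f0 pl (ih x).
have in' x := cint_dom mf mn f0 nl (ih x).
have -> : cvl f h = (fun x => cvl f (posp h) x - cvl f (posp (fun y => - h y)) x).
  by apply/funext => x; exact: cvl_posp.
apply: measurable_funB; apply: measurable_cvl_ge0 => //; exact: posp_ge0.
Qed.

(** The positive and negative parts of h are treated separately; absolute convergence of the
    iterated convolution with |h| is all that they require. *)
Lemma cvlA f g h K t : measurable_fun setT f -> measurable_fun setT g ->
  measurable_fun setT h -> (forall x, 0 <= f x) -> (forall x, 0 <= g x) ->
  (forall x, cint f g x /\ cvl f g x = K x) ->
  (forall x, cint g (fun y => `|h y|) x) -> cint f (cvl g (fun y => `|h y|)) t ->
  [/\ cint K h t, cint f (cvl g h) t & cvl K h t = cvl f (cvl g h) t].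
Proof.
move=> mf mg mh f0 g0 fgK igh ifgh.
have mp := measurable_posp mh.
have mn : measurable_fun setT (posp (fun y => - h y)).
  by apply: measurable_posp; exact: measurableT_comp.
have p0 x := posp_ge0 h x; have n0 x := posp_ge0 (fun y => - h y) x.
have pl x : `|posp h x| <= `|h x| by rewrite ger0_norm// posp_le.
have nl x : `|posp (fun y => - h y) x| <= `|h x| by rewrite ger0_norm// pospN_le.
have ip x := cint_dom mg mp g0 pl (igh x).
have in' x := cint_dom mg mn g0 nl (igh x).
have mcp := measurable_cvl_ge0 mg mp g0 p0 ip.
have mcn := measurable_cvl_ge0 mg mn g0 n0 in'.
have cpl x : `|cvl g (posp h) x| <= cvl g (fun y => `|h y|) x.
  rewrite ger0_norm ?cvl_ge0//; apply: cvl_le => // y.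
  by rewrite ler_wpM2l// posp_le.
have cnl x : `|cvl g (posp (fun y => - h y)) x| <= cvl g (fun y => `|h y|) x.
  rewrite ger0_norm ?cvl_ge0//; apply: cvl_le => // y.
  by rewrite ler_wpM2l// pospN_le.
have icp := cint_dom mf mcp f0 cpl ifgh.
have icn := cint_dom mf mcn f0 cnl ifgh.
have [iKp EKp] := cvlA_ge0 mf mg mp f0 g0 p0 fgK ip icp.
have [iKn EKn] := cvlA_ge0 mf mg mn f0 g0 n0 fgK in' icn.
have cE : cvl g h = fun x => cvl g (posp h) x - cvl g (posp (fun y => - h y)) x.
  by apply/funext => x; exact: cvl_posp.
split.
- by have := cintBr iKp iKn; apply: eq_cint => x; rewrite -posp_sub.
- by rewrite cE; exact: cintBr.
- by rewrite (cvl_posp iKp iKn) cE (cvlBr icp icn) EKp EKn.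
Qed.

End signed_associativity.

(** * Power kernels against L^P functions *)

Section hoelder_kernel.
Context {R : realType}.
Local Notation mu := (@lebesgue_measure R).

Lemma cpow_powR (a q x : R) : 0 < q -> cpow a x `^ q = cpow (q * (a - 1) + 1) x.
Proof.
move=> q0; rewrite /cpow; case: ifP => _; last by rewrite powR0// lt0r_neq0.
by rewrite -powRrM addrK mulrC.
Qed.

(** Hoelder's inequality with t^(a-1) in the dual space of L^P over ]0, T[. The constant does not
    depend on g, which makes all later estimates linear in the norm of the source. *)
Lemma cpow_hoelder (a P T : R) : 1 < P -> P^-1 < a -> 0 < T ->
  exists2 C, 0 <= C & forall (g : R -> R) N t, measurable_fun setT g ->
  (forall x, 0 <= g x) -> (forall x, x <= 0 -> g x = 0) -> 0 <= N -> t <= T ->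
  (\int[mu]_x (g x `^ P)%:E <= (N `^ P)%:E)%E ->
  cint (cpow a) g t /\ cvl (cpow a) g t <= C * N.
Proof.
move=> P1 Pa T0; have P0 : 0 < P by exact: lt_trans P1.
pose Q := P / (P - 1); have Pm : 0 < P - 1 by rewrite subr_gt0.
have Q0 : 0 < Q by rewrite divr_gt0.
have PQ : P^-1 + Q^-1 = 1.
  by rewrite /Q; field; rewrite !lt0r_neq0.
(* The Q-th power of the kernel is t^(bb-1), and bb > 0 means exactly P^-1 < a. *)
pose bb := Q * (a - 1) + 1.
have bb0 : 0 < bb.
  have h : Q * (P^-1 - 1) + 1 = 0.
    by rewrite /Q; field; rewrite !lt0r_neq0.
  by rewrite /bb -[ltLHS]h ltrD2r ltr_pM2l// ltrD2r.
exists ((T `^ bb / bb) `^ Q^-1); first exact: powR_ge0.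
move=> g N t mg g0 gneg N0 tT gN.
(* The factor [kk 1 x] cuts the kernel off where g vanishes anyway; without it the kernel would be
   considered on a half line of infinite length. *)
pose f x := cpow a (t - x) * kk 1 x.
have mf : measurable_fun setT f.
  apply: measurable_funM; last exact: measurable_kk.
  by apply: measurableT_comp; [exact: measurable_cpow|exact: measurable_funB].
have fgE x : cpow a (t - x) * g x = f x * g x.
  rewrite /f kk1E; case: ltP => x0; first by rewrite mulr1.
  by rewrite gneg// !mulr0.
have f0 x : 0 <= f x by rewrite mulr_ge0 ?cpow_ge0 ?kk_ge0.
have H := @hoelder _ _ R mu f g Q P mf mg Q0 P0 ltac:(by rewrite addrC).
have If : (\int[mu]_x (`|f x| `^ Q)%:E <= (T `^ bb / bb)%:E)%E.
  have Tb : (0 <= (T `^ bb / bb)%:E)%E by rewrite lee_fin divr_ge0 ?powR_ge0// ltW.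
  have [t0|t0] := leP t 0.
    rewrite integral0_eq// => x _; rewrite (_ : f x = 0) ?normr0 ?powR0 ?lt0r_neq0//.
    rewrite /f kk1E; case: ltP => x0; last by rewrite mulr0.
    by rewrite /cpow ltNge subr_le0 (le_trans t0)// ?mul0r// ltW.
  have -> : (\int[mu]_x (`|f x| `^ Q)%:E)%E =
      econv (EFin \o cpow bb) (EFin \o kk 1) t.
    apply: eq_integral => x _; rewrite ger0_norm// /f /= -EFinM; congr (_%:E).
    rewrite powRM ?cpow_ge0 ?kk_ge0// cpow_powR//; congr (_ * _).
    by rewrite kk1E; case: ifP => _; rewrite ?powR1// powR0// lt0r_neq0.
  rewrite econvC; try by [move=> x; rewrite lee_fin ?cpow_ge0 ?kk_ge0
    |apply/measurable_EFinP; exact: measurable_cpow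
    |apply/measurable_EFinP; exact: measurable_kk].
  rewrite [leLHS](_ : _ = (t `^ bb / bb)%:E); last first.
    by rewrite -integral_cpow//; apply: eq_integral => x _ /=; rewrite EFinM.
  rewrite lee_fin ler_wpM2r ?invr_ge0 ?(ltW bb0)// ge0_ler_powR ?nnegrE ?(ltW bb0)//.
    exact: ltW.
  exact: ltW.
have Nf : ('N[mu]_Q%:E[EFin \o f] <= ((T `^ bb / bb) `^ Q^-1)%:E)%E.
  rewrite unlock -poweR_EFin; apply: gt0_ler_poweR; rewrite ?invr_ge0 ?(ltW Q0)//.
  - by rewrite in_itv/= leey andbT integral_ge0// => x _; rewrite poweR_ge0.
  - by rewrite in_itv/= leey andbT lee_fin divr_ge0 ?powR_ge0// ltW.
have Ng : ('N[mu]_P%:E[EFin \o g] <= N%:E)%E.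
  rewrite unlock (_ : N%:E = (N `^ P)%:E `^ P^-1)%E; last first.
    by rewrite poweR_EFin -powRrM mulfV ?lt0r_neq0// powRr1.
  apply: gt0_ler_poweR; rewrite ?invr_ge0 ?(ltW P0)//.
  - by rewrite in_itv/= leey andbT integral_ge0// => x _; rewrite poweR_ge0.
  - by rewrite in_itv/= leey andbT lee_fin powR_ge0.
  - apply: le_trans gN; rewrite le_eqVlt; apply/orP; left; apply/eqP.
    by apply: eq_integral => x _ /=; rewrite ger0_norm.
have Ifg : (\int[mu]_x (cpow a (t - x) * g x)%:E <= ((T `^ bb / bb) `^ Q^-1 * N)%:E)%E.
  rewrite EFinM; apply: le_trans (lee_pmul _ _ Nf Ng); rewrite ?Lnorm_ge0//.
  apply: le_trans H; rewrite Lnorm1 le_eqVlt; apply/orP; left; apply/eqP.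
  apply: eq_integral => x _; have fg0 := mulr_ge0 (f0 x) (g0 x).
  by rewrite fgE /= ger0_norm.
have i : cint (cpow a) g t.
  apply/integrableP; split.
    by apply/measurable_EFinP; apply: measurable_conv_ker => //; exact: measurable_cpow.
  apply: (@le_lt_trans _ _ ((T `^ bb / bb) `^ Q^-1 * N)%:E); last exact: ltry.
  apply: le_trans Ifg.
  rewrite le_eqVlt; apply/orP; left; apply/eqP; apply: eq_integral => x _ /=.
  by rewrite ger0_norm// mulr_ge0 ?cpow_ge0.
split => //; rewrite -lee_fin -econv_cint//; last by move=> x; exact: cpow_ge0.
Qed.

End hoelder_kernel.

(** * Square-summable sequences and Minkowski's inequality *)

Section l2_sequences.
Context {R : realType}.
Implicit Types (x y : nat -> R) (M : R).

(** Bounding all partial sums expresses that the l2 norm is at most M without any limit, and lets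
    bounds be compared, added and integrated as numbers. *)
Definition l2le x M := 0 <= M /\ forall n, \sum_(j < n) x j ^+ 2 <= M ^+ 2.

Lemma l2le_dom x y c M : 0 <= c -> (forall j, `|y j| <= c * `|x j|) -> l2le x M ->
  l2le y (c * M).
Proof.
move=> c0 h [M0 H]; split=> [|n]; first exact: mulr_ge0.
apply: (@le_trans _ _ (c ^+ 2 * \sum_(j < n) x j ^+ 2)).
  rewrite big_distrr/=; apply: ler_sum => j _.
  rewrite -[y j ^+ 2]real_normK ?num_real// -[x j ^+ 2]real_normK ?num_real// -exprMn.
  by rewrite lerXn2r ?nnegrE ?mulr_ge0.
by rewrite exprMn ler_wpM2l ?sqr_ge0.
Qed.

Lemma l2le_mono x M M' : M <= M' -> l2le x M -> l2le x M'.
Proof.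
move=> MM' [M0 H]; have M'0 := le_trans M0 MM'; split => // n.
by rewrite (le_trans (H n))// lerXn2r.
Qed.

Lemma l2le_coord x M j : l2le x M -> `|x j| <= M.
Proof.
move=> [M0 H]; rewrite -(@ler_pXn2r _ 2)// ?nnegrE// real_normK ?num_real//.
apply: le_trans (H j.+1); rewrite big_ord_recr/= lerDr.
by apply: sumr_ge0 => i _; exact: sqr_ge0.
Qed.

Lemma finite_cauchy_schwarz n (a b : nat -> R) (A B : R) : 0 <= A -> 0 <= B ->
  \sum_(j < n) a j ^+ 2 <= A ^+ 2 -> \sum_(j < n) b j ^+ 2 <= B ^+ 2 ->
  \sum_(j < n) a j * b j <= A * B.
Proof.
move=> A0 B0 HA HB.
have z (c : nat -> R) : \sum_(j < n) c j ^+ 2 <= 0 ^+ 2 -> forall j : 'I_n, c j = 0.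
  rewrite expr0n/= => h j; apply/eqP; rewrite -sqrf_eq0; apply/eqP.
  apply/le_anti; rewrite sqr_ge0 andbT; apply: le_trans h.
  by rewrite (bigD1 j)//= lerDl sumr_ge0// => i _; exact: sqr_ge0.
have [A00|An0] := eqVneq A 0.
  by rewrite A00 in HA *; rewrite mul0r big1// => j _; rewrite (z _ HA) mul0r.
have [B00|Bn0] := eqVneq B 0.
  by rewrite B00 in HB *; rewrite mulr0 big1// => j _; rewrite (z _ HB) mulr0.
have Ap : 0 < A by rewrite lt0r An0.
have Bp : 0 < B by rewrite lt0r Bn0.
(* The inequality 2 a b <= a^2 B/A + b^2 A/B, with weights that make both sums contribute A B /
   2. *)
apply: (@le_trans _ _ (\sum_(j < n) (a j ^+ 2 * (B / (2 * A)) + b j ^+ 2 * (A / (2 * B))))).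
  apply: ler_sum => j _; rewrite -subr_ge0.
  have -> : a j ^+ 2 * (B / (2 * A)) + b j ^+ 2 * (A / (2 * B)) - a j * b j =
    (a j * B - b j * A) ^+ 2 / (2 * A * B) by field; rewrite ?An0 ?Bn0.
  by rewrite divr_ge0 ?sqr_ge0// !mulr_ge0.
rewrite big_split/= -!mulr_suml.
have -> : A * B = A ^+ 2 * (B / (2 * A)) + B ^+ 2 * (A / (2 * B)) by field; rewrite ?An0 ?Bn0.
by apply: lerD; rewrite ler_wpM2r// divr_ge0// mulr_ge0.
Qed.

Lemma l2le_add x y M N : l2le x M -> l2le y N -> l2le (fun j => x j + y j) (M + N).
Proof.
move=> [M0 HM] [N0 HN]; split=> [|n]; first exact: addr_ge0.
have -> : \sum_(j < n) (x j + y j) ^+ 2 =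
  \sum_(j < n) x j ^+ 2 + (\sum_(j < n) x j * y j) *+ 2 + \sum_(j < n) y j ^+ 2.
  by rewrite -sumrMnl -!big_split/=; apply: eq_bigr => j _; rewrite sqrrD.
rewrite sqrrD; apply: lerD => //; apply: lerD => //.
by rewrite ler_pMn2r//; exact: finite_cauchy_schwarz.
Qed.

Lemma l2le_eq x y M : (forall j, x j = y j) -> l2le x M -> l2le y M.
Proof. by move=> /funext ->. Qed.

Lemma l2le_sub x y M N : l2le x M -> l2le y N -> l2le (fun j => x j - y j) (M + N).
Proof.
move=> hx hy; apply: (l2le_add hx).
rewrite -[N]mul1r; apply: l2le_dom hy => // j.
by rewrite normrN mul1r.
Qed.

Lemma Rintegral_sum n (h : nat -> R -> R) :
  (forall j, (@lebesgue_measure R).-integrable setT (EFin \o h j)) ->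
  (@lebesgue_measure R).-integrable setT (EFin \o (fun r => \sum_(j < n) h j r)) /\
  \int[@lebesgue_measure R]_r (\sum_(j < n) h j r) =
  \sum_(j < n) \int[@lebesgue_measure R]_r (h j r).
Proof.
move=> ih; have i := @integrable_sum _ _ R (@lebesgue_measure R) setT measurableT _
  (index_enum 'I_n) xpredT (fun j => EFin \o h j) (fun j _ => ih j).
have {}i : (@lebesgue_measure R).-integrable setT (EFin \o (fun r => \sum_(j < n) h j r)).
  by apply: eq_integrable i => // r _ /=; rewrite sumEFin.
split => //; apply: EFin_inj; rewrite -sumEFin /Rintegral fineK; last exact: integrable_fin_num.
under eq_integral do rewrite -sumEFin.
rewrite (@integral_sum _ _ R (@lebesgue_measure R) setT measurableT _ (fun j : 'I_n => EFin \o h j))//.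
by apply: eq_bigr => j _; rewrite fineK//; exact: (integrable_fin_num _ (ih j)).
Qed.

(* Minkowski's integral inequality, by testing against the vector of integrals. *)
Lemma l2le_integral (ka f : nat -> R -> R) (k g : R -> R) :
  (forall j, measurable_fun setT (ka j)) -> (forall j, measurable_fun setT (f j)) ->
  (forall j r, `|ka j r| <= k r) -> (forall r, l2le (f ^~ r) (g r)) ->
  (@lebesgue_measure R).-integrable setT (EFin \o (fun r => k r * g r)) ->
  l2le (fun j => \int[@lebesgue_measure R]_r (ka j r * f j r))
       (\int[@lebesgue_measure R]_r (k r * g r)).
Proof.
move=> mk mf kk fg ikg; set v := fun j => _; set I := \int[_]_r _.
have k0 r : 0 <= k r by apply: le_trans (kk 0%N r).
have g0 r : 0 <= g r by have [] := fg r.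
have I0 : 0 <= I by apply: Rintegral_ge0 => r _; rewrite mulr_ge0.
have ij j : (@lebesgue_measure R).-integrable setT (EFin \o (fun r => ka j r * f j r)).
  apply: le_integrable ikg => //.
    by apply/measurable_EFinP; apply: measurable_funM; [exact: mk|exact: mf].
  move=> r _ /=; rewrite lee_fin [leRHS]ger0_norm ?mulr_ge0// normrM.
  by apply: ler_pM => //; exact: (l2le_coord j (fg r)).
split => // n; pose S := \sum_(j < n) v j ^+ 2.
have S0 : 0 <= S by apply: sumr_ge0 => j _; exact: sqr_ge0.
have SI : S <= Num.sqrt S * I.
  have iv j : (@lebesgue_measure R).-integrable setT
      (EFin \o (fun r => v j * (ka j r * f j r))).
    exact: (integrableZl measurableT (v j) (ij j)).
  have [isum Esum] := Rintegral_sum n iv.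
  have SE : S = \int[@lebesgue_measure R]_r (\sum_(j < n) v j * (ka j r * f j r)).
    by rewrite Esum; apply: eq_bigr => j _; rewrite RintegralZl// -expr2.
  rewrite {1}SE -RintegralZl//; apply: le_Rintegral => //.
    exact: (integrableZl measurableT _ ikg).
  move=> r _; under eq_bigr do rewrite mulrCA.
  apply: (@le_trans _ _ (k r * (Num.sqrt S * g r))); last by rewrite mulrCA.
  apply: (@le_trans _ _ (\sum_(j < n) k r * (`|v j| * `|f j r|))).
    apply: ler_sum => j _; rewrite (le_trans (ler_norm _))// normrM normrM.
    by rewrite ler_wpM2r ?mulr_ge0.
  rewrite -mulr_sumr ler_wpM2l//.
  apply: (@finite_cauchy_schwarz n (fun j => `|v j|) (fun j => `|f j r|)); rewrite ?sqrtr_ge0//.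
    rewrite sqr_sqrtr// le_eqVlt; apply/orP; left; apply/eqP; apply: eq_bigr => j _.
    by rewrite real_normK ?num_real.
  have [_ /(_ n)] := fg r; apply: le_trans.
  rewrite le_eqVlt; apply/orP; left; apply/eqP; apply: eq_bigr => j _.
  by rewrite real_normK ?num_real.
have [S00|Sn0] := eqVneq S 0; first by rewrite -/S S00 sqr_ge0.
have Sp : 0 < Num.sqrt S by rewrite sqrtr_gt0 lt0r Sn0.
rewrite -/S -(sqr_sqrtr S0) lerXn2r ?nnegrE ?sqrtr_ge0//.
by rewrite -(ler_pM2l Sp) -expr2 sqr_sqrtr.
Qed.

End l2_sequences.

Section kernel_increments.
Context {R : realType}.
Implicit Types x y a s : R.

(** If x <= 0 < y, then y <= y - x and the power splits. For x > 0 the relative decrease 1 -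
    (x/y)^(1-a) is at most (y - x)/y, hence at most ((y - x)/x)^s. Thus s powers of the increment
    cost s powers in the singularity. *)
Lemma cpow_increment a s x y : 0 < s -> s <= 1 -> 0 < a -> a < 1 -> x <= y ->
  `|cpow a y - cpow a x| <= (y - x) `^ s * (cpow (a - s) x + cpow (a - s) y).
Proof.
move=> s0 s1 a0 a1 xy.
have R0 : 0 <= (y - x) `^ s * (cpow (a - s) x + cpow (a - s) y).
  by rewrite mulr_ge0 ?powR_ge0// addr_ge0 ?cpow_ge0.
have [y0|y0] := leP y 0.
  by rewrite {1 2}/cpow ltNge y0 ltNge (le_trans xy y0) subrr normr0.
have [x0|x0] := leP x 0.
  rewrite {1 2 3}/cpow y0 ltNge x0 subr0 add0r ger0_norm ?powR_ge0//.
  rewrite /cpow y0; have -> : a - 1 = s + (a - s - 1) by ring.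
  rewrite powRDp// ler_wpM2r ?powR_ge0// ge0_ler_powR ?nnegrE ?(ltW s0) ?(ltW y0) ?subr_ge0//.
  by rewrite lerBrDr gerDl.
have yx : 0 <= (y - x) / y by rewrite divr_ge0 ?subr_ge0// ltW.
have xya : x / y <= (x / y) `^ (1 - a).
  rewrite ger1_powR ?gerBl ?(ltW a0)// divr_gt0//=.
  by rewrite ler_pdivrMr// mul1r.
have ya : y `^ (a - 1) = x `^ (a - 1) * (x / y) `^ (1 - a).
  rewrite powRM ?(ltW x0) ?invr_ge0 ?(ltW y0)// powRV ?(ltW y0)// mulrA -powRDp//.
  by have -> : a - 1 + (1 - a) = 0; [ring|rewrite powRr0 mul1r opprB].
apply: (@le_trans _ _ ((y - x) `^ s * cpow (a - s) x)); last first.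
  by rewrite ler_wpM2l ?powR_ge0// lerDl cpow_ge0.
rewrite /cpow y0 x0 ya.
rewrite -[X in _ - X]mulr1 -mulrBr normrM ger0_norm ?powR_ge0//.
have xy1 : (x / y) `^ (1 - a) <= 1.
  have h1 : 1 `^ (1 - a) = 1 :> R by rewrite powR1.
  rewrite -[leRHS]h1 ge0_ler_powR ?nnegrE ?subr_ge0 ?(ltW a1) ?divr_ge0 ?(ltW x0) ?(ltW y0)//.
  by rewrite ler_pdivrMr// mul1r.
rewrite ler0_norm ?subr_le0// opprB.
have -> : a - s - 1 = (a - 1) + - s by ring.
rewrite [x `^ (a - 1 + - s)]powRDp// mulrCA ler_wpM2l ?powR_ge0//.
apply: (@le_trans _ _ ((y - x) / y)).
  by rewrite mulrBl mulfV ?lt0r_neq0// lerD2l lerN2.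
apply: (@le_trans _ _ (((y - x) / y) `^ s)).
  have [->|n0] := eqVneq ((y - x) / y) 0; first by rewrite powR_ge0.
  rewrite ger1_powR// lt0r n0 yx/= ler_pdivrMr// mul1r gerBl//; exact: ltW.
rewrite -powRV ?(ltW x0)// -powRM ?subr_ge0 ?invr_ge0 ?(ltW x0)//.
rewrite ge0_ler_powR ?nnegrE ?(ltW s0)//.
  by rewrite divr_ge0 ?subr_ge0// ltW.
by rewrite ler_wpM2l ?subr_ge0// lef_pV2.
Qed.

Lemma kk_increment a s x y : 0 < s -> s <= 1 -> 0 < a -> a < 1 -> x <= y ->
  `|kk a y - kk a x| <= (Gamma a)^-1 * (y - x) `^ s * (cpow (a - s) x + cpow (a - s) y).
Proof.
move=> s0 s1 a0 a1 xy; have G0 := Gamma_gt0 a a0.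
have -> : kk a y - kk a x = (Gamma a)^-1 * (cpow a y - cpow a x).
  by rewrite !cpow_kk// -mulrBr mulKf// lt0r_neq0.
rewrite normrM ger0_norm ?invr_ge0 ?(ltW G0)// -mulrA ler_wpM2l ?invr_ge0 ?(ltW G0)//.
exact: cpow_increment.
Qed.

End kernel_increments.

(** * Estimates of the Duhamel term *)

Section source_estimates.
Context {R : realType}.
Local Notation mu := (@lebesgue_measure R).
Variables (al T P lam1 : R) (lam : nat -> R).
Hypotheses (al0 : 0 < al) (al1 : al < 1) (T0 : 0 < T) (P1 : 1 < P).
Hypotheses (lam10 : 0 < lam1) (lamlb : forall j, lam1 <= lam j).

Let lam_gt0 j : 0 < lam j. Proof. exact: lt_le_trans (lamlb j). Qed.

(** The coefficients of F as everywhere defined functions that vanish at nonpositive times. The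
    function g dominates their l2 norm at each time and N bounds the L^P norm of g, so constants can
    be stated uniformly over all sources. *)
Record source (f : nat -> R -> R) (g : R -> R) (N : R) : Prop := Source {
  source_mf : forall j, measurable_fun setT (f j);
  source_mg : measurable_fun setT g;
  source_l2 : forall r, l2le (f ^~ r) (g r);
  source_causal : forall r, r <= 0 -> g r = 0;
  source_N : 0 <= N;
  source_int : (\int[mu]_r (g r `^ P)%:E <= (N `^ P)%:E)%E }.

(** The j-th coefficient of O_1(t) F. *)
Definition duhamel (f : nat -> R -> R) j t := cvl (ML al (lam j) al) (f j) t.

Section fixed_source.
Variables (f : nat -> R -> R) (g : R -> R) (N : R) (S : source f g N).

Lemma source_g_ge0 r : 0 <= g r. Proof. by have [] := source_l2 S r. Qed.

Lemma source_f_le j r : `|f j r| <= g r. Proof. exact: (l2le_coord j (source_l2 S r)). Qed.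

Lemma source_f_causal j r : r <= 0 -> f j r = 0.
Proof. by move=> r0; have := source_f_le j r; rewrite (source_causal S r0) normr_le0 => /eqP. Qed.

Lemma cint_cpow_g a t : P^-1 < a -> cint (cpow a) g t.
Proof.
move=> Pa; have TT : 0 < Num.max 1 t by rewrite lt_max ltr01.
have [C C0 HC] := cpow_hoelder P1 Pa TT.
have [] // := HC g N t (source_mg S) source_g_ge0 (source_causal S) (source_N S) _ (source_int S).
by rewrite le_max lexx orbT.
Qed.

Lemma cint_kk_g a t : P^-1 < a -> cint (kk a) g t.
Proof.
move=> Pa; have a0 : 0 < a by rewrite (lt_trans _ Pa)// invr_gt0 (lt_trans _ P1).
have := cintZl (Gamma a)^-1 (cint_cpow_g t Pa); apply: eq_cint => x.
by rewrite cpow_kk// mulKf// lt0r_neq0// Gamma_gt0.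
Qed.

Lemma measurable_absf j : measurable_fun setT (fun r => `|f j r|).
Proof. by apply: measurableT_comp => //; exact: (source_mf S j). Qed.

Lemma cint_kk_absf a j t : P^-1 < a -> cint (kk a) (fun r => `|f j r|) t.
Proof.
move=> Pa; have a0 : 0 < a by rewrite (lt_trans _ Pa)// invr_gt0 (lt_trans _ P1).
apply: (cint_dom _ _ _ _ (cint_kk_g t Pa)).
- exact: measurable_kk.
- exact: measurable_absf.
- by move=> x; exact: kk_ge0.
- by move=> x; rewrite normr_id source_f_le.
Qed.

Lemma cint_abs (h f' : R -> R) t : measurable_fun setT f' -> measurable_fun setT h ->
  (forall x, 0 <= h x) -> cint h (fun r => `|f' r|) t -> cint h f' t.
Proof. by move=> mf' mh h0; apply: cint_dom. Qed.

Lemma cint_ML_absf j t : P^-1 < al -> cint (ML al (lam j) al) (fun r => `|f j r|) t.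
Proof.
move=> Pal; apply: (cint_le (c := 1) _ _ _ (cint_kk_absf j t Pal)).
- exact: measurable_ML.
- exact: measurable_absf.
move=> x; rewrite mul1r normrM normr_id ler_wpM2r// ger0_norm ?ML_al_ge0//.
exact: ML_al_le_kk.
Qed.

Lemma cint_ML_f j t : P^-1 < al -> cint (ML al (lam j) al) (f j) t.
Proof.
move=> Pal; apply: (cint_abs _ _ _ (cint_ML_absf j t Pal)).
- exact: (source_mf S j).
- exact: measurable_ML.
- by move=> x; exact: ML_al_ge0.
Qed.

Lemma measurable_duhamel j : P^-1 < al -> measurable_fun setT (duhamel f j).
Proof.
move=> Pal; apply: measurable_cvl.
- exact: measurable_ML.
- exact: (source_mf S j).
- by move=> x; exact: ML_al_ge0.
- by move=> x; exact: cint_ML_absf.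
Qed.

Lemma duhamel_le0 j t : t <= 0 -> duhamel f j t = 0.
Proof.
move=> t0; apply: cvl_eq0 => x.
have [x0|x0] := leP x 0; first by rewrite source_f_causal// !mulr0.
by rewrite ML_le0 ?mul0r// subr_le0 (le_trans t0)// ltW.
Qed.

End fixed_source.

(** The bound of lam^th e by a multiple of t^(al (1 - th) - 1) is uniform in j, so Minkowski's
    inequality reduces the l2 norm to a convolution with g. *)
Lemma duhamel_weighted th : 0 <= th -> th <= 1 -> P^-1 < al * (1 - th) ->
  exists2 C, 0 <= C & forall f g N t, source f g N -> t <= T ->
  l2le (fun j => lam j `^ th * duhamel f j t) (C * N).
Proof.
move=> th0 th1 Pth.
have Pal : P^-1 < al by rewrite (lt_le_trans Pth)// ler_piMr ?(ltW al0)// gerBl.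
have [C1 C10 HC1] := ML_al_interp al0 al1 th0 th1.
have [C2 C20 HC2] := cpow_hoelder P1 Pth T0.
exists (C1 * C2) => [|f g N t S tT]; first exact: mulr_ge0.
have [i B] := HC2 g N t (source_mg S) (source_g_ge0 S) (source_causal S) (source_N S) tT (source_int S).
pose ka j r := lam j `^ th * ML al (lam j) al (t - r).
pose k r := C1 * cpow (al * (1 - th)) (t - r).
have mk j : measurable_fun setT (ka j).
  apply: measurable_funM => //; apply: measurableT_comp; first exact: measurable_ML.
  exact: measurable_funB.
have kak j r : `|ka j r| <= k r.
  rewrite /ka normrM (ger0_norm (powR_ge0 _ _)) ger0_norm ?ML_al_ge0//.
  rewrite (le_trans (ler_wpM2l (powR_ge0 _ _) (HC1 (lam j) (t - r) (lam_gt0 j))))//.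
  rewrite mulrA mulrCA -powRDp// subrr powRr0 mulr1//.
have ik : mu.-integrable setT (EFin \o (fun r => k r * g r)).
  have := cintZl C1 i; exact: eq_integrable.
have := l2le_integral mk (source_mf S) kak (source_l2 S) ik.
move/l2le_mono => /(_ (C1 * C2 * N)) h.
apply: (l2le_eq _ (h _)) => [j|].
  by rewrite /duhamel -cvlZl; [|exact: (cint_ML_f S)].
have -> : \int[mu]_r (k r * g r) = C1 * cvl (cpow (al * (1 - th))) g t.
  by rewrite -cvlZl.
by rewrite -mulrA ler_wpM2l.
Qed.

Hypothesis Pal : P^-1 < al.

Section fixed_source_equation.
Variables (f : nat -> R -> R) (g : R -> R) (N : R) (S : source f g N).

(** Boundedness up to time T, written as domination by [cpow 1]; it provides the absolute
    convergence required by [cvlA]. *)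
Lemma cvl_ML_absf_bound : exists2 C, 0 <= C & forall j t, t <= T ->
  0 <= cvl (ML al (lam j) al) (fun r => `|f j r|) t <= C * cpow 1 t.
Proof.
have [C C0 HC] := cpow_hoelder P1 Pal T0.
have G0 := Gamma_gt0 al al0.
exists ((Gamma al)^-1 * (C * N)) => [|j t tT].
  by rewrite mulr_ge0 ?invr_ge0 ?(ltW G0)// mulr_ge0// (source_N S).
rewrite cvl_ge0//=; last by move=> x; exact: ML_al_ge0.
have [t0|t0] := leP t 0.
  rewrite cvl_eq0 => [|x]; first by rewrite mulr_ge0 ?cpow_ge0// mulr_ge0 ?invr_ge0 ?(ltW G0)// mulr_ge0// (source_N S).
  have [x0|x0] := leP x 0; first by rewrite (source_f_causal S)// normr0 mulr0.
  by rewrite ML_le0 ?mul0r// subr_le0 (le_trans t0)// ltW.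
rewrite /cpow t0 subrr powRr0 mulr1.
have [i B] := HC g N t (source_mg S) (source_g_ge0 S) (source_causal S) (source_N S) tT (source_int S).
apply: (@le_trans _ _ ((Gamma al)^-1 * cvl (cpow al) g t)).
  rewrite -cvlZl//; apply: cvl_le; [exact: (cint_ML_absf S)|exact: cintZl|move=> x].
  apply: ler_pM; rewrite ?ML_al_ge0 ?(source_f_le S)//.
  by rewrite (le_trans (ML_al_le_kk al0 al1 (lam_gt0 j) _))// cpow_kk// mulKf// lt0r_neq0.
by rewrite ler_wpM2l ?invr_ge0 ?(ltW G0).
Qed.

(* [O_1] in fractional integral form: [v = I^al (f - lam v)]. *)
Lemma duhamel_fractional j t : t <= T ->
  cint (kk al) (f j) t /\ cint (kk al) (duhamel f j) t /\
  duhamel f j t = cvl (kk al) (f j) t - lam j * cvl (kk al) (duhamel f j) t.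
Proof.
move=> tT; pose e := ML al (lam j) al; have lj := lam_gt0 j.
have ifK : cint (kk al) (f j) t.
  by apply: (cint_abs (source_mf S j) _ _ (cint_kk_absf S j t Pal)); [exact: measurable_kk|move=> x; exact: kk_ge0].
have [C C0 HC] := cvl_ML_absf_bound.
have me : measurable_fun setT e by exact: measurable_ML.
have ma := measurable_absf S j.
have ia x := cint_ML_absf S j x Pal.
have icv : cint (kk al) (cvl e (fun r => `|f j r|)) t.
  have d1 := domk_kk T al0.
  have d2 : domk T (cvl e (fun r => `|f j r|)) C 1.
    split=> [|//|x xT]; first by apply: measurable_cvl_ge0 => // x; exact: ML_al_ge0.
    by have /andP[h1 h2] := HC j x xT; rewrite ger0_norm.
  exact: (domk_cint al0 ltr01 (ltW T0) tT d1 d2).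
have KE x : cint (kk al) e x /\ cvl (kk al) e x = ML al (lam j) (al + al) x.
  by split; [exact: cint_kk_ML|exact: cvl_kk_ML].
have [iK ikv KV] := cvlA (measurable_kk al) me (source_mf S j) (fun x => kk_ge0 x al0)
  (fun x => ML_al_ge0 al0 al1 lj x) KE ia icv.
split=> //; split=> //.
(* As k_al * e = ML (2 al), all terms become convolutions with f, and their kernels agree by
   [ML_recr]. *)
rewrite -KV {1}/duhamel -/e.
rewrite -cvlZl// -cvlBl//; last exact: cintZl.
by apply: eq_cvl => x; rewrite /e (ML_recr al0 lj (t - x) al0).
Qed.

(** The function w = f - lam v of which v is the fractional integral, hence the Caputo derivative of
    v. *)
Definition residual j r := f j r - lam j * duhamel f j r.

Lemma cint_residual j t : t <= T -> cint (kk al) (residual j) t.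
Proof.
by move=> tT; have [i1 [i2 _]] := duhamel_fractional j tT; apply: cintBr => //; exact: cintZr.
Qed.

Lemma duhamel_residual j t : t <= T -> duhamel f j t = cvl (kk al) (residual j) t.
Proof.
move=> tT; have [i1 [i2 ->]] := duhamel_fractional j tT.
by rewrite /residual cvlBr// ?cvlZr//; exact: cintZr.
Qed.

Lemma measurable_residual j : measurable_fun setT (residual j).
Proof.
apply: measurable_funB; first exact: (source_mf S j).
by apply: measurable_funM => //; exact: (measurable_duhamel S).
Qed.

Lemma residual_le0 j r : r <= 0 -> residual j r = 0.
Proof. by move=> r0; rewrite /residual (source_f_causal S)// (duhamel_le0 S)// mulr0 subrr. Qed.

End fixed_source_equation.

Lemma lam_powN_le c j : 0 <= c -> lam j `^ (- c) <= lam1 `^ (- c).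
Proof.
move=> c0; rewrite !powRN lef_pV2 ?posrE ?powR_gt0//.
by rewrite ge0_ler_powR ?nnegrE ?(ltW lam10) ?(ltW (lam_gt0 j)).
Qed.

Lemma l2le_lower_weight (x : nat -> R) a b M : a <= b ->
  l2le (fun j => lam j `^ b * x j) M ->
  l2le (fun j => lam j `^ a * x j) (lam1 `^ (- (b - a)) * M).
Proof.
move=> ab; apply: l2le_dom; first exact: powR_ge0.
move=> j; have -> : lam j `^ a = lam j `^ (- (b - a)) * lam j `^ b.
  by rewrite -powRDp//; congr powR; ring.
rewrite -mulrA normrM ger0_norm ?powR_ge0// ler_wpM2r//.
by rewrite lam_powN_le// subr_ge0.
Qed.

(* Hoelder continuity of [v = I^al w] in a weak norm: there [w = f - lam v] is as
   integrable as [f], and the increments of the kernel of [I^al] are controlled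
   by [h^s] times the kernel of [I^(al-s)]. *)
Lemma duhamel_hoelder s q' : 0 < s -> s <= 1 -> P^-1 < al - s -> 0 <= q' -> q' <= 1 ->
  P^-1 < al * q' ->
  exists2 C, 0 <= C & forall f g N t1 t2, source f g N -> t1 <= t2 -> t2 <= T ->
  l2le (fun j => lam j `^ (- q') * (duhamel f j t2 - duhamel f j t1))
    (C * N * (t2 - t1) `^ s).
Proof.
move=> s0 s1 Ps q'0 q'1 Pq'.
have [C1 C10 HC1] := @duhamel_weighted (1 - q') ltac:(by rewrite subr_ge0)
  ltac:(by rewrite gerBl) ltac:(by rewrite subKr).
have [C2 C20 HC2] := cpow_hoelder P1 Ps T0.
have G0 := Gamma_gt0 al al0.
have as0 : 0 < al - s by rewrite (lt_trans _ Ps)// invr_gt0 (lt_trans _ P1).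
pose c1 := lam1 `^ (- q').
pose D := c1 * C2 + C1 * (T `^ (al - s) / (al - s)).
have D0 : 0 <= D.
  by rewrite addr_ge0 ?mulr_ge0 ?powR_ge0 ?invr_ge0 ?(ltW as0).
exists ((Gamma al)^-1 * (D + D)) => [|f g N t1 t2 S t12 t2T].
  by rewrite mulr_ge0 ?invr_ge0 ?(ltW G0)// addr_ge0.
have t1T := le_trans t12 t2T.
have N0 := source_N S.
(* Bounds the weighted residual in l2: the part f contributes c1 g, and lam^(-q') lam v = lam^(1-q')
   v is bounded by C1 N. *)
pose G r := c1 * g r + C1 * N * kk 1 r.
(* Minkowski's inequality integrates over the whole line, while the bound of v holds up to T only;
   cutting at T does not change the convolutions at t1 and t2. *)
pose w j r := lam j `^ (- q') * (if r <= T then residual f j r else 0).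
have mw j : measurable_fun setT (w j).
  apply: measurable_funM => //; apply: measurable_fun_if => //.
  - by apply: measurable_fun_ler => //.
  - by apply: measurable_funTS; exact: (measurable_residual S).
have g0 := source_g_ge0 S.
have wG r : l2le (w ^~ r) (G r).
  have G00 : 0 <= G r.
    apply: addr_ge0; first exact: mulr_ge0 (powR_ge0 _ _) (g0 r).
    exact: mulr_ge0 (mulr_ge0 C10 N0) (kk_ge0 r ltr01).
  have [rT|rT] := leP r T; last first.
    split=> // n; rewrite big1 ?sqr_ge0// => j _.
    by rewrite /w leNgt rT/= mulr0 expr0n.
  have [r0|r0] := leP r 0.
    split=> // n; rewrite big1 ?sqr_ge0// => j _.
    by rewrite /w rT (residual_le0 S)// mulr0 expr0n.
  have h1 : l2le (fun j => lam j `^ (- q') * f j r) (c1 * g r).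
    apply: (l2le_dom (powR_ge0 _ _) _ (source_l2 S r)) => j.
    by rewrite normrM ger0_norm ?powR_ge0// ler_wpM2r// lam_powN_le.
  have h2 := HC1 f g N r S rT.
  have := l2le_sub h1 h2; rewrite /G kk1// mulr1; apply: l2le_eq => j.
  rewrite /w rT /residual mulrBr mulrA; congr (_ - _ * _).
  by rewrite addrC powRDp// powRr1// ltW.
have iG a : P^-1 < a -> forall t, t <= T -> cint (cpow a) G t.
  move=> Pa t tT; have a0 : 0 < a by rewrite (lt_trans _ Pa)// invr_gt0 (lt_trans _ P1).
  apply: cintDr; apply: cintZr; first exact: (cint_cpow_g S t Pa).
  have [i1 _] := cvl_kk t a0 (@ltr01 R).
  by have := cintZl (Gamma a) i1; apply: eq_cint => x; rewrite cpow_kk.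
have BG t : t <= T -> cvl (cpow (al - s)) G t <= D * N.
  move=> tT; have [i B] := HC2 g N t (source_mg S) g0 (source_causal S) N0 tT (source_int S).
  have [i1 E1] := cvl_kk t as0 (@ltr01 R).
  have Gs0 := Gamma_gt0 (al - s) as0.
  have i2 : cint (cpow (al - s)) (kk 1) t.
    by have := cintZl (Gamma (al - s)) i1; apply: eq_cint => x; rewrite cpow_kk.
  have E2 : cvl (cpow (al - s)) (kk 1) t = Gamma (al - s) * kk (al - s + 1) t.
    by rewrite -E1 -cvlZl//; apply: eq_cvl => x; rewrite cpow_kk.
  rewrite /G cvlDr; [|exact: cintZr|exact: cintZr].
  rewrite !cvlZr// E2 /D mulrDl; apply: lerD; first by rewrite -mulrA ler_wpM2l ?powR_ge0.
  rewrite -[C1 * N * _]mulrA -[C1 * _ * N]mulrA ler_wpM2l// [leRHS]mulrC ler_wpM2l//.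
  have [t0|t0] := leP t 0.
    by rewrite kk_le0// mulr0 mulr_ge0 ?powR_ge0// invr_ge0 ltW.
  have -> : Gamma (al - s) * kk (al - s + 1) t = t `^ (al - s) / (al - s).
    rewrite kkE// addrK (GammaS as0); move: (Gamma _) (t `^ _) Gs0 => G' h G'0.
    by field; rewrite !lt0r_neq0.
  rewrite ler_wpM2r ?invr_ge0 ?(ltW as0)// ge0_ler_powR ?nnegrE ?(ltW as0) ?(ltW t0) ?(ltW T0)//.
pose h := t2 - t1.
pose ka (j : nat) r := kk al (t2 - r) - kk al (t1 - r).
pose k r := (Gamma al)^-1 * h `^ s * (cpow (al - s) (t1 - r) + cpow (al - s) (t2 - r)).
have mka j : measurable_fun setT (ka j).
  by apply: measurable_funB; apply: measurableT_comp;
    [exact: measurable_kk|exact: measurable_funB|exact: measurable_kk|exact: measurable_funB].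
have kka j r : `|ka j r| <= k r.
  have := @kk_increment R al s (t1 - r) (t2 - r) s0 s1 al0 al1.
  rewrite lerD2r t12 => /(_ isT); rewrite /ka/k /h.
  by have -> : t2 - r - (t1 - r) = t2 - t1 by ring.
have i1 := iG _ Ps t1 t1T; have i2 := iG _ Ps t2 t2T.
have i12 : mu.-integrable setT (EFin \o (fun r => (cpow (al - s) (t1 - r) * G r) + (cpow (al - s) (t2 - r) * G r))).
  exact: (integrableD measurableT i1 i2).
have ik : mu.-integrable setT (EFin \o (fun r => k r * G r)).
  have := integrableZl measurableT ((Gamma al)^-1 * h `^ s) i12.
  by apply: eq_integrable => // r _ /=; rewrite -EFinM /k -mulrA mulrDl.
have kG : \int[mu]_r (k r * G r) <= (Gamma al)^-1 * (D + D) * N * h `^ s.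
  have -> : \int[mu]_r (k r * G r) = (Gamma al)^-1 * h `^ s *
      (cvl (cpow (al - s)) G t1 + cvl (cpow (al - s)) G t2).
    rewrite [X in _ * (X + _)]cvlE [X in _ * (_ + X)]cvlE -RintegralD//.
    by rewrite -RintegralZl//; apply: eq_Rintegral => r _; rewrite /k -mulrA mulrDl.
  have -> : (Gamma al)^-1 * (D + D) * N * h `^ s = (Gamma al)^-1 * h `^ s * (D * N + D * N) by ring.
  rewrite ler_wpM2l//; last by apply: lerD; exact: BG.
  by rewrite mulr_ge0 ?powR_ge0// invr_ge0 ltW.
apply: (l2le_mono kG); apply: (l2le_eq _ (l2le_integral mka mw kka wG ik)) => j.
rewrite !(duhamel_residual S)// /ka.
have ir t : t <= T -> mu.-integrable setT (EFin \o (fun r => kk al (t - r) * w j r)) /\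
    \int[mu]_r (kk al (t - r) * w j r) = lam j `^ (- q') * cvl (kk al) (residual f j) t.
  move=> tT; have ic := cint_residual S j tT.
  have E r : kk al (t - r) * w j r = lam j `^ (- q') * (kk al (t - r) * residual f j r).
    rewrite /w; case: ifPn => [_|]; first by rewrite mulrCA.
    by rewrite -ltNge => Tr; rewrite kk_le0 ?mul0r ?mulr0// subr_le0 (le_trans tT)// ltW.
  split.
    apply: eq_integrable (integrableZl measurableT (lam j `^ (- q')) ic) => // r _ /=.
    by rewrite -EFinM E.
  by rewrite cvlE -RintegralZl//; apply: eq_Rintegral => r _; rewrite E.
have [j1 E1] := ir t1 t1T; have [j2 E2] := ir t2 t2T.
transitivity (\int[mu]_r (kk al (t2 - r) * w j r) - \int[mu]_r (kk al (t1 - r) * w j r)).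
  rewrite -(RintegralB measurableT j2 j1); apply: eq_Rintegral => r _.
  exact: mulrBl.
by rewrite E1 E2 mulrBr.
Qed.

End source_estimates.

(** * Caputo derivatives *)

Section signed_translation.
Context {R : realType}.
Local Notation mu := (@lebesgue_measure R).

Lemma integral_shift (a : R) (f : R -> \bar R) : measurable_fun setT f ->
  (\int[mu]_x f (x + a)%R = \int[mu]_x f x)%E.
Proof.
move=> mf; rewrite integralE [RHS]integralE; congr (_ - _)%E.
  transitivity (\int[mu]_x (f^\+)%E (x + a)%R)%E; first by apply: eq_integral => x _; rewrite !funeposE.
  exact: (@ge0_integral_shift _ a (f^\+)%E (measurable_funepos mf) (fun x => funepos_ge0 f x)).
transitivity (\int[mu]_x (f^\-)%E (x + a)%R)%E; first by apply: eq_integral => x _; rewrite !funenegE.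
exact: (@ge0_integral_shift _ a (f^\-)%E (measurable_funeneg mf) (fun x => funeneg_ge0 f x)).
Qed.

Lemma Rintegral_shift (a : R) (f : R -> R) : measurable_fun setT f ->
  \int[mu]_x f (x + a) = \int[mu]_x f x.
Proof.
move=> mf; have mE : measurable_fun setT (EFin \o f) by exact/measurable_EFinP.
by rewrite /Rintegral -(integral_shift a mE).
Qed.

Lemma cvl_shift (f g : R -> R) a t : measurable_fun setT f -> measurable_fun setT g ->
  cvl f (fun x => g (x - a)) t = cvl f g (t - a).
Proof.
move=> mf mg.
have mm : measurable_fun setT (fun x : R => f (t - x) * g (x - a)).
  by apply: measurable_funM; apply: measurableT_comp => //; exact: measurable_funB.
rewrite cvlE -(Rintegral_shift a mm).
by apply: eq_Rintegral => x _; rewrite addrK opprD addrA addrAC.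
Qed.

Lemma cint_shift (f g : R -> R) a t : measurable_fun setT f -> measurable_fun setT g ->
  cint f g (t - a) -> cint f (fun x => g (x - a)) t.
Proof.
move=> mf mg /integrableP[_ i].
have mm : measurable_fun setT (fun x : R => f (t - x) * g (x - a)).
  by apply: measurable_funM; apply: measurableT_comp => //; exact: measurable_funB.
apply/integrableP; split; first exact/measurable_EFinP.
have mE : measurable_fun setT (fun x : R => `|(f (t - x) * g (x - a))%:E|%E).
  by apply: measurableT_comp => //; exact/measurable_EFinP.
rewrite -(integral_shift a mE); apply: le_lt_trans i.
rewrite le_eqVlt; apply/orP; left; apply/eqP; apply: eq_integral => x _ /=.
by rewrite addrK opprD addrA addrAC.
Qed.

End signed_translation.

Section integral_without_measurability.
Context d (T : measurableType d) {R : realType} (mu : {measure set T -> \bar R}).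
Local Open Scope ereal_scope.

Lemma ge0_le_integral_nomeas (f g : T -> \bar R) : (forall x, 0 <= f x) ->
  (forall x, f x <= g x) -> \int[mu]_x f x <= \int[mu]_x g x.
Proof.
move=> f0 fg; have g0 x : 0 <= g x by exact: le_trans (fg x).
rewrite (ge0_integralTE _ f0) (ge0_integralTE _ g0).
apply: ge_ereal_sup => _ [h /= hf <-]; apply: ereal_sup_ubound; exists h => //= x.
exact: le_trans (fg x).
Qed.

End integral_without_measurability.

(** * Steklov averages and their convergence in L^1 *)

Section steklov_average.
Context {R : realType}.
Local Notation mu := (@lebesgue_measure R).
Implicit Types (h t : R) (f : R -> R).

(** The indicator of ]0, h], as a difference of Heaviside functions: averaging then is a difference
    quotient of the primitive. *)
Definition box h (y : R) := kk 1 y - kk 1 (y - h).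

Lemma boxE h y : 0 <= h -> box h y = if (0 < y) && (y <= h) then 1 else 0.
Proof.
move=> h0; rewrite /box !kk1E subr_gt0; have [y0|y0] := ltP 0 y => /=.
  by have [yh|hy] := leP y h; rewrite ?subr0 ?subrr.
by rewrite ltNge (le_trans y0 h0)/= subrr.
Qed.

Lemma box_ge0 h y : 0 <= h -> 0 <= box h y.
Proof. by move=> h0; rewrite boxE//; case: ifP. Qed.

Lemma measurable_box h : measurable_fun setT (box h).
Proof.
apply: measurable_funB; first exact: measurable_kk.
by apply: measurableT_comp; [exact: measurable_kk|exact: measurable_funB].
Qed.

Lemma integral_box h t : 0 <= h ->
  mu.-integrable setT (EFin \o (fun x : R => box h (t - x))) /\
  \int[mu]_x box h (t - x) = h.
Proof.
move=> h0.
have E : (fun x : R => box h (t - x)) = \1_(`[t - h, t[%classic).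
  apply/funext => x; rewrite boxE// indicE mem_setE in_itv/= subr_gt0 lerBlDr.
  by rewrite [h + _]addrC -lerBlDr andbC; case: ifP.
rewrite E; split; first exact: integrable_indic_itv.
rewrite /Rintegral integral_indic//= setIT.
have -> := @lebesgue_measure_itv R `[t - h, t[; rewrite /= lte_fin.
case: ltP => [_|]; first by rewrite -EFinB/=; ring.
move=> th; apply/eqP; rewrite eq_le h0/=; lra.
Qed.

(** Backward average over [t - h, t[, so that causal functions stay causal and values beyond T are
    never read. *)
Definition avg h f t := h^-1 * cvl (box h) f t.

Lemma avg_near h f t c eps : 0 < h -> measurable_fun setT f ->
  (forall x, t - h <= x -> x < t -> `|f x - c| <= eps) -> 0 <= eps ->
  cint (box h) f t /\ `|avg h f t - c| <= eps.
Proof.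
move=> h0 mf fc eps0; have [ib Eb] := integral_box t (ltW h0).
have i1 : cint (box h) f t.
  apply: le_integrable (integrableZl measurableT (`|c| + eps) ib) => //.
    by apply/measurable_EFinP; apply: measurable_conv_ker => //; exact: measurable_box.
  move=> x _ /=; rewrite lee_fin normrM [leRHS]normrM.
  rewrite [`|box h _|]ger0_norm ?box_ge0 ?(ltW h0)// [leRHS]mulrC.
  rewrite boxE ?(ltW h0)//; case: ifPn => [/andP[tx xt]|_]; last by rewrite !mul0r.
  rewrite !mul1r [leRHS]ger0_norm ?addr_ge0//.
  have := fc x; rewrite -subr_gt0 lerBlDr tx addrC -lerBlDr xt => /(_ isT isT) h1.
  by rewrite -[f x](subrK c) (le_trans (ler_normD _ _))// addrC lerD2l.
split => //.
have i2 : mu.-integrable setT (EFin \o (fun x : R => c * box h (t - x))).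
  exact: (integrableZl measurableT c ib).
have -> : avg h f t - c = h^-1 * \int[mu]_x (box h (t - x) * (f x - c)).
  have cE : h^-1 * \int[mu]_x (c * box h (t - x)) = c.
    by rewrite RintegralZl// Eb mulrC mulfK// lt0r_neq0.
  rewrite -[X in _ - X]cE /avg cvlE -mulrBr -RintegralB//; congr (_ * _).
  by apply: eq_Rintegral => x _; rewrite /= [box h _ * (_ - c)]mulrBr (mulrC c).
rewrite normrM ger0_norm ?invr_ge0 ?(ltW h0)// mulrC ler_pdivrMr//.
have i3 : mu.-integrable setT (EFin \o (fun x : R => box h (t - x) * (f x - c))).
  have := integrableB measurableT i1 i2; apply: eq_integrable => // x _ /=.
  by rewrite -EFinD [box h _ * (_ - c)]mulrBr (mulrC c).
apply: (le_trans (le_normr_Rintegral measurableT i3)).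
rewrite -[X in _ <= _ * X]Eb -RintegralZl//; apply: le_Rintegral => //.
- exact: (integrable_norm i3).
- exact: (integrableZl measurableT eps ib).
- move=> x _; rewrite normrM ger0_norm ?box_ge0 ?(ltW h0)//.
  rewrite boxE ?(ltW h0)//; case: ifPn => [/andP[tx xt]|_]; last by rewrite mul0r mulr0.
  rewrite mul1r mulr1; apply: fc; last by rewrite -subr_gt0.
  by rewrite lerBlDr addrC -lerBlDr.
Qed.

(** Only x is confined to the interval: near the left end a backward average reads values outside
    it. *)
Lemma uniform_continuity_itv (g : R -> R) (a b eps : R) : continuous g -> 0 < eps ->
  exists2 d, 0 < d & forall x y, a <= x -> x <= b -> `|x - y| < d -> `|g y - g x| <= eps.
Proof.
move=> cg eps0.
have /compact_near_coveringP H := @segment_compact R a b.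
pose Pd (d x : R) := forall y, `|x - y| < d -> `|g y - g x| <= eps.
have := H R (0 : R)^'+ Pd _.
have hx x : `[a, b]%classic x -> \forall x' \near x & d \near (0 : R)^'+, Pd d x'.
  move=> _; have /cvgrPdist_le /(_ (eps / 2)) := cg x.
  rewrite divr_gt0// => /(_ isT) /nbhs_ballP[r /= r0 Hr].
  exists (ball x (r / 2), [set d | 0 < d < r / 2]).
    split; first by apply: nbhsx_ballx; rewrite divr_gt0.
    near=> d; apply/andP; split => //; near: d; apply: nbhs_right_lt; exact: divr_gt0.
  move=> [x' d] /= [xx' /andP[d0 dr]] y x'y.
  have h1 := Hr x'; have h2 := Hr y.
  rewrite /ball/= in xx' h1 h2.
  have {}h1 : `|g x - g x'| <= eps / 2 by apply: h1; lra.
  have {}h2 : `|g x - g y| <= eps / 2.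
    by apply: h2; rewrite (le_lt_trans (ler_distD x' _ _))//; lra.
  rewrite (le_trans (ler_distD (g x) _ _))// distrC; lra.
move=> /(_ _ hx) [] //.
move=> d /= d0 Hd.
exists (d / 2); first exact: divr_gt0.
move=> x y ax xb xy; have := Hd (d / 2); apply => //=.
- by rewrite sub0r normrN gtr0_norm ?divr_gt0// ltr_pdivrMr// ltr_pMr// ltr1n.
- exact: divr_gt0.
- by rewrite in_itv/= ax xb.
Unshelve. all: end_near. Qed.

Lemma abs_avg_le h f t : 0 < h -> measurable_fun setT f ->
  (`|avg h f t|%:E <= h^-1%:E * econv (EFin \o box h) (EFin \o (fun x : R => `|f x|)%R) t)%E.
Proof.
move=> h0 mf; rewrite /avg normrM ger0_norm ?invr_ge0 ?(ltW h0)// EFinM.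
apply: lee_pmul; rewrite ?lee_fin ?invr_ge0 ?(ltW h0)//.
have mm : measurable_fun setT (EFin \o (fun x : R => box h (t - x) * f x)).
  by apply/measurable_EFinP; apply: measurable_conv_ker => //; exact: measurable_box.
have h1 : (`|cvl (box h) f t|%:E <= `|\int[mu]_x (EFin \o (fun x : R => box h (t - x) * f x)%R) x|)%E.
  by rewrite cvlE /Rintegral; case: (integral _ _ _) => //= *; rewrite ?normr0 ?leey.
apply: (le_trans h1); apply: (le_trans (le_abse_integral mu measurableT mm)).
rewrite le_eqVlt; apply/orP; left; apply/eqP; apply: eq_integral => x _ /=.
by rewrite normrM ger0_norm ?box_ge0 ?(ltW h0)// EFinM.
Qed.

Lemma integral_box0 h : 0 <= h -> (\int[mu]_x (box h x)%:E = h%:E)%E.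
Proof.
move=> h0; have [i E] := integral_box 0 h0.
rewrite -[in RHS]E /Rintegral fineK; last exact: (integrable_fin_num _ i).
rewrite -[LHS]ge0_integral_opp; last 2 first.
- by apply/measurable_EFinP; exact: measurable_box.
- by move=> x; rewrite lee_fin box_ge0.
by apply: eq_integral => x _; rewrite sub0r.
Qed.

(** Tonelli's theorem: the kernel [box h] has integral h, which the factor 1/h cancels. *)
Lemma avg_contraction h f : 0 < h -> measurable_fun setT f ->
  (\int[mu]_t `|avg h f t|%:E <= \int[mu]_t `|f t|%:E)%E.
Proof.
move=> h0 mf.
have mb : measurable_fun setT (EFin \o box h) by apply/measurable_EFinP; exact: measurable_box.
have ma : measurable_fun setT (EFin \o (fun x : R => `|f x|)%R).
  by apply/measurable_EFinP; exact: measurableT_comp.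
have b0 x : (0 <= (EFin \o box h) x)%E by rewrite lee_fin box_ge0// ltW.
have a0 x : (0 <= (EFin \o (fun x : R => `|f x|)%R) x)%E by rewrite lee_fin.
apply: (@le_trans _ _ (\int[mu]_t (h^-1%:E *
    econv (EFin \o box h) (EFin \o (fun x : R => `|f x|)%R) t))%E).
  by apply: ge0_le_integral_nomeas => t; [rewrite lee_fin|exact: abs_avg_le].
rewrite ge0_integralZl//; last 3 first.
- exact: measurable_econv.
- by move=> t _; exact: econv_ge0.
- by rewrite lee_fin invr_ge0 ltW.
rewrite integral_econv// [X in (_ * (X * _))%E]integral_box0 ?(ltW h0)//.
by rewrite muleA -EFinM mulVf ?lt0r_neq0// mul1e.
Qed.

Lemma cint_box h f t : 0 <= h -> measurable_fun setT f -> mu.-integrable setT (EFin \o f) ->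
  cint (box h) f t.
Proof.
move=> h0 mf intf; apply: le_integrable intf => //.
  by apply/measurable_EFinP; apply: measurable_conv_ker => //; exact: measurable_box.
move=> x _ /=; rewrite lee_fin normrM ler_piMl// ger0_norm ?box_ge0// boxE//.
by case: ifP.
Qed.

Lemma measurable_avg h f : 0 <= h -> measurable_fun setT f ->
  mu.-integrable setT (EFin \o f) -> measurable_fun setT (avg h f).
Proof.
move=> h0 mf intf; apply: measurable_funM => //; apply: measurable_cvl => //.
- exact: measurable_box.
- by move=> x; exact: box_ge0.
- move=> x; apply: cint_box => //; first exact: measurableT_comp.
  exact: (integrable_norm intf).
Qed.

Lemma integral_le_setT (A : set R) (f : R -> \bar R) : measurable A ->
  (forall x, 0 <= f x)%E -> measurable_fun setT f -> (\int[mu]_(x in A) f x <= \int[mu]_x f x)%E.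
Proof. by move=> mA f0 mf; apply: ge0_subset_integral. Qed.

Lemma avg_cvg_L1 T f eps : 0 < T -> measurable_fun setT f ->
  mu.-integrable setT (EFin \o f) -> 0 < eps ->
  exists2 d, 0 < d & forall h, 0 < h -> h < d ->
    (\int[mu]_(t in `]0%R, T[) `|avg h f t - f t|%:E <= eps%:E)%E.
Proof.
move=> T0 mf intf eps0.
(* For h < 1 the averages at times of ]0, T[ read f on [-1, T] only. *)
pose E : set R := `[-1, T]%classic.
have mE : measurable E by exact: measurable_itv.
have fE : (mu E < +oo)%E.
  have -> := @lebesgue_measure_itv R `[-1, T]; rewrite /=.
  by case: ifP => _; rewrite ?ltry// -EFinB ltry.
have intE : mu.-integrable E (EFin \o f) by apply: integrableS intf.
have [g_ [cg ig cvg]] := approximation_continuous_integrable mE fE intE.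
have e3 : 0 < eps / 3 by rewrite divr_gt0.
have [n gn] : exists n, (\int[mu]_(z in E) `|(f z - g_ n z)%:E| <= (eps / 3)%:E)%E.
  have /fine_cvgP[fn] := cvg; move/cvgrPdist_le => /(_ _ e3) [N _ HN].
  have [M _ HM] := fn; exists (maxn N M).
  have := HN _ (leq_maxl N M); have := HM _ (leq_maxr N M) => /= h1.
  by rewrite sub0r normrN ger0_norm ?fine_ge0 ?integral_ge0// -lee_fin fineK.
set g := g_ n in gn; have {cg}cg : continuous g by exact: cg.
have mg : measurable_fun setT g by exact: continuous_measurable_fun.
(* Density argument: the average of the continuous g is uniformly close to g, and the L^1-small
   error k is handled by contraction. *)
pose k : R -> R := (fun x : R => f x - g x) \_ E.
have mfg : measurable_fun setT (fun x : R => f x - g x) by exact: measurable_funB.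
have mk : measurable_fun setT k.
  by apply/(measurable_restrictT _ mE); apply: measurable_funTS.
have intk : mu.-integrable setT (EFin \o k).
  have : mu.-integrable E (EFin \o (fun x => f x - g x)).
    by apply: eq_integrable (@integrableB _ _ R mu _ mE _ _ intE (ig n)).
  by move/(proj1 (@integrable_mkcond _ _ R mu E _ mE)); apply: eq_integrable => // x _; rewrite /= restrict_EFin.
have kn : (\int[mu]_x `|k x|%:E <= (eps / 3)%:E)%E.
  apply: le_trans gn; rewrite [leRHS]integral_mkcond le_eqVlt; apply/orP; left; apply/eqP.
  by apply: eq_integral => x _; rewrite /k !patchE; case: ifP => //= _; rewrite normr0.
have e3T : 0 < eps / 3 / T by rewrite divr_gt0.
have [d d0 Hd] := @uniform_continuity_itv g 0 T (eps / 3 / T) cg e3T.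
exists (Num.min d 1); first by rewrite lt_min d0/=.
move=> h h0; rewrite lt_min => /andP[hd h1].
have key t : t \in `]0, T[ ->
    `|avg h f t - f t| <= `|avg h k t| + (eps / 3 / T + `|k t|).
  rewrite in_itv/= => /andP[t0 tT].
  have [ig1 gnear] : cint (box h) g t /\ `|avg h g t - g t| <= eps / 3 / T.
    apply: avg_near => //; last exact: ltW.
    move=> x hx xt; apply: Hd; rewrite ?(ltW t0) ?(ltW tT)//.
    by rewrite ger0_norm ?subr_ge0 ?(ltW xt)//; lra.
  have tE : t \in E by rewrite mem_setE/= in_itv/=; lra.
  have ik : cint (box h) k t by apply: cint_box => //; exact: ltW.
  have -> : avg h f t = avg h k t + avg h g t.
    rewrite /avg -mulrDr -cvlDr//; congr (_ * _); apply: eq_cvl => x.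
    rewrite boxE ?(ltW h0)//; case: ifPn => [/andP[tx xt]|_]; last by rewrite !mul0r.
    rewrite /k patchE ifT ?subrK// mem_setE/= in_itv/=; lra.
  have kt : k t = f t - g t by rewrite /k patchE tE.
  rewrite -addrA (le_trans (ler_normD _ _))// lerD2l kt.
  have -> : avg h g t - f t = (avg h g t - g t) + (g t - f t) by ring.
  by rewrite (le_trans (ler_normD _ _))// [`|g t - _|]distrC lerD2r.
have mT : measurable `]0, T[%classic by exact: measurable_itv.
have mak : measurable_fun setT (avg h k) by apply: measurable_avg => //; exact: ltW.
have maf : measurable_fun setT (avg h f) by apply: measurable_avg => //; exact: ltW.
apply: (@le_trans _ _ (\int[mu]_(t in `]0%R, T[)
    (`|avg h k t|%:E + ((eps / 3 / T)%:E + `|k t|%:E)))%E).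
  apply: ge0_le_integral => //.
  - apply: measurable_funTS; apply/measurable_EFinP; apply: measurableT_comp => //.
    exact: measurable_funB.
  - apply: measurable_funTS; apply: emeasurable_funD.
      by apply/measurable_EFinP; exact: measurableT_comp.
    apply: emeasurable_funD => //.
    by apply/measurable_EFinP; exact: measurableT_comp.
have mk1 : measurable_fun setT (fun x : R => `|k x|%:E).
  by apply/measurable_EFinP; exact: measurableT_comp.
have mak1 : measurable_fun setT (fun x : R => `|avg h k x|%:E).
  by apply/measurable_EFinP; exact: measurableT_comp.
rewrite ge0_integralD//; last 3 first.
- exact: measurable_funTS.
- by move=> x _; rewrite adde_ge0 ?lee_fin// ltW.
- by apply: measurable_funTS; exact: emeasurable_funD.
rewrite ge0_integralD//; last 2 first.
- by move=> x _; rewrite lee_fin ltW.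
- exact: measurable_funTS.
have -> : eps%:E = ((eps / 3)%:E + ((eps / 3)%:E + (eps / 3)%:E))%E.
  by rewrite -!EFinD; congr EFin; field.
apply: leeD; last apply: leeD.
- apply: le_trans kn; apply: le_trans (avg_contraction h0 mk).
  exact: integral_le_setT.
- rewrite integral_cst// [X in (_ * X)%E](_ : _ = T%:E) ?lee_fin.
    by rewrite mulfVK// lt0r_neq0.
  by have := @lebesgue_measure_itv R `]0, T[; rewrite /= lte_fin T0 sube0.
- by apply: le_trans kn; exact: integral_le_setT.
Qed.

End steklov_average.

Opaque econv.

Section causal_integrals.
Context {R : realType}.
Local Notation mu := (@lebesgue_measure R).

Lemma causal_integral (f : R -> R) t : measurable_fun setT f -> (forall r, r <= 0 -> f r = 0) ->
  \int[mu]_(x in `[0, t]) f x = cvl (kk 1) f t.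
Proof.
move=> mf f0; rewrite /Rintegral -integral_itv_bndo_bndc; last first.
  by apply: measurable_funTS; exact/measurable_EFinP.
rewrite -/(Rintegral mu `[0, t[%classic f) Rintegral_mkcond; apply: eq_Rintegral => x _.
rewrite patchE mem_setE in_itv/= kk1E subr_gt0.
have [x0|x0] := leP x 0; first by rewrite (f0 _ x0) mulr0; case: ifP.
by rewrite (ltW x0)/=; case: ifP; rewrite ?mul1r ?mul0r.
Qed.

Lemma causal_frac_int a (f : R -> R) t : 0 < a -> a < 1 -> (forall r, r <= 0 -> f r = 0) ->
  cint (kk a) f t -> frac_int a f t = cvl (kk a) f t.
Proof.
move=> a0 a1 f0 i.
have ga : Gamma a != 0 by rewrite lt0r_neq0// Gamma_gt0.
transitivity ((Gamma a)^-1 * cvl (fun x => Gamma a * kk a x) f t); last first.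
  by rewrite cvlZl// mulKf.
congr (_ * _); rewrite Rintegral_mkcond; apply: eq_Rintegral => x _.
rewrite patchE mem_setE in_itv/=.
have [x0|x0] := leP x 0; first by rewrite (f0 _ x0) !mulr0; case: ifP.
rewrite (ltW x0)/=; have [xt|tx] := leP x t; last first.
  by rewrite kk_le0 ?mulr0 ?mul0r// subr_le0 ltW.
have [xt'|xt'] := ltP x t; first by rewrite kkE ?subr_gt0// mulrCA mulfV// mulr1.
have -> : x = t by apply/eqP; rewrite eq_le xt.
(* At the singular endpoint both conventions give 0, because a - 1 is not 0. *)
by rewrite subrr kk_le0// mulr0 powR0// subr_eq0 lt_eqF.
Qed.

End causal_integrals.

Section difference_quotients.
Context {R : realType}.
Local Notation mu := (@lebesgue_measure R).
Implicit Types (f : R -> R) (a h t : R).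

Definition quot h f t := h^-1 * (f t - f (t - h)).

Lemma measurable_quot h f : measurable_fun setT f -> measurable_fun setT (quot h f).
Proof.
move=> mf; have m1 : measurable_fun setT (fun t : R => f (t - h)).
  by apply: measurableT_comp => //; exact: measurable_funB.
have m2 : measurable_fun setT (fun t : R => f t - f (t - h)) by exact: measurable_funB.
exact: measurable_funM.
Qed.

Lemma cint_kk1_bounded f t N : measurable_fun setT f -> (forall x, x <= 0 -> f x = 0) ->
  (forall x, x <= t -> `|f x| <= N) -> cint (kk 1) f t.
Proof.
move=> mf f0 fN; have [i _] := cvl_kk t (@ltr01 R) (@ltr01 R).
apply: (cint_le (measurable_kk 1) mf (c := N) _ i) => x.
rewrite !kk1E; case: ltP => xt; last by rewrite !mul0r normr0 mulr0.
case: ltP => x0; last by rewrite f0// mulr0 normr0 mulr0.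
by rewrite !mul1r mulr1; apply: fN; rewrite ltW// -subr_gt0.
Qed.

Lemma cvl_quot a t h f : measurable_fun setT f ->
  cint (kk a) f t -> cint (kk a) f (t - h) ->
  cint (kk a) (quot h f) t /\
  cvl (kk a) (quot h f) t = quot h (cvl (kk a) f) t.
Proof.
move=> mf i1 i2.
have i3 := cint_shift (measurable_kk a) mf i2.
have i4 := cintBr i1 i3.
split; first exact: (cintZr _ i4).
by rewrite /quot (cvlZr _ i4) (cvlBr i1 i3) (cvl_shift _ _ (measurable_kk a) mf).
Qed.

Lemma avg_quot h f t : cint (kk 1) f t -> cint (kk 1) f (t - h) ->
  avg h f t = quot h (cvl (kk 1) f) t.
Proof.
move=> i1 i2; rewrite /avg /quot; congr (_ * _).
have i2' : cint (fun y => kk 1 (y - h)) f t.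
  by apply: eq_integrable i2 => // x _ /=; rewrite addrAC.
rewrite (cvlBl i1 i2').
apply: (congr1 (fun z => cvl (kk 1) f t - z)).
apply: eq_Rintegral => x _.
by rewrite addrAC.
Qed.

Lemma cint_kk1 f t : measurable_fun setT f -> mu.-integrable setT (EFin \o f) ->
  cint (kk 1) f t.
Proof.
move=> mf intf; apply: le_integrable intf => //.
  by apply/measurable_EFinP; apply: measurable_conv_ker => //; exact: measurable_kk.
by move=> x _ /=; rewrite lee_fin normrM ler_piMl// kk1E; case: ifP;
  rewrite ?normr1 ?normr0.
Qed.

(** Applying the kernel of I^(1-a) to I^a w gives the primitive of w. Associativity of extended
    convolutions for |w| first yields the integrability under which the signed identity holds. *)
Lemma cvl_kk_kk1 a (w : R -> R) t : 0 < a -> a < 1 -> measurable_fun setT w ->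
  mu.-integrable setT (EFin \o w) -> (forall x, cint (kk a) (fun r => `|w r|) x) ->
  cint (kk (1 - a)) (cvl (kk a) w) t /\
  cvl (kk (1 - a)) (cvl (kk a) w) t = cvl (kk 1) w t.
Proof.
move=> a0 a1 mw intw iaw.
have a1' : 0 < 1 - a by rewrite subr_gt0.
have maw : measurable_fun setT (fun r => `|w r|) by exact: measurableT_comp.
have k0 b (b0 : 0 < b) (x : R) : 0 <= kk b x by exact: kk_ge0.
have mf f : measurable_fun setT f -> measurable_fun setT (EFin \o f : R -> \bar R).
  by move=> ?; exact/measurable_EFinP.
have e0 (f : R -> R) : (forall x, 0 <= f x) -> forall x, (0 <= (EFin \o f) x)%E.
  by move=> f0 x; rewrite lee_fin.
have kA x : cint (kk (1 - a)) (kk a) x /\ cvl (kk (1 - a)) (kk a) x = kk 1 x.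
  by have := cvl_kk x a1' a0; rewrite (subrK a 1).
have h : cint (kk (1 - a)) (cvl (kk a) (fun r => `|w r|)) t.
  have mcv : measurable_fun setT (cvl (kk a) (fun r => `|w r|)).
    by apply: measurable_cvl_ge0 => //; [exact: measurable_kk|exact: k0].
  have cv0 x : 0 <= cvl (kk a) (fun r => `|w r|) x by apply: cvl_ge0 => // y; exact: k0.
  have aw : cint (kk 1) (fun r => `|w r|) t by apply: cint_kk1 => //; exact: (integrable_norm intw).
  have E0 := econvA t (mf _ (measurable_kk (1 - a))) (mf _ (measurable_kk a)) (mf _ maw)
    (e0 _ (k0 _ a1')) (e0 _ (k0 _ a0)) (e0 _ (fun x => normr_ge0 (w x))).
  have E1 : econv (EFin \o kk (1 - a)) (EFin \o kk a) = EFin \o kk 1.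
    apply/funext => x.
    have Ex := econv_kk x a1' a0.
    by rewrite (subrK a 1) in Ex.
  have E2 : econv (EFin \o kk a) (EFin \o (fun r => `|w r|)) =
      EFin \o cvl (kk a) (fun r => `|w r|).
    apply/funext => x.
    exact: (econv_cint (k0 _ a0) (fun=> normr_ge0 _) (iaw x)).
  have E3 := econv_cint (k0 _ ltr01) (fun=> normr_ge0 _) aw.
  have E4 := congr1 (fun z => econv (EFin \o kk (1 - a)) z t) E2.
  have E5 := congr1 (fun z => econv z (EFin \o (fun r => `|w r|)) t) E1.
  have [] := econv_cvl (measurable_kk (1 - a)) mcv (k0 _ a1') cv0
    (etrans (esym E4) (etrans E0 (etrans E5 E3))); done.
have [_ h1 h2] := cvlA (measurable_kk (1 - a)) (measurable_kk a) mw (k0 _ a1') (k0 _ a0) kA iaw h.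
by split => //; rewrite h2.
Qed.

End difference_quotients.

Section caputo_derivative.
Context {R : realType}.
Local Notation mu := (@lebesgue_measure R).
Variables (T al : R).
Hypotheses (T0 : 0 < T) (al0 : 0 < al) (al1 : al < 1).
Variables (w V : R -> R).
Hypothesis mw : measurable_fun setT w.
Hypothesis w0 : forall r, r <= 0 -> w r = 0.
Hypothesis iw : mu.-integrable setT (EFin \o w).
Hypothesis iaw : forall x, cint (kk al) (fun r => `|w r|) x.
Hypothesis VE : cvl (kk al) w = V.
Variable M : R.
Hypothesis VM : forall x, x <= T -> `|V x| <= M.
Hypothesis Vuc : forall eps, 0 < eps -> exists2 d, 0 < d &
  forall x y, x <= y -> y <= T -> y - x < d -> `|V x - V y| <= eps.

Let mV : measurable_fun setT V.
Proof.
rewrite -VE; apply: measurable_cvl => //; first exact: measurable_kk.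
by move=> x; exact: kk_ge0.
Qed.

Let V0 x : x <= 0 -> V x = 0.
Proof.
move=> x0; rewrite -VE; apply: cvl_eq0 => r; have [r0|r0] := leP r 0; first by rewrite w0// mulr0.
by rewrite kk_le0 ?mul0r// subr_le0 (le_trans x0)// ltW.
Qed.

Let cint_kk1_V t : t <= T -> cint (kk 1) V t.
Proof.
by move=> tT; apply: (@cint_kk1_bounded _ _ _ M) => // x xt; apply: VM; exact: le_trans tT.
Qed.

Let quot0 h r : 0 < h -> r <= 0 -> quot h V r = 0.
Proof.
move=> h0 r0; rewrite /quot !V0 ?subrr ?mulr0//.
by rewrite subr_le0 (le_trans r0)// ltW.
Qed.

Let VE_kk1 t : cint (kk (1 - al)) V t /\ cvl (kk (1 - al)) V t = cvl (kk 1) w t.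
Proof. by move: (cvl_kk_kk1 t al0 al1 mw iw iaw); rewrite -VE. Qed.

(** The approximants are v0 plus Steklov averages of V = I^al w. Their derivatives are difference
    quotients of V, and I^(1-al) maps these to difference quotients of the primitive of w, that is,
    to averages of w, which converge to w in L^1. *)
Lemma caputo_cvl_truncated v0 v : (forall t, t \in `[0, T] -> v t = v0 + V t) ->
  caputo T al v w.
Proof.
move=> vE; split; first exact: integrableS iw.
pose h n : R := n.+1%:R^-1; have h0 n : 0 < h n by rewrite invr_gt0.
exists (fun n t => v0 + \int[mu]_(r in `[0, t]) quot (h n) V r), (fun n => quot (h n) V).
have intE n t : t <= T -> \int[mu]_(r in `[0, t]) quot (h n) V r = avg (h n) V t.
  move=> tT; have hn := h0 n.
  have i1 := cint_kk1_V tT; have i2 : cint (kk 1) V (t - h n).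
    by apply: cint_kk1_V; rewrite lerBlDr (le_trans tT)// lerDl ltW.
  rewrite (causal_integral t (measurable_quot (h n) mV) (fun r => @quot0 _ r hn)).
  by rewrite (avg_quot i1 i2); have [_ ->] := cvl_quot mV i1 i2.
split.
- move=> n; split.
    apply: measurable_bounded_integrable => //.
    + have := @lebesgue_measure_itv R `]0, T[; rewrite /= lte_fin T0 sube0 => ->.
      by rewrite ltry.
    + exact: measurable_funTS (measurable_quot (h n) mV).
    + exists ((h n)^-1 * (M + M)); split; first exact: num_real.
      move=> K MK x; rewrite /= in_itv/= => /andP[x0 xT]; apply: le_trans (ltW MK).
      rewrite /quot normrM ger0_norm ?invr_ge0 ?(ltW (h0 n))//.
      rewrite ler_wpM2l ?invr_ge0 ?(ltW (h0 n))//.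
      rewrite (le_trans (ler_normB _ _))// lerD// VM//; first exact: ltW.
      by rewrite lerBlDr (le_trans (ltW xT))// lerDl ltW.
  move=> t; rewrite in_itv/= => /andP[t0 tT]; congr (_ + _).
  by rewrite set_itv1 Rintegral_set1 addr0.
- move=> eps eps0.
  have e2 : 0 < eps / 2 by rewrite divr_gt0.
  have [d d0 Hd] := Vuc e2.
  have /cvgrPdist_lt /(_ d d0) : h n @[n --> \oo] --> (0 : R) by exact: cvg_harmonic.
  apply: filterS => n; rewrite sub0r normrN gtr0_norm// => hd t.
  rewrite in_itv/= => /andP[t0 tT]; rewrite intE// vE; last by rewrite in_itv/= t0.
  rewrite opprD addrACA subrr add0r.
  have [_ hh] : cint (box (h n)) V t /\ `|avg (h n) V t - V t| <= eps / 2.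
    apply: avg_near => //; last exact: ltW.
    by move=> x hx xt; apply: Hd => //; [exact: ltW|lra].
  by apply: le_lt_trans hh _; lra.
- have fracE n t : t <= T -> frac_int (1 - al) (quot (h n) V) t = avg (h n) w t.
    move=> tT; have al1' : 0 < 1 - al by rewrite subr_gt0.
    have [i1 E1] := VE_kk1 t.
    have [i2 E2] := VE_kk1 (t - h n).
    have [i3 E3] := cvl_quot mV i1 i2.
    have iw' s : cint (kk 1) w s by exact: cint_kk1.
    rewrite (causal_frac_int al1' _ (fun r => @quot0 _ r (h0 n)) i3); last first.
      by rewrite ltrBlDr ltrDl.
    by rewrite E3 (avg_quot (iw' _) (iw' _)); congr (_ * _); exact: (congr2 (fun x y => x - y) E1 E2).
  apply/fine_cvgP.
  have small eps : 0 < eps -> \forall n \near \oo,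
     (\int[mu]_(t in `]0%R, T[) `|frac_int (1 - al) (quot (h n) V) t - w t|%:E <= eps%:E)%E.
    move=> eps0; have [d d0 Hd] := avg_cvg_L1 T0 mw iw eps0.
    have /cvgrPdist_lt /(_ d d0) : h n @[n --> \oo] --> (0 : R) by exact: cvg_harmonic.
    apply: filterS => n; rewrite sub0r normrN gtr0_norm// => hd.
    apply: le_trans (Hd _ (h0 n) hd).
    rewrite le_eqVlt; apply/orP; left; apply/eqP; apply: eq_integral => t.
    by rewrite inE/= in_itv/= => /andP[_ tT]; rewrite fracE// ltW.
  split.
    apply: filterS (small 1 ltr01) => n h1; rewrite ge0_fin_numE ?integral_ge0//.
    by rewrite (le_lt_trans h1) ?ltry.
  apply/cvgrPdist_le => eps eps0; apply: filterS (small _ eps0) => n /= h1.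
  rewrite sub0r normrN ger0_norm ?fine_ge0 ?integral_ge0// -lee_fin fineK//.
  by rewrite ge0_fin_numE ?integral_ge0// (le_lt_trans h1) ?ltry.
Qed.

End caputo_derivative.

Lemma kk_nonincr (R : realType) (a x y : R) : 0 < a -> a <= 1 -> 0 < x -> x <= y ->
  kk a y <= kk a x.
Proof.
move=> a0 a1 x0 xy; have y0 := lt_le_trans x0 xy.
rewrite (kkE a x0) (kkE a y0) ler_pM2r ?invr_gt0 ?Gamma_gt0//.
rewrite -[a - 1]opprB !powRN lef_pV2 ?posrE ?powR_gt0//.
by rewrite ge0_ler_powR ?nnegrE ?subr_ge0// ltW.
Qed.

Lemma caputo_eq (R : realType) (T al : R) (v w w' : R -> R) :
  (forall t, t \in `]0, T[ -> w t = w' t) -> caputo T al v w -> caputo T al v w'.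
Proof.
move=> ww' [iw [vn [dvn [h1 h2 h3]]]]; split.
  by apply: eq_integrable iw => // t; rewrite inE/= => tT; rewrite /= ww'.
exists vn, dvn; split => //.
apply: cvg_trans h3; apply: near_eq_cvg; apply: nearW => n.
by apply: eq_integral => t; rewrite inE/= => tT; rewrite ww'.
Qed.

(** Removes the global integrability of w by cutting it off at T, which affects neither I^al w up to
    T nor the derivative on ]0, T[. *)
Lemma caputo_cvl (R : realType) (T al M v0 : R) (v w : R -> R) :
  0 < T -> 0 < al -> al < 1 -> measurable_fun setT w -> (forall r, r <= 0 -> w r = 0) ->
  (forall x, cint (kk al) (fun r => `|w r|) x) ->
  (forall x, x <= T -> `|cvl (kk al) w x| <= M) ->
  (forall eps, 0 < eps -> exists2 d, 0 < d & forall x y, x <= y -> y <= T -> y - x < d ->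
     `|cvl (kk al) w x - cvl (kk al) w y| <= eps) ->
  (forall t, t \in `[0, T] -> v t = v0 + cvl (kk al) w t) ->
  caputo T al v w.
Proof.
move=> T0 al0 al1 mw w0 iw VM Vuc vE.
pose D : set R := `]-oo, T[%classic.
have mD : measurable D by exact: measurable_itv.
pose w' : R -> R := w \_ D.
have w'E x : w' x = if x < T then w x else 0.
  by rewrite /w' patchE mem_setE in_itv/=.
have mw' : measurable_fun setT w'.
  by apply/(measurable_restrictT _ mD); apply: measurable_funTS.
have maw : measurable_fun setT (fun r => `|w r|) by exact: measurableT_comp.
have maw' : measurable_fun setT (fun r => `|w' r|) by exact: measurableT_comp.
have w'w x : `|w' x| <= `|w x| by rewrite w'E; case: ifP; rewrite ?normr0.
have kT : 0 < kk al T by exact: kk_gt0.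
have iw' : lebesgue_measure.-integrable setT (EFin \o w').
  (* On ]0, T[ the kernel k_al(T - r) is at least k_al(T), so integrability of the convolution at T
     forces that of w. *)
  have := integrableZl measurableT (kk al T)^-1 (iw T).
  apply: le_integrable => //; first exact/measurable_EFinP.
  move=> x _; rewrite /= lee_fin normrM ger0_norm ?invr_ge0 ?(ltW kT)//.
  rewrite mulrC ler_pdivlMr//; rewrite w'E; have [xT|xT] := ltP x T; last by rewrite normr0 mul0r.
  have [x0|x0] := leP x 0; first by rewrite w0// normr0 mul0r.
  rewrite normrM normr_id mulrC ler_wpM2r//.
  rewrite [leRHS]ger0_norm; last exact: kk_ge0.
  apply: kk_nonincr => //; first exact: ltW.
    by rewrite subr_gt0.
  by rewrite gerBl ltW.
have ww' x : x <= T -> cvl (kk al) w' x = cvl (kk al) w x.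
  move=> xT; apply: eq_cvl => r; rewrite w'E; case: ltP => // rT.
  by rewrite kk_le0 ?mul0r// subr_le0 (le_trans xT).
apply: (@caputo_eq _ _ _ _ w').
  by move=> t; rewrite in_itv/= => /andP[_ tT]; rewrite w'E tT.
apply: (@caputo_cvl_truncated _ _ _ T0 al0 al1 w' (cvl (kk al) w') mw' _ iw' _ erefl M _ _ v0).
- by move=> r r0; rewrite w'E w0//; case: ifP.
- move=> x; apply: (cint_dom (measurable_kk al) maw' _ _ (iw x)).
    by move=> y; exact: kk_ge0.
  by move=> y; rewrite normr_id.
- by move=> x xT; rewrite ww'//; exact: VM.
- move=> eps /Vuc[d d0 Hd]; exists d => // x y xy yT xyd.
  by rewrite !ww'//; [exact: Hd|exact: le_trans yT].
- by move=> t; rewrite in_itv/= => /andP[t0 tT]; rewrite vE ?in_itv/= ?t0// ww'.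
Qed.

(** * The final value problem for coefficient sequences *)

Section l2_continuity.
Context {R : realType}.
Implicit Types (y : nat -> R) (A : set R).

Definition l2tail n y j : R := if (j < n)%N then 0 else y j.

Definition l2cont A (x : R -> nat -> R) t0 := forall eps, 0 < eps -> exists2 d, 0 < d &
  forall t, A t -> `|t - t0| < d -> l2le (fun j => x t j - x t0 j) eps.

(** The sum of n squares of M/(n+1) is at most M^2; the successor avoids a division by 0 when n =
    0. *)
Lemma l2le_head n y M : 0 <= M -> (forall j, (j < n)%N -> `|y j| <= M / n.+1%:R) ->
  l2le (fun j => y j - l2tail n y j) M.
Proof.
move=> M0 hy; split => // N.
have le1 j : (j < n)%N -> (y j - l2tail n y j) ^+ 2 <= (M / n.+1%:R) ^+ 2.
  move=> jn; rewrite /l2tail jn subr0 -[y j ^+ 2]real_normK ?num_real//.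
  by rewrite ler_pXn2r ?nnegrE ?hy// divr_ge0.
have z j : (n <= j)%N -> (y j - l2tail n y j) ^+ 2 = 0.
  by move=> nj; rewrite /l2tail ltnNge nj subrr expr0n.
have h1 : \sum_(j < N) (y j - l2tail n y j) ^+ 2 <= \sum_(j < n) (M / n.+1%:R) ^+ 2.
  rewrite -(big_mkord xpredT (fun j => (y j - l2tail n y j) ^+ 2)).
  have [nN|Nn] := leqP n N.
    rewrite (big_cat_nat (n := n))//= [X in _ + X]big_nat_cond.
    rewrite [X in _ + X]big1 ?addr0 => [|j /andP[/andP[nj _] _]]; last exact: z.
    by rewrite big_mkord; apply: ler_sum => j _; exact: le1.
  rewrite big_mkord (big_ord_widen n (fun j => (y j - l2tail n y j) ^+ 2) (ltnW Nn)).
  rewrite big_mkcond/=; apply: ler_sum => j _; case: ifP => _; first exact: le1.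
  exact: sqr_ge0.
apply: (le_trans h1); rewrite sumr_const card_ord -[leLHS]mulr_natl.
apply: (@le_trans _ _ (n.+1%:R ^+ 2 * (M / n.+1%:R) ^+ 2)).
  rewrite ler_wpM2r ?sqr_ge0// -natrX ler_nat.
  by rewrite (leq_trans (leqnSn n))// leq_pmulr.
by rewrite -exprMn mulrC divfK// pnatr_eq0.
Qed.

Lemma l2le_tail_eventually y M eps : l2le y M -> 0 < eps -> exists n, l2le (l2tail n y) eps.
Proof.
move=> [M0 hy] eps0; pose S n := \sum_(j < n) y j ^+ 2.
have hs : has_sup (range S).
  by split; [exists (S 0%N); exists 0%N|exists (M ^+ 2) => _ [n _ <-]; exact: hy].
have e2 : 0 < eps ^+ 2 by rewrite exprn_gt0.
have [_ [n _ <-] hn] := sup_adherent e2 hs; exists n; split; first exact: ltW.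
move=> N; have hN : S (maxn n N) <= sup (range S).
  by apply: sup_upper_bound => //; exists (maxn n N).
have h1 : \sum_(j < N) l2tail n y j ^+ 2 <= S (maxn n N) - S n.
  rewrite lerBrDr addrC /S.
  rewrite -!(big_mkord xpredT (fun j => y j ^+ 2)) -(big_mkord xpredT (fun j => l2tail n y j ^+ 2)).
  rewrite (big_cat_nat (n := n) (p := maxn n N))//= ?leq_maxl// lerD2l.
  have [nN|Nn] := leqP n N; last first.
    rewrite [leRHS]big_geq// big_nat_cond big1// => j /andP[/andP[_ jN] _].
    by rewrite /l2tail (ltn_trans jN Nn) expr0n.
  rewrite (big_cat_nat (n := n))//= [X in X + _]big_nat_cond [X in X + _]big1 ?add0r.
    by apply: ler_sum_nat => j /andP[nj _]; rewrite /l2tail ltnNge nj.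
  by move=> j /andP[/andP[_ jn] _]; rewrite /l2tail jn expr0n.
by apply: (le_trans h1); lra.
Qed.

(** Continuity of each coordinate and tails that are small uniformly near [t0] together give
    continuity in l2. In each application below the tail condition is the substantial one. *)
Lemma l2cont_tails A (x : R -> nat -> R) t0 : A t0 ->
  (forall j eps, 0 < eps -> exists2 d, 0 < d &
     forall t, A t -> `|t - t0| < d -> `|x t j - x t0 j| <= eps) ->
  (forall eps, 0 < eps -> exists n, exists2 d, 0 < d &
     forall t, A t -> `|t - t0| < d -> l2le (l2tail n (x t)) eps) ->
  l2cont A x t0.
Proof.
move=> At0 hc ht eps eps0; have e3 : 0 < eps / 3 by rewrite divr_gt0.
have [n [d1 d10 H1]] := ht _ e3.
have e3n : 0 < eps / 3 / n.+1%:R by rewrite divr_gt0.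
have unif k e : 0 < e -> exists2 d, 0 < d & forall t, A t -> `|t - t0| < d ->
    forall j, (j < k)%N -> `|x t j - x t0 j| <= e.
  move=> e0; elim: k => [|k [d d0 Hd]]; first by exists 1.
  have [d' d'0 Hd'] := hc k e e0.
  exists (Num.min d d') => [|t At]; first by rewrite lt_min d0.
  rewrite lt_min => /andP[td td'] j; rewrite ltnS leq_eqVlt => /predU1P[->|jk].
    exact: Hd'.
  exact: Hd.
have [d2 d20 H2] := unif n _ e3n.
exists (Num.min d1 d2) => [|t At]; first by rewrite lt_min d10.
rewrite lt_min => /andP[td1 td2].
have h1 := @l2le_head n (fun j => x t j - x t0 j) (eps / 3) (ltW e3) (H2 t At td2).
have h2 := H1 t At td1; have h3 : l2le (l2tail n (x t0)) (eps / 3).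
  by apply: H1 => //; rewrite subrr normr0.
have := l2le_add h1 (l2le_sub h2 h3).
have -> : eps / 3 + (eps / 3 + eps / 3) = eps by field.
apply: l2le_eq => j; rewrite /l2tail; case: ifP => _; ring.
Qed.

Lemma l2cont_sub A (x y : R -> nat -> R) t0 : l2cont A x t0 -> l2cont A y t0 ->
  l2cont A (fun t j => x t j - y t j) t0.
Proof.
move=> hx hy eps eps0; have e2 : 0 < eps / 2 by rewrite divr_gt0.
have [d1 d10 H1] := hx _ e2; have [d2 d20 H2] := hy _ e2.
exists (Num.min d1 d2) => [|t At]; first by rewrite lt_min d10.
rewrite lt_min => /andP[td1 td2].
have := l2le_sub (H1 t At td1) (H2 t At td2).
have -> : eps / 2 + eps / 2 = eps by field.
by apply: l2le_eq => j; ring.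
Qed.

End l2_continuity.

Lemma powR_small (R : realType) (K s eps : R) : 0 <= K -> 0 < s -> 0 < eps ->
  exists2 d, 0 < d & forall y, 0 <= y -> y < d -> K * y `^ s <= eps.
Proof.
move=> K0 s0 eps0; have K1 : 0 < K + 1 by rewrite ltr_wpDl.
have e1 : 0 < eps / (K + 1) by rewrite divr_gt0.
exists ((eps / (K + 1)) `^ s^-1); first by rewrite powR_gt0.
move=> y y0 yd; have h : y `^ s <= eps / (K + 1).
  have -> : eps / (K + 1) = ((eps / (K + 1)) `^ s^-1) `^ s.
    by rewrite -powRrM mulVf ?lt0r_neq0// powRr1// ltW.
  by rewrite ge0_ler_powR ?nnegrE ?(ltW s0) ?powR_ge0// ltW.
rewrite (le_trans (ler_wpM2l K0 h))// mulrA ler_pdivrMr// mulrC ler_wpM2l ?(ltW eps0)//.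
by rewrite lerDl.
Qed.

(** * Weighted estimates for the coefficients of the solution *)

Section final_value_sequences.
Context {R : realType}.
Variables (al T P p q s p' qh lam1 : R) (lam : nat -> R).
Hypotheses (al0 : 0 < al) (al1 : al < 1) (T0 : 0 < T) (P1 : 1 < P).
Hypotheses (lam10 : 0 < lam1) (lamlb : forall j, lam1 <= lam j).
Hypotheses (s0 : 0 < s) (Ps : P^-1 < al * q - s) (q0 : 0 < q) (q1 : q < 1) (pq : p + q = 1).
Hypotheses (p'0 : 0 < p') (p'1 : p' + s / al <= p).
Hypotheses (qh0 : 0 <= qh) (qhq : qh <= q) (qhs : qh <= s / al).

Let lam_gt0 j : 0 < lam j. Proof. exact: lt_le_trans (lamlb j). Qed.
Let P0 : 0 < P^-1. Proof. by rewrite invr_gt0 (lt_trans _ P1). Qed.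
Let sal0 : 0 < s / al. Proof. by rewrite divr_gt0. Qed.
Let sE : s = al * (s / al). Proof. by rewrite mulrCA mulfV ?mulr1// lt0r_neq0. Qed.
Let p0 : 0 < p. Proof. by rewrite (lt_le_trans _ p'1)// addr_gt0. Qed.
Let p1 : p < 1. Proof. by rewrite -pq ltrDl. Qed.
Let salq : s / al < q.
Proof. rewrite -(ltr_pM2l al0) -sE -subr_gt0; exact: lt_trans Ps. Qed.
Let Pal : P^-1 < al.
Proof.
by rewrite (lt_le_trans Ps)// lerBlDr (le_trans (ler_piMr (ltW al0) (ltW q1)))// lerDl ltW.
Qed.

(** The final datum left to the homogeneous part once the Duhamel term is subtracted. *)
Definition defect f (phi : nat -> R) j := phi j - duhamel al lam f j T.

(** The initial value of the coefficient, since the homogeneous part decays like E(t) and has to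
    equal the defect at T. *)
Definition amplitude f phi j := defect f phi j / ML al (lam j) 1 T.

(* The factor of [amplitude] is [E_al(- lam t^al)], including at [t = 0] where
   [ML] vanishes. *)
Definition hom f phi j t :=
  amplitude f phi j * (1 - lam j * cvl (kk 1) (ML al (lam j) al) t).

Definition sol f phi j t := duhamel al lam f j t + hom f phi j t.

Lemma sol_gt0 f phi j t : 0 < t -> sol f phi j t =
  duhamel al lam f j t + defect f phi j * (ML al (lam j) 1 t / ML al (lam j) 1 T).
Proof.
move=> t0; rewrite /sol /hom -(kk1_subE al0 (lam_gt0 j)) kk1// subKr /amplitude.
by rewrite mulrAC mulrA.
Qed.

(** The weight p + qh is admissible for the Duhamel term because al (1 - p - qh) = al (q - qh) >= al
    q - s > P^-1; this uses qh <= s/al. *)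
Lemma defect_weighted : exists2 C, 0 <= C & forall f g N phi Phi, source P f g N ->
  l2le (fun j => lam j `^ (p + qh) * phi j) Phi ->
  l2le (fun j => lam j `^ (p + qh) * defect f phi j) (C * (Phi + N)).
Proof.
have [C C0 HC] := @duhamel_weighted _ al T P lam1 lam al0 al1 T0 P1 lam10 lamlb (p + qh)
  ltac:(by rewrite addr_ge0// ltW) ltac:(by rewrite -pq lerD2l)
  ltac:(by rewrite (lt_le_trans Ps)// -pq opprD addrA [_ + q]addrC addrK mulrBr lerD2l lerN2 [leRHS]sE ler_pM2l).
exists (1 + C) => [|f g N phi Phi S hphi]; first by rewrite addr_ge0.
have := l2le_sub hphi (HC f g N T S (lexx T)).
have Phi0 : 0 <= Phi by case: hphi.
have h : Phi + C * N <= (1 + C) * (Phi + N).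
  have N0 := source_N S; have := mulr_ge0 C0 Phi0.
  by move: (C * N) (mulrDr C Phi N) => x; rewrite mulrDl mul1r => ->; lra.
by move/(l2le_mono h); apply: l2le_eq => j; rewrite mulrBr.
Qed.

(** A budget: of the weight p + qh of the datum, c is kept in the norm and th is spent to weaken the
    singularity at 0. *)
Lemma homogeneous_weighted th c : 0 <= th -> th <= 1 -> c + th <= p + qh ->
  exists2 C, 0 <= C & forall psi K t, 0 < t ->
  l2le (fun j => lam j `^ (p + qh) * psi j) K ->
  l2le (fun j => lam j `^ c * (psi j * (ML al (lam j) 1 t / ML al (lam j) 1 T)))
    (C * K * t `^ (- (al * (1 - th)))).
Proof.
move=> th0 th1 cth; have [C C0 HC] := ML1_ratio al0 al1 th0 th1 T0 lam10.
exists (C * lam1 `^ (- (p + qh - (c + th)))) => [|psi K t t0 h]; first by rewrite mulr_ge0 ?powR_ge0.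
have := l2le_lower_weight lam10 lamlb cth h => h'.
have := l2le_dom (mulr_ge0 C0 (powR_ge0 t (- (al * (1 - th))))) _ h'.
move=> /(_ (fun j => lam j `^ c * (psi j * (ML al (lam j) 1 t / ML al (lam j) 1 T)))) h2.
have {}h2 := h2 _.
have E : C * t `^ (- (al * (1 - th))) * (lam1 `^ (- (p + qh - (c + th))) * K) =
   C * lam1 `^ (- (p + qh - (c + th))) * K * t `^ (- (al * (1 - th))).
  by move: (t `^ _) (lam1 `^ _) => x y; ring.
rewrite E in h2; apply: h2 => j.
have r0 : 0 <= ML al (lam j) 1 t / ML al (lam j) 1 T.
  by rewrite divr_ge0// ltW// ML1_gt0.
have := ler_wpM2l (mulr_ge0 (powR_ge0 (lam j) c) (normr_ge0 (psi j))) (HC (lam j) t (lamlb j) t0).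
move: (ML al (lam j) 1 t / _) r0 => ra ra0.
rewrite !normrM !(ger0_norm (powR_ge0 _ _)) (ger0_norm ra0) (powRDp c th (lam_gt0 j)).
move: (t `^ _) (lam j `^ c) (lam j `^ th) `|psi j| => a b d g h3.
rewrite mulrA (le_trans h3)// le_eqVlt; apply/orP; left; apply/eqP; ring.
Qed.

(** The homogeneous part requires c + th <= p + qh and the Duhamel term c <= p + s/al. The estimates
    of the solution in time-integrated and time-weighted spaces are instances of this one. *)
Lemma sol_weighted th c : 0 <= th -> th <= 1 -> c + th <= p + qh -> 0 <= c ->
  c <= p + s / al -> exists2 C, 0 <= C & forall f g N phi Phi t, source P f g N ->
  l2le (fun j => lam j `^ (p + qh) * phi j) Phi -> 0 < t -> t <= T ->
  l2le (fun j => lam j `^ c * sol f phi j t) (C * (Phi + N) * t `^ (- (al * (1 - th)))).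
Proof.
move=> th0 th1 cth c0 cs.
have c1 : c <= 1 by rewrite (le_trans cs)// -pq lerD2l ltW.
have Pc : P^-1 < al * (1 - c).
  rewrite (lt_le_trans Ps)// [X in _ - X]sE -mulrBr ler_pM2l// -pq.
  by move: cs; move: (s / al) => x; lra.
have [C1 C10 H1] := homogeneous_weighted th0 th1 cth.
have [C2 C20 H2] := defect_weighted.
have [C3 C30 H3] := @duhamel_weighted _ al T P lam1 lam al0 al1 T0 P1 lam10 lamlb c c0 c1 Pc.
pose b := al * (1 - th); have b0 : 0 <= b by rewrite mulr_ge0 ?subr_ge0// ltW.
exists (C3 * T `^ b + C1 * C2) => [|f g N phi Phi t S hphi t0 tT].
  by rewrite addr_ge0// mulr_ge0// powR_ge0.
have Phi0 : 0 <= Phi by case: hphi.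
have N0 := source_N S.
have h1 := H1 _ _ t t0 (H2 _ _ _ _ _ S hphi).
have := l2le_add (H3 f g N t S tT) h1.
have h : C3 * N + C1 * (C2 * (Phi + N)) * t `^ (- b) <=
    (C3 * T `^ b + C1 * C2) * (Phi + N) * t `^ (- b).
  rewrite !mulrDl [C1 * (C2 * _)]mulrA lerD2r.
  (* The Duhamel term is bounded without singularity; up to time T this factor lets it fit under the
     singular bound. *)
  have hb : 1 <= T `^ b * t `^ (- b).
    by rewrite powRN ler_pdivlMr ?powR_gt0// mul1r ge0_ler_powR ?nnegrE// ltW.
  have -> : C3 * T `^ b * (Phi + N) * t `^ (- b) = C3 * ((Phi + N) * (T `^ b * t `^ (- b))).
    by move: (T `^ b) (t `^ _) => x y; ring.
  rewrite ler_wpM2l//; apply: (@le_trans _ _ (Phi + N)); first by rewrite lerDr.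
  by rewrite ler_peMr// addr_ge0.
move/(l2le_mono h); apply: l2le_eq => j.
by rewrite sol_gt0// mulrDr.
Qed.

(** Going from the final back to the initial value costs one power of lam, by the lower bound for
    E(T). *)
Lemma amplitude_le : exists2 C, 0 <= C &
  forall f phi j, `|amplitude f phi j| <= C * (lam j * `|defect f phi j|).
Proof.
have [C C0 HC] := ML1_ratio al0 al1 (@ler01 R) (lexx 1) T0 lam10.
pose G := Gamma (1 - al) * T `^ al; have G0 : 0 <= G by rewrite mulr_ge0 ?powR_ge0// ltW// Gamma_gt0// subr_gt0.
exists (lam1^-1 + G) => [|f phi j]; first by rewrite addr_ge0// invr_ge0 ltW.
have E0 := ML1_gt0 al0 al1 (lam_gt0 j) T0.
have h := ML1_lower_bound al0 al1 (lam_gt0 j) T0.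
rewrite /amplitude normrM normfV (gtr0_norm E0) mulrC mulrA ler_wpM2r//.
apply: (le_trans h); rewrite mulrDl lerD//.
  by rewrite mulrC ler_pdivlMr// mul1r.
by rewrite /G mulrAC.
Qed.

Lemma l2le_coord_weight c (x : nat -> R) M j : l2le (fun j => lam j `^ c * x j) M ->
  `|x j| <= lam j `^ (- c) * M.
Proof.
move=> /(l2le_coord j); rewrite normrM ger0_norm ?powR_ge0// powRN => h.
by rewrite mulrC ler_pdivlMr ?powR_gt0// mulrC.
Qed.

(** Weights add up: - (1 - p') from the norm, 1 from the amplitude and s/al from Hoelder continuity
    of exponent s give p' + s/al, which is at most p. This is the origin of the condition on p'. *)
Lemma homogeneous_hoelder : exists2 C, 0 <= C & forall f phi K t1 t2,
  l2le (fun j => lam j `^ (p + qh) * defect f phi j) K -> 0 <= t1 -> t1 <= t2 ->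
  l2le (fun j => lam j `^ (- (1 - p')) * (hom f phi j t2 - hom f phi j t1))
    (C * K * (t2 - t1) `^ s).
Proof.
have sal : s <= al by rewrite [leLHS]sE ler_piMr ?(ltW al0)// (le_trans (ltW salq))// ltW.
have [C1 C10 H1] := ML1_hoelder al0 al1 s0 sal.
have [C2 C20 H2] := amplitude_le.
have pp : p' + s / al <= p + qh by rewrite (le_trans p'1)// lerDl.
exists (C2 * C1 * lam1 `^ (- (p + qh - (p' + s / al)))) => [|f phi K t1 t2 h t10 t12].
  by rewrite !mulr_ge0 ?powR_ge0.
have {h} := l2le_lower_weight lam10 lamlb pp h.
pose c := C2 * C1 * (t2 - t1) `^ s.
have c0 : 0 <= c by rewrite !mulr_ge0 ?powR_ge0.
move=> /(l2le_dom c0) h.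
have E : c * (lam1 `^ (- (p + qh - (p' + s / al))) * K) =
  C2 * C1 * lam1 `^ (- (p + qh - (p' + s / al))) * K * (t2 - t1) `^ s.
  by rewrite /c; move: (lam1 `^ _) ((t2 - t1) `^ _) => x y; ring.
rewrite E in h; apply: h => j.
have h1 := H1 (lam j) t1 t2 (lam_gt0 j) t10 t12.
have h2 := H2 f phi j.
have -> : hom f phi j t2 - hom f phi j t1 = - (amplitude f phi j *
    (lam j * (cvl (kk 1) (ML al (lam j) al) t2 - cvl (kk 1) (ML al (lam j) al) t1))).
  by rewrite /hom; move: (cvl _ _ _) (cvl _ _ _) => x y; ring.
move: h1; move: (lam j * (_ - _)) => X h1.
rewrite mulrN normrN; move: h2; move: (amplitude f phi j) => am h2; rewrite !normrM !(ger0_norm (powR_ge0 _ _)).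
rewrite (_ : lam j `^ (p' + s / al) = lam j `^ (- (1 - p')) * lam j * lam j `^ (s / al)); last first.
  rewrite -{3}(powRr1 (ltW (lam_gt0 j))) -!powRDp//; congr (_ `^ _).
  by move: (s / al) => x; ring.
have := ler_pM (normr_ge0 _) (normr_ge0 _) h2 h1 => h3.
have := ler_wpM2l (powR_ge0 (lam j) (- (1 - p'))) h3 => h4.
apply: (le_trans h4); rewrite le_eqVlt; apply/orP; left; apply/eqP; rewrite /c.
by move: (lam j) (_ `^ (s / al)) (_ `^ (- (1 - p'))) ((t2 - t1) `^ _) `|defect f phi j| => x y z w v; ring.
Qed.

Lemma sol_hoelder : exists2 C, 0 <= C & forall f g N phi Phi t1 t2, source P f g N ->
  l2le (fun j => lam j `^ (p + qh) * phi j) Phi -> 0 <= t1 -> t1 <= t2 -> t2 <= T ->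
  l2le (fun j => lam j `^ (- (1 - p')) * (sol f phi j t2 - sol f phi j t1))
    (C * (Phi + N) * (t2 - t1) `^ s).
Proof.
have s1 : s <= 1.
  by rewrite [leLHS]sE (le_trans (ler_piMr (ltW al0) (le_trans (ltW salq) (ltW q1))))// ltW.
have Ps1 : P^-1 < al - s.
  by rewrite (lt_le_trans Ps)// lerD2r ler_piMr// ltW.
have p'q : p' <= 1 by apply: le_trans (ltW p1); apply: le_trans p'1; rewrite lerDl ltW.
have q'0 : 0 <= 1 - p' by rewrite subr_ge0.
have q'1 : 1 - p' <= 1 by rewrite gerBl ltW.
have Pq' : P^-1 < al * (1 - p').
  rewrite (lt_le_trans Ps)// [X in _ - X]sE -mulrBr ler_pM2l//.
  by rewrite -pq; move: p'1 (ltW sal0); move: (s / al) => x; lra.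
have [C1 C10 H1] := homogeneous_hoelder.
have [C2 C20 H2] := defect_weighted.
have [C3 C30 H3] := @duhamel_hoelder _ al T P lam1 lam al0 al1 T0 P1 lam10 lamlb Pal s (1 - p')
  s0 s1 Ps1 q'0 q'1 Pq'.
exists (C3 + C1 * C2) => [|f g N phi Phi t1 t2 S hphi t10 t12 t2T].
  by rewrite addr_ge0// mulr_ge0.
have Phi0 : 0 <= Phi by case: hphi.
have N0 := source_N S.
have := l2le_add (H3 f g N t1 t2 S t12 t2T) (H1 f phi _ t1 t2 (H2 _ _ _ _ _ S hphi) t10 t12).
have h : C3 * N * (t2 - t1) `^ s + C1 * (C2 * (Phi + N)) * (t2 - t1) `^ s <=
    (C3 + C1 * C2) * (Phi + N) * (t2 - t1) `^ s.
  rewrite -mulrDl ler_wpM2r ?powR_ge0// mulrDl [C1 * (C2 * _)]mulrA lerD2r ler_wpM2l//.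
  by rewrite lerDr.
move/(l2le_mono h); apply: l2le_eq => j.
rewrite -mulrDr /sol; apply: congr1; rewrite [in RHS]opprD; exact: addrACA.
Qed.

Section fixed_data.
Variables (f : nat -> R -> R) (g : R -> R) (N : R) (phi : nat -> R) (Phi : R).
Hypotheses (S : source P f g N) (hphi : l2le (fun j => lam j `^ (p + qh) * phi j) Phi).

Lemma sol_coord_hoelder j : exists2 K, 0 <= K & forall t1 t2, 0 <= t1 -> t1 <= t2 -> t2 <= T ->
  `|sol f phi j t2 - sol f phi j t1| <= K * (t2 - t1) `^ s.
Proof.
have [C C0 HC] := sol_hoelder.
have Phi0 : 0 <= Phi by case: hphi.
have N0 := source_N S.
exists (lam j `^ (1 - p') * (C * (Phi + N))) => [|t1 t2 t10 t12 t2T].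
  by rewrite !mulr_ge0 ?powR_ge0// addr_ge0.
have := l2le_coord_weight j (HC f g N phi Phi t1 t2 S hphi t10 t12 t2T).
by rewrite opprK mulrA.
Qed.

(* The Caputo derivative of [sol], written with the kernel [ML _ _ 1] so that it
   vanishes on the negative half line. *)
Definition sol_deriv j r := residual al lam f j r -
  lam j * amplitude f phi j * ML al (lam j) 1 r.

Lemma sol_derivE j r : 0 < r -> sol_deriv j r = f j r - lam j * sol f phi j r.
Proof.
move=> r0; rewrite /sol_deriv /residual /sol /hom -(kk1_subE al0 (lam_gt0 j)) kk1// subKr.
by rewrite mulrDr opprD addrA mulrA.
Qed.

Lemma measurable_sol_deriv j : measurable_fun setT (sol_deriv j).
Proof.
have m1 := measurable_ML al0 (lam_gt0 j) (@ltr01 R).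
have m2 : measurable_fun setT (residual al lam f j).
  exact: (measurable_residual al0 al1 P1 lam10 lamlb Pal S).
apply: measurable_funB => //; exact: measurable_funM.
Qed.

Lemma cint_sol_deriv j t : cint (kk al) (fun r => `|sol_deriv j r|) t.
Proof.
pose T' := Num.max T t; have T'0 : 0 < T' by rewrite lt_max T0.
have tT' : t <= T' by rewrite le_max lexx orbT.
have i1 := @cint_residual _ al T' P lam1 lam al0 al1 T'0 P1 lam10 lamlb Pal f g N S j t tT'.
have i2 := cint_kk_ML al0 (lam_gt0 j) t al0 (@ltr01 R).
have i3 := cintBr i1 (cintZr (lam j * amplitude f phi j) i2).
apply: eq_integrable (integrable_norm i3) => // x _ /=.
by rewrite normrM ger0_norm ?kk_ge0.
Qed.

(** For the homogeneous part, 1 - E is both lam (1 * e) and lam (k_al * E); the second form exhibits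
    it as a fractional integral. *)
Lemma sol_fractional j t : 0 <= t -> t <= T ->
  sol f phi j t = amplitude f phi j + cvl (kk al) (sol_deriv j) t.
Proof.
move=> t0 tT.
have i1 := @cint_residual _ al T P lam1 lam al0 al1 T0 P1 lam10 lamlb Pal f g N S j t tT.
have i2 := cint_kk_ML al0 (lam_gt0 j) t al0 (@ltr01 R).
have E1 := @duhamel_residual _ al T P lam1 lam al0 al1 T0 P1 lam10 lamlb Pal f g N S j t tT.
have E2 := kk1_subE al0 (lam_gt0 j) t; have E3 := kk1_subE' al0 (lam_gt0 j) t.
rewrite /sol_deriv (cvlBr i1 (cintZr _ i2)) (cvlZr _ i2) -E1 /sol /hom -E2.
rewrite -mulrA (mulrCA (lam j)) -E3.
by move: (kk 1 t) (ML _ _ _ _) (duhamel _ _ _ _ _) => x y z; ring.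
Qed.

Lemma sol_caputo j : caputo T al (sol f phi j) (sol_deriv j).
Proof.
have [K K0 HK] := sol_coord_hoelder j.
pose V := cvl (kk al) (sol_deriv j).
have VE t : 0 <= t -> t <= T -> V t = sol f phi j t - amplitude f phi j.
  by move=> t0 tT; rewrite (sol_fractional j t0 tT) addrAC subrr add0r.
have D0 r : r <= 0 -> sol_deriv j r = 0.
  move=> r0; rewrite /sol_deriv ML_le0// mulr0 subr0.
  exact: (residual_le0 al lam S).
have V0 x : x <= 0 -> V x = 0.
  move=> x0; apply: cvl_eq0 => r; have [r0|r0] := leP r 0; first by rewrite D0// mulr0.
  by rewrite kk_le0 ?mul0r// subr_le0 (le_trans x0)// ltW.
have VH x y : x <= y -> y <= T -> `|V x - V y| <= K * (y - x) `^ s.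
  move=> xy yT; have [y0|y0] := leP y 0.
    by rewrite !V0// ?(le_trans xy)// subrr normr0 mulr_ge0 ?powR_ge0.
  have [x0|x0] := leP 0 x.
    rewrite !VE ?(le_trans xy)// ?(ltW y0)// opprB addrA subrK distrC; exact: HK.
  rewrite (V0 x (ltW x0)) -(V0 0 (lexx 0)) !VE ?(ltW T0) ?(ltW y0)//.
  rewrite opprB addrA subrK distrC (le_trans (HK _ _ _ _ _))// ?(ltW y0)//.
  rewrite ler_wpM2l// ge0_ler_powR ?nnegrE ?(ltW s0) ?subr_ge0 ?(ltW y0)//.
  by rewrite subr0 lerDl oppr_ge0 ltW.
apply: (@caputo_cvl _ T al (K * T `^ s) (amplitude f phi j)) => //.
- exact: measurable_sol_deriv.
- exact: cint_sol_deriv.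
- move=> x xT; have [x0|x0] := leP x 0.
    by rewrite -/V V0// normr0 mulr_ge0 ?powR_ge0.
  have := VH 0 x (ltW x0) xT; rewrite V0// sub0r normrN subr0 => h.
  rewrite (le_trans h)// ler_wpM2l// ge0_ler_powR ?nnegrE ?(ltW s0) ?(ltW x0) ?(ltW T0)//.
- move=> eps eps0; have [d d0 Hd] := powR_small K0 s0 eps0.
  exists d => // x y xy yT xyd; rewrite (le_trans (VH _ _ xy yT))//.
  by rewrite Hd// subr_ge0.
- by move=> t; rewrite in_itv/= => /andP[t0 tT]; exact: sol_fractional.
Qed.

Hypothesis lamoo : forall L, exists n, forall j, (n <= j)%N -> L <= lam j.

(** A spare positive weight forces small tails, uniformly over the bounded set, since lam tends to
    infinity. *)
Lemma l2tail_weight d M eps : 0 < d -> 0 <= M -> 0 < eps -> exists n, forall x,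
  l2le (fun j => lam j `^ d * x j) M -> l2le (l2tail n x) eps.
Proof.
move=> d0 M0 eps0; have M1 : 0 < (M + 1) / eps by rewrite divr_gt0// ltr_wpDl.
pose L := ((M + 1) / eps) `^ d^-1; have [n hn] := lamoo L; exists n => x hx.
have L0 : 0 < L by rewrite powR_gt0.
have h : L `^ (- d) * M <= eps.
  rewrite /L -powRrM mulrN mulVf ?lt0r_neq0// powR_inv1 ?(ltW M1)// invf_div.
  by rewrite mulrAC ler_pdivrMr ?ltr_wpDl// ler_wpM2l ?(ltW eps0)// lerDl.
apply: (l2le_mono h); apply: (l2le_dom (powR_ge0 _ _) _ hx) => j.
rewrite /l2tail; case: ltnP => nj; first by rewrite normr0 mulr_ge0 ?powR_ge0.
rewrite normrM ger0_norm ?powR_ge0// mulrA ler_peMl// powRN mulrC ler_pdivlMr ?powR_gt0//.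
by rewrite mul1r ge0_ler_powR ?nnegrE ?(ltW d0) ?(ltW L0) ?(ltW (lam_gt0 j))// hn.
Qed.

Let A : set R := `]0, T]%classic.

Lemma hoelder_coord_continuous (x : R -> R) K t0 : 0 <= K ->
  (forall t1 t2, 0 <= t1 -> t1 <= t2 -> t2 <= T -> `|x t2 - x t1| <= K * (t2 - t1) `^ s) ->
  A t0 -> forall eps, 0 < eps -> exists2 d, 0 < d &
  forall t, A t -> `|t - t0| < d -> `|x t - x t0| <= eps.
Proof.
move=> K0 h; rewrite /A/= in_itv/= => /andP[t00 t0T] eps eps0.
have [d d0 Hd] := powR_small K0 s0 eps0; exists d => // t.
rewrite /A/= in_itv/= => /andP[t1 tT]; have [tt|/ltW tt] := leP t t0 => td.
  rewrite distrC (le_trans (h _ _ _ tt t0T))// ?(ltW t1)// Hd ?subr_ge0//.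
  by move: td; rewrite distrC ger0_norm// subr_ge0.
rewrite (le_trans (h _ _ _ tt tT))// ?(ltW t00)// Hd ?subr_ge0//.
by move: td; rewrite ger0_norm// subr_ge0.
Qed.

Lemma powRN_near (b t0 t : R) : 0 <= b -> 0 < t0 -> `|t - t0| < t0 / 2 ->
  t `^ (- b) <= (t0 / 2) `^ (- b).
Proof.
move=> b0 t00 h; have h2 : t0 / 2 <= t by have := ler_norm (t0 - t); rewrite distrC; lra.
have h3 : 0 < t0 / 2 by rewrite divr_gt0.
have h4 : 0 < t := lt_le_trans h3 h2.
by rewrite !powRN lef_pV2 ?posrE ?powR_gt0// ge0_ler_powR ?nnegrE// ltW.
Qed.

Lemma sol_l2cont t0 : A t0 -> l2cont A (fun t j => sol f phi j t) t0.
Proof.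
move=> At0; have /andP[t00 t0T] : (0 < t0) && (t0 <= T) by move: At0; rewrite /A/= in_itv.
apply: l2cont_tails => //.
  move=> j; have [K K0 HK] := sol_coord_hoelder j.
  exact: (hoelder_coord_continuous K0 HK).
move=> eps eps0.
(* The spare weight: the solution is bounded with weight p - p', locally uniformly in ]0, T]. *)
have dp : 0 < p - p' by rewrite subr_gt0 (lt_le_trans _ p'1)// ltrDl.
have pp : p' <= 1 by rewrite (le_trans _ (ltW p1))// ltW// -subr_gt0.
have cth : p - p' + p' <= p + qh by rewrite subrK lerDl.
have cs : p - p' <= p + s / al by rewrite lerD2l (le_trans _ (ltW sal0))// oppr_le0 ltW.
have [C C0 HC] := sol_weighted (ltW p'0) pp cth (ltW dp) cs.
have Phi0 : 0 <= Phi by case: hphi.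
have N0 := source_N S.
pose b := al * (1 - p'); have b0 : 0 <= b by rewrite mulr_ge0 ?subr_ge0// ltW.
have CK0 : 0 <= C * (Phi + N) by rewrite mulr_ge0// addr_ge0.
have M0 : 0 <= C * (Phi + N) * (t0 / 2) `^ (- b) by rewrite mulr_ge0 ?powR_ge0.
have [n Hn] := l2tail_weight dp M0 eps0; exists n.
exists (t0 / 2) => [|t]; first by rewrite divr_gt0.
rewrite /A/= in_itv/= => /andP[t1 tT] /(powRN_near b0 t00) h.
apply: Hn; apply: l2le_mono (HC f g N phi Phi t S hphi t1 tT).
exact: ler_wpM2l.
Qed.

(** The Duhamel term admits the weight p + s/al, so s/al remains as spare weight above p. *)
Lemma duhamel_l2cont t0 : A t0 -> l2cont A (fun t j => lam j `^ p * duhamel al lam f j t) t0.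
Proof.
move=> At0; have /andP[t00 t0T] : (0 < t0) && (t0 <= T) by move: At0; rewrite /A/= in_itv.
have N0 := source_N S.
have ps1 : p + s / al <= 1 by rewrite -pq lerD2l ltW.
have ps0 : 0 <= p + s / al by rewrite addr_ge0// ltW.
have Pps : P^-1 < al * (1 - (p + s / al)).
  by rewrite (lt_le_trans Ps)// -pq opprD addrA [_ + q]addrC addrK mulrBr lerD2l lerN2 [leRHS]sE.
have [C C0 HC] := @duhamel_weighted _ al T P lam1 lam al0 al1 T0 P1 lam10 lamlb _ ps0 ps1 Pps.
have M0 : 0 <= C * N by rewrite mulr_ge0.
apply: l2cont_tails => //.
  have s1 : s <= 1.
    by rewrite [leLHS]sE (le_trans (ler_piMr (ltW al0) (le_trans (ltW salq) (ltW q1))))// ltW.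
  have Ps1 : P^-1 < al - s by rewrite (lt_le_trans Ps)// lerD2r ler_piMr// ltW.
  have Pal1 : P^-1 < al * 1 by rewrite mulr1.
  have [C1 C10 H1] := @duhamel_hoelder _ al T P lam1 lam al0 al1 T0 P1 lam10 lamlb Pal s 1
    s0 s1 Ps1 ler01 (lexx 1) Pal1.
  move=> j; pose K := lam j `^ p * (lam j `^ 1 * (C1 * N)).
  have K0 : 0 <= K by rewrite /K !mulr_ge0 ?powR_ge0.
  apply: (hoelder_coord_continuous K0) => // t1 t2 t10 t12 t2T.
  rewrite -mulrBr normrM ger0_norm ?powR_ge0// /K -mulrA ler_wpM2l ?powR_ge0//.
  have := l2le_coord_weight j (H1 f g N t1 t2 S t12 t2T).
  by rewrite opprK mulrA.
move=> eps eps0; have [n Hn] := l2tail_weight sal0 M0 eps0; exists n.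
exists 1 => // t; rewrite /A/= in_itv/= => /andP[t1 tT] _; apply: Hn.
by apply: l2le_eq (HC f g N t S tT) => j; rewrite mulrA -powRDp// addrC.
Qed.

(** If qh = 0 no weight is spare here. Instead, E(t)/E(T) with th = 0 is bounded uniformly in j near
    [t0], and it multiplies the fixed l2 sequence lam^p (phi - v(T)), whose tails are small. *)
Lemma hom_l2cont t0 : A t0 -> l2cont A (fun t j => lam j `^ p * hom f phi j t) t0.
Proof.
move=> At0; have /andP[t00 t0T] : (0 < t0) && (t0 <= T) by move: At0; rewrite /A/= in_itv.
have [C2 C20 H2] := defect_weighted.
have [K hpsi] : exists K, l2le (fun j => lam j `^ (p + qh) * defect f phi j) K.
  by exists (C2 * (Phi + N)); exact: H2 S hphi.
have K0 : 0 <= K by case: hpsi.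
apply: l2cont_tails => //.
  have [C1 C10 H1] := homogeneous_hoelder.
  move=> j; pose M := lam j `^ p * (lam j `^ (1 - p') * (C1 * K)).
  have M0 : 0 <= M by rewrite /M !mulr_ge0 ?powR_ge0.
  apply: (hoelder_coord_continuous M0) => // t1 t2 t10 t12 t2T.
  rewrite -mulrBr normrM ger0_norm ?powR_ge0// /M -mulrA ler_wpM2l ?powR_ge0//.
  have := l2le_coord_weight j (H1 f phi K t1 t2 hpsi t10 t12).
  by rewrite opprK mulrA.
move=> eps eps0.
have ppq : p <= p + qh by rewrite lerDl.
have hy := l2le_lower_weight lam10 lamlb ppq hpsi.
have [C C0 HC] := ML1_ratio al0 al1 (lexx (0 : R)) (@ler01 R) T0 lam10.
pose c := C * (t0 / 2) `^ (- (al * (1 - 0))).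
have c0 : 0 <= c by rewrite mulr_ge0 ?powR_ge0.
have c1 : 0 < c + 1 by rewrite ltr_wpDl.
have [n Hn] := l2le_tail_eventually hy (divr_gt0 eps0 c1); exists n.
exists (t0 / 2) => [|t]; first by rewrite divr_gt0.
rewrite /A/= in_itv/= => /andP[t1 tT] tt0.
have al10 : 0 <= al * (1 - 0) by rewrite subr0 mulr1 ltW.
have hb := powRN_near al10 t00 tt0.
have hc : c * (eps / (c + 1)) <= eps.
  by rewrite mulrA ler_pdivrMr// mulrC ler_wpM2l ?(ltW eps0)// lerDl.
apply: (l2le_mono hc); apply: (l2le_dom c0 _ Hn) => j.
rewrite /l2tail; case: ltnP => nj; first by rewrite normr0 mulr0.
rewrite /hom -(kk1_subE al0 (lam_gt0 j)) kk1// subKr /amplitude.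
have := HC (lam j) t (lamlb j) t1; rewrite powRr0 mulr1 => h.
have {}h : ML al (lam j) 1 t / ML al (lam j) 1 T <= c.
  by apply: (le_trans h); rewrite ler_wpM2l.
have r0 : 0 <= ML al (lam j) 1 t / ML al (lam j) 1 T.
  by rewrite divr_ge0// ltW// ML1_gt0.
rewrite mulrAC -[defect f phi j * _ / _]mulrA; move: (ML al (lam j) 1 t / _) r0 h => r r0 h.
by rewrite mulrA normrM (ger0_norm r0) mulrC ler_wpM2r.
Qed.

Lemma sol_l2cont_weighted t0 : A t0 -> l2cont A (fun t j => lam j `^ p * sol f phi j t) t0.
Proof.
(* The sum is written as the Duhamel term minus (0 minus the homogeneous one), so that continuity of
   differences suffices. *)
move=> At0; have h := l2cont_sub (duhamel_l2cont At0)
  (l2cont_sub (x := fun _ _ => 0) _ (hom_l2cont At0)).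
move=> eps eps0; have [|d d0 Hd] := h _ eps eps0.
  by move=> e e0; exists 1 => // t _ _; split => [|n]; rewrite ?(ltW e0)// big1 ?sqr_ge0// => j _; rewrite subrr expr0n.
exists d => // t At td; apply: l2le_eq (Hd t At td) => j.
by rewrite /sol; move: (duhamel _ _ _ _ _) (duhamel _ _ _ _ _) (hom _ _ _ _) (hom _ _ _ _) (lam j `^ p) => x y z w v; ring.
Qed.

End fixed_data.

End final_value_sequences.

(** * Completeness of L2 *)

Section square_integrable.
Context d (X : measurableType d) {R : realType} (mu : {measure set X -> \bar R}).
Implicit Types f g h w : X -> R.

Definition sqint f := measurable_fun setT f /\ mu.-integrable setT (EFin \o (fun x => f x ^+ 2)).

Definition ip f g := \int[mu]_x (f x * g x).

Lemma sqint_mul f g : sqint f -> sqint g -> mu.-integrable setT (EFin \o (fun x => f x * g x)).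
Proof.
move=> [mf i_f] [mg i_g]; apply: le_integrable (integrableD measurableT i_f i_g) => //.
  by apply/measurable_EFinP; exact: measurable_funM.
move=> x _; rewrite /= lee_fin [leRHS]ger0_norm ?addr_ge0 ?sqr_ge0//.
have h1 := sqr_ge0 (f x + g x); have h2 := sqr_ge0 (f x - g x).
rewrite sqrrD in h1; rewrite sqrrB in h2.
move: h1 h2 (sqr_ge0 (f x)) (sqr_ge0 (g x)); move: (f x ^+ 2) (g x ^+ 2) (f x * g x) => a b c *.
by rewrite ler_norml; apply/andP; split; lra.
Qed.

Lemma sqintZ a f : sqint f -> sqint (fun x => a * f x).
Proof.
move=> [mf i]; split; first exact: measurable_funM.
by apply: eq_integrable (integrableZl measurableT (a ^+ 2) i) => // x _ /=; rewrite exprMn EFinM.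
Qed.

Lemma sqintD f g : sqint f -> sqint g -> sqint (fun x => f x + g x).
Proof.
move=> sf sg; have [mf i_f] := sf; have [mg i_g] := sg; split; first exact: measurable_funD.
have i1 := integrableZl measurableT 2 (sqint_mul sf sg).
apply: eq_integrable (integrableD measurableT (integrableD measurableT i_f i1) i_g) => // x _ /=.
by rewrite sqrrD -EFinM -!EFinD mulr_natl.
Qed.

Lemma sqint0 : sqint (fun=> 0).
Proof. by split => //; apply: eq_integrable (integrable0 mu _) => // x _; rewrite /= expr0n. Qed.

Lemma sqintB f g : sqint f -> sqint g -> sqint (fun x => f x - g x).
Proof.
move=> sf /(sqintZ (-1)) sg; have := sqintD sf sg.
by congr sqint; apply/funext => x; rewrite mulN1r.
Qed.

Lemma sqint_sum n (c : nat -> R) (e : nat -> X -> R) : (forall j, sqint (e j)) ->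
  sqint (fun x => \sum_(j < n) c j * e j x).
Proof.
move=> se; elim: n => [|n IH].
  by have := sqint0; congr sqint; apply/funext => x; rewrite big_ord0.
have := sqintD IH (sqintZ (c n) (se n)).
by congr sqint; apply/funext => x; rewrite big_ord_recr.
Qed.

Lemma ipC f g : ip f g = ip g f.
Proof. by apply: eq_Rintegral => x _; rewrite mulrC. Qed.

Lemma ipZl a f g : sqint f -> sqint g -> ip (fun x => a * f x) g = a * ip f g.
Proof.
move=> sf sg; rewrite /ip -RintegralZl//; last exact: sqint_mul.
by apply: eq_Rintegral => x _; rewrite mulrA.
Qed.

Lemma ipDl f g h : sqint f -> sqint g -> sqint h ->
  ip (fun x => f x + g x) h = ip f h + ip g h.
Proof.
move=> sf sg sh; rewrite /ip -RintegralD//; try exact: sqint_mul.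
by apply: eq_Rintegral => x _; rewrite mulrDl.
Qed.

Lemma ipBl f g h : sqint f -> sqint g -> sqint h ->
  ip (fun x => f x - g x) h = ip f h - ip g h.
Proof.
move=> sf sg sh; rewrite /ip -RintegralB//; try exact: sqint_mul.
by apply: eq_Rintegral => x _; rewrite mulrBl.
Qed.

Lemma ip_suml n (c : nat -> R) (e : nat -> X -> R) h : (forall j, sqint (e j)) -> sqint h ->
  ip (fun x => \sum_(j < n) c j * e j x) h = \sum_(j < n) c j * ip (e j) h.
Proof.
move=> se sh; elim: n => [|n IH].
  rewrite big_ord0 /ip /Rintegral integral0_eq// => x _.
  by rewrite big_ord0 mul0r.
rewrite big_ord_recr/= -IH -ipZl// -ipDl//; last exact: sqintZ; last exact: sqint_sum.
by apply: eq_Rintegral => x _; rewrite big_ord_recr.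
Qed.

Lemma ip_ge0 f : 0 <= ip f f.
Proof. by apply: Rintegral_ge0 => x _; rewrite -expr2 sqr_ge0. Qed.

Lemma ip_sqr_le f g : sqint f -> sqint g -> ip f g ^+ 2 <= ip f f * ip g g.
Proof.
move=> sf sg; set A := ip f f; set B := ip f g; set C := ip g g.
have key s : 0 <= A - 2 * s * B + s ^+ 2 * C.
  have ss := sqintZ s sg; have sfs := sqintB sf ss.
  have := ip_ge0 (fun x => f x - s * g x).
  rewrite ipBl// [ip f _]ipC [ip (fun x => s * g x) _]ipC !ipBl// !ipZl//.
  rewrite [ip f (fun x => s * g x)]ipC !ipZl// [ip g (fun x => s * g x)]ipC ipZl//.
  rewrite [ip g f]ipC -/A -/B -/C => h; rewrite expr2; lra.
have A0 : 0 <= A := ip_ge0 f.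
have [C0|Cn0] := eqVneq C 0.
  have [B0|Bn0] := eqVneq B 0; first by rewrite B0 expr0n C0 mulr0.
  (* For C = 0 the quadratic expression is affine in s, and this s gives it the value -1. *)
  have := key ((A + 1) / (2 * B)); rewrite C0 mulr0 addr0.
  have -> : 2 * ((A + 1) / (2 * B)) * B = A + 1 by field.
  by move=> h; exfalso; lra.
have Cp : 0 < C by rewrite lt0r Cn0 ip_ge0.
have := key (B / C).
have -> : A - 2 * (B / C) * B + (B / C) ^+ 2 * C = (A * C - B ^+ 2) / C by field.
by rewrite pmulr_lge0 ?invr_gt0// subr_ge0.
Qed.

Lemma L2P f : f \in Lfun mu 2%:E <-> sqint f.
Proof.
split=> [h|[mf i]].
  split; last exact: Lfun2_integrable_sqr.
  by move: h; rewrite inE => /andP[+ _]; rewrite inE.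
rewrite inE; apply/andP; split; rewrite inE//=.
rewrite /finite_norm unlock; apply: poweR_lty.
have /integrableP[_] := i; apply: le_lt_trans.
rewrite le_eqVlt; apply/orP; left; apply/eqP; apply: eq_integral => x _ /=.
by rewrite powR_mulrn// real_normK ?num_real// ger0_norm ?sqr_ge0.
Qed.

Lemma Lnorm2E f : sqint f -> fine ('N[mu]_(2%:E)[EFin \o f])%E = Num.sqrt (ip f f).
Proof.
move=> [mf i]; rewrite unlock.
have -> : (\int[mu]_x `|(EFin \o f) x| `^ 2)%E = (ip f f)%:E.
  rewrite /ip /Rintegral fineK.
    by apply: eq_integral => x _ /=; rewrite powR_mulrn// real_normK ?num_real// expr2.
  by apply: (integrable_fin_num measurableT); apply: eq_integrable i => // x _ /=; rewrite expr2.
by rewrite poweR_EFin/= powR12_sqrt// ip_ge0.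
Qed.

Lemma ip_eq0_ae f : sqint f -> ip f f = 0 -> {ae mu, forall x, f x = 0}.
Proof.
move=> [mf i] h.
have E : (\int[mu]_x `|(EFin \o (fun x => f x ^+ 2)%R) x| = 0)%E.
  rewrite -[RHS]/(0%:E) -h /ip /Rintegral fineK.
    by apply: eq_integral => x _ /=; rewrite ger0_norm ?sqr_ge0// expr2.
  by apply: (integrable_fin_num measurableT); apply: eq_integrable i => // x _ /=; rewrite expr2.
have m2 : measurable_fun setT (EFin \o (fun x => f x ^+ 2)) by exact: (measurable_int mu).
have := (ae_eq_integral_abs mu measurableT m2).1 E.
apply: filterS => x /(_ I) /= [] /eqP; rewrite sqrf_eq0 => /eqP ->; done.
Qed.

End square_integrable.

Section L2_completeness.
Context d (X : measurableType d) {R : realType} (mu : {measure set X -> \bar R}).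

Lemma measurable_sqr (f : X -> R) : measurable_fun setT f ->
  measurable_fun setT (fun x => (f x ^+ 2)%:E).
Proof. by move=> mf; apply/measurable_EFinP; exact: measurable_funX. Qed.

Lemma limn_einf_le (u : (\bar R)^nat) (l : \bar R) : (\forall n \near \oo, (u n <= l)%E) ->
  (limn_einf u <= l)%E.
Proof.
move=> h; rewrite limn_einf_lim; apply: lime_le; first exact: is_cvg_einfs.
apply: filterS h => n; apply: le_trans.
by apply: ereal_inf_lbound; exists n => //=.
Qed.

Lemma nneseries_le_geometric (u : (\bar R)^nat) : (forall k, (0 <= u k)%E) ->
  (forall k, (u k <= (2^-1 ^+ k)%:E)%E) -> (\sum_(k <oo) u k <= 2%:E)%E.
Proof.
move=> u0 hu; apply: lime_le; first exact: is_cvg_nneseries.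
apply: nearW => n; apply: (@le_trans _ _ (\sum_(0 <= k < n) (2^-1 ^+ k)%:E)%E).
  exact: lee_sum.
rewrite sumEFin lee_fin big_mkord.
have -> : \sum_(k < n) (2^-1 ^+ k : R) = 2 - 2 * 2^-1 ^+ n.
  elim: n => [|n IH]; first by rewrite big_ord0 expr0; ring.
  by rewrite big_ord_recr/= IH exprS; field.
by rewrite gerBl mulr_ge0// exprn_ge0// invr_ge0.
Qed.

(* Along a subsequence with [||S_(n k+1) - S_(n k)||^2 <= 8^-k], the function
   [h = sum_k 4^k (S_(n k+1) - S_(n k))^2] is integrable, and the subsequence
   converges wherever [h] is finite. *)
Lemma L2_complete (S : nat -> X -> R) : (forall n, sqint mu (S n)) ->
  (forall eps, 0 < eps -> exists N, forall a b, (N <= a)%N -> (N <= b)%N ->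
     (\int[mu]_x ((S a x - S b x) ^+ 2)%:E <= eps%:E)%E) ->
  exists w, [/\ sqint mu w, forall x, (forall n, S n x = 0) -> w x = 0 &
    forall eps, 0 < eps -> exists N, forall n, (N <= n)%N ->
     (\int[mu]_x ((S n x - w x) ^+ 2)%:E <= eps%:E)%E].
Proof.
move=> sS cS.
have h8 k : 0 < (8^-1 : R) ^+ k by rewrite exprn_gt0// invr_gt0.
have [N HN] := choice (fun k => cS _ (h8 k)).
(* Partial sums of the thresholds: nondecreasing in k, and at least both [N k] and k. *)
pose n k := (\sum_(i < k.+1) (N i).+1)%N.
have Nn k : (N k <= n k)%N by rewrite /n big_ord_recr/= (leq_trans (leqnSn _))// leq_addl.
have kn k : (k <= n k)%N.
  elim: k => // k IH; by rewrite /n big_ord_recr/= addnS ltnS (leq_trans IH)// leq_addr.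
have nn k : (n k <= n k.+1)%N by rewrite /n [leqRHS]big_ord_recr/= leq_addr.
pose dd k x := S (n k.+1) x - S (n k) x.
have md k : measurable_fun setT (dd k).
  by apply: measurable_funB; [exact: (sS (n k.+1)).1|exact: (sS (n k)).1].
pose h x := (\sum_(k <oo) ((4 ^+ k)%:E * ((dd k x) ^+ 2)%:E))%E.
have t0 k x : (0 <= (4 ^+ k)%:E * ((dd k x) ^+ 2)%:E :> \bar R)%E.
  by rewrite mule_ge0 ?lee_fin ?sqr_ge0// exprn_ge0.
have mt k : measurable_fun setT (fun x => (4 ^+ k)%:E * ((dd k x) ^+ 2)%:E : \bar R)%E.
  by apply: emeasurable_funM => //; exact: measurable_sqr.
have mh : measurable_fun setT h by exact: (ge0_emeasurable_sum (P := xpredT)).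
have h0 x : (0 <= h x)%E by exact: nneseries_ge0.
have ih : (\int[mu]_x h x <= 2%:E)%E.
  rewrite integral_nneseries//; apply: nneseries_le_geometric => k.
    by apply: integral_ge0 => x _.
  rewrite ge0_integralZl//; last 2 first.
  - exact: measurable_sqr.
  - by move=> x _; rewrite lee_fin sqr_ge0.
  have := HN k (n k.+1) (n k) (leq_trans (Nn k) (nn k)) (Nn k).
  move=> /(lee_wpmul2l (x := (4 ^+ k)%:E)) => /(_ _)/le_trans; apply.
    by rewrite lee_fin exprn_ge0.
  by rewrite -EFinM lee_fin -exprMn; apply: lerXn2r; rewrite ?nnegrE; lra.
have iH : mu.-integrable setT h.
  apply/integrableP; split=> //; apply: le_lt_trans (ltry 2).
  by apply: le_trans ih; rewrite le_eqVlt; apply/orP; left; apply/eqP;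
    apply: eq_integral => x _; rewrite gee0_abs.
have [Z [mZ Z0 hZ]] := integrable_ae measurableT iH.
have fin x : ~ Z x -> h x \is a fin_num.
  by move=> nZ; apply: contrapT => hf; apply: nZ; apply: hZ => /= /(_ I).
(* Setting the functions to 0 on the null set [Z] makes the sequence converge everywhere, so its
   limit is measurable. *)
pose T k x := if x \in Z then 0 else S (n k) x.
have mT k : measurable_fun setT (T k).
  apply: measurable_fun_if => //.
  - apply: (measurable_fun_bool true); rewrite setTI.
    by rewrite (_ : _ @^-1` _ = Z)//; apply/seteqP; split => x /=; rewrite ?inE//= => /asboolP.
  - exact: measurable_funTS (sS (n k)).1.
have cT x : cvgn (fun k => T k x).
  have [xZ|xZ] := boolP (x \in Z).
    rewrite (_ : (fun k => T k x) = (fun=> 0)); first exact: is_cvg_cst.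
    by apply/funext => k; rewrite /T xZ.
  rewrite (_ : (fun k => T k x) = (fun k => S (n k) x)); last first.
    by apply/funext => k; rewrite /T (negbTE xZ).
  move: xZ; rewrite notin_setE => /fin hf; set H := fine (h x).
  have H0 : 0 <= H by rewrite fine_ge0.
  have dle k : `|dd k x| <= Num.sqrt H * 2^-1 ^+ k.
    have h1 : ((4 ^+ k)%:E * ((dd k x) ^+ 2)%:E <= H%:E)%E.
      rewrite fineK//; apply: le_trans (nneseries_lim_ge (P := xpredT) (m := 0) k.+1 _) => //.
      by rewrite big_nat_recr//= leeDr// sume_ge0.
    rewrite -EFinM lee_fin in h1.
    rewrite -sqrtr_sqr -[leRHS]ger0_norm ?mulr_ge0 ?sqrtr_ge0 ?exprn_ge0 ?invr_ge0//.
    rewrite -sqrtr_sqr ler_wsqrtr// exprMn sqr_sqrtr// -exprM mulnC exprM.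
    rewrite (_ : 2^-1 ^+ 2 = 4^-1); last by field.
    by rewrite exprVn ler_pdivlMr ?exprn_gt0// mulrC.
  have cd : cvgn (series (fun k => dd k x)).
    apply: normed_cvg; apply: (@series_le_cvg _ _ (geometric (Num.sqrt H) 2^-1)) => //.
    - by move=> k /=.
    - by move=> k; rewrite /geometric/= mulr_ge0 ?sqrtr_ge0 ?exprn_ge0 ?invr_ge0.
    - by apply: is_cvg_geometric_series; rewrite ger0_norm ?invr_ge0// invf_lt1// ltr1n.
  have E k : S (n k) x = S (n 0%N) x + series (fun k => dd k x) k.
    elim: k => [|k IH]; first by rewrite /series/= big_geq// addr0.
    by rewrite seriesSr addrA -IH /dd addrC subrK.
  rewrite (_ : (fun k => S (n k) x) = (fun k => S (n 0%N) x + series (fun k => dd k x) k)); last exact/funext.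
  by apply: is_cvgD => //; exact: is_cvg_cst.
pose w x := limn (fun k => T k x).
have mw : measurable_fun setT w.
  by apply: (@measurable_fun_cvg _ _ _ _ T) => // x _; exact: cT.
have ST m k : (\int[mu]_x ((S m x - T k x) ^+ 2)%:E = \int[mu]_x ((S m x - S (n k) x) ^+ 2)%:E)%E.
  apply: ge0_ae_eq_integral => //.
  - by apply: measurable_sqr; apply: measurable_funB => //; exact: (sS m).1.
  - by apply: measurable_sqr; apply: measurable_funB => //; [exact: (sS m).1|exact: (sS (n k)).1].
  - by move=> x _; rewrite lee_fin sqr_ge0.
  - by move=> x _; rewrite lee_fin sqr_ge0.
  - exists Z; split => // x /= hx; apply: contrapT => nZ; apply: hx => _.
    by rewrite /T ifF//; apply/negbTE; rewrite notin_setE.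
(* Fatou's lemma along the subsequence transfers the Cauchy estimate to the limit. *)
have key eps : 0 < eps -> exists N, forall m, (N <= m)%N ->
     (\int[mu]_x ((S m x - w x) ^+ 2)%:E <= eps%:E)%E.
  move=> eps0; have [M HM] := cS _ eps0; exists M => m Mm.
  have mST k : measurable_fun setT (fun x => ((S m x - T k x) ^+ 2)%:E).
    by apply: measurable_sqr; apply: measurable_funB => //; exact: (sS m).1.
  have ST0 k x : [set: X] x -> (0 <= ((S m x - T k x) ^+ 2)%:E)%E.
    by rewrite lee_fin sqr_ge0.
  have := fatou mu measurableT mST ST0.
  have -> : (\int[mu]_x limn_einf (fun k => ((S m x - T k x) ^+ 2)%:E))%E =
     (\int[mu]_x ((S m x - w x) ^+ 2)%:E)%E.
    apply: eq_integral => x _; have c1 : ((S m x - T k x) ^+ 2)%:E @[k --> \oo] --> ((S m x - w x) ^+ 2)%:E.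
      apply: cvg_EFin; first exact: nearW.
      have c2 : (fun k => S m x - T k x) @ \oo --> S m x - w x.
        by apply: cvgB; [exact: cvg_cst|exact: cT].
      exact: (cvgM c2 c2).
    rewrite is_cvg_limn_einfE; first exact/cvg_lim.
    by apply/cvg_ex; eexists; exact: c1.
  move=> /le_trans; apply; apply: limn_einf_le; exists M => // k /= Mk.
  rewrite ST; apply: HM => //; exact: (leq_trans Mk).
exists w; split => //; last first.
  (* This keeps limits of functions that are extended by 0 outside a domain equal to 0 there. *)
  move=> x Sx; rewrite /w (_ : (fun k => T k x) = fun=> 0); first exact: lim_cst.
  by apply/funext => i; rewrite /T Sx; case: ifP.
have [M HM] := key 1 ltr01.
have i1 : sqint mu (fun x => S M x - w x).
  split; first by apply: measurable_funB => //; exact: (sS M).1.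
  apply/integrableP; split; first by apply: measurable_sqr; apply: measurable_funB => //; exact: (sS M).1.
  apply: le_lt_trans (ltry 1); apply: le_trans (HM M (leqnn M)).
  by rewrite le_eqVlt; apply/orP; left; apply/eqP; apply: eq_integral => x _ /=;
    rewrite ger0_norm ?sqr_ge0.
by have := sqintB (sS M) i1; congr sqint; apply/funext => x; rewrite subKr.
Qed.

End L2_completeness.

(** * Eigenfunction expansions *)

Section l2_series.
Context {R : realType}.
Implicit Types x y : nat -> R.

Lemma l2le_cvg x M : l2le x M ->
  cvgn (series (fun j => x j ^+ 2)) /\ limn (series (fun j => x j ^+ 2)) <= M ^+ 2.
Proof.
move=> [M0 hx]; have h n : series (fun j => x j ^+ 2) n <= M ^+ 2 by rewrite seriesEord/=; exact: hx.
have c : cvgn (series (fun j => x j ^+ 2)).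
  apply: nondecreasing_is_cvgn; last by exists (M ^+ 2) => _ [n _ <-]; exact: h.
  by apply: nondecreasing_series => n _ _; exact: sqr_ge0.
by split=> //; apply: limr_le => //; exact: nearW.
Qed.

Lemma l2le_of_cvg x (l : R) : series (fun j => x j ^+ 2) @ \oo --> l -> l2le x (Num.sqrt l).
Proof.
move=> c; have h n : \sum_(j < n) x j ^+ 2 <= l.
  have -> : \sum_(j < n) x j ^+ 2 = series (fun j => x j ^+ 2) n by rewrite seriesEord/=.
  rewrite -(cvg_lim _ c)//.
  apply: nondecreasing_cvgn_le; last by apply/cvg_ex; exists l.
  by apply: nondecreasing_series => i _ _; exact: sqr_ge0.
have l0 : 0 <= l by have := h 0%N; rewrite big_ord0.
by split=> [|n]; rewrite ?sqrtr_ge0// sqr_sqrtr.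
Qed.

Lemma sqrt_limn_le x M : l2le x M -> Num.sqrt (limn (series (fun j => x j ^+ 2))) <= M.
Proof.
move=> h; have [_ l] := l2le_cvg h; case: h => M0 _.
by rewrite -(ger0_norm M0) -sqrtr_sqr ler_wsqrtr.
Qed.

Lemma l2le_mul_cvg x y M N : l2le x M -> l2le y N ->
  cvgn (series (fun j => x j * y j)) /\ `|limn (series (fun j => x j * y j))| <= M * N.
Proof.
move=> hx hy; have [M0 sx] := hx; have [N0 sy] := hy.
have cs (a b : nat -> R) n : l2le a M -> l2le b N -> `|\sum_(j < n) a j * b j| <= M * N.
  move=> [_ ha] [_ hb]; rewrite ler_norml (finite_cauchy_schwarz M0 N0 (ha n) (hb n)) andbT.
  have ha' : \sum_(j < n) (- a j) ^+ 2 <= M ^+ 2 by under eq_bigr do rewrite sqrrN.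
  have := @finite_cauchy_schwarz _ n (fun j => - a j) b M N M0 N0 ha' (hb n).
  by under eq_bigr do rewrite mulNr; rewrite sumrN lerNl.
have habs (a : nat -> R) K : l2le a K -> l2le (fun j => `|a j|) K.
  move=> [K0 ha]; split => // n; have := ha n.
  by under [X in _ -> X <= _]eq_bigr do rewrite real_normK ?num_real//.
have c : cvgn (series (fun j => x j * y j)).
  apply: normed_cvg; apply: nondecreasing_is_cvgn.
    by apply: nondecreasing_series => n _ _; exact: normr_ge0.
  exists (M * N) => _ [n _ <-].
  have -> : [normed series (fun j => x j * y j)] n = \sum_(j < n) `|x j * y j|.
    by rewrite /normed_series_of /series/= big_mkord.
  rewrite (le_trans _ (cs _ _ n (habs _ _ hx) (habs _ _ hy)))//.
  rewrite (le_trans _ (ler_norm _))// le_eqVlt; apply/orP; left; apply/eqP.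
  by apply: eq_bigr => j _; rewrite normrM.
split => //; have cn := is_cvg_norm c.
rewrite -(cvg_lim _ (cvg_norm c))//; apply: limr_le; first exact: is_cvg_norm.
by apply: nearW => n; rewrite seriesEord/=; exact: cs.
Qed.

Lemma l2le_finite n (x : nat -> R) : (forall j, (n <= j)%N -> x j = 0) ->
  l2le x (Num.sqrt (\sum_(j < n) x j ^+ 2)).
Proof.
move=> x0; have s0 : 0 <= \sum_(j < n) x j ^+ 2 by apply: sumr_ge0 => j _; exact: sqr_ge0.
split=> [|N]; rewrite ?sqrtr_ge0// sqr_sqrtr//.
rewrite -!(big_mkord xpredT (fun j => x j ^+ 2)).
have [nN|Nn] := leqP n N.
  rewrite (big_cat_nat (n := n))//= [X in _ + X]big_nat_cond [X in _ + X]big1 ?addr0//.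
  by move=> j /andP[/andP[nj _] _]; rewrite x0// expr0n.
rewrite [leRHS](big_cat_nat (n := N) (p := n))//=; last exact: ltnW.
by rewrite lerDl; apply: sumr_ge0 => j _; exact: sqr_ge0.
Qed.

End l2_series.

Section spectral_theory.
Context {R : realType} {k : nat}.
Local Notation V := 'rV[R]_k.+1.
Local Notation X := (caratheodory_type (@lebesgue_outer R k)).
Local Notation lambda := (@lebesgue_rV R k).
Variables (D : set V) (m : nat -> R) (e : nat -> V -> R).
Local Notation L2 := (Lb D 2).
Local Notation "<< f , g >>" := (inner D f g).
Implicit Types (v w f g : V -> R) (c : nat -> R).

(** Extension by zero turns inner products over D into integrals over the whole space, where the
    results on square-integrable functions apply. *)
Definition ext0 f : X -> R := f \_ D.
Local Notation sq f := (sqint lambda (ext0 f)).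

Lemma L2E f : ns_mem L2 f <-> sq f. Proof. exact: L2P. Qed.

Lemma innerE f g : << f, g >> = ip lambda (ext0 f) (ext0 g).
Proof.
rewrite /inner Rintegral_mkcond; apply: eq_Rintegral => x _.
by rewrite /ext0 !patchE; case: ifP; rewrite ?mul0r.
Qed.

Lemma ext0B f g : ext0 (f - g) = (fun x => ext0 f x - ext0 g x).
Proof. by apply/funext => x; rewrite /ext0 !patchE; case: ifP; rewrite ?subr0. Qed.

Lemma ext0_lin a f g : ext0 (fun x => a * f x + g x) = (fun x => a * ext0 f x + ext0 g x).
Proof. by apply/funext => x; rewrite /ext0 !patchE; case: ifP; rewrite ?mulr0 ?addr0. Qed.

Lemma ext0_sum n c : ext0 (fun x => \sum_(j < n) c j * e j x) =
  (fun x => \sum_(j < n) c j * ext0 (e j) x).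
Proof.
apply/funext => x; rewrite /ext0 patchE; case: ifPn => xD.
  by apply: eq_bigr => j _; rewrite patchE xD.
by rewrite big1// => j _; rewrite patchE (negbTE xD) mulr0.
Qed.

Lemma L2B f g : ns_mem L2 f -> ns_mem L2 g -> ns_mem L2 (f - g).
Proof.
move=> /(L2E _).1 sf /(L2E _).1 sg; apply: (L2E _).2; rewrite ext0B.
exact: (sqintB sf sg).
Qed.

Lemma L2lin a f g : ns_mem L2 f -> ns_mem L2 g -> ns_mem L2 (fun x => a * f x + g x).
Proof.
move=> /(L2E _).1 sf /(L2E _).1 sg; apply: (L2E _).2; rewrite ext0_lin.
exact: (sqintD (sqintZ a sf) sg).
Qed.

Lemma L2_normE f : ns_mem L2 f -> ns_norm L2 f = Num.sqrt << f, f >>.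
Proof. by move=> /(L2E _).1 sf; rewrite innerE -Lnorm2E. Qed.

Lemma innerC f g : << f, g >> = << g, f >>. Proof. by rewrite !innerE ipC. Qed.

Lemma innerBl f g h : ns_mem L2 f -> ns_mem L2 g -> ns_mem L2 h ->
  << f - g, h >> = << f, h >> - << g, h >>.
Proof.
move=> /(L2E _).1 sf /(L2E _).1 sg /(L2E _).1 sh.
by rewrite !innerE ext0B; exact: (ipBl sf sg sh).
Qed.

Lemma inner_linl a f g h : ns_mem L2 f -> ns_mem L2 g -> ns_mem L2 h ->
  << fun x => a * f x + g x, h >> = a * << f, h >> + << g, h >>.
Proof.
move=> /(L2E _).1 sf /(L2E _).1 sg /(L2E _).1 sh.
rewrite !innerE ext0_lin -(ipZl a sf sh); exact: (ipDl (sqintZ a sf) sg sh).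
Qed.

Lemma inner_ge0 f : 0 <= << f, f >>. Proof. by rewrite innerE ip_ge0. Qed.

Lemma inner_le f g : ns_mem L2 f -> ns_mem L2 g -> `|<< f, g >>| <= ns_norm L2 f * ns_norm L2 g.
Proof.
move=> Lf Lg; rewrite !L2_normE// -sqrtrM ?inner_ge0// -sqrtr_sqr ler_wsqrtr//.
by rewrite !innerE; apply: ip_sqr_le; exact: (L2E _).1.
Qed.

Hypothesis eL2 : forall j, ns_mem L2 (e j).

Lemma L2_sum n c : ns_mem L2 (fun x => \sum_(j < n) c j * e j x).
Proof.
apply: (L2E _).2; rewrite ext0_sum.
exact: (sqint_sum n c (fun j => (L2E _).1 (eL2 j))).
Qed.

Lemma inner_suml n c h : ns_mem L2 h ->
  << fun x => \sum_(j < n) c j * e j x, h >> = \sum_(j < n) c j * << e j, h >>.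
Proof.
move=> /(L2E _).1 sh; rewrite innerE ext0_sum (ip_suml n c (fun j => (L2E _).1 (eL2 j)) sh).
by apply: eq_bigr => j _; rewrite innerE.
Qed.

Hypothesis orth : forall i j, << e i, e j >> = (i == j)%:R.

Lemma inner_sum_e n c i : << fun x => \sum_(j < n) c j * e j x, e i >> =
  if (i < n)%N then c i else 0.
Proof.
rewrite inner_suml//; case: ltnP => [lt_in|le_ni].
  rewrite (bigD1 (Ordinal lt_in))//= orth eqxx mulr1 big1 ?addr0// => j ji.
  by rewrite orth; have /negbTE-> : nat_of_ord j != i;
    [by apply: contra ji => /eqP ji; apply/eqP/val_inj|rewrite mulr0].
rewrite big1// => j _; rewrite orth; case: eqP => [ji|]; last by rewrite mulr0.
by have := ltn_ord j; rewrite ji ltnNge le_ni.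
Qed.

Lemma inner_sum_sum n c : << fun x => \sum_(j < n) c j * e j x, fun x => \sum_(j < n) c j * e j x >> =
  \sum_(j < n) c j ^+ 2.
Proof.
rewrite inner_suml; last exact: L2_sum.
by apply: eq_bigr => j _; rewrite innerC inner_sum_e ltn_ord expr2.
Qed.

Lemma inner_sumB n c w : ns_mem L2 w ->
  << (fun x => \sum_(j < n) c j * e j x) - w, (fun x => \sum_(j < n) c j * e j x) - w >> =
  << w, w >> - \sum_(j < n) << w, e j >> ^+ 2 + \sum_(j < n) (c j - << w, e j >>) ^+ 2.
Proof.
move=> Lw; have LS := L2_sum n c; set S := (fun x => \sum_(j < n) _) in LS *.
rewrite innerBl//; last exact: L2B.
rewrite [<< S, S - w >>]innerC [<< w, S - w >>]innerC !innerBl//.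
rewrite [<< w, S >>]innerC inner_sum_sum inner_suml//.
have -> : \sum_(j < n) (c j - << w, e j >>) ^+ 2 = \sum_(j < n) c j ^+ 2 -
    2 * \sum_(j < n) c j * << e j, w >> + \sum_(j < n) << w, e j >> ^+ 2.
  rewrite mulr_sumr -sumrN -!big_split/=; apply: eq_bigr => j _.
  by rewrite [<< e j, w >>]innerC; ring.
by move: (\sum_(j < n) << w, e j >> ^+ 2) => x; ring.
Qed.

Hypothesis compl : forall v, ns_mem L2 v -> L2_series D e (fun j => << v, e j >>) v.

(** With c_j = (v, e_j) the squared distance from v to its partial sum is (v, v) minus the partial
    sum of squares, and completeness sends it to 0. *)
Lemma parseval v : ns_mem L2 v -> series (fun j => << v, e j >> ^+ 2) @ \oo --> << v, v >>.
Proof.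
move=> Lv; have [_ h] := compl Lv.
have h2 := cvgM h h; rewrite mulr0 in h2.
have h3 : (fun n => << v, v >> - series (fun j => << v, e j >> ^+ 2) n) @ \oo --> (0 : R).
  rewrite [X in X @ \oo --> _](_ : _ =
    (fun n => ns_norm L2 ((fun x => \sum_(j < n) << v, e j >> * e j x) - v)) \*
    (fun n => ns_norm L2 ((fun x => \sum_(j < n) << v, e j >> * e j x) - v))); first exact: h2.
  apply/funext => n; pose S x := \sum_(j < n) << v, e j >> * e j x.
  transitivity (ns_norm L2 (S - v) * ns_norm L2 (S - v)); last by [].
  rewrite L2_normE; last by apply: L2B => //; exact: (L2_sum n (fun j => << v, e j >>)).
  rewrite -expr2 sqr_sqrtr ?inner_ge0// /S (inner_sumB n (fun j => << v, e j >>) Lv) seriesEord/=.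
  by rewrite [X in _ = _ + X]big1 ?addr0// => j _; rewrite subrr expr0n.
have h4 : (fun n => << v, v >> - (<< v, v >> - series (fun j => << v, e j >> ^+ 2) n)) @ \oo
    --> << v, v >> - 0.
  by apply: cvgB; [exact: cvg_cst|exact: h3].
rewrite subr0 in h4; rewrite (_ : series (fun j => << v, e j >> ^+ 2) = (fun n => << v, v >> -
  (<< v, v >> - series (fun j => << v, e j >> ^+ 2) n))); first exact: h4.
by apply/funext => n; rewrite subKr.
Qed.

Lemma L2_coef_l2le v : ns_mem L2 v -> l2le (fun j => << v, e j >>) (ns_norm L2 v).
Proof. by move=> Lv; rewrite L2_normE//; apply: l2le_of_cvg; exact: parseval. Qed.

Lemma L2_norm_le v M : ns_mem L2 v -> l2le (fun j => << v, e j >>) M -> ns_norm L2 v <= M.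
Proof.
move=> Lv h; rewrite L2_normE// -(cvg_lim _ (parseval Lv))//; exact: sqrt_limn_le.
Qed.

Lemma L2_norm_ge0 v : ns_mem L2 v -> 0 <= ns_norm L2 v.
Proof. by move=> Lv; rewrite L2_normE// sqrtr_ge0. Qed.

Lemma L2_series_coef c w : L2_series D e c w -> ns_mem L2 w /\ forall j, << w, e j >> = c j.
Proof.
move=> [Lw h]; split=> // j; apply/eqP; rewrite -subr_eq0 -normr_le0.
apply/ler_addgt0Pl => eps eps0; rewrite addr0.
have /cvgrPdist_le /(_ _ eps0) [N _ HN] := h.
have := HN (maxn N j.+1) (leq_maxl _ _); rewrite sub0r normrN => h1.
set n := maxn N j.+1 in h1; have jn : (j < n)%N by rewrite leq_maxr.
have LS : ns_mem L2 ((fun x => \sum_(j < n) c j * e j x) - w) by apply: L2B => //; exact: L2_sum.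
apply: le_trans (le_trans (l2le_coord j (L2_coef_l2le LS)) _); last exact: le_trans (ler_norm _) h1.
by rewrite innerBl//; [rewrite inner_sum_e jn distrC|exact: L2_sum].
Qed.

Lemma L2_coef_inj v w : ns_mem L2 v -> ns_mem L2 w -> (forall j, << v, e j >> = << w, e j >>) ->
  ae_in_D D (fun x => v x = w x).
Proof.
move=> Lv Lw h; have Lvw := L2B Lv Lw.
have z : << v - w, v - w >> = 0.
  apply/eqP; rewrite eq_le inner_ge0 andbT -sqrtr_eq0 eq_le sqrtr_ge0 andbT -L2_normE//.
  apply: L2_norm_le => //; split=> // n; rewrite big1 ?expr0n// => j _.
  by rewrite innerBl// h subrr expr0n.
have := ip_eq0_ae ((L2E _).1 Lvw); rewrite -innerE => /(_ z).
apply: filterS => x + Dx; rewrite /ext0 patchE mem_set// => /eqP.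
by rewrite [(v - w) x]/(v x - w x) subr_eq0 => /eqP.
Qed.

Lemma riesz_fischer c M : l2le c M -> exists w, L2_series D e c w.
Proof.
move=> hc; pose S n : X -> R := ext0 (fun x => \sum_(j < n) c j * e j x).
have sS n : sqint lambda (S n) by apply/L2E; exact: L2_sum.
have intE (f : V -> R) : sq f -> (\int[lambda]_x ((ext0 f x) ^+ 2)%:E = << f, f >>%:E)%E.
  move=> [mf i_f]; rewrite innerE /ip /Rintegral fineK.
    by apply: eq_integral => x _; rewrite expr2.
  by apply: (integrable_fin_num measurableT); apply: eq_integrable i_f => // x _ /=; rewrite expr2.
have SB a n : (n <= a)%N ->
    << (fun x => \sum_(j < a) c j * e j x) - (fun x => \sum_(j < n) c j * e j x),
       (fun x => \sum_(j < a) c j * e j x) - (fun x => \sum_(j < n) c j * e j x) >> =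
    \sum_(j < a) (l2tail n c j) ^+ 2.
  move=> na; rewrite -inner_sum_sum.
  suff -> : (fun x => \sum_(j < a) c j * e j x) - (fun x => \sum_(j < n) c j * e j x) =
    (fun x => \sum_(j < a) l2tail n c j * e j x) by [].
  apply/funext => x; rewrite -[LHS]/(\sum_(j < a) c j * e j x - \sum_(j < n) c j * e j x).
  rewrite -(big_mkord xpredT (fun j => c j * e j x)) -(big_mkord xpredT (fun j => c j * e j x)).
  rewrite -(big_mkord xpredT (fun j => l2tail n c j * e j x)).
  rewrite (big_cat_nat (n := n) (p := a))//= addrAC subrr add0r [RHS](big_cat_nat (n := n))//=.
  rewrite [X in _ = X + _]big_nat_cond [X in _ = X + _]big1 ?add0r => [|j /andP[/andP[_ jn] _]];
    last by rewrite /l2tail jn mul0r.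
  by apply: eq_big_nat => j /andP[nj _]; rewrite /l2tail ltnNge nj.
have cau eps : 0 < eps -> exists N, forall a b, (N <= a)%N -> (N <= b)%N ->
    (\int[lambda]_x ((S a x - S b x) ^+ 2)%:E <= eps%:E)%E.
  move=> eps0; have e0 : 0 < Num.sqrt eps by rewrite sqrtr_gt0.
  have [N [_ hN]] := l2le_tail_eventually hc e0; exists N => a b.
  wlog ba : a b / (b <= a)%N => [hw Na Nb|Na Nb].
    have [ba|/ltnW ab] := leqP b a; first exact: hw.
    apply: le_trans (hw b a ab Nb Na); rewrite le_eqVlt; apply/orP; left; apply/eqP.
    by apply: eq_integral => x _; rewrite -[S a x - _]opprB sqrrN.
  have -> : (\int[lambda]_x ((S a x - S b x) ^+ 2)%:E = (\sum_(j < a) (l2tail b c j) ^+ 2)%:E)%E.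
    have sAB := (L2E _).1 (L2B (L2_sum a c) (L2_sum b c)).
    by rewrite -(SB a b ba) -(intE _ sAB) ext0B.
  rewrite lee_fin -(@sqr_sqrtr _ eps) ?(ltW eps0)//; apply: le_trans (hN a).
  apply: ler_sum => j _; rewrite /l2tail; case: ltnP => jb; case: ltnP => // jN.
  - by rewrite expr0n sqr_ge0.
  - by move: (leq_trans jN Nb); rewrite ltnNge jb.
have [w [sw wD hw]] := L2_complete sS cau.
(* The limit vanishes off D since every partial sum does, so it is its own extension by zero. *)
have we : ext0 (w : V -> R) = w.
  apply/funext => x; rewrite /ext0 patchE; case: ifPn => // xD.
  by rewrite wD// => n; rewrite /S /ext0 patchE (negbTE xD).
have Lw : ns_mem L2 (w : V -> R) by apply: (L2E _).2; rewrite we.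
exists w; split=> //; apply/cvgrPdist_le => eps eps0.
have [N HN] := hw (eps ^+ 2) ltac:(by rewrite exprn_gt0).
exists N => // n Nn; have LS := L2B (L2_sum n c) Lw.
rewrite sub0r normrN L2_normE// ger0_norm ?sqrtr_ge0//.
rewrite -[leRHS]ger0_norm ?(ltW eps0)// -sqrtr_sqr ler_wsqrtr//.
have := HN n Nn; rewrite -lee_fin -intE; last exact: (L2E _).1.
by rewrite ext0B we.
Qed.

Lemma inner_series v w : ns_mem L2 v -> ns_mem L2 w ->
  series (fun j => << v, e j >> * << w, e j >>) @ \oo --> << v, w >>.
Proof.
move=> Lv Lw; have [_ h] := compl Lv.
have [c _] := l2le_mul_cvg (L2_coef_l2le Lv) (L2_coef_l2le Lw).
have hw : (fun n => ns_norm L2 ((fun x => \sum_(j < n) << v, e j >> * e j x) - v) *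
    ns_norm L2 w) @ \oo --> (0 : R).
  by rewrite -[X in _ --> X](mul0r (ns_norm L2 w)); apply: cvgM; [exact: h|exact: cvg_cst].
apply/cvgrPdist_le => eps eps0.
have /cvgrPdist_le /(_ _ eps0) := hw; apply: filterS => n.
rewrite sub0r normrN => hn; apply: (le_trans _ (le_trans (ler_norm _) hn)).
have LS := L2_sum n (fun j => << v, e j >>).
rewrite distrC seriesEord/=.
have -> : \sum_(j < n) << v, e j >> * << w, e j >> = << fun x => \sum_(j < n) << v, e j >> * e j x, w >>.
  by rewrite (inner_suml n (fun j => << v, e j >>) Lw); apply: eq_bigr => j _; rewrite [<< e j, w >>]innerC.
rewrite -innerBl//; apply: inner_le => //; exact: L2B.
Qed.

Hypotheses (m0 : 0 < m 0%N) (mle : nondecreasing_seq m).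

Let m_ge0 j : m 0%N <= m j. Proof. exact: mle. Qed.
Let m_gt0 j : 0 < m j. Proof. exact: lt_le_trans (m_ge0 j). Qed.

Definition coef v j := << v, e j >>.

(** [pow_op] is chosen by [xget] among functions equal almost everywhere; all have the same
    coefficients, through which the norm is computed. This and [Vpos_elim] translate between V_gamma
    and weighted l2. *)
Lemma Vpos_intro gam v M : ns_mem L2 v -> l2le (fun j => m j `^ gam * coef v j) M ->
  ns_mem (Vpos D m e gam) v /\ ns_norm (Vpos D m e gam) v <= M.
Proof.
move=> Lv h; have [w hw] := riesz_fischer h.
have ex : exists w, pow_op_rel D m e gam v w by exists w.
split; first by split.
rewrite -[ns_norm _ v]/(ns_norm L2 (pow_op D m e gam v)).
have := xgetPex 0 ex; rewrite -/(pow_op D m e gam v) => /L2_series_coef [Lp hp].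
by apply: L2_norm_le => //; apply: l2le_eq h => j; rewrite hp.
Qed.

Lemma Vpos_elim gam v : ns_mem (Vpos D m e gam) v ->
  ns_mem L2 v /\ l2le (fun j => m j `^ gam * coef v j) (ns_norm (Vpos D m e gam) v).
Proof.
move=> [Lv ex]; split=> //; rewrite -[ns_norm _ v]/(ns_norm L2 (pow_op D m e gam v)).
have := xgetPex 0 ex; rewrite -/(pow_op D m e gam v) => /L2_series_coef [Lp hp].
by apply: l2le_eq (L2_coef_l2le Lp) => j; rewrite hp.
Qed.

Lemma Vpos_lin gam a v w : ns_mem (Vpos D m e gam) v -> ns_mem (Vpos D m e gam) w ->
  ns_mem (Vpos D m e gam) (fun x => a * v x + w x).
Proof.
move=> /Vpos_elim[Lv hv] /Vpos_elim[Lw hw].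
have hav : l2le (fun j => m j `^ gam * (a * coef v j)) (`|a| * ns_norm (Vpos D m e gam) v).
  by apply: (l2le_dom (normr_ge0 a) _ hv) => j; rewrite mulrCA normrM.
have [|//] := @Vpos_intro gam _ (`|a| * ns_norm (Vpos D m e gam) v + ns_norm (Vpos D m e gam) w) (L2lin a Lv Lw).
apply: l2le_eq (l2le_add hav hw) => j.
by rewrite -mulrDr /coef inner_linl.
Qed.

Lemma Vpos_sum gam n c : ns_mem (Vpos D m e gam) (fun x => \sum_(j < n) c j * e j x) /\
  ns_norm (Vpos D m e gam) (fun x => \sum_(j < n) c j * e j x) <=
    Num.sqrt (\sum_(j < n) (m j `^ gam * c j) ^+ 2).
Proof.
apply: Vpos_intro; first exact: L2_sum.
have := @l2le_finite _ n (fun j => if (j < n)%N then m j `^ gam * c j else 0).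
have -> : \sum_(j < n) (if (j < n)%N then m j `^ gam * c j else 0) ^+ 2 =
  \sum_(j < n) (m j `^ gam * c j) ^+ 2 by apply: eq_bigr => j _; rewrite ltn_ord.
move=> h; apply: l2le_eq (h _) => [j|j nj]; last by rewrite ltnNge nj.
by rewrite /coef inner_sum_e; case: ifP; rewrite ?mulr0.
Qed.

Lemma Vpos_e gam j : ns_mem (Vpos D m e gam) (e j).
Proof.
have [h _] := Vpos_sum gam j.+1 (fun i => (i == j)%:R).
move: h; congr (ns_mem _ _); apply/funext => x.
rewrite big_ord_recr/= eqxx mul1r big1 ?add0r// => i _.
by rewrite ltn_eqF ?mul0r.
Qed.

(** The element of a dual space with given coefficients. It does not mention gamma, so one object
    serves every V_(-gamma) in which the coefficients are admissible. *)
Definition functional c : (V -> R) -> R := fun v => limn (series (fun j => c j * coef v j)).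

Lemma functional_e c j : functional c (e j) = c j.
Proof.
apply/cvg_lim => //; apply: cvg_near_cst; exists j.+1 => // n /= jn.
rewrite seriesEord/= (bigD1 (Ordinal jn))//= /coef orth eqxx mulr1 big1 ?addr0// => i ij.
rewrite orth eq_sym; have /negbTE-> : nat_of_ord i != j by apply: contra ij => /eqP ij; apply/eqP/val_inj.
by rewrite mulr0.
Qed.

Lemma functional_pairing gam c M v : l2le (fun j => m j `^ (- gam) * c j) M ->
  ns_mem (Vpos D m e gam) v -> cvgn (series (fun j => c j * coef v j)) /\
  `|functional c v| <= M * ns_norm (Vpos D m e gam) v.
Proof.
move=> hc /Vpos_elim[Lv hv]; have := l2le_mul_cvg hc hv.
rewrite (_ : (fun j => _) = (fun j => c j * coef v j))//; apply/funext => j.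
by rewrite mulrACA -powRDp// addrC subrr powRr0 mul1r.
Qed.

Lemma functional_Vneg gam c M : l2le (fun j => m j `^ (- gam) * c j) M ->
  ns_mem (Vneg D m e gam) (functional c).
Proof.
move=> hc; split; last by exists M => v Vv; have [] := functional_pairing hc Vv.
move=> a v w Vv Vw; have [cv _] := functional_pairing hc Vv; have [cw _] := functional_pairing hc Vw.
have [Lv _] := Vpos_elim Vv; have [Lw _] := Vpos_elim Vw.
apply/cvg_lim => //.
have h : (fun n => a * series (fun j => c j * coef v j) n + series (fun j => c j * coef w j) n) @ \oo
    --> a * functional c v + functional c w.
  by apply: cvgD; [apply: cvgMr; exact: cv|exact: cw].
move: h; apply: cvg_trans; apply: near_eq_cvg; apply: nearW => n /=.
rewrite !seriesEord/= mulr_sumr -big_split/=; apply: eq_bigr => j _.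
by rewrite /coef inner_linl//; ring.
Qed.

Lemma Vneg_eq_mem gam l1 l2 : Vneg_eq D m e gam l1 l2 -> ns_mem (Vneg D m e gam) l1 ->
  ns_mem (Vneg D m e gam) l2.
Proof.
move=> h [lin [C HC]]; split; last by exists C => v Vv; rewrite -h//; exact: HC.
move=> a v w Vv Vw; rewrite -(h _ Vv) -(h _ Vw) -(h _ (Vpos_lin a Vv Vw)); exact: lin.
Qed.

Lemma embed_functional v w : ns_mem L2 v -> ns_mem L2 w -> embed D v w = functional (coef v) w.
Proof. by move=> Lv Lw; apply/esym/cvg_lim => //; exact: inner_series. Qed.

Lemma embed_Vneg gam v : 0 <= gam -> ns_mem L2 v -> ns_mem (Vneg D m e gam) (embed D v).
Proof.
move=> g0 Lv; have h : l2le (fun j => m j `^ (- gam) * coef v j) (m 0%N `^ (- gam) * ns_norm L2 v).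
  apply: (l2le_dom (powR_ge0 _ _) _ (L2_coef_l2le Lv)) => j.
  by rewrite normrM ger0_norm ?powR_ge0// ler_wpM2r//; exact: lam_powN_le.
apply: Vneg_eq_mem (functional_Vneg h) => w /Vpos_elim[Lw _].
by rewrite embed_functional.
Qed.

Lemma Vneg_normE gam (l : (V -> R) -> R) : ns_norm (Vneg D m e gam) l =
  Num.sqrt (limn (series (fun j => (m j `^ (- gam) * l (e j)) ^+ 2))).
Proof.
rewrite /=; congr (Num.sqrt (limn (series _))); apply/funext => j.
rewrite exprMn mulrC; congr (_ * _).
by rewrite expr2 -powRDp//; congr (_ `^ _); ring.
Qed.

Lemma Vneg_norm_le gam (l : (V -> R) -> R) M : l2le (fun j => m j `^ (- gam) * l (e j)) M ->
  ns_norm (Vneg D m e gam) l <= M.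
Proof. by move=> h; rewrite Vneg_normE; exact: sqrt_limn_le. Qed.

Lemma Vneg_norm_l2le gam (l : (V -> R) -> R) M : l2le (fun j => m j `^ (- gam) * l (e j)) M ->
  l2le (fun j => m j `^ (- gam) * l (e j)) (ns_norm (Vneg D m e gam) l).
Proof. by move=> h; rewrite Vneg_normE; apply: l2le_of_cvg; have [] := l2le_cvg h. Qed.

(** Testing l on a finite combination turns its boundedness into S <= C sqrt S, where S is the
    partial sum of squares; hence S <= C^2. *)
Lemma Vneg_l2le gam (l : (V -> R) -> R) : ns_mem (Vneg D m e gam) l ->
  l2le (fun j => m j `^ (- gam) * l (e j)) (ns_norm (Vneg D m e gam) l).
Proof.
move=> [lin [C HC]]; pose y j := m j `^ (- gam) * l (e j).
have l0 : l 0 = 0.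
  have V0 : ns_mem (Vpos D m e gam) 0.
    have [h _] := Vpos_sum gam 0 (fun=> 0); move: h; congr (ns_mem _ _).
    by apply/funext => x; rewrite big_ord0.
  have := lin 1 0 0 V0 V0; rewrite (_ : (fun x => _) = 0); last first.
    by apply/funext => x; rewrite mulr0 add0r.
  by rewrite mul1r => /eqP; rewrite -subr_eq subrr => /eqP <-.
have lsum n c : l (fun x => \sum_(j < n) c j * e j x) = \sum_(j < n) c j * l (e j).
  elim: n => [|n IH].
    by rewrite big_ord0 -[RHS]l0; congr l; apply/funext => x; rewrite big_ord0.
  rewrite big_ord_recr/= -IH addrC -lin; [|exact: Vpos_e|by have [] := Vpos_sum gam n c].
  by congr l; apply/funext => x; rewrite big_ord_recr/= addrC.
have bd n : \sum_(j < n) y j ^+ 2 <= C ^+ 2.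
  (* The Riesz representative of l in V_gamma, up to truncation: its pairing with l and its squared
     norm are both the partial sum of squares. *)
  pose c j := m j `^ (- gam) * y j.
  have [Vc Nc] := Vpos_sum gam n c.
  have E1 : l (fun x => \sum_(j < n) c j * e j x) = \sum_(j < n) y j ^+ 2.
    by rewrite lsum; apply: eq_bigr => j _; rewrite /c mulrAC expr2.
  have E2 : \sum_(j < n) (m j `^ gam * c j) ^+ 2 = \sum_(j < n) y j ^+ 2.
    by apply: eq_bigr => j _; rewrite /c mulrA -powRDp// subrr powRr0 mul1r.
  have s0 : 0 <= \sum_(j < n) y j ^+ 2 by apply: sumr_ge0 => j _; exact: sqr_ge0.
  have := HC _ Vc; rewrite E1 ger0_norm// => h; rewrite E2 in Nc.
  move: (\sum_(j < n) y j ^+ 2) s0 h Nc => S S0 h Nc.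
  have nn0 : 0 <= ns_norm (Vpos D m e gam) (fun x => \sum_(j < n) c j * e j x).
    by have [_ []] := Vpos_elim Vc.
  move: (ns_norm _ _) nn0 h Nc => N N0 h Nc.
  have N2 : N ^+ 2 <= S by rewrite -(sqr_sqrtr S0) ler_pXn2r ?nnegrE ?sqrtr_ge0.
  have [->|Sn0] := eqVneq S 0; first exact: sqr_ge0.
  have Sp : 0 < S by rewrite lt0r Sn0.
  rewrite -(ler_pM2r Sp) -expr2; apply: (@le_trans _ _ ((C * N) ^+ 2)).
    by rewrite ler_pXn2r ?nnegrE// (le_trans S0).
  by rewrite exprMn ler_wpM2l ?sqr_ge0.
have hy : l2le y `|C| by split => // n; rewrite real_normK ?num_real.
exact: Vneg_norm_l2le hy.
Qed.

End spectral_theory.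

Import HBNNSimple.
(** * Bochner spaces *)

Section integrals_off_null_sets.
Context d (T : measurableType d) {R : realType} (mu : {measure set T -> \bar R}).
Variable N : set T.
Hypotheses (mN : measurable N) (N0 : mu N = 0%E).

(** A simple function below f is set to 0 on N, which keeps its integral and puts it below g;
    neither f nor g has to be measurable. *)
Lemma ge0_le_integral_off (f g : T -> \bar R) : (forall x, 0 <= f x)%E ->
  (forall x, 0 <= g x)%E -> (forall x, ~ N x -> (f x <= g x)%E) ->
  (\int[mu]_x f x <= \int[mu]_x g x)%E.
Proof.
move=> f0 g0 fg; rewrite (ge0_integralTE _ f0).
apply: ge_ereal_sup => _ [h /= hf <-]; rewrite -integralT_nnsfun.
pose h' x : \bar R := if x \in N then 0%E else (h x)%:E.
have mh : measurable_fun setT (fun x => (h x)%:E) by exact/measurable_EFinP.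
have mh' : measurable_fun setT h'.
  apply: measurable_fun_if => //.
  - apply: (measurable_fun_bool true); rewrite setTI.
    by rewrite (_ : _ @^-1` _ = N)//; apply/seteqP; split => x /=; rewrite ?inE//= => /asboolP.
  - exact: measurable_funTS.
have -> : (\int[mu]_x (h x)%:E = \int[mu]_x h' x)%E.
  apply: ge0_ae_eq_integral => //.
  - by move=> x _; rewrite lee_fin.
  - by move=> x _; rewrite /h'; case: ifP => // _; rewrite lee_fin.
  - exists N; split => // x /= hx; apply: contrapT => nN; apply: hx => _.
    by rewrite /h' ifF//; apply/negbTE; rewrite notin_setE.
apply: ge0_le_integral_nomeas => x; rewrite /h'; case: ifPn => //.
  by move=> _; rewrite lee_fin.
by rewrite notin_setE => nN; exact: le_trans (hf x) (fg x nN).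
Qed.

Lemma Rintegral_off (D : set T) (f g : T -> R) : (forall x, D x -> ~ N x -> f x = g x) ->
  \int[mu]_(x in D) f x = \int[mu]_(x in D) g x.
Proof.
move=> fg; rewrite Rintegral_mkcond [RHS]Rintegral_mkcond /Rintegral; apply: congr1.
have fg' x : ~ N x -> (f \_ D) x = (g \_ D) x.
  by move=> nN; rewrite !patchE; case: ifPn => // /set_mem Dx; exact: fg.
rewrite integralE [RHS]integralE; congr (_ - _)%E; apply/eqP; rewrite eq_le;
  apply/andP; split; apply: ge0_le_integral_off => // x nN.
- by rewrite !funeposE fg'.
- by rewrite !funeposE fg'.
- by rewrite !funenegE fg'.
- by rewrite !funenegE fg'.
Qed.

End integrals_off_null_sets.

Section simple_functions.
Context {R : realType}.

Definition simp (Y : Type) (s : R -> Y) :=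
  finite_set (range s) /\ forall y, measurable (s @^-1` [set y]).

Lemma simp_cst (Y : Type) (y : Y) : simp (fun=> y).
Proof.
split; first by apply: (sub_finite_set (B := [set y])) => [_ [x _ <-]//|]; exact: finite_set1.
move=> z; have [->|yz] := pselect (y = z).
  by rewrite (_ : _ @^-1` _ = setT)//; apply/seteqP; split.
by rewrite (_ : _ @^-1` _ = set0)//; apply/seteqP; split.
Qed.

Lemma simp_comp (Y Z : Type) (phi : Y -> Z) (s : R -> Y) : simp s -> simp (phi \o s).
Proof.
move=> [fs ms]; split; first by have := finite_image phi fs; rewrite image_comp.
move=> z; rewrite (_ : _ @^-1` _ = \bigcup_(y in range s `&` phi @^-1` [set z]) (s @^-1` [set y])).
  apply: fin_bigcup_measurable => [|y _]; last exact: ms.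
  by apply: sub_finite_set fs => y [].
apply/seteqP; split => x /=; first by move=> sx; exists (s x) => //; split => //; exists x.
by move=> [y [_ /= yz] /= ->].
Qed.

Lemma simp_pair (Y Z : Type) (s : R -> Y) (u : R -> Z) : simp s -> simp u ->
  simp (fun t => (s t, u t)).
Proof.
move=> [fs ms] [fu mu]; split.
  apply: (sub_finite_set (B := range s `*` range u)); last exact: finite_setX.
  by move=> _ [x _ <-]; split => /=; exists x.
move=> [y z]; rewrite (_ : _ @^-1` _ = s @^-1` [set y] `&` u @^-1` [set z]); first exact: measurableI.
by apply/seteqP; split => x /= [-> ->].
Qed.

Lemma simp_trunc n (s : nat -> R -> R) : (forall j, simp (s j)) ->
  simp (fun t j => if (j < n)%N then s j t else 0).
Proof.
move=> hs; elim: n => [|n IH]; first by have := simp_cst (fun _ : nat => (0 : R)); congr simp; apply/funext => t; apply/funext.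
have := simp_comp (fun y j => if (j < n)%N then y.1 j else if j == n then y.2 else 0)
  (simp_pair IH (hs n)).
congr simp; apply/funext => t; apply/funext => j /=; rewrite ltnS.
by case: (ltngtP j n) => // ->.
Qed.

Lemma simp_measurable (s : R -> R) : simp s -> measurable_fun setT s.
Proof.
move=> [fs ms] _ Y mY; rewrite setTI.
rewrite (_ : _ @^-1` _ = \bigcup_(y in range s `&` Y) (s @^-1` [set y])).
  apply: fin_bigcup_measurable => [|y _]; last exact: ms.
  by apply: sub_finite_set fs => y [].
apply/seteqP; split => x /=; first by move=> sx; exists (s x) => //; split => //; exists x.
by move=> [y [_ Yy] /= ->].
Qed.

(** The error bound by |x| is what controls tails of coefficient sequences when every coordinate is
    approximated separately. *)
Lemma simp_approx (x : R -> R) : measurable_fun setT x -> exists s : nat -> R -> R,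
  [/\ forall n, simp (s n), forall n t, `|x t - s n t| <= `|x t| &
      forall t, s n t @[n --> \oo] --> x t].
Proof.
move=> mx.
have approx (y : R -> R) : measurable_fun setT y -> (forall t, 0 <= y t) ->
    exists s : nat -> R -> R, [/\ forall n, simp (s n), forall n t, 0 <= s n t <= y t &
      forall t, s n t @[n --> \oo] --> y t].
  move=> my y0; have mE : measurable_fun setT (EFin \o y) by exact/measurable_EFinP.
  pose g := nnsfun_approx measurableT mE.
  have c t : (g n t)%:E @[n --> \oo] --> (y t)%:E.
    by apply: cvg_nnsfun_approx => // z _; rewrite lee_fin.
  have c' t : g n t @[n --> \oo] --> y t by have /fine_cvgP[_] := c t.
  exists (fun n t => g n t); split => //.
  move=> n t; rewrite fun_ge0/=.
  rewrite -(cvg_lim _ (c' t))//; apply: (nondecreasing_cvgn_le (u_ := fun n => g n t)).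
    by move=> i j ij; have := nd_nnsfun_approx measurableT mE ij => /lefP; apply.
  by apply/cvg_ex; exists (y t); exact: c'.
have [a [sa ba ca]] := approx _ (measurable_posp mx) (posp_ge0 x).
have mNx : measurable_fun setT (fun t => - x t) by exact: measurableT_comp.
have [b [sb bb cb]] := approx _ (measurable_posp mNx) (posp_ge0 _).
exists (fun n t => a n t - b n t); split.
- by move=> n; exact: (simp_comp (fun z => z.1 - z.2) (simp_pair (sa n) (sb n))).
- move=> n t; have /andP[a0 ap] := ba n t; have /andP[b0 bp] := bb n t.
  move: ap bp; rewrite /posp.
  have [x0|x0] := leP 0 (x t).
    have h : - x t <= 0 by rewrite oppr_le0.
    rewrite (max_idPr h) => ap bp.
    by rewrite (ger0_norm x0) ler_norml; apply/andP; split; lra.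
  have h : 0 <= - x t by rewrite oppr_ge0 ltW.
  rewrite (max_idPl h) => ap bp.
  by rewrite (ltr0_norm x0) ler_norml; apply/andP; split; lra.
- move=> t; rewrite [X in _ --> X]posp_sub.
  by apply: cvgB; [exact: ca|exact: cb].
Qed.

End simple_functions.

Section bochner_curves.
Context {R : realType} {X : zmodType}.
Local Notation mu := (@lebesgue_measure R).
Variables (T : R) (B : nspace R X).

(* [cmb n y] stands for [sum_(j < n) y_j e_j]; the weights [om] describe the
   norm of [B] on coefficient sequences. *)
Lemma curve_strongly_measurable (cmb : nat -> (nat -> R) -> X) (om : nat -> R)
    (u : R -> X) (x : nat -> R -> R) (G : R -> R) :
  (forall n y, ns_mem B (cmb n y)) -> (forall j, 0 <= om j) ->
  (forall j, measurable_fun setT (x j)) ->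
  (forall n y y', (forall j, (j < n)%N -> y j = y' j) -> cmb n y = cmb n y') ->
  (forall t, t \in `]0, T[ -> ns_mem B (u t)) ->
  (forall t, t \in `]0, T[ -> l2le (fun j => om j * x j t) (G t)) ->
  (forall t n y, t \in `]0, T[ -> 0 <= ns_norm B (cmb n y - u t)) ->
  (forall t n y M, t \in `]0, T[ -> l2le (fun j => om j * ((if (j < n)%N then y j else 0) - x j t)) M ->
     ns_norm B (cmb n y - u t) <= M) ->
  strongly_measurable T B u.
Proof.
move=> mcmb om0 mx cmbE mu_ hG n0 hn.
have [s hs] := choice (fun j => simp_approx (mx j)).
exists (fun n t => cmb n (fun j => if (j < n)%N then s j n t else 0)).
  move=> n; have sj j : simp (s j n) by have [] := hs j.
  have [h1 h2] := simp_comp (cmb n) (simp_trunc n sj).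
  by split => // t; exact: mcmb.
apply: aeW => t tT; split; first exact: mu_.
apply/cvgrPdist_le => eps eps0; have e2 : 0 < eps / 2 by rewrite divr_gt0.
(* Beyond N the error is dominated by the tail of the curve itself; the finitely many remaining
   coordinates converge. *)
have [N hN] := l2le_tail_eventually (hG t tT) e2.
pose z n j := om j * ((if (j < n)%N then s j n t else 0) - x j t).
have zx n j : `|z n j| <= `|om j * x j t|.
  rewrite /z !normrM ler_wpM2l//; case: ifP => _; last by rewrite sub0r normrN.
  by rewrite distrC; have [_ h _] := hs j.
have e2N : 0 < eps / 2 / N.+1%:R by rewrite divr_gt0.
have head k : \forall n \near \oo, forall j, (j < k)%N -> `|z n j| <= eps / 2 / N.+1%:R.
  elim: k => [|k IH]; first exact: nearW.
  have omk : 0 < om k + 1 by rewrite ltr_wpDl.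
  have [_ _ /(_ t) c] := hs k.
  have /cvgrPdist_le /(_ _ (divr_gt0 e2N omk)) := c => [[M1 _ HM1]].
  have [M2 _ HM2] := IH.
  exists (maxn k.+1 (maxn M1 M2)) => // n /=; rewrite !geq_max => /and3P[kn M1n M2n] j.
  rewrite ltnS leq_eqVlt => /predU1P[->|jk]; last exact: HM2.
  have := HM1 n M1n => /= h; rewrite /z kn normrM (ger0_norm (om0 k)) distrC.
  apply: le_trans (ler_wpM2l (om0 k) h) _.
  by rewrite mulrCA ler_piMr ?(ltW e2N)// ler_pdivrMr// mul1r lerDl.
have [M _ HM] := head N; exists M => // n /= Mn.
rewrite sub0r normrN ger0_norm ?n0//; apply: hn => //.
have h1 := @l2le_head _ N (z n) (eps / 2) (ltW e2) (HM n Mn).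
have h2 : l2le (l2tail N (z n)) (1 * (eps / 2)).
  apply: (l2le_dom ler01 _ hN) => j; rewrite mul1r /l2tail; case: ifP => // _.
have := l2le_add h1 h2; have -> : eps / 2 + 1 * (eps / 2) = eps by field.
by apply: l2le_eq => j; rewrite subrK /z; case: ifP.
Qed.

Lemma Bochner_norm_le (p : R) (f : R -> X) (h : R -> R) (N : set R) : 0 < p ->
  measurable N -> mu N = 0%E -> (forall t, 0 <= h t) ->
  (forall t, t \in `]0, T[ -> ~ N t -> `|ns_norm B (f t)| <= h t) ->
  (Bochner_norm T B p f <= (\int[mu]_t ((h t) `^ p)%:E) `^ p^-1)%E.
Proof.
move=> p0 mN N0 h0 hf; rewrite /Bochner_norm unlock; apply: gt0_ler_poweR.
- by rewrite invr_ge0 ltW.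
- by rewrite in_itv/= leey andbT; apply: integral_ge0 => t _; rewrite lee_fin powR_ge0.
- by rewrite in_itv/= leey andbT; apply: integral_ge0 => t _; rewrite lee_fin powR_ge0.
apply: (@ge0_le_integral_off _ _ R mu N mN N0) => t; first by rewrite lee_fin powR_ge0.
  by rewrite lee_fin powR_ge0.
move=> nN; rewrite /= patchE; case: ifPn => [tT|_]; last first.
  by rewrite normr0 powR0 ?lt0r_neq0// lee_fin powR_ge0.
rewrite lee_fin ge0_ler_powR ?nnegrE ?(ltW p0)//; apply: hf => //.
by move: tT; rewrite mem_setE.
Qed.

End bochner_curves.

(** * Coefficients of a Bochner integrable source *)

Section source_of_curve.
Context {R : realType} {k : nat}.
Local Notation V := 'rV[R]_k.+1.
Local Notation mu := (@lebesgue_measure R).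
Variables (D : set V) (e : nat -> V -> R).
Local Notation L2 := (Lb D 2).
Hypothesis eL2 : forall j, ns_mem L2 (e j).
Hypothesis orth : forall i j, inner D (e i) (e j) = (i == j)%:R.
Hypothesis compl : forall v, ns_mem L2 v -> L2_series D e (fun j => inner D v (e j)) v.

Lemma coef_dist_le v w j : ns_mem L2 v -> ns_mem L2 w ->
  `|inner D v (e j) - inner D w (e j)| <= ns_norm L2 (v - w).
Proof.
move=> Lv Lw; rewrite -innerBl//.
exact: (l2le_coord j (L2_coef_l2le eL2 orth compl (L2B Lv Lw))).
Qed.

Lemma L2_norm_dist v w : ns_mem L2 v -> ns_mem L2 w ->
  `|ns_norm L2 v - ns_norm L2 w| <= ns_norm L2 (v - w).
Proof.
have tri f g : ns_mem L2 f -> ns_mem L2 g -> ns_norm L2 f <= ns_norm L2 (f - g) + ns_norm L2 g.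
  move=> Lf Lg; apply: (L2_norm_le eL2 orth compl Lf).
  have := l2le_add (L2_coef_l2le eL2 orth compl (L2B Lf Lg)) (L2_coef_l2le eL2 orth compl Lg).
  by apply: l2le_eq => j; rewrite innerBl// subrK.
move=> Lv Lw; have h1 := tri v w Lv Lw; have h2 := tri w v Lw Lv.
have E : ns_norm L2 (w - v) = ns_norm L2 (v - w).
  rewrite !L2_normE; try exact: L2B.
  congr Num.sqrt; rewrite !innerE; apply: eq_Rintegral => x _.
  by rewrite !ext0B -[ext0 D w x - _]opprB mulrNN.
rewrite E in h2; rewrite ler_norml; apply/andP; split; move: h1 h2;
  move: (ns_norm _ _) (ns_norm _ _) (ns_norm _ _) => a b c; lra.
Qed.

(** Coefficients and norms of the simple approximants converge off a null set, so their limits, cut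
    off there, are measurable representatives. *)
Lemma source_of_BochnerL (T P : R) (F : R -> V -> R) : 0 < P ->
  ns_mem (BochnerL T L2 P) F -> exists f g Z,
  [/\ measurable (Z : set R), mu Z = 0%E, source P f g (ns_norm (BochnerL T L2 P) F) &
    forall t, t \in `[0, T] -> ~ Z t -> [/\ t \in `]0, T[, ns_mem L2 (F t) &
      forall j, f j t = inner D (F t) (e j)]].
Proof.
move=> P0 [[s hs [Z0 [mZ0 Z00 hZ0]]] fin].
(* The endpoints are added because [O1] integrates over closed intervals while F is controlled on
   the open one. *)
pose Z := Z0 `|` [set 0] `|` [set T].
have mZ : measurable Z by apply: measurableU => //; exact: measurableU.
have Znull : mu Z = 0%E.
  have z1 := lebesgue_measure_set1 (0 : R); have zT := lebesgue_measure_set1 T.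
  apply: null_set_setU => //; first exact: measurableU.
  exact: null_set_setU.
pose A : set R := `]0, T[%classic `\` Z.
have mA : measurable A by apply: measurableD => //; exact: measurable_itv.
have AF t : A t -> (t \in `]0, T[) /\ ns_mem L2 (F t) /\
    ((fun n => ns_norm L2 (s n t - F t)) @ \oo --> 0).
  move=> [tT nZ]; split => //.
  have : ~ Z0 t by move=> Zt; apply: nZ; left; left.
  by move=> nZ0; apply: contrapT => h; apply: nZ0; apply: hZ0 => /= /(_ tT).
have Ls n t : ns_mem L2 (s n t) by have [] := hs n.
have simps n : simp (s n) by have [] := hs n.
pose cut (y : R -> R) : R -> R := y \_ A.
have mcut (y : nat -> R -> R) (z : R -> R) : (forall n, simp (y n)) ->
    (forall t, A t -> y n t @[n --> \oo] --> z t) -> measurable_fun setT (cut z).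
  move=> sy cy; apply: (@measurable_fun_cvg _ _ _ _ (fun n => cut (y n))).
    move=> n; apply/(measurable_restrictT _ mA); apply: measurable_funTS.
    exact: simp_measurable.
  move=> t _; rewrite /cut; have [tA|tA] := pselect (A t).
    rewrite patchE mem_set//; have := cy t tA; apply: cvg_trans.
    by apply: near_eq_cvg; apply: nearW => n; rewrite patchE mem_set.
  rewrite patchE memNset//; apply: cvg_near_cst; apply: nearW => n.
  by rewrite patchE memNset.
have cnorm (y : nat -> R) (z : R) (d : nat -> R) : d @ \oo --> 0 ->
    (forall n, `|y n - z| <= d n) -> y @ \oo --> z.
  move=> d0 h; apply/cvgrPdist_le => eps eps0.
  have /cvgrPdist_le /(_ _ eps0) := d0; apply: filterS => n /=.
  rewrite sub0r normrN distrC => hn; apply: le_trans (h n) _.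
  exact: le_trans (ler_norm _) hn.
pose f j := cut (fun t => inner D (F t) (e j)).
pose g := cut (fun t => ns_norm L2 (F t)).
exists f, g, Z; split => //; last first.
  move=> t tT nZ; have tA : A t.
    split => //=; move: tT; rewrite !in_itv/= => /andP[]; rewrite !le_eqVlt.
    move=> /predU1P[t0|->]/= h; first by exfalso; apply: nZ; left; right.
    by case/predU1P: h => // tT; exfalso; apply: nZ; right.
  have [h1 [h2 _]] := AF t tA; split => // j.
  by rewrite /f /cut patchE mem_set.
split.
- move=> j; apply: (mcut (fun n t => inner D (s n t) (e j))).
    by move=> n; exact: (simp_comp (fun v => inner D v (e j)) (simps n)).
  move=> t /AF [_ [LF c]]; apply: (cnorm _ _ _ c) => n; exact: coef_dist_le.
- apply: (mcut (fun n t => ns_norm L2 (s n t))).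
    by move=> n; exact: (simp_comp (ns_norm L2) (simps n)).
  move=> t /AF [_ [LF c]]; apply: (cnorm _ _ _ c) => n; exact: L2_norm_dist.
- move=> t; rewrite /f /g /cut; have [tA|tA] := pselect (A t).
    have [_ [LF _]] := AF t tA; rewrite patchE mem_set//.
    apply: l2le_eq (L2_coef_l2le eL2 orth compl LF) => j; by rewrite patchE mem_set.
  rewrite patchE memNset//; split => // n; rewrite big1 ?expr0n// => j _.
  by rewrite patchE memNset// expr0n.
- move=> t t0; rewrite /g /cut patchE memNset// => -[/=]; rewrite in_itv/= => /andP[].
  by rewrite ltNge t0.
- by rewrite fine_ge0// Lnorm_ge0.
- have B0 : (0 <= Bochner_norm T L2 P F)%E by exact: Lnorm_ge0.
  have Bf : Bochner_norm T L2 P F \is a fin_num by rewrite ge0_fin_numE.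
  rewrite -[ns_norm _ F]/(fine (Bochner_norm T L2 P F)) -poweR_EFin fineK//.
  rewrite /Bochner_norm powR_Lnorm ?lt0r_neq0//.
  apply: ge0_le_integral_nomeas => t; first by rewrite lee_fin powR_ge0.
  rewrite /g /cut /= lee_fin; have [tA|tA] := pselect (A t); last first.
    by rewrite patchE memNset// powR0 ?lt0r_neq0// powR_ge0.
  have [tT [LF _]] := AF t tA.
  rewrite !patchE !mem_set// ger0_norm//.
  exact: L2_norm_ge0.
Qed.

End source_of_curve.

(** * Time integrals of the bound for the derivative *)

Section power_integral.
Context {R : realType}.
Local Notation mu := (@lebesgue_measure R).

Lemma powR_add_le (x y b : R) : 0 <= x -> 0 <= y -> 0 < b ->
  (x + y) `^ b <= 2 `^ b * (x `^ b + y `^ b).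
Proof.
move=> x0 y0 b0; wlog yx : x y x0 y0 / y <= x => [hw|].
  have [yx|/ltW xy] := leP y x; first exact: hw.
  by rewrite addrC [X in _ * X]addrC; exact: hw.
apply: (@le_trans _ _ ((2 * x) `^ b)).
  by apply: ge0_ler_powR; rewrite ?nnegrE ?(ltW b0) ?mulr_ge0 ?addr_ge0//; lra.
by rewrite powRM// ler_wpM2l ?powR_ge0// lerDl powR_ge0.
Qed.

(** Either x <= N, or (x/N)^b <= (x/N)^P. Scaling by N makes the resulting L^b estimate homogeneous,
    as a linear norm bound requires. *)
Lemma powR_le_interp (x N b P : R) : 0 <= x -> 0 < N -> 0 < b -> b <= P ->
  x `^ b <= N `^ b + N `^ b * N `^ (- P) * x `^ P.
Proof.
move=> x0 N0 b0 bP; have [xN|Nx] := leP x N.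
  apply: (@le_trans _ _ (N `^ b)); first by apply: ge0_ler_powR; rewrite ?nnegrE// ltW.
  by rewrite lerDl !mulr_ge0 ?powR_ge0.
apply: (@le_trans _ _ (N `^ b * N `^ (- P) * x `^ P)); last by rewrite lerDr powR_ge0.
have xp : 0 < x := lt_trans N0 Nx.
have -> : x `^ P = x `^ b * x `^ (P - b) by rewrite -powRDp// addrC subrK.
have -> : N `^ b * N `^ (- P) = N `^ (- (P - b)) by rewrite -powRDp//; congr (_ `^ _); ring.
rewrite mulrCA ler_peMr ?powR_ge0// powRN mulrC ler_pdivlMr ?powR_gt0// mul1r.
by apply: ge0_ler_powR; rewrite ?nnegrE ?subr_ge0// ltW.
Qed.

(** L^b norm over ]0, T[ of c g(t) + M t^(-a), where the factor [kk 1 (T - t)] cuts at T: b <= P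
    puts g in L^b, and b a < 1 makes the power integrable. *)
Lemma power_integral_bound (T b P a c : R) : 0 < T -> 0 < b -> b <= P -> b * a < 1 -> 0 <= c ->
  exists2 K, 0 <= K & forall (g : R -> R) N M, measurable_fun setT g -> (forall t, 0 <= g t) ->
  (forall t, t <= 0 -> g t = 0) -> 0 <= N -> 0 <= M ->
  (\int[mu]_t (g t `^ P)%:E <= (N `^ P)%:E)%E ->
  ((\int[mu]_t ((kk 1 (T - t) * (c * g t + M * cpow (1 - a) t)) `^ b)%:E) `^ b^-1
    <= (K * (N + M))%:E)%E.
Proof.
move=> T0 b0 bP ba c0; have ba0 : 0 < 1 - b * a by rewrite subr_gt0.
pose C3 := T `^ (1 - b * a) / (1 - b * a).
have C30 : 0 <= C3 by rewrite divr_ge0 ?powR_ge0// ltW.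
pose L := 2 `^ b * (c `^ b * (T + 1) + C3).
have L0 : 0 <= L by rewrite mulr_ge0 ?powR_ge0// addr_ge0// mulr_ge0 ?powR_ge0// addr_ge0// ltW.
exists (L `^ b^-1) => [|g N M mg g0 gc N0 M0 hg]; first exact: powR_ge0.
(* The scaling divides by a power of the bound, so N is first replaced by a positive N', which is
   let decrease to N at the end. *)
have key N' : 0 < N' -> N <= N' ->
    ((\int[mu]_t ((kk 1 (T - t) * (c * g t + M * cpow (1 - a) t)) `^ b)%:E) `^ b^-1
    <= (L `^ b^-1 * (N' + M))%:E)%E.
  move=> N'0 NN'.
  pose A := 2 `^ b * c `^ b * N' `^ b; pose B := A * N' `^ (- P); pose C := 2 `^ b * M `^ b.
  have A0 : 0 <= A by rewrite !mulr_ge0 ?powR_ge0.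
  have B0 : 0 <= B by rewrite mulr_ge0 ?powR_ge0.
  have C0 : 0 <= C by rewrite mulr_ge0 ?powR_ge0.
  pose k d t := kk 1 (T - t) * cpow d t.
  have k_ge0 d t : 0 <= k d t by rewrite mulr_ge0 ?cpow_ge0// kk_ge0.
  have mk d : measurable_fun setT (fun t => (k d t)%:E).
    apply/measurable_EFinP; apply: measurable_conv_ker; first exact: measurable_kk.
    exact: measurable_cpow.
  have mgP : measurable_fun setT (fun t => (g t `^ P)%:E).
    by apply/measurable_EFinP; apply: (measurableT_comp (measurable_powR _)).
  have pw t : (kk 1 (T - t) * (c * g t + M * cpow (1 - a) t)) `^ b <=
      A * k 1 t + (B * g t `^ P + C * k (1 - b * a) t).
    have rhs0 : 0 <= A * k 1 t + (B * g t `^ P + C * k (1 - b * a) t).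
      by rewrite !addr_ge0// mulr_ge0// powR_ge0.
    have [t0|t0] := leP t 0.
      rewrite [leLHS](_ : _ = 0)//.
      by rewrite gc// /cpow ltNge t0/= !mulr0 addr0 mulr0 powR0 ?lt0r_neq0.
    have [tT|Tt] := leP T t.
      by rewrite kk_le0 ?subr_le0// mul0r powR0 ?lt0r_neq0.
    rewrite /k kk1 ?subr_gt0// !mul1r.
    have h1 := powR_add_le (mulr_ge0 c0 (g0 t)) (mulr_ge0 M0 (cpow_ge0 (1 - a) t)) b0.
    apply: (le_trans h1); rewrite !powRM ?cpow_ge0//.
    have -> : cpow (1 - a) t `^ b = cpow (1 - b * a) t.
      by rewrite cpow_powR//; congr (cpow _ _); ring.
    have -> : cpow 1 t = 1 by rewrite /cpow t0 subrr powRr0.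
    have := ler_wpM2l (mulr_ge0 (powR_ge0 2 b) (powR_ge0 c b)) (powR_le_interp (g0 t) N'0 b0 bP).
    rewrite /B /A /C; move: (g t `^ b) (g t `^ P) (cpow _ _) => x y z h2.
    rewrite mulrDr addrA; apply: lerD; last by rewrite mulrA.
    by rewrite mulrA (le_trans h2)// mulr1 mulrDr !mulrA.
  apply: (@le_trans _ _ ((L * (N' + M) `^ b)%:E `^ b^-1)%E); last first.
    rewrite poweR_EFin lee_fin powRM ?powR_ge0// -powRrM mulfV ?lt0r_neq0// powRr1//.
    by rewrite addr_ge0// ltW.
  apply: gt0_ler_poweR.
  - by rewrite invr_ge0 ltW.
  - by rewrite in_itv/= leey andbT; apply: integral_ge0 => t _; rewrite lee_fin powR_ge0.
  - by rewrite in_itv/= leey andbT lee_fin mulr_ge0 ?powR_ge0.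
  apply: (@le_trans _ _ (\int[mu]_t (A%:E * (k 1 t)%:E +
      (B%:E * (g t `^ P)%:E + C%:E * (k (1 - b * a) t)%:E)))%E).
    apply: ge0_le_integral_nomeas => t; first by rewrite lee_fin powR_ge0.
    by rewrite -!EFinM -!EFinD lee_fin.
  have m1 : measurable_fun setT (fun t => A%:E * (k 1 t)%:E)%E by exact: emeasurable_funM.
  have m2 : measurable_fun setT (fun t => B%:E * (g t `^ P)%:E)%E by exact: emeasurable_funM.
  have m3 : measurable_fun setT (fun t => C%:E * (k (1 - b * a) t)%:E)%E by exact: emeasurable_funM.
  rewrite ge0_integralD//; last 3 first.
  - by move=> t _; rewrite -EFinM lee_fin mulr_ge0.
  - by move=> t _; rewrite -!EFinM -EFinD lee_fin addr_ge0// mulr_ge0// powR_ge0.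
  - exact: emeasurable_funD.
  rewrite ge0_integralD//; last 2 first.
  - by move=> t _; rewrite -EFinM lee_fin mulr_ge0// powR_ge0.
  - by move=> t _; rewrite -EFinM lee_fin mulr_ge0.
  rewrite !ge0_integralZl//; try exact: mk; try by (move=> t _; rewrite lee_fin ?powR_ge0).
  have E1 := integral_cpow (@ltr01 R) T0; have E2 := integral_cpow ba0 T0.
  rewrite [X in (_ * X + _)%E]E1 [X in (_ + (_ + _ * X))%E]E2 divr1 powRr1 ?(ltW T0)//.
  apply: (@le_trans _ _ (A * T + (B * N' `^ P + C * C3))%:E).
    rewrite !EFinD !EFinM leeD2l// leeD2r// lee_wpmul2l ?lee_fin//.
    apply: (le_trans hg); rewrite lee_fin ge0_ler_powR ?nnegrE ?(ltW N'0)//.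
    by rewrite (le_trans (ltW b0)).
  rewrite lee_fin /B -mulrA -powRDp// addNr powRr0 mulr1 /L /A /C.
  have h1 : N' `^ b <= (N' + M) `^ b.
    by rewrite ge0_ler_powR ?nnegrE ?addr_ge0 ?(ltW b0) ?(ltW N'0)// lerDl.
  have h2 : M `^ b <= (N' + M) `^ b.
    by rewrite ge0_ler_powR ?nnegrE ?addr_ge0 ?(ltW b0) ?(ltW N'0)// lerDr ltW.
  have cb := mulr_ge0 (powR_ge0 2 b) (powR_ge0 c b).
  have := ler_wpM2l (mulr_ge0 cb (addr_ge0 (ltW T0) ler01)) h1.
  have := ler_wpM2l (mulr_ge0 (powR_ge0 2 b) C30) h2.
  move: (N' `^ b) (M `^ b) ((N' + M) `^ b) (2 `^ b) (c `^ b) => x y z v w; lra.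
apply/lee_addgt0Pr => eps eps0; set K := L `^ b^-1.
have K0 : 0 <= K by exact: powR_ge0.
have K1 : 0 < K + 1 by rewrite ltr_wpDl.
have e1 : 0 < eps / (K + 1) by rewrite divr_gt0.
apply: le_trans (key (N + eps / (K + 1)) _ _) _; [by rewrite ltr_wpDl|by rewrite lerDl ltW|].
rewrite -EFinD lee_fin -/K.
have : K * (eps / (K + 1)) <= eps.
  by rewrite mulrA ler_pdivrMr// mulrC ler_wpM2l ?(ltW eps0)// lerDl.
by move: (eps / (K + 1)) => z; lra.
Qed.

End power_integral.

Section modification_on_null_sets.
Context {R : realType} {X : zmodType}.
Local Notation mu := (@lebesgue_measure R).
Variables (T : R) (B : nspace R X) (f f' : R -> X) (N : set R).
Hypotheses (mN : measurable N) (N0 : mu N = 0%E).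
Hypothesis ff' : forall t, t \in `]0, T[ -> ~ N t -> f t = f' t.

Lemma Bochner_norm_eq_off p : Bochner_norm T B p f = Bochner_norm T B p f'.
Proof.
rewrite /Bochner_norm unlock; apply: (congr1 (fun z => z `^ p^-1)%E).
have E t : ~ N t -> ((fun t => ns_norm B (f t)) \_ (`]0, T[%classic)) t =
   ((fun t => ns_norm B (f' t)) \_ (`]0, T[%classic)) t.
  by move=> nN; rewrite !patchE; case: ifPn => //; rewrite mem_setE => tT; rewrite ff'.
apply/eqP; rewrite eq_le; apply/andP; split;
  apply: (@ge0_le_integral_off _ _ R mu N mN N0) => t; rewrite ?lee_fin ?powR_ge0// => nN;
  by rewrite /= E.
Qed.

Lemma BochnerL_eq_off p : ns_mem (BochnerL T B p) f -> ns_mem (BochnerL T B p) f'.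
Proof.
move=> [[s hs [Z [mZ Z0 hZ]]] fin]; split; last by rewrite -Bochner_norm_eq_off.
exists s => //; exists (Z `|` N); split; first exact: measurableU.
  exact: null_set_setU.
move=> t /= h; apply: contrapT => /not_orP[nZ nN]; apply: h => tT.
by rewrite -ff'//; apply: contrapT => h; apply: nZ; apply: hZ => /= /(_ tT).
Qed.

End modification_on_null_sets.

Lemma measurable_sol (R : realType) (al T P lam1 : R) (lam : nat -> R) f g N phi j :
  0 < al -> al < 1 -> 1 < P -> 0 < lam1 -> (forall j, lam1 <= lam j) -> P^-1 < al ->
  source P f g N -> measurable_fun setT (sol al T lam f phi j).
Proof.
move=> al0 al1 P1 lam10 lamlb Pal S; have lj : 0 < lam j := lt_le_trans lam10 (lamlb j).
have m1 : measurable_fun setT (duhamel al lam f j).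
  exact: (measurable_duhamel al0 al1 P1 lam10 lamlb S).
have m2 : measurable_fun setT (cvl (kk 1) (ML al (lam j) al)).
  apply: measurable_cvl_ge0 => [||x|x|x].
  - exact: measurable_kk.
  - exact: measurable_ML.
  - exact: kk_ge0.
  - exact: ML_al_ge0.
  - exact: cint_kk_ML.
apply: measurable_funD => //; apply: measurable_funM => //.
by apply: measurable_funB => //; exact: measurable_funM.
Qed.

Lemma ae_mono d (T : measurableType d) (R : realType) (mu : {measure set T -> \bar R})
    (P Q : T -> Prop) : (forall x, P x -> Q x) ->
  {ae mu, forall x, P x} -> {ae mu, forall x, Q x}.
Proof. by move=> PQ [N [mN N0 hN]]; exists N; split => // x /= nQ; apply: hN => /= /PQ. Qed.

Lemma ae_mono2 d (T : measurableType d) (R : realType) (mu : {measure set T -> \bar R})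
    (P P' Q : T -> Prop) : (forall x, P x -> P' x -> Q x) ->
  {ae mu, forall x, P x} -> {ae mu, forall x, P' x} -> {ae mu, forall x, Q x}.
Proof.
move=> PQ [N [mN N0 hN]] [N' [mN' N'0 hN']]; exists (N `|` N'); split.
- exact: measurableU.
- exact: null_set_setU.
- move=> x /= nQ; apply: contrapT => /not_orP[nN nN']; apply: nQ; apply: PQ.
    by apply: contrapT => h; apply: nN; exact: hN.
  by apply: contrapT => h; apply: nN'; exact: hN'.
Qed.

Lemma oo_in (R : realType) (T t : R) : t \in `]0, T[ -> 0 < t /\ t <= T.
Proof. by rewrite in_itv/= => /andP[t0 /ltW]. Qed.

Lemma oc_in (R : realType) (T t : R) : t \in `]0, T] -> 0 < t /\ t <= T.
Proof. by rewrite in_itv/= => /andP[]. Qed.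

(** * Mild solutions *)

Section curve_criteria.
Context {R : realType} {X : zmodType}.
Local Notation mu := (@lebesgue_measure R).
Variables (T : R) (B : nspace R X).
Hypothesis T0 : 0 < T.

Lemma Bochner_norm_fin (f : R -> X) (M a b : R) : 0 < b -> b * a < 1 -> 0 <= M ->
  (forall t, t \in `]0, T[ -> `|ns_norm B (f t)| <= M * t `^ (- a)) ->
  (Bochner_norm T B b f < +oo)%E.
Proof.
move=> b0 ba M0 hf.
have [K K0 HK] := @power_integral_bound R T b b a 0 T0 b0 (lexx b) ba (lexx 0).
have z : (\int[mu]_t (((fun=> 0) t : R) `^ b)%:E <= (0 `^ b)%:E)%E.
  by rewrite integral0_eq ?lee_fin ?powR_ge0// => t _; rewrite powR0 ?lt0r_neq0.
have := HK (fun=> 0) 0 M _ (fun=> lexx 0) (fun _ _ => erefl) (lexx 0) M0 z.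
move=> /(_ ltac:(exact: measurable_cst)) h.
apply: le_lt_trans (ltry (K * (0 + M))); apply: le_trans h.
apply: (@Bochner_norm_le _ _ T B b f _ set0) => //.
  by move=> t; rewrite mulr_ge0 ?kk_ge0// mul0r add0r mulr_ge0// cpow_ge0.
move=> t tT _; apply: le_trans (hf t tT) _; move: tT; rewrite in_itv/= => /andP[t0 tT].
rewrite kk1 ?subr_gt0// mul1r mul0r add0r /cpow t0 (_ : 1 - a - 1 = - a)//; ring.
Qed.

Lemma weightedC_intro (rho : R) (f : R -> X) (M : R) :
  (forall t, t \in `]0, T] -> ns_mem B (f t)) ->
  (forall t, t \in `]0, T] -> forall eps, 0 < eps -> exists2 d, 0 < d & forall t',
     t' \in `]0, T] -> `|t' - t| < d -> `|ns_norm B (f t' - f t)| <= eps) ->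
  (forall t, t \in `]0, T] -> t `^ rho * ns_norm B (f t) <= M) ->
  ns_mem (weightedC T B rho) f /\ ns_norm (weightedC T B rho) f <= M.
Proof.
move=> mf cf bf.
have ub : ubound [set t `^ rho * ns_norm B (f t) | t in `]0, T]%classic] M.
  by move=> _ [t tT <-]; exact: bf.
split; last first.
  apply: ge_sup => //; exists (T `^ rho * ns_norm B (f T)); exists T => //=.
  by rewrite in_itv/= T0 lexx.
split => //; last by exists M.
move=> t tT; apply/cvgrPdist_le => eps eps0; have [d d0 hd] := cf t tT eps eps0.
rewrite near_withinE; apply/nbhs_ballP; exists d => //= t' tt' t'T.
by rewrite sub0r normrN; apply: hd => //; rewrite distrC.
Qed.

End curve_criteria.

Section mild_solutions.
Context {R : realType} {k : nat}.
Local Notation V := 'rV[R]_k.+1.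
Local Notation mu := (@lebesgue_measure R).
Variables (D : set V) (m : nat -> R) (e : nat -> V -> R).
Local Notation L2 := (Lb D 2).
Hypothesis eL2 : forall j, ns_mem L2 (e j).
Hypothesis orth : forall i j, inner D (e i) (e j) = (i == j)%:R.
Hypothesis compl : forall v, ns_mem L2 v -> L2_series D e (fun j => inner D v (e j)) v.
Hypotheses (m0 : 0 < m 0%N) (mle : nondecreasing_seq m) (moo : m n @[n --> \oo] --> +oo).
Variables (T al beta P p q s p' qh : R).
Hypotheses (T0 : 0 < T) (al0 : 0 < al) (al1 : al < 1) (beta0 : 0 < beta) (P1 : 1 < P).
Hypotheses (s0 : 0 < s) (Ps : P^-1 < al * q - s) (q0 : 0 < q) (q1 : q < 1) (pq : p + q = 1).
Hypotheses (p'0 : 0 < p') (p'1 : p' + s / al <= p).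
Hypotheses (qh0 : 0 <= qh) (qhq : qh <= q) (qhs : qh <= s / al).

Definition ev j := m j `^ beta.
Local Notation lam := ev.
Let lam1 := m 0%N `^ beta.

Let m_gt0 j : 0 < m j. Proof. by apply: lt_le_trans m0 _; exact: mle. Qed.
Let lam10 : 0 < lam1. Proof. exact: powR_gt0. Qed.
Let lamlb j : lam1 <= lam j.
Proof. by apply: ge0_ler_powR; rewrite ?nnegrE ?(ltW beta0) ?(ltW (m_gt0 _))//; exact: mle. Qed.
Let lam_gt0 j : 0 < lam j. Proof. exact: powR_gt0. Qed.

Let evE c j : m j `^ (beta * c) = lam j `^ c. Proof. by rewrite /ev powRrM. Qed.

Lemma ev_infty L : exists n, forall j, (n <= j)%N -> L <= lam j.
Proof.
pose L' := Num.max L 1; have L'0 : 0 < L' by rewrite lt_max ltr01 orbT.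
have /cvgryPge /(_ (L' `^ beta^-1)) [n _ hn] := moo; exists n => j nj.
apply: (@le_trans _ _ L'); first by rewrite le_max lexx.
have -> : L' = (L' `^ beta^-1) `^ beta by rewrite -powRrM mulVf ?lt0r_neq0// powRr1// ltW.
by apply: ge0_ler_powR; rewrite ?nnegrE ?powR_ge0 ?(ltW beta0) ?(ltW (m_gt0 _))//; exact: hn.
Qed.

Let sal0 : 0 < s / al. Proof. by rewrite divr_gt0. Qed.
Let p0 : 0 < p. Proof. by rewrite (lt_le_trans _ p'1)// addr_gt0. Qed.
Let p1 : p < 1. Proof. by rewrite -pq ltrDl. Qed.
Let pp'0 : 0 < p - p'. Proof. by rewrite subr_gt0 (lt_le_trans _ p'1)// ltrDl. Qed.
Let p'le1 : p' <= 1. Proof. by rewrite (le_trans _ (ltW p1))// ltW// -subr_gt0. Qed.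
Let Pal : P^-1 < al.
Proof.
by rewrite (lt_le_trans Ps)// lerBlDr (le_trans (ler_piMr (ltW al0) (ltW q1)))// lerDl ltW.
Qed.

Definition solw th c (h0 : 0 <= th) (h1 : th <= 1) (h2 : c + th <= p + qh) (h3 : 0 <= c)
    (h4 : c <= p + s / al) :=
  sol_weighted al0 al1 T0 P1 lam10 lamlb s0 Ps pq p'0 p'1 qh0 qhq qhs h0 h1 h2 h3 h4.

Let qqh : - (q - qh) + 1 = p + qh.
Proof. by rewrite -pq; ring. Qed.

Let lamM c j : lam j `^ c * lam j = lam j `^ (c + 1).
Proof. by rewrite -{2}(powRr1 (ltW (lam_gt0 j))) -powRDp. Qed.

(** The derivative h - L^beta u. The source coefficients h are kept apart from the f that defines u:
    part (b) needs those of [G], valid at every time, which agree with f almost everywhere only. *)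
Definition wcurve (h f : nat -> R -> R) phic t : (V -> R) -> R :=
  functional D e (fun j => h j t - lam j * sol al T lam f phic j t).

Lemma wcurve_e h f phic t j :
  wcurve h f phic t (e j) = h j t - lam j * sol al T lam f phic j t.
Proof. exact: functional_e. Qed.

(** The norm weight - (q - qh) plus the 1 from lam is p + qh, the full weight of the datum. Nothing
    is left to weaken the singularity, whence t^(- al). *)
Lemma deriv_weighted : exists2 C, 0 <= C & forall f g N phic Phi t, source P f g N ->
  l2le (fun j => lam j `^ (p + qh) * phic j) Phi -> 0 < t -> t <= T ->
  l2le (fun j => m j `^ (- (beta * (q - qh))) * (f j t - lam j * sol al T lam f phic j t))
    (lam1 `^ (- (q - qh)) * g t + C * (Phi + N) * t `^ (- al)).
Proof.
have h1 : p + qh + 0 <= p + qh by rewrite addr0.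
have h2 : 0 <= p + qh by rewrite addr_ge0// ltW.
have h3 : p + qh <= p + s / al by rewrite lerD2l.
have [C C0 HC] := solw (lexx 0) ler01 h1 h2 h3.
exists C => // f g N phic Phi t S hphi t0 tT.
have := HC f g N phic Phi t S hphi t0 tT; rewrite subr0 mulr1 => hx.
have qq : 0 <= q - qh by rewrite subr_ge0.
have hf : l2le (fun j => lam j `^ (- (q - qh)) * f j t) (lam1 `^ (- (q - qh)) * g t).
  apply: (l2le_dom (powR_ge0 _ _) _ (source_l2 S t)) => j.
  rewrite normrM (ger0_norm (powR_ge0 _ _)); apply: ler_wpM2r; first exact: normr_ge0.
  exact: (lam_powN_le lam10 lamlb j qq).
apply: l2le_eq (l2le_sub hf hx) => j.
by rewrite -[- (beta * _)]mulrN evE [in RHS]mulrBr [in RHS]mulrA lamM qqh.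
Qed.

Lemma wcurve_Lp b : 0 < b -> b <= P -> b * al < 1 -> exists2 C, 0 <= C &
  forall f g N phic Phi, source P f g N ->
  l2le (fun j => lam j `^ (p + qh) * phic j) Phi ->
  ns_mem (BochnerL T (Vneg D m e (beta * (q - qh))) b) (wcurve f f phic) /\
  ns_norm (BochnerL T (Vneg D m e (beta * (q - qh))) b) (wcurve f f phic) <= C * (N + Phi).
Proof.
move=> b0 bP bal; have [C C0 HC] := deriv_weighted.
have [K K0 HK] := @power_integral_bound R T b P al (lam1 `^ (- (q - qh))) T0 b0 bP bal (powR_ge0 _ _).
exists (K * (1 + C)) => [|f g N phic Phi S hphi]; first by rewrite mulr_ge0// addr_ge0.
have Phi0 : 0 <= Phi by case: hphi.
have N0 := source_N S.
have M0 : 0 <= C * (Phi + N) by rewrite mulr_ge0// addr_ge0.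
pose B := Vneg D m e (beta * (q - qh)).
have B0 l : 0 <= ns_norm B l by exact: sqrtr_ge0.
have hw t : 0 < t -> t <= T -> l2le (fun j => m j `^ (- (beta * (q - qh))) * wcurve f f phic t (e j))
    (lam1 `^ (- (q - qh)) * g t + C * (Phi + N) * t `^ (- al)).
  move=> t0 tT; apply: l2le_eq (HC f g N phic Phi t S hphi t0 tT) => j.
  by rewrite wcurve_e.
have cp t : 0 < t -> t `^ (- al) = cpow (1 - al) t.
  by move=> t0; rewrite /cpow t0; congr (_ `^ _); ring.
have bound : (Bochner_norm T B b (wcurve f f phic) <= (K * (1 + C) * (N + Phi))%:E)%E.
  apply: le_trans (le_trans (HK g N (C * (Phi + N)) (source_mg S) (source_g_ge0 S)
    (source_causal S) N0 M0 (source_int S)) _); last first.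
    rewrite lee_fin -mulrA ler_wpM2l//; have := mulr_ge0 C0 N0; have := mulr_ge0 C0 Phi0; lra.
  apply: (@Bochner_norm_le _ _ T B b _ _ set0) => //.
    move=> t; rewrite mulr_ge0 ?kk_ge0// addr_ge0//.
      exact: mulr_ge0 (powR_ge0 _ _) (source_g_ge0 S t).
    exact: mulr_ge0 M0 (cpow_ge0 _ _).
  move=> t tT _; have [t0 tT'] := oo_in tT; rewrite ger0_norm//.
  have -> : kk 1 (T - t) = 1 by rewrite kk1// subr_gt0; move: tT; rewrite in_itv/= => /andP[].
  rewrite mul1r -cp//; apply: (@Vneg_norm_le _ _ D m e m0 mle); exact: hw.
have Bn0 : (0 <= Bochner_norm T B b (wcurve f f phic))%E by exact: Lnorm_ge0.
have Bfin : (Bochner_norm T B b (wcurve f f phic) < +oo)%E by exact: (le_lt_trans bound (ltry _)).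
split; last first.
  rewrite -[ns_norm _ _]/(fine (Bochner_norm T B b (wcurve f f phic))).
  by rewrite -lee_fin fineK// ge0_fin_numE.
split => //.
pose cmb n (y : nat -> R) : (V -> R) -> R := embed D (fun z => \sum_(j < n) y j * e j z).
have qq : 0 <= beta * (q - qh) by rewrite mulr_ge0 ?subr_ge0// ltW.
apply: (@curve_strongly_measurable _ _ T B cmb (fun j => m j `^ (- (beta * (q - qh))))
  (wcurve f f phic) (fun j t => f j t - lam j * sol al T lam f phic j t)
  (fun t => lam1 `^ (- (q - qh)) * g t + C * (Phi + N) * t `^ (- al))).
- move=> n y; apply: (embed_Vneg eL2 orth compl m0 mle qq); exact: L2_sum.
- by move=> j; exact: powR_ge0.
- move=> j; have ms := @measurable_sol _ al T P lam1 lam f g N phic j al0 al1 P1 lam10 lamlb Pal S.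
  apply: measurable_funB; first exact: (source_mf S j).
  exact: measurable_funM.
- move=> n y y' yy'; congr (embed D _); apply/funext => z; apply: eq_bigr => j _; by rewrite yy'.
- move=> t /oo_in[t0 tT]; apply: (functional_Vneg eL2 orth compl m0 mle).
  exact: (HC f g N phic Phi t S hphi t0 tT).
- by move=> t /oo_in[t0 tT]; exact: (HC f g N phic Phi t S hphi t0 tT).
- by move=> t n y _; exact: B0.
- move=> t n y M _ h; apply: (@Vneg_norm_le _ _ D m e m0 mle); apply: l2le_eq h => j; congr (_ * _).
  rewrite -[RHS]/(cmb n y (e j) - wcurve f f phic t (e j)) wcurve_e.
  by rewrite /cmb /embed inner_sum_e.
Qed.

(** With norm weight - q the solution appears with weight p and singularity t^(- al), which the
    weight of the space compensates. Continuity combines that of G with [sol_l2cont_weighted]. *)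
Lemma wcurve_weightedC : exists2 C, 0 <= C & forall f g N phic Phi G, source P f g N ->
  l2le (fun j => lam j `^ (p + qh) * phic j) Phi ->
  ns_mem (weightedC T (Vneg D m e (beta * q)) al) G ->
  ns_mem (weightedC T (Vneg D m e (beta * q)) al) (wcurve (fun j t => G t (e j)) f phic) /\
  ns_norm (weightedC T (Vneg D m e (beta * q)) al) (wcurve (fun j t => G t (e j)) f phic) <=
    ns_norm (weightedC T (Vneg D m e (beta * q)) al) G + C * (Phi + N).
Proof.
have h1 : p + 0 <= p + qh by rewrite addr0 lerDl.
have h3 : p <= p + s / al by rewrite lerDl ltW.
have [C C0 HC] := solw (lexx 0) ler01 h1 (ltW p0) h3.
exists C => // f g N phic Phi G S hphi [Gmem Gc Gub].
pose B := Vneg D m e (beta * q); pose W := wcurve (fun j t => G t (e j)) f phic.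
have WE t j : W t (e j) = G t (e j) - lam j * sol al T lam f phic j t by exact: wcurve_e.
have B0 l : 0 <= ns_norm B l by exact: sqrtr_ge0.
have wq j (a b : R) : m j `^ (- (beta * q)) * (a - lam j * b) =
    m j `^ (- (beta * q)) * a - lam j `^ p * b.
  have qp : - q + 1 = p by rewrite -pq; ring.
  by rewrite -mulrN evE mulrBr [in LHS](mulrA _ (lam j)) lamM qp.
have hG t : t \in `]0, T] -> l2le (fun j => m j `^ (- (beta * q)) * G t (e j)) (ns_norm B (G t)).
  by move=> tT; apply: (Vneg_l2le eL2 orth compl m0 mle); exact: Gmem.
have hW t : t \in `]0, T] -> l2le (fun j => m j `^ (- (beta * q)) * W t (e j))
    (ns_norm B (G t) + C * (Phi + N) * t `^ (- al)).
  move=> tT; have [t0 tT'] := oc_in tT.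
  have := HC f g N phic Phi t S hphi t0 tT'; rewrite subr0 mulr1 => hx.
  by apply: l2le_eq (l2le_sub (hG t tT) hx) => j; rewrite WE wq.
apply: (@weightedC_intro _ _ T B T0 al W) => //.
- move=> t tT; apply: (functional_Vneg eL2 orth compl m0 mle (M := ns_norm B (G t) + C * (Phi + N) * t `^ (- al))).
  by apply: l2le_eq (hW t tT) => j; rewrite WE.
- move=> t tT eps eps0; have e2 : 0 < eps / 2 by rewrite divr_gt0.
  have [d d0 hd] := sol_l2cont_weighted al0 al1 T0 P1 lam10 lamlb s0 Ps q1 pq p'0 p'1 qh0 qhq qhs
    S hphi ev_infty tT e2.
  have := Gc t tT; move/cvgrPdist_le => /(_ _ e2).
  rewrite near_withinE => /nbhs_ballP[d' /= d'0 hd'].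
  exists (Num.min d d') => [|t' t'T]; first by rewrite lt_min d0.
  rewrite lt_min => /andP[tt'd tt'd']; rewrite ger0_norm//.
  apply: (@Vneg_norm_le _ _ D m e m0 mle).
  have hGG : l2le (fun j => m j `^ (- (beta * q)) * (G t' - G t) (e j)) (eps / 2).
    have hs : l2le (fun j => m j `^ (- (beta * q)) * (G t' - G t) (e j))
        (ns_norm B (G t') + ns_norm B (G t)).
      by apply: l2le_eq (l2le_sub (hG t' t'T) (hG t tT)) => j; rewrite -mulrBr.
    apply: l2le_mono (@Vneg_norm_l2le _ _ D m e m0 mle _ _ _ hs).
    have := hd' t'; rewrite /ball/= distrC => /(_ tt'd' t'T).
    by rewrite sub0r normrN ger0_norm.
  have := l2le_sub hGG (hd t' t'T tt'd).
  have -> : eps / 2 + eps / 2 = eps by field.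
  apply: l2le_eq => j.
  have E1 := congr2 (fun a b => a - b) (WE t' j) (WE t j).
  have -> : (W t' - W t) (e j) = _ := E1.
  have -> : (G t' - G t) (e j) = G t' (e j) - G t (e j) by [].
  move: (wq j (G t' (e j)) (sol al T lam f phic j t')) (wq j (G t (e j)) (sol al T lam f phic j t)).
  move: (sol al T lam f phic j t) (sol al T lam f phic j t') (G t' (e j)) (G t (e j))
    (lam j) (lam j `^ p) (m j `^ _) => a b g1 g2 l c d1 w1 w2.
  by rewrite [RHS]mulrBr w1 w2; ring.
- move=> t tT; have [t0 tT'] := oc_in tT.
  have hn : ns_norm B (W t) <= ns_norm B (G t) + C * (Phi + N) * t `^ (- al).
    by apply: (@Vneg_norm_le _ _ D m e m0 mle); exact: hW.
  apply: (le_trans (ler_wpM2l (powR_ge0 t al) hn)); rewrite mulrDr; apply: lerD.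
    by apply: sup_upper_bound; [split => //; exists (t `^ al * ns_norm B (G t)); exists t|exists t].
  by rewrite mulrCA -powRDp// subrr powRr0 mulr1.
Qed.

Section fixed_data.
Variables (F : R -> V -> R) (phi : V -> R) (f : nat -> R -> R) (g : R -> R) (Z : set R) (N Phi : R).
Hypotheses (mZ : measurable Z) (Z0 : mu Z = 0%E) (S : source P f g N).
Hypothesis hZ : forall t, t \in `[0, T] -> ~ Z t -> [/\ t \in `]0, T[, ns_mem L2 (F t) &
  forall j, f j t = inner D (F t) (e j)].
Hypotheses (Lphi : ns_mem L2 phi)
  (hphi : l2le (fun j => lam j `^ (p + qh) * coef D e phi j) Phi).

Local Notation x := (sol al T lam f (coef D e phi)).

Lemma duhamel_integral j t : 0 <= t -> t <= T ->
  \int[mu]_(tau in `[0, t]) (inner D (F tau) (e j) * ml_kernel al (m j `^ beta) (t - tau)) =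
  duhamel al lam f j t.
Proof.
move=> t0 tT.
rewrite (@Rintegral_off _ _ R mu Z mZ Z0 `[0, t]%classic _
   (fun tau => f j tau * ml_kernel al (lam j) (t - tau))); last first.
  move=> tau; rewrite /= in_itv/= => /andP[tau0 taut] nZ.
  have [|_ _ ->//] := hZ _ nZ; rewrite in_itv/= tau0; exact: le_trans tT.
rewrite Rintegral_mkcond; apply: eq_Rintegral => tau _.
rewrite patchE mem_setE in_itv/=; case: ifPn => [/andP[tau0 taut]|].
  by rewrite (ml_kernelE al0 al1) ?subr_ge0// mulrC.
rewrite negb_and -!ltNge => /orP[h|h].
  by rewrite (source_f_causal S _ (ltW h)) mulr0.
by rewrite ML_le0 ?mul0r// subr_le0 ltW.
Qed.

Let O1_coef t w : 0 <= t -> t <= T -> O1 D m e al beta t F w ->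
  ns_mem L2 w /\ forall j, inner D w (e j) = duhamel al lam f j t.
Proof.
move=> t0 tT /(L2_series_coef eL2 orth compl)[Lw h]; split=> // j.
by rewrite h duhamel_integral.
Qed.

Let ratioE t j : 0 < t -> mittag_leffler al 1 (- (m j `^ beta * t `^ al)) /
  mittag_leffler al 1 (- (m j `^ beta * T `^ al)) = ML al (lam j) 1 t / ML al (lam j) 1 T.
Proof.
move=> t0; have E r : 0 < r -> mittag_leffler al 1 (- (m j `^ beta * r `^ al)) = ML al (lam j) 1 r.
  move=> r0; rewrite -[m j `^ beta]/(lam j); exact: (mittag_leffler1E al0 (lam_gt0 j) r0).
by rewrite !E.
Qed.

Let O2_coef t v w : 0 < t -> O2 D m e T al beta t v w -> ns_mem L2 w /\
  forall j, inner D w (e j) = inner D v (e j) * (ML al (lam j) 1 t / ML al (lam j) 1 T).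
Proof.
move=> t0 /(L2_series_coef eL2 orth compl)[Lw h]; split=> // j.
by rewrite h ratioE.
Qed.

(** The terms from O_2 and O_3 together apply E(t)/E(T) to phi - v(T), the defect. *)
Lemma mild_coef t w1 w2 w3 : 0 < t -> t <= T -> O1 D m e al beta t F w1 ->
  O2 D m e T al beta t phi w2 -> O3 D m e T al beta t F w3 ->
  ns_mem L2 (fun y => w1 y + w2 y + w3 y) /\
  forall j, inner D (fun y => w1 y + w2 y + w3 y) (e j) = x j t.
Proof.
move=> t0 tT /(O1_coef (ltW t0) tT)[L1 h1] /(O2_coef t0)[Lw2 h2].
move=> [v [w [/(O1_coef (ltW T0) (lexx T))[Lv hv] /(O2_coef t0)[Lw hw] ->]]].
have L12 := L2lin 1 L1 Lw2.
have -> : (fun y => w1 y + w2 y + (- w) y) = (fun y => (-1) * w y + (1 * w1 y + w2 y)).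
  by apply/funext => y; rewrite mulN1r mul1r addrC.
split=> [|j]; first exact: L2lin.
rewrite inner_linl// inner_linl// h1 h2 hw hv (sol_gt0 T al0 lam10 lamlb)// /defect /coef.
move: (inner D phi (e j)) (duhamel al lam f j T) (duhamel al lam f j t)
  (ML al (lam j) 1 t / _) => a b c d; ring.
Qed.

Lemma mild_exists t : 0 < t -> t <= T -> exists w1 w2 w3, [/\ O1 D m e al beta t F w1,
  O2 D m e T al beta t phi w2 & O3 D m e T al beta t F w3].
Proof.
move=> t0 tT.
have Pal1 : P^-1 < al * (1 - 0) by rewrite subr0 mulr1.
have [C C0 HC] := @duhamel_weighted _ al T P lam1 lam al0 al1 T0 P1 lam10 lamlb 0 (lexx 0) ler01 Pal1.
have dw r : r <= T -> l2le (fun j => duhamel al lam f j r) (C * N).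
  by move=> rT; apply: l2le_eq (HC f g N r S rT) => j; rewrite powRr0 mul1r.
have o1 r : 0 <= r -> r <= T -> exists w, O1 D m e al beta r F w.
  move=> r0 rT; have [w hw] := riesz_fischer eL2 orth (dw r rT); exists w.
  by rewrite /O1; under [X in L2_series _ _ X _]funext do rewrite duhamel_integral//.
have [C1 C10 HC1] := ML1_ratio al0 al1 (lexx 0) ler01 T0 lam10.
have o2 v : ns_mem L2 v -> exists w, O2 D m e T al beta t v w.
  move=> Lv; have h : l2le (fun j => inner D v (e j) * (ML al (lam j) 1 t / ML al (lam j) 1 T))
      (C1 * t `^ (- (al * (1 - 0))) * ns_norm L2 v).
    apply: (l2le_dom _ _ (L2_coef_l2le eL2 orth compl Lv)) => [|j].
      by rewrite mulr_ge0 ?powR_ge0.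
    have := HC1 (lam j) t (lamlb j) t0; rewrite powRr0 mulr1 => h1.
    have r0 : 0 <= ML al (lam j) 1 t / ML al (lam j) 1 T by rewrite divr_ge0// ltW// ML1_gt0.
    move: (_ / _) r0 h1 => r r0 h1; rewrite normrM (ger0_norm r0) mulrC.
    exact: ler_wpM2r.
  have [w hw] := riesz_fischer eL2 orth h; exists w.
  by rewrite /O2; under [X in L2_series _ _ X _]funext do rewrite ratioE//.
have [w1 h1] := o1 t (ltW t0) tT; have [w2 h2] := o2 phi Lphi.
have [v hv] := o1 T (ltW T0) (lexx T); have [Lv _] := O1_coef (ltW T0) (lexx T) hv.
have [w hw] := o2 v Lv.
by exists w1, w2, (- w); split => //; exists v, w.
Qed.

(** Values are chosen for each time of ]0, T] separately; measurability in time is recovered later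
    from the coefficients. The time 0 is left out, as the bounds in L^2 blow up there. *)
Lemma sol_curve : exists u : R -> V -> R, forall t, 0 < t -> t <= T ->
  ns_mem L2 (u t) /\ forall j, inner D (u t) (e j) = x j t.
Proof.
have h t : exists w, 0 < t -> t <= T -> ns_mem L2 w /\ forall j, inner D w (e j) = x j t.
  have [t0|t0] := leP t 0; first by exists 0.
  have [tT|tT] := leP t T; last by exists 0.
  have [w1 [w2 [w3 [h1 h2 h3]]]] := mild_exists t0 tT.
  exists (fun y => w1 y + w2 y + w3 y) => _ _.
  exact: (mild_coef t0 tT h1 h2 h3).
have [u hu] := choice h; by exists u.
Qed.

(** The defining formula prescribes the coefficients of a mild solution at almost every time, and
    coefficients determine a function of L^2(D) almost everywhere. *)
Lemma mild_unique (u : R -> V -> R) : (forall t, 0 < t -> t <= T ->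
  ns_mem L2 (u t) /\ forall j, inner D (u t) (e j) = x j t) ->
  (exists2 a, 1 <= a & ns_mem (BochnerL T L2 a) u) ->
  unique_mild_solution D m e T al beta F phi u.
Proof.
move=> hu [a a1 ua].
have agree t w1 w2 w3 : 0 < t -> t <= T -> O1 D m e al beta t F w1 ->
    O2 D m e T al beta t phi w2 -> O3 D m e T al beta t F w3 ->
    ae_in_D D (fun y => u t y = w1 y + w2 y + w3 y).
  move=> t0 tT h1 h2 h3; have [Lw hw] := mild_coef t0 tT h1 h2 h3.
  have [Lu hut] := hu t t0 tT.
  by apply: (L2_coef_inj eL2 orth compl) => // j; rewrite hut hw.
split; first split.
- by exists a, 2; split => //; rewrite ler1n.
- apply: aeW => t /oo_in[t0 tT].
  have [w1 [w2 [w3 [h1 h2 h3]]]] := mild_exists t0 tT.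
  by exists w1, w2, w3; split => //; exact: agree.
- move=> u' [_]; apply: ae_mono => t h tT; have [w1 [w2 [w3 [h1 h2 h3 h4]]]] := h tT.
  have [t0 tT'] := oo_in tT.
  have h5 := agree t w1 w2 w3 t0 tT' h1 h2 h3.
  by apply: ae_mono2 h4 h5 => y e1 e2 Dy; rewrite e1// e2.
Qed.

Section curve.
Variable u : R -> V -> R.
Hypothesis hu : forall t, 0 < t -> t <= T ->
  ns_mem L2 (u t) /\ forall j, inner D (u t) (e j) = x j t.

Let coef_u t : 0 < t -> t <= T -> coef D e (u t) = x^~ t.
Proof. by move=> t0 tT; apply/funext => j; have [_ h] := hu t0 tT; exact: h. Qed.

Let PN0 : 0 <= Phi + N.
Proof. by rewrite addr_ge0 ?(source_N S)//; case: hphi. Qed.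

Let cmb n (y : nat -> R) : V -> R := fun z => \sum_(j < n) y j * e j z.

Let coef_diff n y t j : 0 < t -> t <= T ->
  coef D e (cmb n y - u t) j = (if (j < n)%N then y j else 0) - x j t.
Proof.
move=> t0 tT; have [Lu h] := hu t0 tT.
by rewrite /coef innerBl ?h ?inner_sum_e//; exact: L2_sum.
Qed.

(** The choice th = p' gives the singularity t^(- al (1 - p')), whose a-th power is integrable by
    the last hypothesis. *)
Lemma curve_Lp_Vpos c a : 0 <= c -> c + p' <= p -> 1 <= a -> a * (al * (1 - p')) < 1 ->
  ns_mem (BochnerL T (Vpos D m e (beta * c)) a) u.
Proof.
move=> c0 cp a1 aal.
have cp1 : c + p' <= p + qh by rewrite (le_trans cp)// lerDl.
have cp2 : c <= p + s / al.
  by rewrite (le_trans _ (le_trans cp _))// ?lerDl ltW.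
have [C C0 HC] := solw (ltW p'0) p'le1 cp1 c0 cp2.
have hx t : 0 < t -> t <= T -> l2le (fun j => m j `^ (beta * c) * x j t)
    (C * (Phi + N) * t `^ (- (al * (1 - p')))).
  by move=> t0 tT; apply: l2le_eq (HC f g N _ Phi t S hphi t0 tT) => j; rewrite evE.
have B0 v : 0 <= ns_norm (Vpos D m e (beta * c)) v by rewrite fine_ge0// Lnorm_ge0.
have hV t : 0 < t -> t <= T -> ns_mem (Vpos D m e (beta * c)) (u t) /\
    ns_norm (Vpos D m e (beta * c)) (u t) <= C * (Phi + N) * t `^ (- (al * (1 - p'))).
  move=> t0 tT; have [Lu _] := hu t0 tT; apply: (Vpos_intro eL2 orth compl) => //.
  by rewrite coef_u//; exact: hx.
split; last first.
  apply: (Bochner_norm_fin T0 (lt_le_trans ltr01 a1) aal (mulr_ge0 C0 PN0)) => t /oo_in[t0 tT].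
  rewrite ger0_norm//.
  by have [] := hV t t0 tT.
apply: (@curve_strongly_measurable _ _ T _ cmb (fun j => m j `^ (beta * c)) u
  x (fun t => C * (Phi + N) * t `^ (- (al * (1 - p'))))).
- by move=> n y; have [] := @Vpos_sum _ _ D m e eL2 orth compl (beta * c) n y.
- by move=> j; exact: powR_ge0.
- by move=> j; exact: (@measurable_sol _ al T P lam1 lam f g N (coef D e phi) j al0 al1 P1 lam10 lamlb Pal S).
- move=> n y y' yy'; apply/funext => z; apply: eq_bigr => j _; by rewrite yy'.
- by move=> t /oo_in[t0 tT]; have [] := hV t t0 tT.
- by move=> t /oo_in[t0 tT]; exact: hx.
- by move=> t n y _; exact: B0.
- move=> t n y M /oo_in[t0 tT] h.
  have [Lu _] := hu t0 tT.
  have [] // := @Vpos_intro _ _ D m e eL2 orth compl (beta * c) (cmb n y - u t) M.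
    by apply: L2B => //; exact: L2_sum.
  by apply: l2le_eq h => j; rewrite coef_diff.
Qed.

(** Supplies the integrability that the definition of a mild solution demands, with spatial exponent
    2. *)
Lemma curve_Lp_L2 a : 1 <= a -> a * (al * (1 - p')) < 1 -> ns_mem (BochnerL T L2 a) u.
Proof.
move=> a1 aal.
have p'p : p' <= p by rewrite ltW// -subr_gt0.
have cp1 : 0 + p' <= p + qh by rewrite add0r (le_trans p'p)// lerDl.
have cp2 : 0 <= p + s / al by rewrite addr_ge0// ltW.
have [C C0 HC] := solw (ltW p'0) p'le1 cp1 (lexx 0) cp2.
have hx t : 0 < t -> t <= T -> l2le (fun j => x j t)
    (C * (Phi + N) * t `^ (- (al * (1 - p')))).
  by move=> t0 tT; apply: l2le_eq (HC f g N _ Phi t S hphi t0 tT) => j; rewrite powRr0 mul1r.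
have B0 v : 0 <= ns_norm L2 v by rewrite fine_ge0// Lnorm_ge0.
have hV t : 0 < t -> t <= T -> ns_norm L2 (u t) <= C * (Phi + N) * t `^ (- (al * (1 - p'))).
  move=> t0 tT; have [Lu h] := hu t0 tT; apply: (L2_norm_le eL2 orth compl) => //.
  by apply: l2le_eq (hx t t0 tT) => j; rewrite h.
split; last first.
  apply: (Bochner_norm_fin T0 (lt_le_trans ltr01 a1) aal (mulr_ge0 C0 PN0)) => t /oo_in[t0 tT].
  by rewrite ger0_norm//; exact: hV.
apply: (@curve_strongly_measurable _ _ T _ cmb (fun=> 1) u
  x (fun t => C * (Phi + N) * t `^ (- (al * (1 - p'))))).
- by move=> n y; exact: L2_sum.
- by move=> j; exact: ler01.
- by move=> j; exact: (@measurable_sol _ al T P lam1 lam f g N (coef D e phi) j al0 al1 P1 lam10 lamlb Pal S).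
- move=> n y y' yy'; apply/funext => z; apply: eq_bigr => j _; by rewrite yy'.
- by move=> t /oo_in[t0 tT]; have [] := hu t0 tT.
- move=> t /oo_in[t0 tT].
  by apply: l2le_eq (hx t t0 tT) => j; rewrite mul1r.
- by move=> t n y _; exact: B0.
- move=> t n y M /oo_in[t0 tT] h.
  have [Lu _] := hu t0 tT.
  apply: (L2_norm_le eL2 orth compl); first by apply: L2B => //; exact: L2_sum.
  by apply: l2le_eq h => j; rewrite mul1r -coef_diff.
Qed.

(** The choice c = 0 and th = p leaves the singularity t^(- al (1 - p)) = t^(- al q), the weight of
    the space. *)
Lemma curve_weightedC : ns_mem (weightedC T L2 (al * q)) u.
Proof.
have pq1 : 0 + p <= p + qh by rewrite add0r lerDl.
have cp2 : 0 <= p + s / al by rewrite addr_ge0// ltW.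
have [C C0 HC] := solw (ltW p0) (ltW p1) pq1 (lexx 0) cp2.
have B0 v : 0 <= ns_norm L2 v by rewrite fine_ge0// Lnorm_ge0.
have [] // := @weightedC_intro _ _ T L2 T0 (al * q) u (C * (Phi + N)).
- by move=> t /oc_in[t0 tT]; have [] := hu t0 tT.
- move=> t tT eps eps0.
  have [d d0 hd] := sol_l2cont al0 al1 T0 P1 lam10 lamlb s0 Ps q0 q1 pq p'0 p'1 qh0 qhq qhs
    S hphi ev_infty tT eps0.
  exists d => // t' t'T tt'; rewrite ger0_norm//.
  have [t0 tT1] := oc_in tT; have [t'0 t'T1] := oc_in t'T.
  have [Lu h] := hu t0 tT1; have [Lu' h'] := hu t'0 t'T1.
  apply: (L2_norm_le eL2 orth compl); first exact: L2B.
  by apply: l2le_eq (hd t' t'T tt') => j; rewrite innerBl// h h'.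
- move=> t /oc_in[t0 tT]; have [Lu h] := hu t0 tT.
  rewrite mulrC -ler_pdivlMr ?powR_gt0// -powRN.
  apply: (L2_norm_le eL2 orth compl) => //.
  have := HC f g N _ Phi t S hphi t0 tT.
  have -> : 1 - p = q by rewrite -pq addrAC subrr add0r.
  by apply: l2le_eq => j; rewrite powRr0 mul1r h.
Qed.

(** Version of u in the dual space defined also at t = 0, where u(0) need not lie in L^2(D). *)
Definition ucurve t := functional D e (x^~ t).

Lemma ucurve_embed gam t : t \in `]0, T] -> Vneg_eq D m e gam (ucurve t) (embed D (u t)).
Proof.
rewrite in_itv/= => /andP[t0 tT] v /(Vpos_elim eL2 orth compl)[Lv _].
have [Lu _] := hu t0 tT.
by rewrite (embed_functional eL2 orth compl)// coef_u.
Qed.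

End curve.

Lemma ucurve_hoelder : Hoelder T (Vneg D m e (beta * (1 - p'))) s ucurve.
Proof.
have [C C0 HC] := sol_hoelder al0 al1 T0 P1 lam10 lamlb s0 Ps q0 q1 pq p'0 p'1 qh0 qhq qhs.
have w j y : m j `^ (- (beta * (1 - p'))) * y = lam j `^ (- (1 - p')) * y by rewrite -mulrN evE.
have pq1 : 0 + p <= p + qh by rewrite add0r lerDl.
have cp2 : 0 <= p + s / al by rewrite addr_ge0// ltW.
have [C1 C10 HC1] := solw (ltW p0) (ltW p1) pq1 (lexx 0) cp2.
have hp : - (1 - p') <= 0 by rewrite oppr_le0 subr_ge0.
have hT := l2le_lower_weight lam10 lamlb hp (HC1 f g N _ Phi T S hphi T0 (lexx T)).
split.
  move=> t; rewrite in_itv/= => /andP[t0 tT].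
  have h := l2le_sub hT (HC f g N _ Phi t T S hphi t0 tT (lexx T)).
  apply: (functional_Vneg eL2 orth compl m0 mle); apply: l2le_eq h => j.
  by rewrite -mulrBr subKr w.
have key t1 t2 : 0 <= t1 -> t1 <= t2 -> t2 <= T ->
    l2le (fun j => m j `^ (- (beta * (1 - p'))) * (x j t2 - x j t1))
      (C * (Phi + N) * (t2 - t1) `^ s).
  by move=> t10 t12 t2T; apply: l2le_eq (HC f g N _ Phi t1 t2 S hphi t10 t12 t2T) => j; rewrite w.
exists (C * (Phi + N)) => t1 t2 h1 h2.
have /andP[t10 t1T] : 0 <= t1 <= T by move: h1; rewrite in_itv.
have /andP[t20 t2T] : 0 <= t2 <= T by move: h2; rewrite in_itv.
have E j : (ucurve t1 - ucurve t2) (e j) = x j t1 - x j t2.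
  exact: (congr2 (fun a b => a - b) (functional_e orth _ j) (functional_e orth _ j)).
apply: (@Vneg_norm_le _ _ D m e m0 mle); have [t12|/ltW t21] := leP t1 t2.
  rewrite distrC ger0_norm ?subr_ge0//.
  have := l2le_dom ler01 _ (key t1 t2 t10 t12 t2T); rewrite mul1r; apply => j.
  rewrite E; move: (x j t1) (x j t2) (m j `^ _) => a b c.
  by rewrite mul1r !normrM distrC.
rewrite ger0_norm ?subr_ge0//.
by apply: l2le_eq (key t2 t1 t20 t21 t1T) => j; rewrite E.
Qed.

(** Off Z' the coefficients of the curve are the Caputo derivatives f - lam u, so partial sums
    differ from it by a tail of a weighted l2 sequence. *)
Lemma wcurve_caputo h (Z' : set R) : measurable Z' -> mu Z' = 0%E ->
  (forall t, t \in `]0, T[ -> ~ Z' t -> forall j, h j t = f j t) ->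
  caputo_curve D m e T al (beta * (q - qh)) ucurve (wcurve h f (coef D e phi)).
Proof.
move=> mZ' Z'0 hf; have [C C0 HC] := deriv_weighted.
exists (sol_deriv al T lam f (coef D e phi)); split.
  move=> j; have := sol_caputo al0 al1 T0 P1 lam10 lamlb s0 Ps q0 q1 pq p'0 p'1 qh0 qhq qhs S hphi j.
  by congr caputo; apply/funext => t; rewrite /ucurve (functional_e orth).
exists Z'; split => // t /= ht; apply: contrapT => nZ; apply: ht => tT.
have [t0 tT'] := oo_in tT.
have hw : l2le (fun j => m j `^ (- (beta * (q - qh))) * wcurve h f (coef D e phi) t (e j))
    (lam1 `^ (- (q - qh)) * g t + C * (Phi + N) * t `^ (- al)).
  by apply: l2le_eq (HC f g N _ Phi t S hphi t0 tT') => j; rewrite wcurve_e hf.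
split.
  by apply: (functional_Vneg eL2 orth compl m0 mle); apply: l2le_eq hw => j; rewrite wcurve_e.
apply/cvgrPdist_le => eps eps0; have [n0 hn0] := l2le_tail_eventually hw eps0.
exists n0 => // n /= nn0; rewrite sub0r normrN ger0_norm ?sqrtr_ge0//.
apply: (@Vneg_norm_le _ _ D m e m0 mle).
apply: (l2le_mono (M := 1 * eps)); first by rewrite mul1r.
apply: (l2le_dom ler01 _ hn0) => j; rewrite mul1r.
have WE := wcurve_e h f (coef D e phi) t j; move: WE; set W := wcurve _ _ _ t => WE.
rewrite -[(embed _ _ - _) _]/(embed D (fun y => \sum_(j < n) sol_deriv al T lam f (coef D e phi) j t * e j y) (e j) - W (e j)).
rewrite /embed (inner_sum_e eL2 orth n (fun j => sol_deriv al T lam f (coef D e phi) j t)) /l2tail.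
case: ifPn => jn.
  rewrite (sol_derivE T al0 lam10 lamlb)// WE hf// subrr mulr0 normr0.
  by case: ifP.
rewrite ifF; first by rewrite sub0r !normrM normrN.
by apply/negbTE; rewrite -leqNgt; rewrite -leqNgt in jn; exact: leq_trans jn.
Qed.

End fixed_data.

End mild_solutions.

(** * Choice of the exponents and assembly of (a) and (b) *)

Theorem theorem3p4 (R : realType) (k : nat) (D : set 'rV[R]_k.+1)
    (A : 'I_k.+1 -> 'I_k.+1 -> 'rV[R]_k.+1 -> R) (b : 'rV[R]_k.+1 -> R)
    (bc : @boundary_condition R)
    (m : nat -> R) (e : nat -> 'rV[R]_k.+1 -> R)
    (T alpha beta : R)
    (D_open : open D) (D_connected : connected D) (D_bounded : bounded_set D)
    (L_elliptic : elliptic D A b) (L_eigen : eigensystem D A b bc m e)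
    (T_gt0 : 0 < T) (alpha01 : 0 < alpha < 1) (beta01 : 0 < beta <= 1)
    (p q s p' q' r qh ph rh : R)
    (p01 : 0 < p < 1) (q01 : 0 < q < 1) (pq : p + q = 1)
    (s_bnd : 0 < s < Num.min (alpha * q) (1 - alpha * q))
    (p'_bnd : 0 < p' <= p - s / alpha) (q'E : q' = 1 - p')
    (r_bnd : 0 < r <= (1 - alpha * q') / (alpha * q'))
    (qh_bnd : 0 <= qh <= Num.min (Num.min p q) (s / alpha)) (phE : ph = 1 - qh)
    (rh_bnd : 0 < rh <= (1 - alpha) / alpha) :
  let L2 := Lb D 2 in
  let V gamma := Vpos D m e gamma in
  let V_ gamma := Vneg D m e gamma in
  let LF := BochnerL T L2 (1 / (alpha * q - s) + rh) in
  let LW := BochnerL T (V_ (beta * (q - qh))) (1 / alpha - rh) in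
  let CW := weightedC T (V_ (beta * q)) alpha in
  let regular (u : R -> 'rV[R]_k.+1 -> R)
      (U : R -> ('rV[R]_k.+1 -> R) -> R) :=
    [/\ ns_mem (BochnerL T (V (beta * (p - p'))) (1 / (alpha * q') - r)) u,
        ns_mem (weightedC T L2 (alpha * q)) u,
        (forall t : R, t \in `]0, T] ->
           Vneg_eq D m e (beta * q') (U t) (embed D (u t))) &
        Hoelder T (V_ (beta * q')) s U] in
  (exists C3 : R, 0 < C3 /\
    forall (phi : 'rV[R]_k.+1 -> R) (F : R -> 'rV[R]_k.+1 -> R),
    ns_mem (V (beta * (p + qh))) phi -> ns_mem LF F ->
    exists u U W,
      [/\ unique_mild_solution D m e T alpha beta F phi u,
          regular u U,
          caputo_curve D m e T alpha (beta * (q - qh)) U W,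
          ns_mem LW W &
          ns_norm LW W <= C3 * ns_norm LF F
            + C3 * ns_norm (V (beta * (p + qh))) phi]) /\
  (exists C4 : R, 0 < C4 /\
    forall (phi : 'rV[R]_k.+1 -> R) (F : R -> 'rV[R]_k.+1 -> R)
      (G : R -> ('rV[R]_k.+1 -> R) -> R),
    ns_mem (V (beta * (p + qh))) phi -> ns_mem LF F ->
    ns_mem CW G ->
    {ae @lebesgue_measure R, forall t : R, t \in `]0, T[ ->
       Vneg_eq D m e (beta * q) (G t) (embed D (F t))} ->
    exists u U W,
      [/\ unique_mild_solution D m e T alpha beta F phi u,
          regular u U,
          caputo_curve D m e T alpha (beta * (q - qh)) U W,
          ns_mem LW W /\ ns_mem CW W &
          ns_norm LW W + ns_norm CW W <= C4 * ns_norm (V (beta * (p + qh))) phi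
            + C4 * ns_norm LF F + C4 * ns_norm CW G]).
Proof.
case: L_eigen => [[m0 mle moo] H2e orth compl].
have eL2 j : ns_mem (Lb D 2) (e j).
  by have [[dv [ddv [h _]]] _ _] := H2e j; have [] := h ord0.
case/andP: alpha01 => al0 al1; case/andP: beta01 => beta0 _.
case/andP: p01 => p0 p1; case/andP: q01 => q0 q1.
case/andP: s_bnd => s0; rewrite lt_min => /andP[saq _].
case/andP: p'_bnd => p'0; rewrite lerBrDr => p'1.
case/andP: qh_bnd => qh0; rewrite !le_min => /andP[/andP[_ qhq] qhs].
case/andP: r_bnd => r0 r1; case/andP: rh_bnd => rh0 rh1; subst q'.
have d0 : 0 < alpha * q - s by rewrite subr_gt0.
have d1 : alpha * q - s < 1.
  by rewrite ltrBlDr (lt_le_trans (_ : _ < 1 * 1)) ?ltr_pM ?(ltW al0) ?(ltW q0)// mulr1 lerDl ltW.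
have dal : alpha * q - s <= alpha.
  by rewrite lerBlDr (le_trans (ler_piMr (ltW al0) (ltW q1)))// lerDl ltW.
set P := 1 / (alpha * q - s) + rh.
(* Here [rh > 0] is used: it makes the inequality between P^-1 and alpha q - s strict. *)
have dP : (alpha * q - s)^-1 < P by rewrite /P div1r ltrDl.
have P1 : 1 < P by rewrite (lt_trans _ dP)// invf_gt1.
have P0 : 0 < P by exact: lt_trans P1.
have Ps : P^-1 < alpha * q - s by rewrite -[ltRHS]invrK ltf_pV2// posrE invr_gt0.
set b1 := 1 / alpha - rh.
(* Required for the source term: f itself occurs in the derivative, so the time exponent of the
   latter cannot exceed P. *)
have b1P : b1 <= P.
  rewrite /b1 /P !div1r lerBlDr (@le_trans _ _ (alpha * q - s)^-1) ?lef_pV2 ?posrE//.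
  by rewrite -addrA lerDl addr_ge0 ?ltW.
have b1ge : 1 <= b1.
  by rewrite /b1 lerBrDr -lerBrDl (le_trans rh1)// mulrBl divff ?lt0r_neq0.
have b10 : 0 < b1 by exact: lt_le_trans b1ge.
(* Integrability of t^(- alpha b1), strict because [rh] is subtracted; [r] has the same role for a1
   below. *)
have b1al : b1 * alpha < 1.
  by rewrite /b1 mulrBl div1r mulVf ?lt0r_neq0// gtrDl oppr_lt0 mulr_gt0.
have q'0 : 0 < 1 - p'.
  by rewrite subr_gt0 (le_lt_trans _ p1)// (le_trans _ p'1)// lerDl ltW// divr_gt0.
have aq'0 : 0 < alpha * (1 - p') by exact: mulr_gt0.
set a1 := 1 / (alpha * (1 - p')) - r.
have a1ge : 1 <= a1.
  by rewrite /a1 lerBrDr -lerBrDl (le_trans r1)// mulrBl divff ?lt0r_neq0.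
have a1al : a1 * (alpha * (1 - p')) < 1.
  by rewrite /a1 mulrBl div1r mulVf ?lt0r_neq0// gtrDl oppr_lt0 mulr_gt0.
have pp'0 : 0 <= p - p'.
  by rewrite subr_ge0 (le_trans _ p'1)// lerDl ltW// divr_gt0.
have pp' : p - p' + p' <= p by rewrite subrK.
move=> L2 V V_ LF LW CW regular.
(* Everything in the conclusion that does not involve the derivative is the same for both parts. *)
have common phi F : ns_mem (V (beta * (p + qh))) phi -> ns_mem LF F ->
    exists f g Z u, [/\ [/\ measurable Z, lebesgue_measure Z = 0%E,
        source P f g (ns_norm LF F) &
        l2le (fun j => ev m beta j `^ (p + qh) * coef D e phi j)
          (ns_norm (V (beta * (p + qh))) phi)],
      forall t : R, t \in `]0, T[ -> ~ Z t -> ns_mem L2 (F t) /\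
         forall j, f j t = inner D (F t) (e j),
      unique_mild_solution D m e T alpha beta F phi u &
      regular u (ucurve D m e T alpha beta phi f)].
  move=> /(Vpos_elim eL2 orth compl)[Lphi hphi] hF.
  have {}hphi : l2le (fun j => ev m beta j `^ (p + qh) * coef D e phi j)
      (ns_norm (V (beta * (p + qh))) phi).
    by apply: l2le_eq hphi => j; rewrite /ev -powRrM.
  have [f [g [Z [mZ Z0 S hZ]]]] := source_of_BochnerL eL2 orth compl P0 hF.
  have [u hu] := sol_curve eL2 orth compl m0 mle T_gt0 al0 al1 beta0 P1 s0 Ps q1
    mZ Z0 S hZ Lphi.
  exists f, g, Z, u; split => //.
  - move=> t tT nZ; have tT1 : t \in `[0, T].
      by have [t0 tT'] := oo_in tT; rewrite in_itv/= tT' ltW.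
    by have [_ ? ?] := hZ t tT1 nZ.
  - apply: (mild_unique eL2 orth compl m0 mle T_gt0 al0 al1 beta0 P1 s0 Ps q1
      mZ Z0 S hZ Lphi hu); exists a1 => //.
    exact: (curve_Lp_L2 eL2 orth compl m0 mle T_gt0 al0 al1 beta0 P1 s0 Ps q0 q1 pq
      p'0 p'1 qh0 qhq qhs S hphi hu).
  - split.
    + exact: (curve_Lp_Vpos eL2 orth compl m0 mle T_gt0 al0 al1 beta0 P1 s0 Ps q0 q1 pq
        p'0 p'1 qh0 qhq qhs S hphi hu).
    + exact: (curve_weightedC eL2 orth compl m0 mle moo T_gt0 al0 al1 beta0 P1 s0 Ps q0
        q1 pq p'0 p'1 qh0 qhq qhs S hphi hu).
    + by move=> t tT; exact: (ucurve_embed eL2 orth compl hu).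
    + exact: (ucurve_hoelder eL2 orth compl m0 mle T_gt0 al0 al1 beta0 P1 s0 Ps q0 q1 pq
        p'0 p'1 qh0 qhq qhs S hphi).
have [C C0 HC] := wcurve_Lp eL2 orth compl m0 mle T_gt0 al0 al1 beta0 P1 s0 Ps q1 pq
  p'0 p'1 qh0 qhq qhs b10 b1P b1al.
have LF0 F : 0 <= ns_norm LF F by rewrite fine_ge0// Lnorm_ge0.
have V0 phi : 0 <= ns_norm (V (beta * (p + qh))) phi by rewrite fine_ge0// Lnorm_ge0.
split.
  exists (C + 1); split=> [|phi F hphi hF]; first by rewrite ltr_wpDl.
  have [f [g [Z [u [[mZ Z0 S hphi'] hZ hu hr]]]]] := common phi F hphi hF.
  have [Wmem Wle] := HC f g _ _ _ S hphi'.
  exists u, (ucurve D m e T alpha beta phi f), (wcurve D m e T alpha beta f f (coef D e phi)).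
  split => //.
    by apply: (wcurve_caputo eL2 orth compl m0 mle T_gt0 al0 al1 beta0 P1 s0 Ps q0 q1 pq
      p'0 p'1 qh0 qhq qhs S hphi' mZ Z0).
  apply: (le_trans Wle); move: (LF0 F) (V0 phi) C0.
  move: (ns_norm LF F) (ns_norm (V _) phi) (C) => x y c x0 y0 c0.
  by rewrite mulrDr; apply: lerD; apply: ler_wpM2r => //; rewrite lerDl.
have [C' C'0 HC'] := wcurve_weightedC eL2 orth compl m0 mle moo T_gt0 al0 al1 beta0 P1 s0 Ps
  q1 pq p'0 p'1 qh0 qhq qhs.
exists (C + C' + 1); split=> [|phi F G hphi hF hG [N2 [mN2 N20 hN2]]].
  by rewrite ltr_wpDl// addr_ge0.
have [f [g [Z [u [[mZ Z0 S hphi'] hZ hu hr]]]]] := common phi F hphi hF.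
(* Exceptional times of F together with those where G is not F; off them the coefficients of G are
   f. *)
pose Z' := Z `|` N2; pose h j t := G t (e j).
have mZ' : measurable Z' by exact: measurableU.
have Z'0 : lebesgue_measure Z' = 0%E by exact: null_set_setU.
have hf t : t \in `]0, T[ -> ~ Z' t -> forall j, h j t = f j t.
  move=> tT /not_orP[nZ nN] j; have [_ ->//] := hZ t tT nZ.
  have hVt : Vneg_eq D m e (beta * q) (G t) (embed D (F t)).
    by apply: contrapT => nV; apply: nN; apply: hN2 => /= /(_ tT).
  by apply: hVt; have [] := @Vpos_e _ _ D m e eL2 orth compl (beta * q) j.
pose W := wcurve D m e T alpha beta h f (coef D e phi).
(* The derivative is taken to be [W], defined through G, for control at every time; its L^p norm is
   estimated on [W'], which equals [W] almost everywhere. *)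
pose W' := wcurve D m e T alpha beta f f (coef D e phi).
have W'W t : t \in `]0, T[ -> ~ Z' t -> W' t = W t.
  move=> tT nZ; rewrite /W /W' /wcurve; congr functional; apply/funext => j.
  by rewrite (hf t tT nZ).
have [W'mem W'le] := HC f g _ _ _ S hphi'.
have [Wmem Wle] := HC' f g _ _ _ G S hphi' hG.
have nWW' : ns_norm LW W = ns_norm LW W'.
  rewrite -[LHS]/(fine (Bochner_norm T (V_ (beta * (q - qh))) b1 W)).
  by rewrite -(Bochner_norm_eq_off (V_ (beta * (q - qh))) mZ' Z'0 W'W).
have CW0 : 0 <= ns_norm CW G.
  case: hG => _ _ ub.
  apply: (@le_trans _ _ (T `^ alpha * ns_norm (V_ (beta * q)) (G T))).
    exact: mulr_ge0 (powR_ge0 _ _) (sqrtr_ge0 _).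
  have TT : T \in `]0, T] by rewrite in_itv/= T_gt0 lexx.
  by apply: sup_upper_bound; [split => //; exists (T `^ alpha * ns_norm (V_ (beta * q)) (G T))|];
    exists T.
exists u, (ucurve D m e T alpha beta phi f), W; split.
- exact: hu.
- exact: hr.
- exact: (wcurve_caputo eL2 orth compl m0 mle T_gt0 al0 al1 beta0 P1 s0 Ps q0 q1 pq
    p'0 p'1 qh0 qhq qhs S hphi' mZ' Z'0 hf).
- by split; [exact: (BochnerL_eq_off mZ' Z'0 W'W W'mem)|exact: Wmem].
rewrite nWW'; apply: (le_trans (lerD W'le Wle)).
have := LF0 F; have := V0 phi; move: CW0 C0 C'0.
rewrite -/LF -/CW.
move: (ns_norm CW G) (ns_norm LF F) (ns_norm (V (beta * (p + qh))) phi) (C) (C').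
move=> z x y c c' z0 c0 c'0 y0 x0.
rewrite -subr_ge0 (_ : _ - _ = y + x + (c * z + c' * z)); last by ring.
by rewrite addr_ge0 ?addr_ge0 ?mulr_ge0.
Qed.
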